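(* Let $\Delta$ and $\Gamma$ be balanced simplicial complexes that are closed combinatorial $d$-manifolds. Then $\Delta$ and $\Gamma$ are PL homeomorphic if and only if there is a finite sequence of cross-flips that transforms $\Delta$ into (a complex isomorphic to) $\Gamma$.
   Context: All simplicial complexes are finite abstract simplicial complexes. A combinatorial $d$-sphere (resp. combinatorial $d$-ball) is a simplicial complex PL homeomorphic to the boundary of a $(d+1)$-simplex (resp. to a $d$-simplex). A closed combinatorial $d$-manifold is a connected simplicial complex in which the link of every vertex is a combinatorial $(d-1)$-sphere. A proper $m$-coloring of a simplicial complex is a map $\kappa$ from its vertex set to $\{0,\dots,m-1\}$ with $\kappa(u)\ne\kappa(v)$ for every edge $\{u,v\}$; a $d$-dimensional complex is balanced if it admits a proper $(d+1)$-coloring. $\mathcal{C}_d$ denotes the boundary complex of the $(d+1)$-dimensional cross-polytope: vertex set $\{x_0,\dots,x_d,y_0,\dots,y_d\}$, faces all subsets $F$ with $|F\cap\{x_i,y_i\}|\le 1$ for all $i$. A pure $d$-dimensional complex is shellable if its facets can be ordered $F_0,\dots,F_t$ so that for each $j>0$, $\overline{F_j}\cap\bigcup_{i<j}\overline{F_i}$ is pure of dimension $d-1$ (here $\overline{F}$ is the simplex of all subsets of $F$). A subcomplex $D$ is induced in $\Delta$ if every face of $\Delta$ all of whose vertices lie in $D$ is a face of $D$. A proper pure $d$-dimensional subcomplex $D\subset\mathcal{C}_d$ is co-shellable if $\mathcal{C}_d\setminus D$ (the pure subcomplex of $\mathcal{C}_d$ generated by the facets of $\mathcal{C}_d$ not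 in $D$) is shellable. Cross-flip: let $\Delta$ be a balanced closed combinatorial $d$-manifold and $D\subset\Delta$ an induced subcomplex isomorphic to a shellable and co-shellable subcomplex of $\mathcal{C}_d$. The cross-flip replaces $D$ in $\Delta$ by $\mathcal{C}_d\setminus D$ (glued along the common boundary of $D$ and $\mathcal{C}_d\setminus D$ via the given isomorphism; vertices of $\mathcal{C}_d\setminus D$ not in $D$ become new vertices). *)

(* Defs.v *)
From Stdlib Require Import Reals.
From mathcomp Require Import all_boot.
Set Implicit Arguments.
Unset Strict Implicit.
Unset Printing Implicit Defensive.

Definition is_complex (V : finType) (K : {set {set V}}) : Prop :=
  forall F G : {set V}, F \in K -> G \subset F -> G \in K.

Definition vert (V : finType) (K : {set {set V}}) : {set V} :=
  [set v | [set v] \in K].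

Definition iso_cx (V W : finType) (K : {set {set V}}) (L : {set {set W}}) : Prop :=
  exists f : V -> W,
    [/\ {in vert K &, injective f},
        f @: vert K = vert L &
        forall F : {set V}, F \subset vert K -> (F \in K) = (f @: F \in L)].

Definition Rsum (V : finType) (g : V -> R) : R := \big[Rplus/R0]_(v : V) g v.

(** b : V -> R (barycentric coordinates in R^V) is a point of |K| *)
Definition in_real (V : finType) (K : {set {set V}}) (b : V -> R) : Prop :=
  (forall v, Rle R0 (b v)) /\ Rsum b = R1 /\
  exists F, F \in K /\ forall v, v \notin F -> b v = R0.

Definition lin_ext (W V : finType) (pos : W -> V -> R) (b : W -> R) : V -> R :=
  fun v => Rsum (fun w => Rmult (b w) (pos w v)).

(** K' (on W) is a subdivision of K (on V) via the vertex placement pos: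
    every simplex of K' is mapped linearly into a simplex of K, and the
    induced map |K'| -> |K| is a bijection. *)
Definition subdivides (W V : finType) (K' : {set {set W}}) (K : {set {set V}})
    (pos : W -> V -> R) : Prop :=
  [/\ is_complex K',
      (forall w, w \in vert K' -> in_real K (pos w)),
      (forall F', F' \in K' -> exists2 F, F \in K &
          forall w v, w \in F' -> v \notin F -> pos w v = R0),
      (forall b1 b2, in_real K' b1 -> in_real K' b2 ->
          (forall v, lin_ext pos b1 v = lin_ext pos b2 v) -> forall w, b1 w = b2 w) &
      (forall p, in_real K p -> exists2 b, in_real K' b & forall v, lin_ext pos b v = p v)].

Definition PL_homeo (V W : finType) (K : {set {set V}}) (L : {set {set W}}) : Prop :=
  exists (U : finType) (M : {set {set U}}) (pos1 : U -> V -> R) (pos2 : U -> W -> R),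
    subdivides M K pos1 /\ subdivides M L pos2.

(** boundary of the n-simplex (vertices 'I_(n+1)): a (n-1)-sphere *)
Definition simplex_bd (n : nat) : {set {set 'I_n.+1}} := [set F | F != setT].

(** combinatorial (n-1)-sphere *)
Definition comb_sphere (V : finType) (n : nat) (K : {set {set V}}) : Prop :=
  PL_homeo K (simplex_bd n).

Definition link (V : finType) (K : {set {set V}}) (v : V) : {set {set V}} :=
  [set F : {set V} in K | (v \notin F) && (v |: F \in K)].

Definition closed_mfd (d : nat) (V : finType) (K : {set {set V}}) : Prop :=
  [/\ is_complex K,
      (exists v, v \in vert K),
      (forall u w, u \in vert K -> w \in vert K ->
          connect (fun a b => [set a; b] \in K) u w) &
      (forall v, v \in vert K -> comb_sphere d (link K v))].

Definition balanced (d : nat) (V : finType) (K : {set {set V}}) : Prop :=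
  exists kappa : V -> 'I_d.+1,
    forall u v, [set u; v] \in K -> u != v -> kappa u != kappa v.

(** vertex (i,false) is x_i, (i,true) is y_i *)
Definition CX (d : nat) : finType := ('I_d.+1 * bool)%type.

Definition cross (d : nat) : {set {set CX d}} :=
  [set F : {set CX d} | [forall i : 'I_d.+1, ~~ (((i, false) \in F) && ((i, true) \in F))]].

Definition facet (V : finType) (K : {set {set V}}) (F : {set V}) : bool :=
  (F \in K) && [forall G in K, (F \subset G) ==> (G == F)].

Definition gen (V : finType) (S : {set {set V}}) : {set {set V}} :=
  [set G : {set V} | [exists F in S, G \subset F]].

(** pure, with all facets of cardinality n (i.e. pure of dimension n-1), nonempty *)
Definition pure_sz (V : finType) (K : {set {set V}}) (n : nat) : Prop :=
  (exists F, F \in K) /\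
  forall G, G \in K -> (#|G| <= n) && [exists H in K, (G \subset H) && (#|H| == n)].

Definition shellable (d : nat) (V : finType) (K : {set {set V}}) : Prop :=
  exists s : seq {set V},
    [/\ uniq s, s != [::],
        (forall F, (F \in s) = facet K F) &
        forall j, 0 < j < size s ->
          pure_sz [set G : {set V} | (G \subset nth set0 s j) &&
                           [exists i : 'I_j, G \subset nth set0 s i]] d].

Definition cocx (d : nat) (D0 : {set {set CX d}}) : {set {set CX d}} :=
  gen [set F : {set CX d} | facet (cross d) F & F \notin D0].

(** D0 is a proper, pure d-dim, shellable and co-shellable subcomplex of C_d,
    and phi embeds it as an induced subcomplex D = phi(D0) of K. *)
Definition flip_ok (d : nat) (V : finType) (K : {set {set V}})
    (D0 : {set {set CX d}}) (phi : CX d -> V) : Prop :=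
  [/\ is_complex D0, D0 \subset cross d, D0 != cross d & pure_sz D0 d.+1] /\
  [/\ shellable d D0, shellable d (cocx D0),
      {in vert D0 &, injective phi},
      (forall G, G \in D0 -> phi @: G \in K) &
      (forall F, F \in K -> F \subset phi @: vert D0 ->
          exists2 G, G \in D0 & F = phi @: G)].

(** result of the cross-flip: facets of K not in D, together with the facets
    of C_d \ D0 (vertices of D0 identified via phi, other vertices new). *)
Definition flip_result (d : nat) (V : finType) (K : {set {set V}})
    (D0 : {set {set CX d}}) (phi : CX d -> V) : {set {set (V + CX d)%type}} :=
  let psi := fun x : CX d => if x \in vert D0 then @inl V (CX d) (phi x) else inr x in
  gen ([set [set @inl V (CX d) v | v in F] | F : {set V} in
          [set F : {set V} | facet K F & F \notin [set phi @: G | G : {set CX d} in D0]]]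
       :|: [set psi @: G | G : {set CX d} in [set G : {set CX d} | facet (cross d) G & G \notin D0]]).

Record pcx := Pcx { pvt : finType; pK : {set {set pvt}} }.

Definition flip_step (d : nat) (P Q : pcx) : Prop :=
  balanced d (pK P) /\ closed_mfd d (pK P) /\
  exists (D0 : {set {set CX d}}) (phi : CX d -> pvt P),
    flip_ok (pK P) D0 phi /\ iso_cx (flip_result (pK P) D0 phi) (pK Q).

Inductive flips (d : nat) : pcx -> pcx -> Prop :=
| flips_iso P Q : iso_cx (pK P) (pK Q) -> flips d P Q
| flips_step P Q S : flip_step d P Q -> flips d Q S -> flips d P S.

(* Submission.v *)
(* Both notions are compared with stellar equivalence [sq], the relation generated by stellar
   subdivisions.

   PL homeomorphism is stellar equivalence.  A common subdivision of two complexes yields, after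
   cutting by hyperplanes with edge stars, iterated stellar subdivisions, and these are regular:
   they come from a convex piecewise linear height function.  A regular subdivision of a simplex is
   shelled by the line shelling seen from a generic interior point, and coning off the simplices in
   decreasing dimension along these shellings leads to the derived subdivision, which depends on
   the coarse complex only.

   Flips are stellar.  Coning off a shellable ball, facet by facet, is a sequence of stellar moves;
   the moves are legitimate because a sphere contained in a sphere of the same dimension is the
   whole sphere.  Coning off [D] before a cross-flip and [C_d \ D] after it gives the same complex.

   Stellar equivalence gives flips.  Pachner's theorem is proved with properly colored complexes,
   with arbitrarily many colors.  Colors above [d] are removed by starring the faces that contain
   such a color and whose other colors are small: the result is balanced, and an elementary flip
   becomes a sequence of flips using only one extra color.  Starring once more, the simplex boundary
   swapped by a flip with colors [0, ..., d + 1] becomes the boundary of a cross-polytope, so that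
   the flip becomes a cross-flip. *)

(* With colors built into vertex names, properness is injectivity of the first component on faces,
   and recoloring a vertex is renaming it, which is itself a star. Many colors are wanted because a
   vertex whose color occurs nowhere else fits anywhere; what remains is to decompose a single star
   into flips. This requires the link, a sphere, to be reached by flips from a simplex boundary,
   which is the colored theorem in smaller dimension: hence a simultaneous induction over links.
   Spheres and manifolds are defined by stellar equivalence, so that geometry enters only in the
   passage from and to [PL_homeo]. There simplices are replaced by the cones over them, which need
   no normalization and treat the empty face like any other. The family of faces starred in the
   color reduction serves twice: it does nothing to a complex with colors at most [d], so the ends
   of the chain survive; and in the boundary of a simplex with colors [0, ..., d + 1] it is a single
   flag, whose new vertices are the antipodes of the vertices of colors [0, ..., d]. *)
Require Import Defs.
From Stdlib Require Import Reals.
From mathcomp Require Import all_boot all_order all_algebra finmap archimedean zify ring lra boolp Rstruct.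
Set Implicit Arguments.
Unset Strict Implicit.
Unset Printing Implicit Defensive.
Local Open Scope fset_scope.

(** * A decision procedure for unions and inclusions of finite sets *)

Module SetSolver.
(* A vertex is a pair (color, name). *)
Definition T : choiceType := (nat * nat)%type.
Notation face := {fset T}.
Notation cplx := {fset {fset T}}.

(* The tactic [fs] decides goals about unions, differences and inclusions of faces: it expands them
   pointwise into a propositional formula, whose unsatisfiability is checked by computation. *)
Inductive bform := BT | BF | BV of bool & nat & nat | BN of bform | BA of bform & bform
  | BO of bform & bform.

Fixpoint bval (e : bool -> nat -> nat -> bool) f := match f with
  | BT => true | BF => false | BV t n m => e t n m | BN f => ~~ bval e f
  | BA f g => bval e f && bval e g | BO f g => bval e f || bval e g end.

Definition bN f := match f with BT => BF | BF => BT | BN g => g | _ => BN f end.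
Definition bA f g := match f, g with BT, _ => g | _, BT => f | BF, _ => BF | _, BF => BF
  | _, _ => BA f g end.
Definition bO f g := match f, g with BF, _ => g | _, BF => f | BT, _ => BT | _, BT => BT
  | _, _ => BO f g end.

Lemma bNE e f : bval e (bN f) = ~~ bval e f.
Proof. by case: f => //= f; rewrite negbK. Qed.
Lemma bAE e f g : bval e (bA f g) = bval e f && bval e g.
Proof. by case: f; case: g => //= *; rewrite ?andbT ?andbF. Qed.
Lemma bOE e f g : bval e (bO f g) = bval e f || bval e g.
Proof. by case: f; case: g => //= *; rewrite ?orbT ?orbF. Qed.

Fixpoint bsub t n m (c : bool) f := match f with
  | BV t' n' m' => if [&& eqb t' t, eqn n' n & eqn m' m] then (if c then BT else BF) else f
  | BN f => bN (bsub t n m c f) | BA f g => bA (bsub t n m c f) (bsub t n m c g)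
  | BO f g => bO (bsub t n m c f) (bsub t n m c g) | _ => f end.

Lemma bsubE e t n m f : bval e (bsub t n m (e t n m) f) = bval e f.
Proof.
elim: f => //= [t' n' m'|f <-|f <- g <-|f <- g <-]; rewrite ?bNE ?bAE ?bOE //.
by case: ifP => //= /and3P[/eqP-> /eqP-> /eqP->]; case: (e _ _ _).
Qed.

Fixpoint bvar f := match f with BT | BF => (true, 0, 0) | BV t n m => (t, n, m)
  | BN f => bvar f | BA f _ | BO f _ => bvar f end.
Fixpoint bunit f := match f with BV t n m => Some (t, n, m) | BN (BV t n m) => Some (t, n, m)
  | BA f g => if bunit f is Some n then Some n else bunit g | _ => None end.
Definition bsplit (u : bform -> bool) f p := let: (t, n, m) := p in
  if u (bsub t n m true f) then u (bsub t n m false f) else false.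
(** Davis-Putnam search with fuel [k]. Unit literals are branched on first, so that one of the two
    branches closes at once; running out of fuel counts as failure. *)
Fixpoint bunsat k f := match k with 0 => false | k.+1 =>
  match f with BF => true | BT => false | _ =>
    bsplit (bunsat k) f (if bunit f is Some n then n else bvar f) end end.

Lemma bunsatP k e f : bunsat k f -> bval e f = false.
Proof.
elim: k f => // k IH f.
have key n : bsplit (bunsat k) f n -> bval e f = false.
  case: n => -[t n] m /=; case: ifP => // h1 h2; rewrite -(bsubE e t n m).
  by case: (e _ _ _); apply: IH.
by case: f key => [||? ? ?|?|? ?|? ?] key // h; exact (key _ h).
Qed.

Inductive sexp := SV of nat | SU of sexp & sexp | SI of sexp & sexp | SD of sexp & sexp
  | S1 of nat | S0.
Inductive cform := CT | CF | CIn of nat & sexp | CE of nat & nat | CN of cform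
  | CA of cform & cform | CO of cform & cform | CI of cform & cform
  | CS of sexp & sexp | CD of sexp & sexp.

Section SetSolver.
Variables (z0 : T) (es : seq T) (ss : seq face).
Let el i := nth z0 es i.
Fixpoint sval a : face := match a with
  | SV n => nth fset0 ss n | SU a b => sval a `|` sval b | SI a b => sval a `&` sval b
  | SD a b => sval a `\` sval b | S1 i => [fset el i] | S0 => fset0 end.
Fixpoint cval c : bool := match c with
  | CT => true | CF => false | CIn i a => el i \in sval a | CE i j => el i == el j
  | CN c => ~~ cval c | CA c d => cval c && cval d | CO c d => cval c || cval d
  | CI c d => cval c ==> cval d | CS a b => sval a `<=` sval b
  | CD a b => fdisjoint (sval a) (sval b) end.
Let env (t : bool) n m := if t then el n \in nth fset0 ss m else el n == el m.

(** The indices are ordered, so that an equation and its mirror image are the same variable. *)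
Definition eqf i j := if eqn i j then BT else if i < j then BV false i j else BV false j i.
Lemma eqfE i j : bval env (eqf i j) = (el i == el j).
Proof.
rewrite /eqf; case: ifP => [/eqP->|_]; first by rewrite eqxx.
by case: ifP => //= _; rewrite eq_sym.
Qed.
Fixpoint memf i a := match a with
  | SV n => BV true i n | SU a b => bO (memf i a) (memf i b)
  | SI a b => bA (memf i a) (memf i b) | SD a b => bA (memf i a) (bN (memf i b))
  | S1 j => eqf i j | S0 => BF end.
Lemma memfE i a : bval env (memf i a) = (el i \in sval a).
Proof.
elim: a => //= [a IHa b IHb|a IHa b IHb|a IHa b IHb|j];
  rewrite ?inE ?bOE ?bAE ?bNE ?IHa ?IHb ?eqfE //.
by rewrite andbC.
Qed.
Fixpoint pure c := match c with CS _ _ | CD _ _ => false | CN c => pure c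
  | CA c d | CO c d | CI c d => pure c && pure d | _ => true end.
Fixpoint exact c := match c with
  | CT => BT | CF => BF | CIn i a => memf i a | CE i j => eqf i j
  | CN c => bN (exact c) | CA c d => bA (exact c) (exact d)
  | CO c d => bO (exact c) (exact d) | CI c d => bO (bN (exact c)) (exact d)
  | _ => BT end.
Lemma exactE c : pure c -> bval env (exact c) = cval c.
Proof.
elim: c => //= [i a|i j|c IHc|c IHc d IHd|c IHc d IHd|c IHc d IHd] h;
 rewrite ?memfE ?eqfE ?bNE ?bAE ?bOE ?bNE ?IHc ?IHd ?implybE //; by case/andP: h.
Qed.
Definition conj (s : seq bform) := foldr bA BT s.
Lemma conjE s : bval env (conj s) = all (bval env) s.
Proof. by elim: s => //= f s IH; rewrite bAE IH. Qed.
(** An inclusion or disjointness among the hypotheses is instantiated at the named elements only; a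
    compound hypothesis that contains one is dropped. *)
Definition weak c := match c with
  | CS a b => conj [seq bO (bN (memf i a)) (memf i b) | i <- iota 0 (size es)]
  | CD a b => conj [seq bO (bN (memf i a)) (bN (memf i b)) | i <- iota 0 (size es)]
  | _ => if pure c then exact c else BT end.
Lemma weakE c : cval c -> bval env (weak c).
Proof.
case: c => //= [i a|i j|c|c d|c d|c d|a b|a b] h.
- by rewrite memfE.
- by rewrite eqfE.
- by case: ifP => // p; rewrite (@exactE (CN c)).
- by case: ifP => // p; rewrite (@exactE (CA c d)).
- by case: ifP => // p; rewrite (@exactE (CO c d)).
- by case: ifP => // p; rewrite (@exactE (CI c d)).
- rewrite conjE all_map; apply/allP => i _ /=; rewrite bOE bNE !memfE -implybE.
  by apply/implyP/(fsubsetP h).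
- rewrite conjE all_map; apply/allP => i _ /=; rewrite bOE !bNE !memfE -implybE.
  by apply/implyP/(fdisjointP h).
Qed.
(** Together with [trans]: the laws of equality, instantiated at the named elements, since the
    propositional search treats equations as plain variables. *)
Definition cong := conj [seq (let: (i, j, n) := p in
   bO (bN (eqf i j)) (bA (bO (bN (BV true i n)) (BV true j n)) (bO (BV true i n) (bN (BV true j n)))))
   | p <- [seq (ij, n) | ij <- [seq (i, j) | i <- iota 0 (size es), j <- iota 0 i],
                         n <- iota 0 (size ss)]].
Lemma congE : bval env cong.
Proof.
rewrite conjE all_map; apply/allP => -[[i j] n] _.
rewrite /= bOE bNE eqfE /=.
by case: eqP => //= ->; case: (_ \in _).
Qed.
Definition trans := conj [seq (let: (i, j, k) := p in
   bO (bN (eqf i j)) (bO (bN (eqf j k)) (eqf i k)))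
   | p <- [seq (ij, n) | ij <- [seq (i, j) | i <- iota 0 (size es), j <- iota 0 (size es)],
                         n <- iota 0 (size es)]].
Lemma transE : bval env trans.
Proof.
rewrite conjE all_map; apply/allP => -[[i j] k] _.
by rewrite /= !bOE !bNE !eqfE; case: eqP => //= ->; case: eqP.
Qed.
Lemma fs_solve hs g :
  bunsat 80 (bA (if pure g then bN (exact g) else BT) (bA (conj (map weak hs)) (bA cong trans))) ->
  all cval hs -> cval g.
Proof.
move/(bunsatP env); rewrite !bAE congE transE !andbT conjE all_map => h hh; apply: contraFT h => ng.
apply/andP; split; first by case: ifP => // p; rewrite bNE exactE.
by elim: hs hh => //= c s IH /andP[/weakE-> /IH->].
Qed.
End SetSolver.

Ltac fmem a l := match l with
  | a :: _ => constr:(O)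
  | _ :: ?l' => let n := fmem a l' in constr:(S n) end.
Ltac fadd a l := match l with
  | _ => let n := fmem a l in l
  | _ => constr:(a :: l) end.
Ltac s_atoms A p := match A with
  | ?x `|` ?y => let p1 := s_atoms x p in s_atoms y p1
  | ?x `&` ?y => let p1 := s_atoms x p in s_atoms y p1
  | ?x `\` ?y => let p1 := s_atoms x p in s_atoms y p1
  | [fset ?x] => match p with (?es, ?ss) => let es' := fadd (x : T) es in constr:((es', ss)) end
  | fset0 => p
  | _ => match p with (?es, ?ss) => let ss' := fadd (A : face) ss in constr:((es, ss')) end
  end.
Ltac e_atoms x p := match p with (?es, ?ss) => let es' := fadd (x : T) es in constr:((es', ss)) end.
Ltac c_atoms b p := match b with
  | true => p | false => p
  | ~~ ?x => c_atoms x p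
  | ?x && ?y => let p1 := c_atoms x p in c_atoms y p1
  | ?x || ?y => let p1 := c_atoms x p in c_atoms y p1
  | ?x ==> ?y => let p1 := c_atoms x p in c_atoms y p1
  | ?x `<=` ?y => let p1 := s_atoms x p in s_atoms y p1
  | fdisjoint ?x ?y => let p1 := s_atoms x p in s_atoms y p1
  | ?x == ?y => let p1 := e_atoms x p in e_atoms y p1
  | ?x \in ?A => let p1 := e_atoms x p in s_atoms A p1
  end.
Ltac s_reify A es ss := match A with
  | ?x `|` ?y => let f := s_reify x es ss in let g := s_reify y es ss in constr:(SU f g)
  | ?x `&` ?y => let f := s_reify x es ss in let g := s_reify y es ss in constr:(SI f g)
  | ?x `\` ?y => let f := s_reify x es ss in let g := s_reify y es ss in constr:(SD f g)
  | [fset ?x] => let n := fmem (x : T) es in constr:(S1 n)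
  | fset0 => constr:(S0)
  | _ => let n := fmem (A : face) ss in constr:(SV n)
  end.
Ltac c_reify b es ss := match b with
  | true => constr:(CT) | false => constr:(CF)
  | ~~ ?x => let f := c_reify x es ss in constr:(CN f)
  | ?x && ?y => let f := c_reify x es ss in let g := c_reify y es ss in constr:(CA f g)
  | ?x || ?y => let f := c_reify x es ss in let g := c_reify y es ss in constr:(CO f g)
  | ?x ==> ?y => let f := c_reify x es ss in let g := c_reify y es ss in constr:(CI f g)
  | ?x `<=` ?y => let f := s_reify x es ss in let g := s_reify y es ss in constr:(CS f g)
  | fdisjoint ?x ?y => let f := s_reify x es ss in let g := s_reify y es ss in constr:(CD f g)
  | ?x == ?y => let f := fmem (x : T) es in let g := fmem (y : T) es in constr:(CE f g)
  | ?x \in ?A => let f := fmem (x : T) es in let g := s_reify A es ss in constr:(CIn f g)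
  end.
Lemma bool_eq_intro (a b : bool) : (a ==> b) && (b ==> a) -> a = b.
Proof. by case: a; case: b. Qed.
Lemma false_intro : is_true false -> False.
Proof. by []. Qed.
Lemma imp_intro (a b : bool) : a ==> b -> a -> b.
Proof. by move/implyP. Qed.
(** Gives names to witnesses of failed inclusions and of nonemptiness; only named elements are
    considered afterwards. *)
Ltac fs_prep := repeat match goal with
 | H : is_true (_ && _) |- _ => move/andP: H => [? ?]
 | H : _ /\ _ |- _ => destruct H
 | H : is_true (~~ (_ `<=` _)) |- _ => move/fsubsetPn: H => [? ? ?]
 | H : (_ `<=` _) = false |- _ => move/negbT: H => H
 | H : is_true (_ != fset0) |- _ => move/fset0Pn: H => [? ?]
 end.
Ltac fs_goal := match goal with
 | |- is_true (~~ (_ `<=` _)) => apply/negP => ?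
 | |- is_true (_ != fset0) => rewrite -fsubset0; apply/negP => ?
 | |- is_true (_ `<=` _) => apply/fsubsetP => ? ?
 | |- is_true (fdisjoint _ _) => apply/fdisjointP => ? ?
 | |- @eq bool _ _ => idtac
 | |- @eq _ _ _ => apply/fsetP => ?
 | |- _ => idtac
 end.
Ltac fs_concl := match goal with
 | |- @eq bool _ _ => apply: bool_eq_intro
 | |- False => apply: false_intro
 | |- is_true _ => idtac end.
Ltac fs_rev := repeat match goal with
 | H : ?b = false |- is_true _ => move/negbT: H => H
 | H : is_true ?b |- is_true _ =>
     let p := c_atoms b (@nil T, @nil face) in revert H; apply: imp_intro
 end.
Ltac fs_hyps b es ss := match b with
  | ?x ==> ?y => let f := c_reify x es ss in
     match fs_hyps y es ss with (?hs, ?g) => constr:((f :: hs, g)) end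
  | _ => let g := c_reify b es ss in constr:((@nil cform, g)) end.
Lemma fs_final z es ss hs g :
  bunsat 80 (bA (if pure g then bN (exact g) else BT) (bA (conj (map (weak es) hs)) (bA (cong es ss) (trans es)))) ->
  cval z es ss (foldr CI g hs).
Proof.
move/(@fs_solve z) => h; have {}h : all (cval z es ss) hs -> cval z es ss g by exact: h.
elim: hs h => [|c hs IH] /= h; first exact: h.
by apply/implyP => hc; apply: IH => hh; apply: h; rewrite hc.
Qed.
Ltac fs_core := match goal with |- is_true ?b =>
  match c_atoms b (@nil T, @nil face) with (?es, ?ss) =>
  match fs_hyps b es ss with (?hs, ?g) =>
   change (is_true (cval (0, 0) es ss (foldr CI g hs))); apply: fs_final; vm_compute; exact isT
  end end end.
Ltac fs := intros; try (match goal with |- not _ => intro end); fs_prep; fs_goal; fs_concl; fs_rev; fs_core.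

(** * Complexes and bistellar moves *)

Definition vs (K : cplx) : face := \bigcup_(F <- K) F.

Lemma vsP (K : cplx) x : reflect (exists2 F, F \in K & x \in F) (x \in vs K).
Proof.
apply: (iffP (bigfcupP _ _ _ _)) => [[F /andP[FK _] xF]|[F FK xF]]; first by exists F.
by exists F => //; rewrite FK.
Qed.

Lemma sub_vs (K : cplx) F : F \in K -> F `<=` vs K.
Proof. by move=> FK; apply/fsubsetP => x xF; apply/vsP; exists F. Qed.

Definition closed (K : cplx) := forall F G : face, F \in K -> G `<=` F -> G \in K.

(* [mv A C] replaces [A * bd C * S] by [bd A * C * S]; [mv A [fset x]] is the stellar subdivision
   of [A] with new vertex [x]. *)
Fact mv_key : unit. Proof. exact: tt. Qed.
Definition mv (A C : face) (K : cplx) : cplx := locked_with mv_key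
  [fset G in fpowerset (vs K `|` C) |
     ~~ (A `<=` G) && ((G \in K) || (C `<=` G) && (A `|` (G `\` C) \in K))].

Lemma mvP (A C : face) K G :
  reflect (~~ (A `<=` G) /\ (G \in K \/ (C `<=` G /\ A `|` (G `\` C) \in K)))
          (G \in mv A C K).
Proof.
rewrite /mv unlock !inE /= fpowersetE.
apply: (iffP andP) => [[_ /andP[h1 /orP h2]]|[h1 h2]].
  by split=> //; case: h2 => [|/andP]; [left|right].
split; last by rewrite h1 /=; case: h2 => [->|[-> ->]]; rewrite ?orbT.
case: h2 => [/sub_vs h|[h /sub_vs h']]; fs.
Qed.

(** The last clause makes the link of [A] a join with [bd C]: in a face over [A], the part in [C]
    may be replaced by any maximal proper face of [C]. For a single new vertex it holds trivially,
    so stellar subdivisions are a special case ([star_ok]). *)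
Definition ok (A C : face) (K : cplx) :=
  [/\ A != fset0, C != fset0 & fdisjoint A C] /\
  [/\ A \in K, C \notin K &
      forall (F : face) c, F \in K -> A `<=` F -> c \in C ->
        (F `\` C) `|` (C `\ c) \in K].

Lemma mv_closed A C K : closed K -> ok A C K -> closed (mv A C K).
Proof.
move=> cl [[A0 C0 dAC] [AK CK J]] G H /mvP[nA h] sHG; apply/mvP; split; first by fs.
case: h => [GK|[CG h]]; first by left; apply: (cl G).
case: (boolP (C `<=` H)) => [CH|nCH]; first by right; split=> //; apply: (cl _ _ h); fs.
move/fsubsetPn: (nCH) => [c cC cH]; left.
apply: (cl _ _ (J _ c h _ cC)); fs.
Qed.

Lemma mv_ok_inv A C K : closed K -> ok A C K -> ok C A (mv A C K).
Proof.
move=> cl [[A0 C0 dAC] [AK CK J]]; split; first by split=> //; rewrite fdisjoint_sym.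
split.
- by apply/mvP; split; [fs | right; split=> //; apply: (cl A) => //; fs].
- by apply/mvP => -[]; rewrite fsubset_refl.
move=> F a /mvP[nA h] CF aA; apply/mvP; split; first by fs.
case: h => [FK|[_ h]]; first by move: CK; rewrite (cl F).
right; split; [fs|].
apply: (cl _ _ h); fs.
Qed.

Lemma mv_inv A C K : closed K -> ok A C K -> mv C A (mv A C K) = K.
Proof.
move=> cl [[A0 C0 dAC] [AK CK J]]; apply/fsetP => G; apply/idP/idP.
  case/mvP => nC [/mvP[nA [//|[]]]|[AG /mvP[nA [h|[CG h]]]]].
  - by move=> CG; rewrite CG in nC.
  - by case/negP: CK; apply: (cl _ _ h); fs.
  move/fsubsetPn: (nC) => [c cC cG].
  by apply: (cl _ _ (J _ c h _ cC)); fs.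
move=> GK; apply/mvP; split; first by apply: contra CK; apply: cl.
case: (boolP (A `<=` G)) => AG; last by left; apply/mvP; split=> //; left.
right; split=> //; apply/mvP; split; first by fs.
right; split; [fs | apply: (cl _ _ GK); fs].
Qed.

Lemma star_ok A x K : A \in K -> A != fset0 -> closed K -> x \notin vs K -> ok A [fset x] K.
Proof.
move=> AK A0 cl xK; have sA := sub_vs AK.
split; first by split=> //; fs.
split=> //; first by apply: contra xK => /sub_vs; fs.
move=> F c FK _ cx; apply: (cl F) => //; fs.
Qed.

(** Both subdivisions put the cone from [x] over the common boundary [bd A * bd C * S] in place of
    the stars [A * bd C * S] and [bd A * C * S]. Hence a bistellar move is one stellar subdivision
    followed by an inverse one ([sq_mv]). *)
Lemma mv_star A C K x : closed K -> ok A C K -> x \notin vs K -> x \notin C ->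
  mv C [fset x] (mv A C K) = mv A [fset x] K.
Proof.
move=> cl [[A0 C0 dAC] [AK CK J]] xK xC; have sA := sub_vs AK.
have xA : x \notin A by fs.
apply/fsetP => G; apply/idP/idP.
  case/mvP => nC [/mvP[nA [GK|[CG _]]]|[xG /mvP[nA [h|[CG h]]]]].
  - by apply/mvP; split=> //; left.
  - by rewrite CG in nC.
  - by case/negP: CK; apply: (cl _ _ h); fs.
  apply/mvP; split; first by fs.
  right; split=> //; move/fsubsetPn: (nC) => [c cC cG].
  by apply: (cl _ _ (J _ c h _ cC)); fs.
case/mvP => nA [GK|[xG h]].
  apply/mvP; split; first by apply: contra CK; apply: cl.
  by left; apply/mvP; split=> //; left.
apply/mvP; split.
  apply: contra CK => CG; apply: (cl _ _ h); fs.
right; split=> //; apply/mvP; split; first by fs.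
by right; split; [fs | apply: (cl _ _ h); fs].
Qed.
End SetSolver.
Import SetSolver.

(** * Stars as joins; commuting and splitting bistellar moves *)

Module Moves.
Implicit Types (K L M S : cplx) (A B C D E F G H : face).

Lemma mvE (A C : face) K G : (G \in mv A C K) =
  ~~ (A `<=` G) && ((G \in K) || (C `<=` G) && (A `|` (G `\` C) \in K)).
Proof.
apply/mvP/idP => [[-> [->|[-> ->]]]|/andP[h /orP[h'|/andP[h1 h2]]]]; rewrite ?orbT //.
  by split=> //; left.
by split=> //; right.
Qed.

Fact cone_bd_key : unit. Proof. exact: tt. Qed.
(** The join of [S] with the boundary of the simplex [E], when [E] is disjoint from the vertices of
    [S]. *)
Definition cone_bd (E : face) (S : cplx) : cplx := locked_with cone_bd_key
  [fset F in fpowerset (vs S `|` E) | ~~ (E `<=` F) && (F `\` E \in S)].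

Lemma cone_bdE E S F : (F \in cone_bd E S) = ~~ (E `<=` F) && (F `\` E \in S).
Proof.
rewrite /cone_bd unlock !inE /= fpowersetE andb_idl // => /andP[_ /sub_vs h]; fs.
Qed.

Fact rest_key : unit. Proof. exact: tt. Qed.
(** The candidate for the factor [S] of the star [A * bd C * S]; for a legal move it is this factor
    ([ok_star_is]). With [C] empty it is the link of [A]. *)
Definition rest (A C : face) (K : cplx) : cplx := locked_with rest_key
  [fset F in K | fdisjoint F (A `|` C) && (A `|` F \in K)].

Lemma restE A C K F : closed K ->
  (F \in rest A C K) = fdisjoint F (A `|` C) && (A `|` F \in K).
Proof.
move=> cl; rewrite /rest unlock !inE /= andb_idl // => /andP[_ h]; apply: (cl _ _ h); fs.
Qed.

(* Says that the star of [A] in [K] is [A * bd C * S]. *)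
Definition star_is (K : cplx) (A C : face) (S : cplx) :=
  [/\ A != fset0, C != fset0, fdisjoint A C & fdisjoint (vs S) (A `|` C)] /\
  [/\ C \notin K, fset0 \in S & forall F, A `<=` F ->
      (F \in K) = ~~ (C `<=` F) && (F `\` (A `|` C) \in S)].

Lemma star_isU K A C S X : star_is K A C S ->
  (A `|` X \in K) = ~~ (C `<=` X) && (X `\` (A `|` C) \in S).
Proof.
move=> [[A0 C0 d d'] [_ _ h]]; rewrite h; last by fs.
congr (~~ _ && _); first by apply/idP/idP; fs.
by congr (_ \in S); fs.
Qed.

Lemma star_is_ok K A C S : star_is K A C S -> closed S -> ok A C K.
Proof.
move=> st clS; have [[A0 C0 d d'] [CK S0 h]] := st.
split=> //; split=> //.
- rewrite h ?fsubset_refl //; apply/andP; split; [fs|].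
  by apply: (clS _ _ S0); fs.
move=> F c FK AF cC; move: FK; rewrite !h //; last by fs.
case/andP=> nC FS; apply/andP; split; [fs|].
apply: (clS _ _ FS); fs.
Qed.

Lemma ok_star_is K A C : closed K -> ok A C K -> star_is K A C (rest A C K).
Proof.
move=> cl [[A0 C0 d] [AK CK J]]; split.
  split=> //; apply/fdisjointP => x /vsP[F]; rewrite restE // => /andP[dF _]; fs.
split=> // [|F AF].
  by rewrite restE // fdisjoint0X /= (cl A) //; fs.
rewrite restE //; apply/idP/idP => [FK|/and3P[nC _ h]].
  rewrite (contra (cl _ _ FK) CK) /=; apply/andP; split; [fs|].
  by apply: (cl _ _ FK); fs.
move/fsubsetPn: nC => [c cC cF].
apply: (cl _ _ (J _ c h _ cC)); fs.
Qed.

Lemma rest_sub K A C : rest A C K `<=` K.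
Proof. by apply/fsubsetP => F; rewrite /rest unlock !inE => /andP[]. Qed.

Lemma vsS (K L : cplx) : K `<=` L -> vs K `<=` vs L.
Proof.
by move=> h; apply/fsubsetP => x /vsP[F FK xF]; apply/vsP; exists F => //; apply: (fsubsetP h).
Qed.

Section Comm.
Variables (K : cplx) (A C : face) (S : cplx) (B D : face).
Hypotheses (cl : closed K) (clS : closed S) (st : star_is K A C S) (okS : ok B D S)
  (dD : fdisjoint D (A `|` C)) (DK : D \notin K).

Let R := rest B D S.
Let stS : star_is S B D R. Proof. exact: ok_star_is. Qed.

Lemma commB : fdisjoint B (A `|` C).
Proof.
have [[_ _ _ dS] _] := st; have [_ [BS _ _]] := okS; have := sub_vs BS; fs.
Qed.

Lemma vs_rest : fdisjoint (vs R) (A `|` C `|` B `|` D).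
Proof.
have [[_ _ _ dS] _] := st; have h : vs R `<=` vs S := vsS (rest_sub S B D).
have [[_ _ _ dR] _] := stS; fs.
Qed.

(** In the link [bd C * S] of [A], the link of [B] is [bd C * bd D * R]. This is where the
    additional factor in the link of a lifted move comes from. *)
Lemma comm_star1 : star_is K (A `|` B) D (cone_bd C R).
Proof.
have dB := commB; have dR := vs_rest.
have [[A0 C0 dAC dS] [CK S0 h]] := st; have [[B0 D0 dBD dRS] [DS R0 hS]] := stS.
split.
  split=> //; [fs|fs|apply/fdisjointP => x /vsP[F]].
  rewrite cone_bdE => /andP[_ /sub_vs hF]; fs.
split=> //; first by rewrite cone_bdE fset0D R0 andbT; fs.
move=> F sF; rewrite h; last by fs.
rewrite hS; last by fs.
rewrite cone_bdE andbCA; rewrite (_ : (F `\` (A `|` C) `\` (B `|` D)) = (F `\` (A `|` B `|` D) `\` C)); last by fs.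
congr [&& ~~ _, ~~ _ & _]; by apply/idP/idP; fs.
Qed.


Lemma comm_star2 : star_is (mv (A `|` B) D K) A C (mv B D S).
Proof.
have dB := commB; have [[A0 C0 dAC dS] [CK S0 h]] := st.
have [[B0 D0 dBD dRS] [DS R0 hS]] := stS.
split.
  split=> //; apply/fdisjointP => x /vsP[F]; rewrite mvE => /andP[_ /orP[/sub_vs|/andP[_ /sub_vs]]]; fs.
split.
- rewrite mvE; apply/negP => /andP[_ /orP[hC|/andP[]]]; first by rewrite hC in CK.
  by fs.
- rewrite mvE S0 andbT; fs.
move=> F AF; rewrite mvE mvE.
have -> : (A `|` B `<=` F) = (B `<=` F `\` (A `|` C)) by apply/idP/idP; fs.
rewrite (h F) // (h (_ `|` _)); last by fs.
have -> : (C `<=` A `|` B `|` F `\` D) = (C `<=` F) by apply/idP/idP; fs.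
have -> : (D `<=` F `\` (A `|` C)) = (D `<=` F) by apply/idP/idP; fs.
have -> : (A `|` B `|` F `\` D) `\` (A `|` C) = B `|` F `\` (A `|` C) `\` D by fs.
by do 3!case: (_ `<=` _); rewrite /= ?andbT ?andbF.
Qed.

(** A move [(B, D)] in the factor [S] can be made before [mv A C], over [A], or after it, over [C].
    So a move over [S] may be exchanged for a move over [mv B D S], at the price of two moves whose
    links involve only the smaller complex [R]. *)
Lemma comm_mv : mv A C (mv (A `|` B) D K) = mv (C `|` B) D (mv A C K).
Proof.
have dB := commB; have [[A0 C0 dAC dS] [CK S0 h]] := st.
apply/fsetP => G; rewrite !mvE.
rewrite -[A `|` B `|` ((A `|` _) `\` D)]fsetUA -[A `|` B `|` (G `\` D)]fsetUA.
rewrite !(star_isU _ st).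
have -> : C `|` B `|` G `\` D \in K = false.
  by apply/negbTE; apply: contra CK => /cl; apply; fs.
case: (boolP (A `<=` G)) => [AG|nAG].
  have -> : A `<=` C `|` B `|` G `\` D by fs.
  by rewrite !andbF.
have -> : (A `|` B `<=` G) = false by apply/negbTE; fs.
have -> : (A `<=` C `|` B `|` G `\` D) = false by apply/negbTE; fs.
have -> : (A `|` B `<=` A `|` G `\` C) = (B `<=` G) by apply/idP/idP; fs.
have -> : (C `<=` G `\` C) = false by apply/negbTE; fs.
have -> : (D `<=` A `|` G `\` C) = (D `<=` G) by apply/idP/idP; fs.
have -> : (C `<=` B `|` G `\` D) = (C `<=` G) by apply/idP/idP; fs.
have -> : (C `<=` B `|` (A `|` G `\` C) `\` D) = false by apply/negbTE; fs.
have -> : (C `<=` C `|` B `|` G `\` D) by fs.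
have -> : (C `<=` (C `|` B `|` G `\` D) `\` C) = false by apply/negbTE; fs.
rewrite [C `|` B `<=` G]fsubUset.
have -> : (B `|` (A `|` G `\` C) `\` D) `\` (A `|` C) = B `|` (G `\` (A `|` C `|` D)) by fs.
have -> : (B `|` G `\` D) `\` (A `|` C) = B `|` (G `\` (A `|` C `|` D)) by fs.
have -> : (C `|` B `|` G `\` D) `\` C `\` (A `|` C) = B `|` (G `\` (A `|` C `|` D)) by fs.
have GC : G \in K -> (C `<=` G) = false by move=> GK; apply/negbTE; apply: contra CK; apply: cl.
case: (boolP (G \in K)) GC => [_ /(_ isT)->|_ _]; rewrite /= ?andbT ?andbF ?orbF //.
by case: (C `<=` G); case: (B `<=` G); case: (D `<=` G) => //=;
   rewrite ?andbT ?andbF ?orbF ?orbT.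
Qed.

End Comm.

Lemma star_is_inv K A C S : closed K -> closed S -> star_is K A C S ->
  star_is (mv A C K) C A S.
Proof.
move=> cl clS st; have [[A0 C0 d d'] [CK S0 h]] := st.
split; first by split=> //; [rewrite fdisjoint_sym|rewrite fsetUC].
split=> //; first by rewrite mvE fsubset_refl.
move=> F CF; rewrite mvE (star_isU _ st) CF.
have -> : F \in K = false by apply/negbTE; apply: contra CK => /cl; apply.
have -> : (C `<=` F `\` C) = false by apply/negbTE; fs.
by rewrite /=; congr (_ && (_ \in S)); fs.
Qed.

Section Split.
Variables (K : cplx) (A C : face) (S : cplx) (E' : face) (e : T).
Hypotheses (cl : closed K) (clS : closed S).
Hypothesis hE : [/\ e \notin E', E' != fset0 & fdisjoint (e |` E') (vs S `|` A `|` C)].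
Hypothesis (st : star_is K A C (cone_bd (e |` E') S)).

Lemma split_dS : fdisjoint (vs S) (A `|` C).
Proof.
have [eE E0 dE] := hE; have [[A0 C0 d dS] [CK S0 h]] := st.
apply/fdisjointP => x xS; apply: (fdisjointP dS); apply/vsP.
case/vsP: xS => F FS xF; exists F => //; rewrite cone_bdE; have hF := sub_vs FS.
apply/andP; split; [fs|apply: (clS FS); fs].
Qed.

Lemma split_S0 : fset0 \in S.
Proof. by have [_ [_ + _]] := st; rewrite cone_bdE fset0D => /andP[]. Qed.

Lemma split_star1 : star_is K (A `|` E') C S.
Proof.
have dS' := split_dS; have S0 := split_S0; have [eE E0 dE] := hE; have [[A0 C0 d dS] [CK _ h]] := st.
split; first by split=> //; [fs|fs|fs].
split=> // F sF; rewrite h; last by fs.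
congr (_ && _); rewrite cone_bdE.
apply/andP/idP => [[h1 h2]|hF]; first by apply: (clS h2); fs.
have := sub_vs hF => hs; split; [fs|apply: (clS hF); fs].
Qed.

Lemma split_star2 : star_is (mv (A `|` E') C K) A (e |` C) (cone_bd E' S).
Proof.
have dS' := split_dS; have S0 := split_S0; have [eE E0 dE] := hE; have [[A0 C0 d dS] [CK _ h]] := st.
split.
  split=> //; [fs|fs|apply/fdisjointP => x /vsP[F]].
  rewrite cone_bdE => /andP[_ /sub_vs hF]; fs.
split.
- rewrite mvE; apply/negP => /andP[_ /orP[/cl hC|/andP[_]]].
    by case/negP: CK; apply: hC; fs.
  rewrite -fsetUA (star_isU _ st) cone_bdE => /and3P[_ nE _]; fs.
- rewrite cone_bdE fset0D S0 andbT; fs.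
move=> F AF; rewrite mvE (h F) // -fsetUA (star_isU _ st) !cone_bdE.
have -> : (A `|` E' `<=` F) = (E' `<=` F) by apply/idP/idP; fs.
have -> : (C `<=` E' `|` F `\` C) = false by apply/negbTE; fs.
have -> : (E' `<=` F `\` (A `|` (e |` C))) = (E' `<=` F) by apply/idP/idP; fs.
have -> : (e |` E' `<=` F `\` (A `|` C)) = (e \in F) && (E' `<=` F) .
  by apply/idP/idP => [|/andP[]]; last (by fs); move=> hh; apply/andP; split; fs.
have -> : (e |` E' `<=` (E' `|` F `\` C) `\` (A `|` C)) = (e \in F) by apply/idP/idP; fs.
have -> : (e |` C `<=` F) = (e \in F) && (C `<=` F) by rewrite fsubUset fsub1set.
have -> : (E' `|` F `\` C) `\` (A `|` C) `\` (e |` E') = F `\` (A `|` (e |` C)) `\` E' by fs.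
have -> : F `\` (A `|` C) `\` (e |` E') = F `\` (A `|` (e |` C)) `\` E' by fs.
by case: (_ \in F); case: (_ `<=` F); case: (_ `<=` F); rewrite /= ?andbT ?andbF ?orbF ?orbT.
Qed.

(** The boundary of [e * E'] is [E'] glued to [e * bd E']. The first move treats the part of the
    star over [E']; in what is left, [e] has joined [C] and the factor is [bd E']. So a factor of
    the link is traded for one with a vertex less. *)
Lemma split_mv : mv A C K = mv A (e |` C) (mv (A `|` E') C K).
Proof.
have dS' := split_dS; have S0 := split_S0; have [eE E0 dE] := hE; have [[A0 C0 d dS] [CK _ h]] := st.
apply/fsetP => G; rewrite mvE mvE (star_isU _ split_star2) mvE -fsetUA !(star_isU _ st) !cone_bdE.
case: (boolP (A `<=` G)) => //= nAG.
have -> : (A `|` E' `<=` G) = false by apply/negbTE; fs.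
have -> : (C `<=` G `\` C) = false by apply/negbTE; fs.
have -> : (e |` C `<=` G `\` (e |` C)) = false by apply/negbTE; fs.
have -> : (C `<=` E' `|` G `\` C) = false by apply/negbTE; fs.
have -> : (e |` E' `<=` G `\` C `\` (A `|` C)) = (e \in G) && (E' `<=` G) .
  by apply/idP/idP => [|/andP[]]; last (by fs); move=> hh; apply/andP; split; fs.
have -> : (e |` E' `<=` (E' `|` G `\` C) `\` (A `|` C)) = (e \in G) by apply/idP/idP; fs.
have -> : (e |` C `<=` G) = (e \in G) && (C `<=` G) by rewrite fsubUset fsub1set.
have -> : (E' `<=` G `\` (e |` C) `\` (A `|` (e |` C))) = (E' `<=` G) by apply/idP/idP; fs.
have -> : (E' `|` G `\` C) `\` (A `|` C) `\` (e |` E') = G `\` (A `|` (e |` C)) `\` E' by fs.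
have -> : G `\` C `\` (A `|` C) `\` (e |` E') = G `\` (A `|` (e |` C)) `\` E' by fs.
have -> : G `\` (e |` C) `\` (A `|` (e |` C)) `\` E' = G `\` (A `|` (e |` C)) `\` E' by fs.
by case: (_ \in K) => //; case: (_ \in G); case: (_ `<=` G); case: (_ `<=` G); rewrite /= ?andbT ?andbF ?orbF ?orbT.
Qed.
End Split.
End Moves.
Import Moves.

(** * Renaming, fresh colors and stellar equivalence *)

Module Renaming.
Implicit Types (K L M S : cplx) (A B C D E F G H : face) (f g : T -> T) (x y z : T).

Fact imf_key : unit. Proof. exact: tt. Qed.
Definition imf (f : T -> T) (K : cplx) : cplx := locked_with imf_key [fset (f @` (F : face)) | F in K].

Lemma imfP f K G : reflect (exists2 F, F \in K & G = f @` F) (G \in imf f K).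
Proof. by rewrite /imf locked_withE; apply: (iffP (imfsetP _ _ _ _)) => [[F h ->]|[F h ->]]; exists F. Qed.

Lemma mem_imfT f (F : face) z : injective f -> (f z \in f @` F) = (z \in F).
Proof. by move=> inj; rewrite mem_imfset. Qed.

Lemma imf_sub f (F G : face) : injective f -> (f @` F `<=` f @` G) = (F `<=` G).
Proof.
move=> inj; apply/fsubsetP/fsubsetP => h z zF.
  by rewrite -(mem_imfT G z inj) h // mem_imfT.
by case/imfsetP: zF => y /= yF ->; rewrite mem_imfset //; apply: h.
Qed.

Lemma imf_U f (F G : face) : f @` (F `|` G) = f @` F `|` f @` G.
Proof. exact: imfsetU. Qed.

Lemma imf_D f (F G : face) : injective f -> f @` (F `\` G) = f @` F `\` f @` G.
Proof.
move=> inj; apply/fsetP => z; rewrite in_fsetD; apply/imfsetP/andP => /=.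
  by move=> [y]; rewrite in_fsetD => /andP[h1 h2] ->; rewrite !mem_imfT.
by move=> [h1 /imfsetP[y /= yF e]]; subst z; exists y; rewrite // in_fsetD yF -(mem_imfT G y inj) h1.
Qed.

Lemma imf_1 f z : f @` [fset z] = [fset f z].
Proof. exact: imfset_fset1. Qed.

Lemma imf_0 f : f @` (fset0 : face) = fset0.
Proof. exact: imfset0. Qed.

Lemma imf_inj f : injective f -> injective (fun F : face => f @` F).
Proof.
by move=> inj F G /eqP; rewrite eqEfsubset !imf_sub // => h; apply/eqP; rewrite eqEfsubset.
Qed.

Lemma imfE f K F : injective f -> (f @` F \in imf f K) = (F \in K).
Proof. by move=> inj; rewrite /imf locked_withE mem_imfset //; apply: imf_inj. Qed.

Lemma imf_disj f (F G : face) : injective f -> fdisjoint (f @` F) (f @` G) = fdisjoint F G.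
Proof.
move=> inj; apply/fdisjointP/fdisjointP => h z zF.
  by rewrite -(mem_imfT G z inj) h // mem_imfT.
by case/imfsetP: zF => y /= yF ->; rewrite mem_imfT // h.
Qed.

Lemma sub_imf f (F G : face) : G `<=` f @` F -> exists2 H, H `<=` F & G = f @` H.
Proof.
move=> h; exists [fset z in F | f z \in G]; first by apply/fsubsetP => z; rewrite !inE => /andP[].
apply/fsetP => z; apply/idP/imfsetP => /= [zG|[y]].
  have /imfsetP[y /= yF e] := fsubsetP h z zG.
  by exists y; rewrite // !inE yF -e.
by rewrite !inE => /andP[_ h1] ->.
Qed.

Lemma vs_imf f K : vs (imf f K) = f @` vs K.
Proof.
apply/fsetP => z; apply/vsP/imfsetP => /= [[G /imfP[F FK ->] /imfsetP[y /= yF ->]]|[y /vsP[F FK yF] ->]].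
  by exists y => //; apply/vsP; exists F.
by exists (f @` F); [apply/imfP; exists F | apply/imfsetP; exists y].
Qed.

Lemma imf_closed f K : closed K -> closed (imf f K).
Proof.
by move=> cl G H /imfP[F FK ->] /sub_imf[H' h ->]; apply/imfP; exists H' => //; apply: (cl F).
Qed.

Lemma imf_mv f A C K : injective f -> imf f (mv A C K) = mv (f @` A) (f @` C) (imf f K).
Proof.
move=> inj; apply/fsetP => G; apply/imfP/idP.
  move=> [F FK ->]; move: FK; rewrite !mvE imf_sub // imf_sub // imfE //.
  by rewrite -imf_D // -imf_U imfE.
move=> h; have [H e] : exists H, G = f @` H.
  move: h; rewrite mvE => /andP[_ /orP[/imfP[F _ ->]|/andP[h /imfP[F _ e]]]]; first by exists F.
  suff /sub_imf[H _ ->] : G `<=` f @` (F `|` C) by exists H.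
  rewrite imf_U -e; fs.
exists H => //; move: h; rewrite e !mvE !imf_sub // imfE //.
by rewrite -imf_D // -imf_U imfE.
Qed.

Lemma imf_comp f g K : imf f (imf g K) = imf (f \o g) K.
Proof.
apply/fsetP => G; apply/imfP/imfP => [[_ /imfP[F FK ->] ->]|[F FK ->]].
  by exists F => //; rewrite -imfset_comp.
by exists (g @` F); [apply/imfP; exists F|rewrite -imfset_comp].
Qed.

Lemma eq_imf f g K : {in vs K, f =1 g} -> imf f K = imf g K.
Proof.
move=> h; have e (F : face) : F \in K -> f @` F = g @` F.
  move=> /sub_vs hF; apply: eq_in_imfset => //= z zF; apply: h; exact: (fsubsetP hF).
by apply/fsetP => G; apply/imfP/imfP => -[F FK ->]; exists F; rewrite ?e.
Qed.

Lemma imf_id f K : {in vs K, f =1 id} -> imf f K = K.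
Proof.
move=> h; rewrite (eq_imf h); apply/fsetP => G; apply/imfP/idP => [[F FK ->]|GK].
  by rewrite imfset_id.
by exists G => //; rewrite imfset_id.
Qed.

Definition code (z : T) : nat := choice.pickle (z : (nat * nat)%type).
Lemma code_inj : injective code.
Proof. by move=> x y /(pcan_inj (@choice.pickleK (nat * nat)%type)). Qed.

(** Distinct vertices get distinct colors, all at least [N]: the image of any face is properly
    colored, and avoids every set with colors below [N]. *)
Definition fr (N : nat) (z : T) : T := ((N + code z)%N, 0).
Lemma fr_inj N : injective (fr N).
Proof. by move=> x y [] /addnI /code_inj. Qed.

Definition col (z : T) : nat := z.1.

Lemma col_bound (U : face) : exists N, forall z, z \in U -> col z < N.
Proof.
exists (\sum_(z <- U) col z).+1 => z zU.
by rewrite ltnS big_seq_fsetE (bigD1 [` zU]) //= leq_addr.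
Qed.

Lemma id_bound (U : face) : exists N, forall z : T, z \in U -> z.2 < N.
Proof.
exists (\sum_(z <- U) (z : T).2).+1 => z zU.
by rewrite ltnS big_seq_fsetE (bigD1 [` zU]) //= leq_addr.
Qed.

Lemma fresh_vertex (U : face) : exists x : T, x \notin U.
Proof.
have [N h] := col_bound U; exists (N, 0); apply/negP => /h.
by rewrite /col /= ltnn.
Qed.

Definition step K L := exists A x,
  [/\ closed K, A \in K, A != fset0, x \notin vs K & L = mv A [fset x] K].

Inductive sq (K : cplx) : cplx -> Prop :=
| sq_refl : sq K K
| sq_up L M : sq K L -> step L M -> sq K M
| sq_dn L M : sq K L -> step M L -> sq K M.

Lemma sq_trans K L M : sq K L -> sq L M -> sq K M.
Proof.
by move=> h; elim=> // N P _ IH s; [apply: sq_up s|apply: sq_dn s].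
Qed.

Lemma sq_sym K L : sq K L -> sq L K.
Proof.
elim=> [|N P _ IH s|N P _ IH s]; first exact: sq_refl.
  by apply: sq_trans IH; apply: sq_dn s; exact: sq_refl.
by apply: sq_trans IH; apply: sq_up s; exact: sq_refl.
Qed.

Lemma step_closed K L : step K L -> closed L.
Proof. by move=> [A [x [cl AK A0 xK ->]]]; apply: mv_closed => //; apply: star_ok. Qed.

Lemma sq_closed K L : sq K L -> closed K -> closed L.
Proof.
move=> h clK; elim: h => // [N P _ _ /step_closed //|N P _ _ [A [x []]] //].
Qed.

Lemma step_imf f K L : injective f -> step K L -> step (imf f K) (imf f L).
Proof.
move=> inj [A [x [cl AK A0 xK ->]]]; exists (f @` A), (f x); split.
- exact: imf_closed.
- by rewrite imfE.
- by rewrite -cardfs_eq0 card_imfset // cardfs_eq0.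
- by rewrite vs_imf mem_imfT.
- by rewrite imf_mv // imf_1.
Qed.

Lemma sq_imf f K L : injective f -> sq K L -> sq (imf f K) (imf f L).
Proof.
move=> inj; elim=> [|N P _ IH s|N P _ IH s]; first exact: sq_refl.
  by apply: sq_up IH _; apply: step_imf.
by apply: sq_dn IH _; apply: step_imf.
Qed.

Lemma vs_mv A C K : vs (mv A C K) `<=` vs K `|` C.
Proof.
apply/fsubsetP => z /vsP[G]; rewrite mvE => /andP[_ /orP[/sub_vs|/andP[_ /sub_vs]]]; fs.
Qed.

Lemma sq_mv A C K : closed K -> ok A C K -> sq K (mv A C K).
Proof.
move=> cl okK; have [x xU] := fresh_vertex (vs K `|` C).
have := okK => -[[A0 C0 d] [AK CK _]].
have hv := vs_mv A C K.
apply: (@sq_dn _ (mv A [fset x] K)).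
  by apply: sq_up (sq_refl _) _; exists A, x; split=> //; fs.
exists C, x; rewrite mv_star //; [|fs|fs]; split=> //; last by fs.
  exact: mv_closed.
by have [_ []] := mv_ok_inv cl okK.
Qed.
End Renaming.
Import Renaming.

(** * Links under stellar subdivision *)

Module Links.
Implicit Types (K L M S : cplx) (A B C D E F G H : face) (f g : T -> T) (x y z : T).

Fact bd_key : unit. Proof. exact: tt. Qed.
Definition bd B : cplx := locked_with bd_key [fset F in fpowerset B | ~~ (B `<=` F)].

Lemma bdE B F : (F \in bd B) = (F `<=` B) && ~~ (B `<=` F).
Proof. by rewrite /bd unlock !inE /= fpowersetE. Qed.

Lemma bd_closed B : closed (bd B).
Proof. by move=> F G; rewrite !bdE => /andP[h1 h2] h3; apply/andP; split; fs. Qed.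

Definition lk F K := rest F fset0 K.

Lemma lkE F K H : closed K -> (H \in lk F K) = fdisjoint H F && (F `|` H \in K).
Proof. by move=> cl; rewrite restE // fsetU0. Qed.

Lemma rest_closed A C K : closed K -> closed (rest A C K).
Proof.
move=> cl F G; rewrite !restE // => /andP[h1 h2] h3; apply/andP; split; [fs|].
by apply: (cl _ _ h2); fs.
Qed.

Lemma lk_closed F K : closed K -> closed (lk F K).
Proof. exact: rest_closed. Qed.

Lemma cone_bd_closed E S : closed S -> closed (cone_bd E S).
Proof.
move=> cl F G; rewrite !cone_bdE => /andP[h1 h2] h3; apply/andP; split; [fs|].
by apply: (cl _ _ h2); fs.
Qed.

Lemma notinK K x F : x \notin vs K -> x \in F -> F \in K = false.
Proof. by move=> xK xF; apply/negbTE; apply: contra xK => /sub_vs; fs. Qed.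

Section LinkStar.
Variables (K : cplx) (A : face) (x : T).
Hypotheses (cl : closed K) (AK : A \in K) (xK : x \notin vs K).
Hypothesis A0 : (A != fset0) = true.
Let K' := mv A [fset x] K.

Let xA : x \notin A. Proof. by have := sub_vs AK; fs. Qed.
Let cl' : closed K'.
Proof. by apply: mv_closed => //; apply: star_ok. Qed.

Lemma lk_star_a F : x \notin F -> A `|` F \in K -> ~~ (A `<=` F) ->
  lk F K' = mv (A `\` F) [fset x] (lk F K).
Proof.
move=> xF AF nAF; apply/fsetP => H; rewrite (lkE _ _ cl') 2!mvE 2!(lkE _ _ cl).
have -> : (A `<=` F `|` H) = (A `\` F `<=` H) by apply/idP/idP; fs.
have -> : ([fset x] `<=` F `|` H) = ([fset x] `<=` H) by apply/idP/idP; fs.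
have -> : fdisjoint (A `\` F `|` H `\ x) F = fdisjoint H F by apply/idP/idP; fs.
have -> : F `|` (A `\` F `|` H `\ x) = A `|` (F `|` H) `\ x by fs.
by case: (fdisjoint H F); rewrite /= ?andbF ?andbT.
Qed.

Lemma lk_star_b F : x \notin F -> A `|` F \notin K -> lk F K' = lk F K.
Proof.
move=> xF AF; apply/fsetP => H; rewrite (lkE _ _ cl') (lkE _ _ cl) mvE; congr (_ && _).
have -> : A `|` (F `|` H) `\ x \in K = false.
  by apply/negbTE; apply: contra AF => /cl; apply; fs.
rewrite andbF orbF andb_idl // => FH; apply: contra AF => h; apply: (cl FH); fs.
Qed.

(** Near the new vertex the complex is [x * bd A * lk A]. The link of [x] and [G] is computed factor
    by factor: the boundary of what [G] leaves of [A], joined with the link of [A] and [G]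
    together. *)
Lemma lk_star_c G : x \notin G -> ~~ (A `<=` G) ->
  lk (x |` G) K' = cone_bd (A `\` G) (lk (A `|` G) K).
Proof.
move=> xG nAG; apply/fsetP => H; rewrite lkE // cone_bdE mvE lkE //.
rewrite (notinK (F := x |` G `|` H) xK) /=; last by fs.
have -> : [fset x] `<=` x |` G `|` H by fs.
have -> : (A `<=` x |` G `|` H) = (A `\` G `<=` H) by apply/idP/idP; fs.
rewrite andbCA; congr (_ && _).
case: (boolP (x \in H)) => xH.
  rewrite [X in _ = _ && X](notinK xK) ?andbF; last by fs.
  have -> : fdisjoint H (x |` G) = false by apply/negbTE/negP => dH; fs.
  by [].
have -> : fdisjoint (H `\` (A `\` G)) (A `|` G) = fdisjoint H (x |` G) by apply/idP/idP; fs.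
by congr (_ && (_ \in K)); fs.
Qed.

End LinkStar.

(** A sphere of dimension [n - 1]; [sph 0] is the complex of the empty face alone. With this
    indexing the link of [F] subtracts [#|F|], and joins add. *)
Definition sph n S := exists2 B : face, #|` B| = n.+1 & sq S (bd B).

Lemma sph_sq n S S' : sq S S' -> sph n S -> sph n S'.
Proof. by move=> h [B cB h']; exists B => //; apply: sq_trans h'; apply: sq_sym. Qed.

Lemma sph_closed n S : sph n S -> closed S.
Proof. by move=> [B cB h]; apply: (sq_closed (sq_sym h)); apply: bd_closed. Qed.

Lemma bd_imf f B : injective f -> imf f (bd B) = bd (f @` B).
Proof.
move=> inj; apply/fsetP => G; apply/imfP/idP => [[F FK ->]|].
  by move: FK; rewrite !bdE !imf_sub.
rewrite bdE => /andP[/sub_imf[H hH ->]]; rewrite imf_sub // => h; exists H => //.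
by rewrite bdE hH.
Qed.

Lemma sph_imf f n S : injective f -> sph n S -> sph n (imf f S).
Proof.
move=> inj [B cB h]; exists (f @` B); first by rewrite card_imfset.
by rewrite -bd_imf //; apply: sq_imf.
Qed.

(** For moving the auxiliary vertices of a chain of subdivisions away from [U] while the vertices in
    [V] stay. *)
Lemma shift_away U V : exists2 f : T -> T, injective f &
  {in V, f =1 id} /\ forall z, z \notin V -> f z \notin U `|` V.
Proof.
have [N hN] := id_bound (U `|` V).
exists (fun z : T => if z \in V then z else (z.1, (z.2 + N)%N)).
  move=> x y; case: ifP => hx; case: ifP => hy //.
  - move=> e; have := hN x; rewrite inE hx orbT e /= => /(_ isT).
    by rewrite ltnNge leq_addl.
  - move=> e; have := hN y; rewrite inE hy orbT -e /= => /(_ isT).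
    by rewrite ltnNge leq_addl.
  by case: x y {hx hy} => [a b] [c d] /= [-> /addIn ->].
split=> [z ->//|z /negbTE ->]; apply/negP => /hN /=.
by rewrite ltnNge leq_addl.
Qed.

Lemma cone_bd_mv A C E S : fdisjoint E (A `|` C `|` vs S) -> C != fset0 ->
  cone_bd E (mv A C S) = mv A C (cone_bd E S).
Proof.
move=> d C0; apply/fsetP => G; rewrite !cone_bdE !mvE !cone_bdE.
have -> : (A `<=` G `\` E) = (A `<=` G) by apply/idP/idP; fs.
have -> : (C `<=` G `\` E) = (C `<=` G) by apply/idP/idP; fs.
have -> : (E `<=` A `|` G `\` C) = (E `<=` G) by apply/idP/idP; fs.
have -> : (A `|` G `\` C) `\` E = A `|` G `\` E `\` C by fs.
by case: (E `<=` G); case: (A `<=` G); rewrite /= ?andbF.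
Qed.

Lemma vs_sub_mem S z : closed S -> (z \in vs S) = ([fset z] \in S).
Proof.
move=> cl; apply/vsP/idP => [[F FS zF]|h]; last by exists [fset z]; rewrite ?inE.
by apply: (cl F) => //; fs.
Qed.

Lemma vs_cone_bd E S : vs (cone_bd E S) `<=` E `|` vs S.
Proof. by apply/fsubsetP => z /vsP[F]; rewrite cone_bdE => /andP[_ /sub_vs]; fs. Qed.

Lemma step_cone_bd E S S' : E != fset0 -> fset0 \in S -> fdisjoint E (vs S `|` vs S') -> step S S' ->
  step (cone_bd E S) (cone_bd E S').
Proof.
move=> E0 S0 d [A [x [cl AS A0 xS e]]].
have hA := sub_vs AS; have := A0 => /fset0Pn[a aA].
have xS' : x \in vs S'.
  apply/vsP; exists [fset x]; last by rewrite inE.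
  rewrite e mvE; apply/andP; split; [fs|].
  by apply/orP; right; apply/andP; split; [fs|apply: (cl A) => //; fs].
exists A, x; split=> //.
- exact: cone_bd_closed.
- by rewrite cone_bdE; apply/andP; split; [fs | apply: (cl A) => //; fs].
- by have := vs_cone_bd E S; fs.
- by rewrite e cone_bd_mv //; fs.
Qed.
End Links.
Import Links.

(** * Joins of spheres; links in manifolds *)

Module Spheres.
Implicit Types (K L M S : cplx) (A B C D E F G H : face) (f g : T -> T) (x y z : T).

Lemma step_fset0 K L : step K L -> fset0 \in K.
Proof. by move=> [A [x [cl AK _ _ _]]]; apply: (cl A) => //; fs. Qed.

Lemma step_fset0' K L : step K L -> fset0 \in L.
Proof.
move=> h; have K0 := step_fset0 h; case: h => [A [x [cl AK A0 _ ->]]].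
by rewrite mvE K0 /= andbT; fs.
Qed.

Lemma sq_fset0 K L : sq K L -> fset0 \in K -> fset0 \in L.
Proof. by move=> h K0; elim: h => // [N P _ _ /step_fset0'|N P _ _ /step_fset0]. Qed.

(** A subdivision can be joined with [bd E] only while it avoids [E], and the intermediate complexes
    of the chain may not. An injective renaming that fixes the vertices of [S] moves the whole chain
    away. *)
Lemma sq_away S S' E : sq S S' -> E != fset0 -> fset0 \in S -> fdisjoint E (vs S) ->
  exists f, [/\ injective f, {in vs S, f =1 id}, fdisjoint E (vs (imf f S')) &
     sq (cone_bd E S) (cone_bd E (imf f S'))].
Proof.
move=> h E0 S0 d; have [f inj [f1 f2]] := shift_away E (vs S); exists f.
have dE (M : cplx) : fdisjoint E (vs (imf f M)).
  rewrite vs_imf; apply/fdisjointP => z zE; apply/negP => /imfsetP[y /= _ e].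
  case: (boolP (y \in vs S)) => yS.
    by move: zE; rewrite e f1 //; fs.
  by have := f2 y yS; rewrite -e; fs.
split=> //; elim: h => [|N P h IH s|N P h IH s].
- by rewrite imf_id //; exact: sq_refl.
- apply: (sq_up IH); apply: step_cone_bd => //; last exact: step_imf.
    by apply/imfP; exists fset0; rewrite ?imf_0 //; apply: step_fset0 s.
  by have := dE N; have := dE P; fs.
apply: (sq_dn IH); apply: step_cone_bd => //; last exact: step_imf.
  by apply/imfP; exists fset0; rewrite ?imf_0 //; apply: step_fset0 s.
by have := dE N; have := dE P; fs.
Qed.

Lemma cone_bd_unit b S : b \notin vs S -> closed S -> cone_bd [fset b] S = S.
Proof.
move=> bS cl; apply/fsetP => F; rewrite cone_bdE; apply/andP/idP => [[h1 h2]|FS].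
  by apply: (cl _ _ h2); fs.
by have h := sub_vs FS; split; [fs|apply: (cl _ _ FS); fs].
Qed.

Lemma sph_bd B n : #|` B| = n.+1 -> sph n (bd B).
Proof. by exists B => //; exact: sq_refl. Qed.

Lemma sph_fset0 n S : sph n S -> fset0 \in S.
Proof.
move=> [B cB h]; apply: (sq_fset0 (sq_sym h)); rewrite bdE fsub0set /=.
have : B != fset0 by rewrite -cardfs_gt0 cB.
fs.
Qed.

(** Starring the face [E] in the boundary of the simplex on [E] and [B \ b], with [b] as the new
    vertex, gives [bd E * bd B]. *)
Lemma sph_bd2 B E : B != fset0 -> E != fset0 -> fdisjoint E B ->
  sph (#|` B| + #|` E|).-2%N (cone_bd E (bd B)).
Proof.
move=> B0 E0 d; have /fset0Pn[b bB] := B0.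
have cB : #|` B| = (#|` B `\ b|).+1 by rewrite (cardfsD1 b B) bB.
case: (eqVneq (B `\ b) fset0) => [e|B'0].
  have Be : B = [fset b] by move/eqP: e; rewrite -fsubset0 => e; apply/fsetP => z; fs.
  have -> : cone_bd E (bd B) = bd E.
    apply/fsetP => F; rewrite cone_bdE !bdE Be; apply/idP/idP.
      by move=> /and3P[h1 h2 h3]; apply/andP; split; fs.
    move=> /andP[h1 h2]; apply/and3P; split; rewrite // ?fsubDset; fs.
  by apply: sph_bd; rewrite Be cardfs1 /= prednK // cardfs_gt0.
exists (E `|` (B `\ b)).
  have := cardfsUI E (B `\ b); have -> : E `&` (B `\ b) = fset0 by fs.
  have : (0 < #|` E|)%N by rewrite cardfs_gt0.
  rewrite cardfs0; lia.
apply: (@sq_dn _ (cone_bd E (bd B))); first exact: sq_refl.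
exists E, b; split=> //; first exact: bd_closed.
- by rewrite bdE; apply/andP; split; fs.
- apply/vsP => -[F]; rewrite bdE => /andP[h _] bF; fs.
apply/fsetP => F.
rewrite cone_bdE.
rewrite mvE.
rewrite !(bdE, bdE).
have -> : ([fset b] `<=` F) = (b \in F) by rewrite fsub1set.
case: (boolP (E `<=` F)) => //= nEF.
have -> : (F `\` E `<=` B) = (F `<=` E `|` B) by rewrite fsubDset.
have -> : (B `<=` F `\` E) = (b \in F) && (B `\ b `<=` F).
  apply/idP/idP => [h|/andP[]]; last by fs.
  by apply/andP; split; fs.
have -> : (E `|` F `\ b `<=` E `|` B `\ b) = (F `<=` E `|` B) by apply/idP/idP; fs.
have -> : (E `|` B `\ b `<=` F) = false by apply/negbTE; fs.
have -> : (E `|` B `\ b `<=` E `|` F `\ b) = (B `\ b `<=` F) by apply/idP/idP; fs.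
rewrite andbT; case: (boolP (b \in F)) => bF /=.
  have -> : (F `<=` E `|` B `\ b) = false by apply/negbTE/negP; fs.
  by [].
by rewrite orbF andbT; apply/idP/idP; fs.
Qed.

Lemma bd1 B : #|` B| = 1 -> bd B = [fset fset0].
Proof.
move=> /eqP/cardfs1P[b ->]; apply/fsetP => F; rewrite bdE in_fset1.
apply/idP/eqP => [/andP[h1 h2]|->]; first by fs.
by apply/andP; split; fs.
Qed.

Lemma vs_bd B : (1 < #|` B|)%N -> vs (bd B) = B.
Proof.
move=> cB; apply/fsetP => z; rewrite vs_sub_mem ?bdE; last exact: bd_closed.
rewrite fsub1set; case: (boolP (z \in B)) => //= zB; apply/negP => /fsubset_leq_card.
by rewrite cardfs1 leqNgt cB.
Qed.

Lemma sph_join n S E : sph n S -> E != fset0 -> fdisjoint E (vs S) ->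
  sph (n + #|` E|).-1%N (cone_bd E S).
Proof.
move=> hS E0 d; have S0 := sph_fset0 hS; case: hS => B cB h.
have [f [inj _ dE hf]] := sq_away h E0 S0 d.
apply: (sph_sq (sq_sym hf)); rewrite bd_imf //.
have cB' : #|` f @` B| = n.+1 by rewrite card_imfset.
have B0 : f @` B != fset0 by rewrite -cardfs_gt0 cB'.
(* The boundary of a one-vertex simplex has no vertices, so its disjointness from [E] says nothing
   about that vertex; another vertex is taken instead. *)
case: n cB' cB h => [|n] cB' cB h.
  have [b' hb] := fresh_vertex E; have := @sph_bd2 [fset b'] E.
  rewrite cardfs1 add1n => H; have -> : bd (f @` B) = bd [fset b'].
    by rewrite (bd1 cB') bd1 // cardfs1.
  by apply: H => //; fs.
have := @sph_bd2 (f @` B) E; rewrite cB' => /(_ B0 E0); apply.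
move: dE; rewrite bd_imf // vs_bd // cB'; exact.
Qed.

Lemma join_dim n a b c : (b <= n)%N -> b = (a + c)%N -> (0 < c)%N ->
  (a.+1 <= n)%N /\ (n - b + c).-1%N = (n - a.+1)%N.
Proof. lia. Qed.

(** Dimension [n - 1]. All nonempty faces are tested, because the links after a stellar subdivision
    are expressed by links of larger faces ([lk_star_c]). *)
Definition mfd n K := [/\ closed K, fset0 \in K & forall F, F \in K -> F != fset0 ->
  (#|` F| <= n)%N /\ sph (n - #|` F|)%N (lk F K)].

Lemma lk_bd F B : F `<=` B -> lk F (bd B) = bd (B `\` F).
Proof.
move=> sF; apply/fsetP => H; rewrite lkE; last exact: bd_closed.
rewrite !bdE; apply/idP/idP => [/and3P[h1 h2 h3]|/andP[h1 h2]].
  by apply/andP; split; fs.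
by apply/and3P; split; fs.
Qed.

Lemma mfd_bd B n : #|` B| = n.+1 -> mfd n (bd B).
Proof.
move=> cB; split; first exact: bd_closed.
  by apply: (@sph_fset0 n); apply: sph_bd.
move=> F; rewrite bdE => /andP[h1 h2] F0.
have lt : (#|` F| < #|` B|)%N by apply: fproper_ltn_card; rewrite fproperE h1.
split; first by rewrite -ltnS -cB.
rewrite lk_bd //; apply: sph_bd; rewrite cardfsDS // cB subSn //.
by rewrite -ltnS -cB.
Qed.

Lemma mfd_step n K K' : step K K' -> mfd n K -> mfd n K'.
Proof.
move=> st [cl K0 h]; have cl' := step_closed st; split=> //; first exact: step_fset0' st.
case: st => [A [x [_ AK A0 xK e]]] F FK F0; subst K'.
have okA := star_ok AK A0 cl xK; have xA : x \notin A by have := sub_vs AK; fs.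
move: FK; rewrite mvE => /andP[nA]; case: (boolP (x \in F)) => xF FK.
  have hG : A `|` (F `\ x) \in K.
    by case/orP: FK => [FK|/andP[]] //; rewrite (notinK xK xF) in FK.
  have eF : F = x |` (F `\ x) by fs.
  rewrite eF lk_star_c //; [|fs|fs].
  have cF : #|` F| = (#|` F `\ x|).+1 by rewrite (cardfsD1 x F) xF.
  have AF0 : A `|` F `\ x != fset0 by fs.
  have [le hs] := h _ hG AF0.
  have cAF : #|` A `|` F `\ x| = (#|` F `\ x| + #|` A `\` (F `\ x)|)%N.
    rewrite -(cardfsID (F `\ x) (A `|` F `\ x)); congr (_ + _)%N; congr (#|` _|); fs.
  have D0 : A `\` (F `\ x) != fset0 by fs.
  have cD : (0 < #|` A `\` (F `\ x)|)%N by rewrite cardfs_gt0.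
  have [le1 e1] := join_dim le cAF cD.
  rewrite -eF cF; split=> //; have := sph_join hs D0; rewrite e1.
  apply; apply/fdisjointP => z zD; apply/vsP => -[H]; rewrite lkE // => /andP[dH _]; fs.
have FK' : F \in K by case/orP: FK => // /andP[]; rewrite fsub1set (negbTE xF).
have [le hs] := h _ FK' F0; split=> //.
case: (boolP (A `|` F \in K)) => AF; last by rewrite lk_star_b.
rewrite lk_star_a //; apply: sph_sq hs; apply: sq_up (sq_refl _) _; exists (A `\` F), x.
split=> //; first exact: lk_closed.
- by rewrite lkE //; apply/andP; split; [fs|apply: (cl _ _ AF); fs].
- fs.
- apply/vsP => -[H]; rewrite lkE // => /andP[_ /sub_vs hH] xH; fs.
Qed.

Lemma mfd_step' n K K' : step K K' -> mfd n K' -> mfd n K.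
Proof.
move=> st [cl' _ h]; have K0 := step_fset0 st.
have := st => -[A [x [cl AK A0 xK e]]]; subst K'; split=> // F FK F0.
have xA : x \notin A by have := sub_vs AK; fs.
have xF : x \notin F by have := sub_vs FK; fs.
case: (boolP (A `<=` F)) => AF; last first.
  have FK' : F \in mv A [fset x] K by rewrite mvE AF FK.
  have [le hs] := h _ FK' F0; split=> //; move: hs.
  case: (boolP (A `|` F \in K)) => AFK; last by rewrite lk_star_b.
  rewrite lk_star_a //; apply: sph_sq; apply: sq_dn (sq_refl _) _; exists (A `\` F), x.
  split=> //; first exact: lk_closed.
  - by rewrite lkE //; apply/andP; split; [fs|apply: (cl _ _ AFK); fs].
  - fs.
  - by apply/vsP => -[H]; rewrite lkE // => /andP[_ /sub_vs hH] xH; fs.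
(* The face [F] itself is gone. Exchanging one [a] in [A] for [x] gives a face of the same size and
   with the same link, as the boundary of the point [a] adds nothing to the join. *)
have /fset0Pn[a aA] := A0.
have GK : x |` (F `\ a) \in mv A [fset x] K.
  rewrite mvE; apply/andP; split; [fs|apply/orP; right; apply/andP; split; first by fs].
  by apply: (cl _ _ FK); fs.
have [] := h _ GK; first by fs.
rewrite lk_star_c //; [|fs|fs].
have -> : A `\` (F `\ a) = [fset a] by fs.
have -> : A `|` F `\ a = F by fs.
have -> : #|` x |` F `\ a| = #|` F|.
  rewrite cardfsU1 (_ : x \notin _); last by fs.
  by rewrite (cardfsD1 a F) (_ : a \in F); last by fs.
rewrite cone_bd_unit //; last exact: lk_closed.
by apply/vsP => -[H]; rewrite lkE // => /andP[dH _] aH; fs.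
Qed.

Lemma mfd_sq n K L : sq K L -> mfd n K -> mfd n L.
Proof. by move=> h m; elim: h => // [N P _ IH /mfd_step|N P _ IH /mfd_step']; apply. Qed.

Lemma sph_mfd n S : sph n S -> mfd n S.
Proof. by move=> [B cB h]; apply: (mfd_sq (sq_sym h)); apply: mfd_bd. Qed.
End Spheres.
Import Spheres.

(** * Elementary flips of properly colored complexes *)

Module ColoredFlips.
Implicit Types (K L M S : cplx) (A B C D E F G H : face) (f g : T -> T) (x y z : T)
  (Es : seq face).

Definition rb F := {in F &, injective col}.

Lemma rb_sub F G : rb F -> G `<=` F -> rb G.
Proof. by move=> h /fsubsetP s x y /s xF /s yF; apply: h. Qed.

Lemma rb_add F x : rb F -> (forall z, z \in F -> col z != col x) -> rb (x |` F).
Proof.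
move=> h hx y z; rewrite !inE => /orP[/eqP->|yF] /orP[/eqP->|zF] //; last exact: h.
  by move=> e; have := hx z zF; rewrite e eqxx.
by move=> e; have := hx y yF; rewrite e eqxx.
Qed.

Definition allrb K := forall F, F \in K -> rb F.

(** An elementary flip: the star of [A] is [A * bd C] and nothing more. Properness is required of
    the simplex on [A] and [C] together, whose boundary contains both the old and the new ball. *)
Definition flipR K L := exists A C,
  [/\ closed K, star_is K A C [fset fset0], rb (A `|` C) & L = mv A C K].

Lemma closed_fset0 : closed [fset fset0].
Proof.
move=> F G; rewrite !in_fset1 => /eqP-> h; apply/eqP; fs.
Qed.

Lemma flipR_closed K L : flipR K L -> closed L.
Proof.
move=> [A [C [cl st _ ->]]]; apply: mv_closed => //.
exact: (star_is_ok st closed_fset0).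
Qed.

Lemma flipR_sym K L : flipR K L -> flipR L K.
Proof.
move=> h; have clL := flipR_closed h; case: h => [A [C [cl st r e]]]; subst L.
have okA := star_is_ok st closed_fset0.
exists C, A; split=> //; first by apply: star_is_inv => //; exact: closed_fset0.
  by rewrite fsetUC.
by rewrite mv_inv.
Qed.

Inductive fl (K : cplx) : cplx -> Prop :=
| fl_refl : fl K K
| fl_step L M : fl K L -> flipR L M -> fl K M.

Lemma fl_trans K L M : fl K L -> fl L M -> fl K M.
Proof. by move=> h; elim=> // N P _ IH s; apply: fl_step s. Qed.

Lemma fl_one K L : flipR K L -> fl K L.
Proof. by move=> h; apply: fl_step h; exact: fl_refl. Qed.

Lemma fl_sym K L : fl K L -> fl L K.
Proof.
elim=> [|N P _ IH s]; first exact: fl_refl.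
by apply: fl_trans IH; apply: fl_one; apply: flipR_sym.
Qed.

(** The join of [S] with the boundaries of the simplices in [Es]; their vertices are collected in
    [W Es]. *)
Definition jn Es S := foldr cone_bd S Es.
Definition W Es := foldr (fun E U => E `|` U) (fset0 : face) Es.
Fixpoint nice Es (V : face) := if Es is E :: Es' then
  [/\ E != fset0, fdisjoint E (W Es' `|` V) & nice Es' V] else True.

Lemma jn_closed Es S : closed S -> closed (jn Es S).
Proof. by move=> cl; elim: Es => //= E Es IH; apply: cone_bd_closed. Qed.

Lemma vs_jn Es S : vs (jn Es S) `<=` W Es `|` vs S.
Proof.
elim: Es => /= [|E Es IH]; first by fs.
by have := vs_cone_bd E (jn Es S); fs.
Qed.

Lemma nice_ext Es V U : nice Es V -> fdisjoint U (W Es) -> nice Es (V `|` U).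
Proof.
elim: Es => //= E Es IH [E0 d n] dU; split=> //; [fs|apply: IH => //; fs].
Qed.

Lemma nice_sub Es V U : nice Es V -> U `<=` V -> nice Es U.
Proof. by elim: Es => //= E Es IH [E0 d n] dU; split=> //; [fs|apply: IH]. Qed.

Lemma nice_disj Es V : nice Es V -> fdisjoint (W Es) V.
Proof. by elim: Es => /= [|E Es IH [E0 d /IH]] *; fs. Qed.

(** Induction on the total size of the factors by [split_mv]; a factor with one vertex is trivial
    and is dropped. No vertex outside [A], [C] and the factors is ever used, so that every flip is
    properly colored. *)
Lemma fl_base Es K A C : closed K -> star_is K A C (jn Es [fset fset0]) ->
  nice Es (A `|` C) -> rb (A `|` C `|` W Es) -> fl K (mv A C K).
Proof.
have [n] := ubnP (\sum_(E <- Es) #|` E|)%N; elim: n Es K A C => // n IH [|E Es] K A C.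
  move=> _ cl st _; rewrite /= fsetU0 => r; apply: fl_one; exists A, C; split=> //.
rewrite big_cons /= => le cl st [E0 d ni] r.
have clj : closed (jn Es [fset fset0]) := jn_closed closed_fset0 (Es := Es).
have hv := vs_jn Es [fset fset0].
have v0 : vs [fset fset0] = fset0.
  by apply/fsetP => z; rewrite !inE; apply/vsP => -[F]; rewrite in_fset1 => /eqP ->; rewrite !inE.
rewrite v0 fsetU0 in hv.
have /fset0Pn[e eE] := E0.
have cE : #|` E| = (#|` E `\ e|).+1 by rewrite (cardfsD1 e E) eE.
have le' : (#|` E `\ e| + \sum_(F <- Es) #|` F| < n)%N by move: le; rewrite cE addSn ltnS.
have eE' : E = e |` (E `\ e) by fs.
case: (eqVneq (E `\ e) fset0) => [E1|E'0].
  have Ee : E = [fset e] by rewrite eE' E1 fsetU0.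
  apply: (IH Es) => //; first by apply: leq_ltn_trans le'; exact: leq_addl.
    by move: st; rewrite Ee cone_bd_unit //; fs.
  by apply: rb_sub r _; fs.
have hE : [/\ e \notin E `\ e, E `\ e != fset0 &
   fdisjoint (e |` (E `\ e)) (vs (jn Es [fset fset0]) `|` A `|` C)] by split=> //; fs.
have nd := nice_disj ni.
move: st; rewrite [in cone_bd E]eE' => st.
have st1 := split_star1 clj hE st; have st2 := split_star2 cl clj hE st.
rewrite (split_mv cl clj hE st).
apply: (@fl_trans _ (mv (A `|` E `\ e) C K)).
  apply: (IH Es) => //; first by apply: leq_ltn_trans le'; exact: leq_addl.
    rewrite (_ : A `|` _ `|` C = A `|` C `|` (E `\ e)); last by fs.
    by apply: nice_ext => //; fs.
  by apply: rb_sub r _; fs.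
apply: (IH (E `\ e :: Es)) => //=.
- by rewrite big_cons.
- apply: mv_closed => //; exact: (star_is_ok st1 clj).
- split=> //; first by fs.
  rewrite (_ : A `|` (e |` C) = A `|` C `|` [fset e]); last by fs.
  by apply: nice_ext => //; fs.
by apply: rb_sub r _; fs.
Qed.
End ColoredFlips.
Import ColoredFlips.

(** * Recoloring the link of a move *)

Module Refreshing.
Implicit Types (K L M S : cplx) (A B C D E F G H : face) (f g : T -> T) (x y z : T)
  (Es : seq face) (U V us : face).

Lemma rest_cone_bd A C E S : closed S -> E != fset0 -> fdisjoint E (A `|` C) ->
  rest A C (cone_bd E S) = cone_bd E (rest A C S).
Proof.
move=> cl E0 d; apply/fsetP => F; rewrite restE; last exact: cone_bd_closed.
rewrite !cone_bdE restE //.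
have -> : (E `<=` A `|` F) = (E `<=` F) by apply/idP/idP; fs.
have -> : (A `|` F) `\` E = A `|` F `\` E by fs.
rewrite andbCA; congr (_ && (_ && _)).
by apply/idP/idP; fs.
Qed.

Lemma ok_cone_bd A C E S : ok A C S -> E != fset0 -> fdisjoint E (A `|` C `|` vs S) ->
  ok A C (cone_bd E S).
Proof.
move=> [[A0 C0 d] [AS CS J]] E0 dE; split=> //; split.
- rewrite cone_bdE; apply/andP; split; first by fs.
  by have -> : A `\` E = A by fs.
- rewrite cone_bdE; apply/negP => /andP[_]; have -> : C `\` E = C by fs.
  by move=> h; rewrite h in CS.
move=> F c; rewrite !cone_bdE => /andP[nE FS] AF cC; apply/andP; split; first by fs.
have -> : (F `\` C `|` C `\ c) `\` E = (F `\` E `\` C) `|` C `\ c by fs.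
apply: J => //; fs.
Qed.

Lemma jn_ok Es A C S : ok A C S -> closed S -> nice Es (A `|` C `|` vs S) -> ok A C (jn Es S).
Proof.
move=> okS cl; elim: Es => //= E Es IH [E0 d ni].
apply: ok_cone_bd => //; first exact: IH.
have := vs_jn Es S; fs.
Qed.

Lemma jn_rest Es A C S : closed S -> nice Es (A `|` C) -> rest A C (jn Es S) = jn Es (rest A C S).
Proof.
move=> cl; elim: Es => //= E Es IH [E0 d ni]; rewrite rest_cone_bd //; last by fs.
  by rewrite IH.
exact: jn_closed.
Qed.

Lemma jn_mv Es A C S : C != fset0 -> nice Es (A `|` C `|` vs S) ->
  mv A C (jn Es S) = jn Es (mv A C S).
Proof.
move=> C0; elim: Es => //= E Es IH [E0 d ni]; rewrite -IH // -cone_bd_mv //.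
have := vs_jn Es S; fs.
Qed.

Lemma sub_vs_jn Es S V : closed S -> nice Es (V `|` vs S) -> vs S `<=` vs (jn Es S).
Proof.
move=> cl; elim: Es => //= E Es IH [E0 d ni]; apply/fsubsetP => z zS.
have := fsubsetP (IH ni) z zS; rewrite !vs_sub_mem; [|exact/cone_bd_closed/jn_closed|exact: jn_closed].
move=> h; rewrite cone_bdE; have zE : z \notin E by fs.
apply/andP; split; first by fs.
by have -> : [fset z] `\` E = [fset z] by fs.
Qed.

(** The factors [Es] are carried along because lifting a move from [S] adds [bd C] or [bd A] to its
    link ([lift_move]); the property must apply to such links as well. *)
Definition Pst S := forall Es K A C, closed K -> star_is K A C (jn Es S) ->
  nice Es (A `|` C `|` vs S) -> (forall F, F \in S -> rb (A `|` C `|` W Es `|` F)) ->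
  fl K (mv A C K).

Lemma vs_fset00 : vs [fset fset0] = fset0.
Proof.
by apply/fsetP => z; rewrite !inE; apply/vsP => -[F]; rewrite in_fset1 => /eqP ->; rewrite !inE.
Qed.

Lemma Pst_fset0 : Pst [fset fset0].
Proof.
move=> Es K A C cl st ni r; apply: fl_base st _ _ => //.
  by apply: nice_sub ni _; fs.
by have := r fset0; rewrite in_fset1 eqxx fsetU0 => /(_ isT).
Qed.

Lemma cone_bd_fset0 B : cone_bd B [fset fset0] = bd B.
Proof.
apply/fsetP => F; rewrite cone_bdE bdE in_fset1 andbC; congr (_ && _).
by rewrite fsetD_eq0.
Qed.

(** One move inside the link. Flips lead from [K] to [K1] and from [mv A C K] to [mv A C K1], and in
    [K1] the link factor of [A] has become [mv B D S]. The two lifted moves have [rest B D S] in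
    their links, joined with [bd C] and with [bd A], so that [Pst] provides the flips. *)
Lemma lift_move Es K A C S B D : closed K -> closed S -> star_is K A C (jn Es S) ->
  nice Es (A `|` C `|` vs S) -> ok B D S -> fdisjoint D (A `|` C `|` W Es) -> D \notin K ->
  Pst (rest B D S) ->
  (forall F, F \in rest B D S -> rb (A `|` C `|` B `|` D `|` W Es `|` F)) ->
  let K1 := mv (A `|` B) D K in
  [/\ fl K K1, fl (mv A C K) (mv A C K1), closed K1 & star_is K1 A C (jn Es (mv B D S))].
Proof.
move=> cl clS st ni okS dD DK P r K1.
have clj := jn_closed (Es := Es) clS.
have [[B0 D0 dBD] [BS DS _]] := okS; have hB := sub_vs BS.
have [[A0 C0 dAC dv] _] := st.
have nd := nice_disj ni.
have niD : nice Es (A `|` C `|` vs S `|` D) by apply: nice_ext => //; fs.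
have okj : ok B D (jn Es S) by apply: jn_ok => //; apply: nice_sub niD _; fs.
have okA := star_is_ok st clj.
have dS : fdisjoint (vs S) (A `|` C) by have := sub_vs_jn clS ni; fs.
have restS : rest B D (jn Es S) = jn Es (rest B D S).
  by apply: jn_rest => //; apply: nice_sub niD _; fs.
have vR : vs (rest B D S) `<=` vs S := vsS (rest_sub S B D).
have dD' : fdisjoint D (A `|` C) by fs.
have st1 : star_is K (A `|` B) D (jn (C :: Es) (rest B D S)).
  by rewrite /= -restS; apply: comm_star1.
have st2 : star_is K1 A C (mv B D (jn Es S)) by apply: comm_star2.
have cl1 : closed K1.
  by apply: mv_closed => //; apply: (star_is_ok st1); apply: jn_closed; apply: rest_closed.
split=> //.
- apply: (P (C :: Es)) => //=.
    split=> //; first by fs.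
    by apply: nice_sub niD _; fs.
  by move=> F FR; apply: rb_sub (r F FR) _; fs.
- have -> : mv A C K1 = mv (C `|` B) D (mv A C K) by apply: (comm_mv cl st).
  have st' := star_is_inv cl clj st.
  have DK' : D \notin mv A C K.
    rewrite mvE (negbTE DK) /= negb_and; apply/orP; right; apply/negP => /andP[h _]; fs.
  have dDc : fdisjoint D (C `|` A) by fs.
  apply: (P (A :: Es)) => //=.
  - exact: mv_closed.
  - by rewrite -restS; apply: comm_star1.
  - split=> //; first by fs.
    by apply: nice_sub niD _; fs.
  by move=> F FR; apply: rb_sub (r F FR) _; fs.
by rewrite -jn_mv //; apply: nice_sub niD _; fs.
Qed.

Definition upd (u v : T) (z : T) := if z == u then v else z.

Lemma upd_notin u v F : u \notin F -> upd u v @` F = F.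
Proof.
move=> uF; rewrite -[RHS]imfset_id; apply: eq_in_imfset => //= z zF.
by rewrite /upd; case: eqP => // e; move: uF; rewrite -e zF.
Qed.

Lemma upd_in u v F : u \in F -> upd u v @` F = v |` (F `\ u).
Proof.
move=> uF; transitivity (upd u v @` (u |` (F `\ u))); first by rewrite fsetD1K.
rewrite imfsetU1 upd_notin; last by rewrite !inE eqxx.
by rewrite /upd eqxx.
Qed.

(** Recoloring a vertex is thus a stellar subdivision, and can be lifted like any other move. *)
Lemma mv_rename u v K : closed K -> v \notin vs K -> [fset u] \in K ->
  mv [fset u] [fset v] K = imf (upd u v) K.
Proof.
move=> cl vK uK; have uv := sub_vs uK.
apply/fsetP => G; rewrite mvE !fsub1set; apply/idP/imfP.
  move=> /andP[uG /orP[GK|/andP[vG h]]].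
    by exists G => //; rewrite upd_notin.
  exists ([fset u] `|` G `\ v) => //; rewrite upd_in; fs.
move=> [F FK ->]; case: (boolP (u \in F)) => uF; last first.
  by rewrite upd_notin // uF FK.
have vF := sub_vs FK.
rewrite upd_in //; apply/andP; split; first by fs.
apply/orP; right; apply/andP; split; first by fs.
by apply: (cl _ _ FK); fs.
Qed.

Lemma lk_rest u v K : closed K -> v \notin vs K -> rest [fset u] [fset v] K = lk [fset u] K.
Proof.
move=> cl vK; apply/fsetP => F; rewrite restE // lkE //.
case: (boolP (_ `|` F \in K)) => h; rewrite ?andbF // !andbT.
by have := sub_vs h; move=> h'; apply/idP/idP; fs.
Qed.

Definition rn N (us : face) (z : T) := if z \in us then fr N z else z.

Lemma fr_col N z : (N <= col (fr N z))%N.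
Proof. exact: leq_addr. Qed.

Lemma fr_colN N z y : (col y < N)%N -> col y != col (fr N z).
Proof. by move=> h; rewrite neq_ltn (leq_trans h (fr_col N z)). Qed.

Lemma fr_col_inj N z y : col (fr N z) = col (fr N y) -> z = y.
Proof. by move=> /addnI /code_inj. Qed.

Lemma rb_fr N F : rb (fr N @` F).
Proof.
by move=> x y /imfsetP[x' /= _ ->] /imfsetP[y' /= _ ->] /fr_col_inj ->.
Qed.

Lemma fr_notin N U z : (forall y, y \in U -> (col y < N)%N) -> fr N z \notin U.
Proof. by move=> h; apply/negP => /h; rewrite ltnNge fr_col. Qed.

Lemma rb_U N F G : rb F -> (forall y, y \in F -> (col y < N)%N) -> rb (F `|` fr N @` G).
Proof.
move=> r h x y; rewrite !inE => /orP[xF|/imfsetP[x' /= _ ->]] /orP[yF|/imfsetP[y' /= _ ->]].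
- exact: r.
- by move=> e; have := fr_colN y' (h _ xF); rewrite e eqxx.
- by move=> e; have := fr_colN x' (h _ yF); rewrite e eqxx.
by move/fr_col_inj ->.
Qed.

Lemma imf_upd_rn N (us : face) u S : u \notin us -> (forall y, y \in vs S -> (col y < N)%N) -> u \in vs S ->
  imf (upd u (fr N u)) (imf (rn N us) S) = imf (rn N (u |` us)) S.
Proof.
move=> uus hN uS; rewrite imf_comp; apply: eq_imf => z zS.
rewrite /= /rn /upd !inE; case: (eqVneq z u) => [->|zu] /=; first by rewrite (negbTE uus) eqxx.
case: (boolP (z \in us)) => zus /=; last by rewrite (negbTE zu).
case: eqP => // e; move: (hN u uS); rewrite -e ltnNge fr_col //.
Qed.

Lemma vs_rn N us S : vs (imf (rn N us) S) `<=` (vs S `\` us) `|` fr N @` us.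
Proof.
rewrite vs_imf; apply/fsubsetP => z /imfsetP[y /= yS ->]; rewrite /rn !inE.
by case: ifP => yu; rewrite ?yu ?yS //= mem_imfset ?yu ?orbT //; exact: fr_inj.
Qed.

Lemma refresh n Es K A C S N us : (forall m S', (m < n)%N -> sph m S' -> Pst S') ->
  closed K -> sph n S -> star_is K A C (jn Es S) -> nice Es (A `|` C `|` vs S) ->
  (forall F, F \in S -> rb (A `|` C `|` W Es `|` F)) ->
  (forall y, y \in vs K `|` A `|` C `|` vs S `|` W Es -> (col y < N)%N) -> us `<=` vs S ->
  exists K2, [/\ fl K K2, fl (mv A C K) (mv A C K2), closed K2,
     star_is K2 A C (jn Es (imf (rn N us) S)) & sph n (imf (rn N us) S)] /\
   [/\ forall F, F \in imf (rn N us) S -> rb (A `|` C `|` W Es `|` F),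
     forall G, G \in K2 -> G `<=` fr N @` us -> A `|` G \in K2 & vs K2 `<=` vs K `|` fr N @` us].
Proof.
move=> P cl hS st ni r hN; have clS := sph_closed hS.
have nd := nice_disj ni.
have [k] := ubnP #|` us|; elim: k us => // k IH us le sus.
case: (eqVneq us fset0) => [->|/fset0Pn[u uus]].
  have -> : imf (rn N fset0) S = S by apply: imf_id => z _; rewrite /rn inE.
  exists K; split; first by split=> //; exact: fl_refl.
  rewrite imf_0; split=> //; last by fs.
  move=> G _; rewrite fsubset0 => /eqP->; rewrite fsetU0.
  by have [_ []] := star_is_ok st (jn_closed (Es := Es) clS).
have le' : (#|` us `\ u| < k)%N by move: le; rewrite (cardfsD1 u us) uus ltnS.
have [|K2 [[f1 f2 cl2 st2 s2] [r2 fr2 v2]]] := IH _ le'; first by fs.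
set S2 := imf (rn N (us `\ u)) S in st2 s2 r2.
have clS2 := sph_closed s2.
have uS : u \in vs S by fs.
have uS2 : [fset u] \in S2.
  apply/imfP; exists [fset u]; first by rewrite -vs_sub_mem.
  by rewrite imf_1 /rn !inE eqxx.
have fu (U : face) : fr N u \notin fr N @` (U `\ u).
  by rewrite mem_imfset; [rewrite !inE eqxx | exact: fr_inj].
have hN' (U : face) : U `<=` vs K `|` A `|` C `|` vs S `|` W Es -> fr N u \notin U.
  by move=> /fsubsetP h; apply: fr_notin => y /h; apply: hN.
have vK2 : fr N u \notin vs K2.
  have h : fr N u \notin vs K by apply: hN'; fs.
  by have := fu us; fs.
have vS2 : vs S2 `<=` (vs S `\` (us `\ u)) `|` fr N @` (us `\ u) := vs_rn N (us `\ u) S.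
have uvS2 : fr N u \notin vs S2.
  have h : fr N u \notin vs S by apply: hN'; fs.
  by have := fu us; fs.
have u0 : [fset u] != fset0 by fs.
have okS2 := star_ok uS2 u0 clS2 uvS2.
have ni2 : nice Es (A `|` C `|` vs S2).
  apply: (@nice_sub _ (A `|` C `|` vs S `|` fr N @` (us `\ u))); last by fs.
  apply: nice_ext => //; apply/fdisjointP => z /imfsetP[y /= _ ->].
  by apply: fr_notin => y' hy'; apply: hN; rewrite !inE hy' ?orbT.
have mr : mv [fset u] [fset fr N u] S2 = imf (rn N us) S.
  rewrite mv_rename // /S2 imf_upd_rn //; first by rewrite fsetD1K.
    by rewrite !inE eqxx.
  by move=> y yS; apply: hN; rewrite !inE yS ?orbT.
have rr F : F \in lk [fset u] S2 -> rb (A `|` C `|` [fset u] `|` [fset fr N u] `|` W Es `|` F).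
  rewrite lkE // => /andP[dF /[dup] FS2 /r2 rF].
  rewrite (_ : _ `|` F = fr N u |` (A `|` C `|` W Es `|` ([fset u] `|` F))); last by fs.
  apply: rb_add => // z zU; case: (boolP (z \in fr N @` (us `\ u))) => [/imfsetP[y /= yu ->]|zn].
    by apply/eqP => /fr_col_inj e; move: yu; rewrite e !inE eqxx.
  apply: fr_colN; apply: hN; move: zU; have := sub_vs FS2; fs.
have PR : Pst (rest [fset u] [fset fr N u] S2).
  rewrite lk_rest //; have [_ _ h] := sph_mfd s2.
  have [le1 sl] := h _ uS2 u0; apply: P sl; rewrite cardfs1 in le1 *.
  by rewrite ltn_subrL.
have [|||g1 g2 cl3 st3] := lift_move cl2 clS2 st2 ni2 okS2 _ _ PR.
- have h : fr N u \notin A `|` C `|` W Es by apply: hN'; fs.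
  by fs.
- by apply: contra vK2 => h; rewrite vs_sub_mem.
- by move=> F; rewrite lk_rest // => /rr.
exists (mv (A `|` [fset u]) [fset fr N u] K2); rewrite -mr; split.
  split=> //; [exact: fl_trans g1 | exact: fl_trans g2 |].
  by apply: sph_sq s2; apply: sq_mv.
have hA : fr N u \notin A by apply: hN'; fs.
have uf : u \notin fr N @` us.
  have hu : (col u < N)%N by apply: hN; rewrite !inE uS ?orbT.
  by apply/imfsetP => -[y /= _ e]; move: hu; rewrite e ltnNge fr_col.
have uA : u \notin A.
  by have [[_ _ _ dv] _] := st; have := sub_vs_jn clS ni; fs.
split.
- move=> F; rewrite mvE !fsub1set => /andP[uF /orP[/r2//|/andP[vF FS2]]].
  have dF : [fset u] `|` F `\ fr N u = [fset u] `|` (F `\ fr N u `\ u) by fs.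
  have /rr h : F `\ fr N u `\ u \in lk [fset u] S2.
    by rewrite lkE // -dF FS2 andbT; fs.
  by apply: rb_sub h _; fs.
- move=> G GK3 sG; case: (boolP (fr N u \in G)) => uG.
    move: GK3; rewrite !mvE => /andP[nG /orP[GK2|/andP[_ h]]].
      by rewrite (notinK vK2 uG) in GK2.
    apply/andP; split; first by fs.
    apply/orP; right; apply/andP; split; first by fs.
    by apply: (cl2 _ _ h); fs.
  have GK2 : G \in K2.
    by move: GK3; rewrite mvE fsub1set (negbTE uG) /= orbF => /andP[].
  have sG' : G `<=` fr N @` (us `\ u).
    apply/fsubsetP => z zG; have /imfsetP[y /= yus e] := fsubsetP sG z zG.
    rewrite e mem_imfset; last exact: fr_inj.
    by rewrite !inE yus andbT; apply: contra uG => /eqP <-; rewrite -e.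
  rewrite mvE (fr2 G GK2 sG') /= andbT.
  by fs.
have := vs_mv (A `|` [fset u]) [fset fr N u] K2; move: v2.
have -> : fr N @` us = fr N u |` fr N @` (us `\ u) by rewrite -imfsetU1 fsetD1K.
fs.
Qed.

Lemma imf_star_is f K A C S : injective f -> closed K -> star_is K A C S -> closed S ->
  star_is (imf f K) (f @` A) (f @` C) (imf f S).
Proof.
move=> inj cl st clS; have [[A0 C0 d dS] [CK S0 h]] := st; split.
  split; rewrite ?vs_imf -?imf_U ?imf_disj //.
    by rewrite -cardfs_gt0 card_imfset // cardfs_gt0.
  by rewrite -cardfs_gt0 card_imfset // cardfs_gt0.
split; rewrite ?imfE //; first by rewrite -(imf_0 f) imfE.
move=> G sG; apply/imfP/idP => [[F FK eG]|/andP[nC /imfP[F FS e]]].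
  move: sG; rewrite eG !imf_sub // -imf_U -imf_D // imfE // => sG.
  by rewrite -h.
have {}e : G = f @` (A `|` F `|` [fset z in C | f z \in G]).
  apply/fsetP => z; rewrite !imf_U !inE; apply/idP/idP => [zG|/orP[/orP[/(fsubsetP sG)//|]|]].
  - case: (boolP (z \in f @` A)) => //= zA; rewrite -e !inE negb_or zA zG /= andbT.
    case: (boolP (z \in f @` C)) => //= /imfsetP[y /= yC ey]; rewrite ey mem_imfset //.
    by rewrite !inE yC -ey.
  - by rewrite -e !inE => /andP[].
  by move=> /imfsetP[y /=]; rewrite !inE => /andP[_ yG] ->.
exists (A `|` F `|` [fset z in C | f z \in G]) => //.
rewrite h; last by fs.
move: nC; rewrite {1}e imf_sub // => -> /=.
set Z := [fset _ in C | _]; have sZ : Z `<=` C by apply/fsubsetP => z; rewrite !inE => /andP[].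
by apply: (clS _ _ FS); fs.
Qed.

Lemma imf_fset00 f : imf f [fset fset0] = [fset fset0].
Proof. by rewrite imf_id // => z; rewrite vs_fset00 inE. Qed.

Lemma mem_jn Es S G : nice Es (vs S) -> G \in jn Es S -> fdisjoint G (W Es) -> G \in S.
Proof.
elim: Es => //= E Es IH [E0 d ni]; rewrite cone_bdE => /andP[nE h] dG.
have e : G `\` E = G by fs.
by apply: IH => //; rewrite ?e // in h *; fs.
Qed.


Lemma star_is_rest K A C S : closed K -> closed S -> star_is K A C S -> rest A C K = S.
Proof.
move=> cl clS st; have [[A0 C0 d dS] [CK S0 h]] := st.
apply/fsetP => F; rewrite restE // (star_isU _ st); apply/idP/idP.
  by case/and3P=> h1 h2 h3; have -> : F = F `\` (A `|` C) by fs.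
move=> FS; have hF := sub_vs FS; apply/and3P; split; [fs|fs|].
by have <- : F = F `\` (A `|` C) by fs.
Qed.

Lemma nice_rcons Es B V : nice Es (V `|` B) -> B != fset0 -> fdisjoint B V -> nice (Es ++ [:: B]) V.
Proof.
elim: Es => /= [_ B0 d|E Es IH [E0 d ni] B0 dB]; first by split=> //; fs.
have eW : W (Es ++ [:: B]) = W Es `|` B.
  by elim: (Es) => /= [|E' Es' ->]; fs.
by split=> //; [rewrite eW; fs|apply: IH].
Qed.

Lemma W_rcons Es B : W (Es ++ [:: B]) = W Es `|` B.
Proof. by elim: Es => /= [|E Es ->]; fs. Qed.

Lemma fr_disj N F U : (forall y, y \in U -> (col y < N)%N) -> fdisjoint (fr N @` F) U.
Proof. by move=> h; apply/fdisjointP => z /imfsetP[y /= _ ->]; apply: fr_notin. Qed.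

Lemma refresh_all n Es K A C S f : (forall m S', (m < n)%N -> sph m S' -> Pst S') ->
  injective f -> closed K -> sph n S -> star_is K A C (jn Es (imf f S)) ->
  nice Es (A `|` C `|` vs (imf f S)) ->
  (forall F, F \in imf f S -> rb (A `|` C `|` W Es `|` F)) ->
  exists N K2, [/\ fl K K2, fl (mv A C K) (mv A C K2), closed K2 &
     star_is K2 A C (jn Es (imf (fr N \o f) S))] /\
   [/\ forall y, y \in A `|` C `|` W Es -> (col y < N)%N, nice Es (A `|` C), rb (A `|` C `|` W Es),
     forall G, G \in K2 -> G `<=` fr N @` (f @` vs S) -> A `|` G \in K2 &
     forall z, z \notin vs S -> fr N (f z) \notin vs K2].
Proof.
move=> P inj cl hS st ni r.
have [N hN] := col_bound (vs K `|` A `|` C `|` vs (imf f S) `|` W Es).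
have hfS := sph_imf inj hS.
have [K2 [[f1 f2 cl2 st2 s2] [r2 fr2 v2]]] :=
  refresh P cl hfS st ni r hN (fsubset_refl _).
have e : imf (rn N (vs (imf f S))) (imf f S) = imf (fr N \o f) S.
  rewrite -imf_comp; apply: eq_imf => z hz; by rewrite /rn hz.
exists N, K2; split; first by rewrite -e.
have S0 := sph_fset0 hfS.
split.
- by move=> y hy; apply: hN; move: hy; rewrite !inE => /orP[/orP[]|] ->; rewrite ?orbT.
- by apply: nice_sub ni _; fs.
- by have := r _ S0; rewrite fsetU0.
- by move: fr2; rewrite vs_imf.
move=> z zS; apply/negP => /(fsubsetP v2); rewrite in_fsetU => /orP[h|].
  by have := hN (fr N (f z)); rewrite !inE h => /(_ isT); rewrite ltnNge fr_col.
by rewrite vs_imf mem_imfset ?mem_imfset ?(negbTE zS) //; exact: fr_inj.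
Qed.

Lemma flipR_sq K L : flipR K L -> sq K L.
Proof.
move=> [A [C [cl st _ ->]]]; apply: sq_mv => //; exact: (star_is_ok st closed_fset0).
Qed.

Lemma fl_sq K L : fl K L -> sq K L.
Proof.
elim=> [|N P _ IH /flipR_sq h]; first exact: sq_refl.
exact: sq_trans IH h.
Qed.

(** Induction along the flips from [bd B]: the link [M] is refreshed and the last flip is undone in
    it, which leaves the link [L]. At [bd B] the link is a join of simplex boundaries and [fl_base]
    applies. Refreshing renames the link at each stage, whence the quantification over [f]. *)
Lemma Pst_flips n S B : (forall m S', (m < n)%N -> sph m S' -> Pst S') -> #|` B| = n.+1 ->
  fl (bd B) S -> forall f, injective f -> Pst (imf f S).
Proof.
move=> P cB; elim=> {S} [|L M hfl IH fM] f inj Es K A C cl st ni r.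
  have [N [K2 [[f1 f2 cl2 st2] [hN ni2 r2 _ _]]]] := refresh_all P inj cl (sph_bd cB) st ni r.
  apply: (fl_trans f1); apply: fl_trans (fl_sym f2).
  set g := fr N \o f in st2; have ginj : injective g by exact: inj_comp (@fr_inj N) inj.
  have eg : g @` B = fr N @` (f @` B) by rewrite -imfset_comp.
  rewrite bd_imf // eg -cone_bd_fset0 in st2.
  have dB : fdisjoint (fr N @` (f @` B)) (A `|` C `|` W Es) by apply: fr_disj.
  have B0 : fr N @` (f @` B) != fset0.
    by rewrite -cardfs_gt0 !card_imfset ?cB //; exact: fr_inj.
  apply: (@fl_base (Es ++ [:: fr N @` (f @` B)])) => //.
  - by rewrite /jn foldr_cat.
  - by apply: nice_rcons => //; [apply: nice_ext => //; fs | fs].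
  by rewrite W_rcons fsetUA; apply: rb_U.
have sM : sph n M.
  by apply: sph_sq (sph_bd cB); apply: sq_trans (fl_sq hfl) (flipR_sq fM).
have [N [K2 [[f1 f2 cl2 st2] [hN ni2 r2 fr2 v2]]]] := refresh_all P inj cl sM st ni r.
apply: (fl_trans f1); apply: fl_trans (fl_sym f2).
set g := fr N \o f in st2; have ginj : injective g by exact: inj_comp (@fr_inj N) inj.
have eg F : g @` F = fr N @` (f @` F) by rewrite -imfset_comp.
have [A1 [C1 [clM stM _ eL]]] := flipR_sym fM.
have clgM := imf_closed (f := g) clM.
have stg := imf_star_is ginj clM stM closed_fset0; rewrite imf_fset00 in stg.
have okg := star_is_ok stg closed_fset0.
have dC1 : fdisjoint (g @` C1) (A `|` C `|` W Es) by rewrite eg; apply: fr_disj.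
have dvM (M' : cplx) : fdisjoint (vs (imf g M')) (A `|` C `|` W Es).
  by rewrite vs_imf eg; apply: fr_disj.
have ni3 (M' : cplx) : nice Es (A `|` C `|` vs (imf g M')).
  by apply: nice_ext => //; have := dvM M'; fs.
have [CK2 rr] : g @` C1 \notin K2 /\ forall F, F \in [fset fset0] ->
     rb (A `|` C `|` g @` A1 `|` g @` C1 `|` W Es `|` F).
  split; last first.
    move=> F; rewrite in_fset1 => /eqP ->; rewrite fsetU0 !eg.
    rewrite (_ : _ `|` W Es = A `|` C `|` W Es `|` fr N @` (f @` A1 `|` f @` C1)); last first.
      by rewrite imf_U; fs.
    by apply: rb_U.
  (* A face of [K2] made of new vertices spans a face with [A], so it lies in the link; but the face
     to be inserted is missing there. *)
  apply/negP => hC; have sC := sub_vs hC.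
  have sC1 : C1 `<=` vs M.
    apply/fsubsetP => z zC; apply/negPn/negP => /v2/negP; apply; apply: (fsubsetP sC).
    by rewrite (_ : fr N (f z) = g z) // mem_imfset.
  have := fr2 _ hC; rewrite -eg imf_sub // => /(_ sC1).
  rewrite (star_isU _ st2) => /andP[_ hh]; have [_ [+ _ _]] := stg; case/negP.
  have eC : g @` C1 `\` (A `|` C) = g @` C1 by fs.
  by rewrite eC in hh; apply: mem_jn hh _; [apply: nice_sub (ni3 M) _; fs | fs].
have [||g1 g2 cl3 st3] := lift_move cl2 clgM st2 (ni3 M) okg dC1 CK2.
- by rewrite (star_is_rest clgM closed_fset0 stg); exact: Pst_fset0.
- by move=> F; rewrite (star_is_rest clgM closed_fset0 stg); apply: rr.
apply: (fl_trans g1); apply: fl_trans (fl_sym g2).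
rewrite -imf_mv // -eL in st3.
apply: (IH g ginj Es) => // F /imfP[F' _ ->]; rewrite eg; exact: rb_U.
Qed.
End Refreshing.
Import Refreshing.

(** * Pachner's theorem with arbitrarily many colors *)

Module ColoredPachner.
Implicit Types (K L M S : cplx) (A B C D E F G H : face) (f g : T -> T) (x y z : T)
  (Es : seq face) (U V us : face).

(** The link of [A] is a sphere of smaller dimension, to which the hypothesis applies without
    additional factors. *)
Lemma fl_star n K A x : (forall m S, (m < n)%N -> sph m S -> Pst S) -> mfd n K ->
  A \in K -> A != fset0 -> x \notin vs K ->
  (forall F, F \in K -> A `<=` F -> rb (x |` F)) -> fl K (mv A [fset x] K).
Proof.
move=> P [cl K0 h] AK A0 xK r; have okA := star_ok AK A0 cl xK.
have st := ok_star_is cl okA; have [le sl] := h _ AK A0.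
have e : rest A [fset x] K = lk A K.
  apply/fsetP => F; rewrite restE // lkE //.
  case: (boolP (A `|` F \in K)) => hF; rewrite ?andbF // !andbT.
  by have := sub_vs hF; move=> h'; apply/idP/idP; fs.
rewrite e in st; apply: (P (n - #|` A|)%N (lk A K) _ sl [::]) => //=.
  by rewrite ltn_subrL cardfs_gt0 A0 /= (leq_trans _ le) // cardfs_gt0.
move=> F; rewrite lkE // => /andP[_ hF].
by apply: rb_sub (r _ hF _) _; fs.
Qed.

(** One vertex at a time, by starring the vertex itself; the color of its replacement occurs nowhere
    else, so properness persists. *)
Lemma fl_fresh n K N : (forall m S, (m < n)%N -> sph m S -> Pst S) -> mfd n K ->
  allrb K -> (forall y, y \in vs K -> (col y < N)%N) -> fl K (imf (fr N) K).
Proof.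
move=> P mK rK hN.
suff H us : us `<=` vs K -> [/\ fl K (imf (rn N us) K), mfd n (imf (rn N us) K) & allrb (imf (rn N us) K)].
  have [+ _ _] := H (vs K) (fsubset_refl _).
  by rewrite (eq_imf (g := fr N)) // => z zK; rewrite /rn zK.
have [k] := ubnP #|` us|; elim: k us => // k IH us le sus.
case: (eqVneq us fset0) => [->|/fset0Pn[u uus]].
  have -> : imf (rn N fset0) K = K by apply: imf_id => z _; rewrite /rn inE.
  by split=> //; exact: fl_refl.
have le' : (#|` us `\ u| < k)%N by move: le; rewrite (cardfsD1 u us) uus ltnS.
have [|h1 h2 h3] := IH _ le'; first by fs.
set K2 := imf (rn N (us `\ u)) K in h1 h2 h3; have [cl2 K20 _] := h2.
have clK : closed K by case: mK.
have uK : u \in vs K by fs.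
have uK2 : [fset u] \in K2.
  apply/imfP; exists [fset u]; first by rewrite -vs_sub_mem.
  by rewrite imf_1 /rn !inE eqxx.
have vK2 : vs K2 `<=` (vs K `\` (us `\ u)) `|` fr N @` (us `\ u) := vs_rn N (us `\ u) K.
have uv2 : fr N u \notin vs K2.
  have h : fr N u \notin vs K by apply: fr_notin.
  have h' : fr N u \notin fr N @` (us `\ u).
    by rewrite mem_imfset; [rewrite !inE eqxx | exact: fr_inj].
  by fs.
have u0 : [fset u] != fset0 by fs.
have mr : mv [fset u] [fset fr N u] K2 = imf (rn N us) K.
  rewrite mv_rename // /K2 imf_upd_rn //; first by rewrite fsetD1K.
  by rewrite !inE eqxx.
have rr F : F \in K2 -> rb (fr N u |` F).
  move=> FK; apply: rb_add; first exact: h3.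
  move=> z zF; case: (boolP (z \in fr N @` (us `\ u))) => [/imfsetP[y /= yu ->]|zn].
    by apply/eqP => /fr_col_inj e; move: yu; rewrite e !inE eqxx.
  by apply: fr_colN; apply: hN; have := sub_vs FK; fs.
rewrite -mr; split.
- apply: fl_trans h1 _; apply: fl_star P h2 _ _ _ _ => // F FK _; exact: rr.
- by apply: mfd_sq h2; apply: sq_mv => //; apply: star_ok.
move=> F; rewrite mvE !fsub1set => /andP[_ /orP[/h3//|/andP[vF h]]].
by apply: rb_sub (rr _ h) _; fs.
Qed.

(** After renaming by [fr N] all vertices, also those of the intermediate complexes, have different
    colors, so that every star of the chain is properly colored. The ends are connected to their
    renamings by [fl_fresh]. *)
Lemma fl_of_sq_P n K L : (forall m S, (m < n)%N -> sph m S -> Pst S) -> mfd n K ->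
  sq K L -> allrb K -> allrb L -> fl K L.
Proof.
move=> P mK h rK rL; have [N hN] := col_bound (vs K `|` vs L).
have mL := mfd_sq h mK.
apply: (@fl_trans _ (imf (fr N) K)).
  by apply: fl_fresh P mK rK _ => y yK; apply: hN; rewrite inE yK.
apply: (@fl_trans _ (imf (fr N) L)); last first.
  by apply: fl_sym; apply: fl_fresh P mL rL _ => y yL; apply: hN; rewrite inE yL orbT.
move: mK; have inj := @fr_inj N.
have one M M' : mfd n M -> step M M' -> fl (imf (fr N) M) (imf (fr N) M').
  move=> mM st; have [A [x [cl AK A0 xK e]]] := st; subst M'.
  have mM' : mfd n (imf (fr N) M).
    case: mM => _ M0 hM; split; first exact: imf_closed.
      by rewrite -(imf_0 (fr N)) imfE.
    move=> _ /imfP[F FM ->] F0; have F0' : F != fset0.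
      by move: F0; rewrite -!cardfs_gt0 card_imfset.
    have [le sl] := hM _ FM F0'; rewrite card_imfset //; split=> //.
    suff -> : lk (fr N @` F) (imf (fr N) M) = imf (fr N) (lk F M) by exact: sph_imf.
    have clM : closed (imf (fr N) M) by exact: imf_closed.
    apply/fsetP => G; rewrite lkE //; apply/idP/imfP => [/andP[d hG]|[H]].
      have [H hH eG] : exists2 H, H `<=` vs M & G = fr N @` H.
        by apply: sub_imf; rewrite -vs_imf; have := sub_vs hG; fs.
      exists H => //; rewrite lkE //; move: d hG; rewrite eG -imf_U imfE // imf_disj //.
      by move=> -> ->.
    by rewrite lkE // => /andP[d hH] ->; rewrite -imf_U imfE // imf_disj // d hH.
  rewrite imf_mv // imf_1; apply: fl_star P mM' _ _ _ _.
  - by rewrite imfE.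
  - by rewrite -cardfs_gt0 card_imfset // cardfs_gt0.
  - by rewrite vs_imf mem_imfset.
  move=> F /imfP[G GM ->] _; rewrite -imf_1 -imf_U; exact: rb_fr.
elim: h => [mK|L' M h IH st mK|L' M h IH st mK]; first exact: fl_refl.
  by apply: fl_trans (IH mK) _; apply: one => //; exact: mfd_sq h mK.
apply: fl_trans (IH mK) _; apply: fl_sym; apply: one => //.
exact: (mfd_step' st (mfd_sq h mK)).
Qed.


Lemma sq_rename f K : closed K -> {in vs K &, injective f} -> fdisjoint (f @` vs K) (vs K) ->
  sq K (imf f K).
Proof.
move=> cl inj d; pose r us z := if z \in us then f z else z.
suff H us : us `<=` vs K -> sq K (imf (r us) K).
  have := H _ (fsubset_refl _); rewrite (eq_imf (g := f)) // => z zK; by rewrite /r zK.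
have [k] := ubnP #|` us|; elim: k us => // k IH us le sus.
case: (eqVneq us fset0) => [->|/fset0Pn[u uus]].
  have -> : imf (r fset0) K = K by apply: imf_id => z _; rewrite /r inE.
  exact: sq_refl.
have le' : (#|` us `\ u| < k)%N by move: le; rewrite (cardfsD1 u us) uus ltnS.
have h : sq K (imf (r (us `\ u)) K) by apply: IH => //; fs.
have cl2 := sq_closed h cl; apply: (sq_trans h).
have uK : u \in vs K by fs.
have fK z : z \in vs K -> f z \notin vs K by move=> zK; apply: (fdisjointP d); apply/imfsetP; exists z.
have uK2 : [fset u] \in imf (r (us `\ u)) K.
  apply/imfP; exists [fset u]; first by rewrite -vs_sub_mem.
  by rewrite imf_1 /r !inE eqxx.
have uv2 : f u \notin vs (imf (r (us `\ u)) K).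
  rewrite vs_imf; apply/imfsetP => -[z /= zK]; rewrite /r; case: ifP => zu e.
    by move: zu; rewrite (inj u z) // !inE eqxx.
  by have := fK u uK; rewrite e zK.
suff <- : mv [fset u] [fset f u] (imf (r (us `\ u)) K) = imf (r us) K.
  by apply: sq_mv => //; apply: star_ok => //; fs.
rewrite mv_rename // imf_comp; apply: eq_imf => z zK.
rewrite /= /r /upd !inE; case: (eqVneq z u) => [->|zu] /=; first by rewrite eqxx uus.
case: (boolP (z \in us)) => zus /=; last by rewrite (negbTE zu).
by case: eqP => // e; move: (fK z zK); rewrite e uK.
Qed.

(** The values of [f] may themselves be vertices of [K]; the renaming goes through a disjoint
    copy. *)
Lemma sq_iso f K : closed K -> {in vs K &, injective f} -> sq K (imf f K).
Proof.
move=> cl inj; have [N hN] := col_bound (vs K `|` f @` vs K).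
have hf (g : T -> T) (M : cplx) : (forall z, z \in vs M -> (col z < N)%N) ->
   (forall z, z \in vs M -> exists y, g z = fr N y) -> fdisjoint (g @` vs M) (vs M).
  move=> h1 h2; apply/fdisjointP => z /imfsetP[y /= /h2[y' ->] ->].
  exact: fr_notin.
pose g y := fr N (head (0, 0) [seq z <- vs K | f z == y]).
have gf z : z \in vs K -> g (f z) = fr N z.
  move=> zK; rewrite /g; congr (fr N _).
  have hz : z \in [seq z' <- vs K | f z' == f z] by rewrite mem_filter eqxx.
  have hall z' : z' \in [seq z' <- vs K | f z' == f z] -> z' = z.
    by rewrite mem_filter => /andP[/eqP e z'K]; apply: inj.
  by case: [seq _ <- _ | _] hz hall => //= z' s _ /(_ z' (mem_head _ _)).
apply: (@sq_trans _ (imf (fr N) K)).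
  apply: sq_rename => //; first by move=> x y _ _ /fr_inj.
  by apply: hf => z zK; [apply: hN; rewrite inE zK|exists z].
apply: sq_sym; rewrite (_ : imf (fr N) K = imf g (imf f K)); last first.
  by rewrite imf_comp; apply: eq_imf => z zK; rewrite /= gf.
apply: sq_rename; first exact: imf_closed.
  move=> a b; rewrite vs_imf => /imfsetP[x /= xK ->] /imfsetP[y /= yK ->].
  by rewrite !gf // => /fr_inj ->.
by apply: hf => z; rewrite vs_imf => zK; [apply: hN; rewrite inE zK orbT|eexists; reflexivity].
Qed.

(** The two statements feed each other: in the dimension of [S], [fl_of_sq_P] needs [Pst] only for
    smaller spheres, and it supplies the flips between [S] and a simplex boundary from which
    [Pst_flips] derives [Pst S]. *)
Lemma Pst_sph n S : sph n S -> Pst S.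
Proof.
have [k] := ubnP n; elim: k n S => // k IH n S lt sS.
have P m S' : (m < n)%N -> sph m S' -> Pst S'.
  by move=> mn; apply: IH; apply: leq_trans mn _.
move=> Es K A C cl st ni r.
have rS : allrb S by move=> F /r h; apply: rb_sub h _; fs.
case: (sS) => B cB hB.
have hB' : sq S (bd (fr 0 @` B)).
  apply: sq_trans hB _; rewrite -bd_imf; last exact: fr_inj.
  by apply: sq_iso => [|x y _ _ /fr_inj]; first exact: bd_closed.
have h : fl (bd (fr 0 @` B)) S.
  apply: fl_sym; apply: (fl_of_sq_P P (sph_mfd sS)) => // F.
  by rewrite bdE => /andP[h _]; apply: rb_sub (rb_fr (N := 0) (F := B)) h.
have cB' : #|` fr 0 @` B| = n.+1 by rewrite card_imfset //; exact: fr_inj.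
have := Pst_flips P cB' h (f := id) (fun x y e => e).
by rewrite imf_id // => PS; apply: (PS Es).
Qed.

Theorem fl_of_sq n K L : mfd n K -> sq K L -> allrb K -> allrb L -> fl K L.
Proof. by move=> mK; apply: fl_of_sq_P mK => m S _; exact: Pst_sph. Qed.
End ColoredPachner.
Import ColoredPachner.

(** * Coning off a shelled ball by moves *)

Module Coning.
Implicit Types (K L M S X N : cplx) (A B C D E F G H : face) (f g : T -> T) (x y z v : T)
  (U V us : face) (l : seq (face * face)).

(* A shelling is a list of pairs (facet, restriction), latest facet first. *)
Definition gn l G := has (fun p : face * face => G `<=` p.1) l.
Definition noA l G := all (fun p : face * face => ~~ (p.1 `\` p.2 `<=` G)) l.

Fixpoint shl l := if l is (F, C) :: l' then
  [/\ C `<=` F, (forall G, G `<=` F -> gn l' G = ~~ (C `<=` G)) & shl l'] else True.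

Definition gnN N l G := has (fun p : face * face => G `\` p.1 \in N) l.

Definition Wl l : face := foldr (fun (p : face * face) U => p.1 `|` U) fset0 l.

(* The stage of coning off [gn l] in [X] with apex [v]; the interior faces removed so far are those
   containing some [F `\` C].  The complex [N] is the link of the cell that is being coned off. *)
Fact coneY_key : unit. Proof. exact: tt. Qed.
Definition coneY X N v l : cplx := locked_with coneY_key
  [fset G in fpowerset (v |` (vs X `|` vs N `|` Wl l)) |
    (if v \in G then gnN N l (G `\ v) else G \in X) && noA l G].

Lemma coneYE X N v l G :
  (G \in coneY X N v l) = (if v \in G then gnN N l (G `\ v) else G \in X) && noA l G.
Proof.
rewrite /coneY unlock !inE /= fpowersetE andb_idl // => /andP[h _].
case: ifP h => vG; last by move=> /sub_vs; fs.
rewrite /gnN => /hasP[[F C] pl /= /sub_vs hp].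
have hl : F `<=` Wl l.
  elim: l pl => //= -[F' C'] l IH; rewrite inE => /orP[/eqP[-> _]|/IH] /=; fs.
fs.
Qed.

Lemma coneY_nil X N v : v \notin vs X -> coneY X N v [::] = X.
Proof.
move=> vX; apply/fsetP => G; rewrite coneYE /= andbT; case: ifP => // vG.
by rewrite (notinK vX vG).
Qed.

(** A shelling that can be coned off in [X], every facet being joined with [N]. Beyond the
    conditions of [shl], the facet [F] must have survived the earlier stages, and a surviving face
    over [F \ C] must lie in the join of [F] with [N]. *)
Fixpoint shok X N l := if l is (F, C) :: l' then
  [/\ C `<=` F, F `\` C != fset0, (forall G, G `<=` F -> gn l' G = ~~ (C `<=` G)),
      noA l' F & fdisjoint F (vs N)] /\
  [/\ (forall n, n \in N -> F `|` n \in X),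
      (forall H, H \in X -> F `\` C `<=` H -> noA l' H -> H `\` F \in N) & shok X N l']
  else True.

Lemma shok_mem X N l p : shok X N l -> p \in l -> fdisjoint p.1 (vs N) /\
  forall n, n \in N -> p.1 `|` n \in X.
Proof.
elim: l => //= -[F C] l IH [[? ? ? ? ?] [? ? ?]]; rewrite inE => /orP[/eqP->//|].
exact: IH.
Qed.

Section ConeStep.
Variables (X N : cplx) (v : T) (l : seq (face * face)) (F C : face).
Hypotheses (clX : closed X) (clN : closed N) (N0 : fset0 \in N) (vX : v \notin vs X).
Hypothesis (ok_ : shok X N ((F, C) :: l)).
Let A := F `\` C.
Let Y := coneY X N v l.

Let vN : v \notin vs N.
Proof.
case: ok_ => _ [h _ _]; apply: contra vX => /vsP[n nN vn]; apply/vsP; exists (F `|` n); first exact: h.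
by rewrite inE vn orbT.
Qed.

Let FX : F \in X. Proof. by case: ok_ => _ [/(_ fset0 N0)]; rewrite fsetU0. Qed.

Lemma noA_F G : G `\` (v |` F) \in N -> noA l G.
Proof.
case: (ok_) => -[sC A0 h1 h2 d] [_ _ sl] hG; apply/allP => -[F' C'] pl.
have vF : v \notin F by have := sub_vs FX; fs.
have /= hp := allP h2 _ pl; have [/= dp hpX] := shok_mem sl pl.
have pX : F' `<=` vs X by apply: sub_vs; have := hpX _ N0; rewrite fsetU0.
have := sub_vs hG; fs.
Qed.

Lemma gnN_F G : v \in G -> (G `\ v) `\` F \in N -> ~~ (C `<=` G) -> gnN N l (G `\ v).
Proof.
case: (ok_) => -[sC A0 h1 h2 d] [_ _ sl] vG hG nC.
have : gn l ((G `\ v) `&` F) by rewrite h1; [fs|fs].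
case/hasP => -[F' C'] pl /= sp; apply/hasP; exists (F', C') => //=; apply: (clN hG); fs.
Qed.

(** The faces of [F] covered before are those missing a vertex of [C], and the earlier cones join
    them to [v]. Together with [F] itself they make the link of [F \ C] equal to [bd (v * C) * N];
    so coning off [F] is the move from [F \ C] to [v * C]. *)
Lemma cone_star : star_is Y A (v |` C) N.
Proof.
case: (ok_) => -[sC A0 h1 h2 d] [hn h3 sl].
have vF : v \notin F by have := sub_vs FX; fs.
split; first by split=> //; [fs|rewrite /A; fs|rewrite /A; have := vN; fs].
split=> //.
- rewrite coneYE; apply/negP; have -> : v \in v |` C by fs.
  move=> /andP[/hasP[[F' C'] pl /= hp] _]; have [/= dp _] := shok_mem sl pl.
  have : gn l C.
    by apply/hasP; exists (F', C') => //=; have := sub_vs hp; fs.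
  by rewrite h1 // fsubset_refl.
move=> H AH; rewrite coneYE.
have -> : H `\` (A `|` (v |` C)) = H `\` (v |` F) by rewrite /A; fs.
apply/idP/idP.
  case: ifP => vH /andP[h4 h5].
    case/hasP: (h4) => -[F' C'] pl /= hp; have [/= dp hpX] := shok_mem sl pl.
    have HX : H `\ v \in X by apply: (clX (hpX _ hp)); fs.
    have AH' : F `\` C `<=` H `\ v by move: AH; rewrite /A; fs.
    have h5' : noA l (H `\ v).
      by apply/allP => -[F1 C1] ql /=; have /= := allP h5 _ ql; fs.
    have hN := h3 _ HX AH' h5'.
    apply/andP; split; last by apply: (clN hN); fs.
    have : gn l ((H `\ v) `&` F).
      by apply/hasP; exists (F', C') => //=; have := sub_vs hp; fs.
    by rewrite h1; fs.
  have hN := h3 _ h4 AH h5.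
  apply/andP; split; last by apply: (clN hN); fs.
  by fs.
case/andP => nC hN; rewrite (noA_F hN) andbT; case: ifP => vH.
  by apply: gnN_F => //; [apply: (clN hN); fs|fs].
by apply: (clX (hn _ hN)); fs.
Qed.

Lemma cone_mv : mv A (v |` C) Y = coneY X N v ((F, C) :: l).
Proof.
case: (ok_) => -[sC A0 h1 h2 d] [hn h3 sl].
have vF : v \notin F by have := sub_vs FX; fs.
apply/fsetP => G; rewrite mvE (star_isU _ cone_star) coneYE /Y coneYE /= -/A.
case: (boolP (A `<=` G)) => nA /=; first by rewrite ?andbF.
have -> : (v |` C `<=` G `\` (v |` C)) = false by apply/negbTE; fs.
have -> : G `\` (v |` C) `\` (A `|` (v |` C)) = G `\` (v |` F) by rewrite /A; fs.
have -> : (v |` C `<=` G) = (v \in G) && (C `<=` G) by rewrite fsubUset fsub1set.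
case: (boolP (v \in G)) => vG /=; last by rewrite orbF.
have -> : G `\` (v |` F) = G `\ v `\` F by fs.
apply/idP/idP.
  case/orP => [/andP[-> ->]|/andP[_ hN]]; first by rewrite orbT.
  by rewrite hN noA_F //; apply: (clN hN); fs.
case/andP => /orP[hN|->] -> //; rewrite andbT hN andbT.
by case: (boolP (C `<=` G)) => nC; rewrite ?orbT // orbF; apply: gnN_F.
Qed.
End ConeStep.

Lemma coneY_closed_sq X N v l : closed X -> closed N -> fset0 \in N -> v \notin vs X ->
  shok X N l -> sq X (coneY X N v l).
Proof.
move=> clX clN N0 vX; elim: l => [|[F C] l IH] h; first by rewrite coneY_nil //; exact: sq_refl.
have hl : shok X N l by case: h => _ [].
have sY := IH hl; apply: (sq_trans sY); rewrite -(cone_mv clX clN N0 vX h).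
have clY := sq_closed sY clX.
apply: sq_mv => //; apply: (star_is_ok _ clN); exact: cone_star.
Qed.

Lemma gnN_fset0 l G : gnN [fset fset0] l G = gn l G.
Proof. by apply: eq_has => p; rewrite in_fset1 fsetD_eq0. Qed.
End Coning.
Import Coning.

(** * Reversible shellings under stellar subdivision *)

Module Bishellings.
Implicit Types (K L M S X N : cplx) (A B C D E F G H : face) (x y z v f : T)
  (U V us : face) (l : seq (face * face)) (s t : seq T).

Definition sset s : face := [fset y in s].

Lemma ssetE s y : (y \in sset s) = (y \in s).
Proof. by rewrite inE. Qed.

Lemma sset_cons y s : sset (y :: s) = y |` sset s.
Proof. by apply/fsetP => z; rewrite !inE. Qed.

Lemma sset_cat s t : sset (s ++ t) = sset s `|` sset t.
Proof. by apply/fsetP => z; rewrite !inE ?mem_cat. Qed.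

Lemma sset_id F : sset F = F.
Proof. by apply/fsetP => z; rewrite !inE. Qed.

Definition opt1 (b : bool) x : face := if b then [fset x] else fset0.

(** The pieces of a facet [H] over [F], with their restrictions. A face of a piece is old if it
    misses a vertex of [s'], by the pieces already present, or if its carrier was old; for [f] in
    [C] the latter holds for all faces without [x], whence [opt1]. *)
Fixpoint blk F x H C s := if s is f :: s' then
  (x |` (H `\ f), (C `\` F) `|` sset s' `|` opt1 (f \in C) x) :: blk F x H C s' else [::].

(** Lists run from the latest piece to the earliest, and the pieces for [f] outside [C] must come
    after those inside ([ordF_tail]). The inner reversal makes the order for [H \ C] the exact
    reverse of the order for [C], as needed in [opp_starP]. *)
Definition ordF F C : seq T := rev (F `\` C) ++ (F `&` C).

Definition starP F x (p : face * face) :=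
  if F `<=` p.1 then blk F x p.1 p.2 (ordF F p.2) else [:: p].

Definition starL F x l := flatten [seq starP F x p | p <- l].

(** The carrier of a face of the star in the complex before starring. *)
Definition carF F x G := if x \in G then F `|` (G `\ x) else G.

Lemma mv_car F x K G : x \notin vs K -> (G \in mv F [fset x] K) = ~~ (F `<=` G) && (carF F x G \in K).
Proof.
move=> xK; rewrite mvE fsub1set /carF; case: (boolP (x \in G)) => xG /=; last by rewrite orbF.
by rewrite (notinK xK xG).
Qed.

Lemma gn_blk F x H C s G : gn (blk F x H C s) G = has (fun f => G `<=` x |` (H `\ f)) s.
Proof. by elim: s => //= f s ->. Qed.

Lemma mem_ordF F C y : (y \in ordF F C) = (y \in F).
Proof. by rewrite mem_cat mem_rev !inE; case: (y \in F); case: (y \in C). Qed.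

Lemma gn_starP F x H C G : F != fset0 -> x \notin F -> x \notin H ->
  gn (starP F x (H, C)) G = ~~ (F `<=` G) && (carF F x G `<=` H).
Proof.
move=> F0 xF xH; rewrite /starP /= /carF; case: ifP => FH.
  rewrite gn_blk; apply/hasP/idP => [[f]|].
    rewrite mem_ordF => fF sG; apply/andP; split; first by fs.
    by case: ifP => xG; fs.
  case/andP=> /fsubsetPn[f fF fG] h; exists f; first by rewrite mem_ordF.
  by case: ifP h => xG; fs.
rewrite /= orbF; case: ifP => xG.
  have -> : (F `|` G `\ x `<=` H) = false by apply/negbTE; fs.
  by rewrite andbF; apply/negbTE; fs.
rewrite andb_idl // => GH; apply: contraFN FH; fs.
Qed.

Definition xfree x l := all (fun p : face * face => x \notin p.1) l.

Lemma gn_cat l1 l2 G : gn (l1 ++ l2) G = gn l1 G || gn l2 G.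
Proof. exact: has_cat. Qed.

Lemma gn_starL F x l G : F != fset0 -> x \notin F -> xfree x l ->
  gn (starL F x l) G = ~~ (F `<=` G) && gn l (carF F x G).
Proof.
move=> F0 xF; elim: l => /= [|[H C] l IH] /=; first by rewrite andbF.
case/andP=> xH xl; rewrite /starL /= gn_cat gn_starP // IH //.
by case: (F `<=` G).
Qed.

Lemma shl_blk F x H C l s : x \notin H -> F `<=` H -> C `<=` H -> F != fset0 -> xfree x l ->
  (forall G, G `<=` H -> gn l G = ~~ (C `<=` G)) -> shl (starL F x l) -> {subset s <= F} ->
  (forall s1 f s2, s = s1 ++ f :: s2 -> f \notin C -> F `&` C `<=` sset s2) -> uniq s ->
  shl (blk F x H C s ++ starL F x l).
Proof.
move=> xH FH CH F0 xl h hl; elim: s => [//|f s IH] sF ord /= /andP[fs us].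
have xF : x \notin F by fs.
have fF : f \in F by apply: sF; rewrite mem_head.
have sF' : sset s `<=` F.
  by apply/fsubsetP => y; rewrite ssetE => ys; apply: sF; rewrite inE ys orbT.
have f_s : f \notin sset s by rewrite ssetE.
have hs : f \notin C -> F `&` C `<=` sset s by move=> fC; apply: (ord [::]).
split; last first.
  apply: IH => // [y ys|s1 g s2 e]; first by apply: sF; rewrite inE ys orbT.
  by apply: (ord (f :: s1)); rewrite e.
- move=> G sG; rewrite gn_cat gn_blk gn_starL //.
  have nFG : ~~ (F `<=` G) by fs.
  rewrite nFG /=.
  have -> : has (fun f' => G `<=` x |` (H `\ f')) s = ~~ (sset s `<=` G).
    apply/hasP/idP => [[y ys sy]|/fsubsetPn[y]].
      by have : y \in sset s; [rewrite ssetE | fs].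
    by rewrite ssetE => ys yG; exists y => //; fs.
  rewrite /carF; case: ifP => xG.
    rewrite h; last by fs.
    have -> : (C `<=` F `|` G `\ x) = (C `\` F `<=` G) by apply/idP/idP; fs.
    rewrite !fsubUset; have -> : opt1 (f \in C) x `<=` G by rewrite /opt1; case: ifP; fs.
    by rewrite andbT negb_and orbC.
  rewrite h; last by fs.
  rewrite !fsubUset /opt1; case: ifP => fC.
    have -> : (C `<=` G) = false by apply/negbTE; fs.
    by rewrite fsub1set xG andbF orbT.
  have {}hs : F `&` C `<=` sset s by apply: hs; rewrite fC.
  rewrite fsub0set andbT negb_and; case: (boolP (sset s `<=` G)) => sG' /=; rewrite ?orbT // orbF.
  by congr (~~ _); apply/idP/idP; fs.
by rewrite /opt1; case: ifP; fs.
Qed.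

Lemma uniq_ordF F C : uniq (ordF F C).
Proof.
rewrite cat_uniq rev_uniq !fset_uniq andbT /=; apply/hasP => -[y].
by rewrite !inE => /andP[_ yC]; rewrite mem_rev !inE yC.
Qed.

Lemma cat_split_suffix (a b s1 s2 : seq T) f :
  a ++ b = s1 ++ f :: s2 -> f \notin b -> {subset b <= s2}.
Proof.
elim: a s1 => [|y a IH] [|y' s1] /=.
- by move=> -> ; rewrite mem_head.
- by move=> ->; rewrite inE mem_cat mem_head !orbT.
- by move=> [_ <-] _ z zb; rewrite mem_cat zb orbT.
by move=> [_ e]; apply: IH e.
Qed.

Lemma ordF_tail F C s1 f s2 : ordF F C = s1 ++ f :: s2 -> f \notin C -> F `&` C `<=` sset s2.
Proof.
move=> e fC; apply/fsubsetP => y yFC; rewrite ssetE.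
apply: (cat_split_suffix e) => //; by rewrite inE negb_and fC orbT.
Qed.

Lemma shl_starL F x l : F != fset0 -> x \notin F -> xfree x l -> shl l -> shl (starL F x l).
Proof.
move=> F0 xF; elim: l => //= -[H C] l IH /= /andP[xH xl] [CH h hl].
rewrite /starL /= -/(starL F x l) /starP /=; case: ifP => FH; last first.
  split=> //; last exact: IH.
  move=> G GH; rewrite gn_starL // /carF.
  have -> : x \in G = false by apply/negbTE; fs.
  by rewrite h // (contraFN _ FH) //; fs.
apply: shl_blk => //; first exact: IH.
- by move=> y; rewrite mem_ordF.
- by move=> s1 f s2; apply: ordF_tail.
exact: uniq_ordF.
Qed.

Definition compl (p : face * face) := (p.1, p.1 `\` p.2).
Definition opp l := rev (map compl l).

Lemma blk_opp F x H C s t : F `<=` H -> C `<=` H -> x \notin H -> uniq (s ++ t) ->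
  F = sset (s ++ t) ->
  rev (map compl (blk F x H C s)) ++ blk F x H (H `\` C) t = blk F x H (H `\` C) (rev s ++ t).
Proof.
move=> FH CH xH; elim: s t => //= f s IH t /andP[fst u] eF.
rewrite rev_cons cat_rcons [rev (f :: s)]rev_cons cat_rcons -IH /=; last 2 first.
- move: fst u; rewrite !mem_cat negb_or !cat_uniq /= => /andP[fs ft] /and3P[us h ut].
  rewrite us ft ut /= !andbT negb_or fs /=; exact: h.
- by rewrite eF; apply/fsetP => z; rewrite !(inE, mem_cat) orbCA.
congr (_ ++ _ :: _); rewrite /compl /=; congr (_, _).
have eF' : F = f |` (sset s `|` sset t) by rewrite -sset_cat -sset_cons.
have f1 : f \notin sset s `|` sset t by rewrite -sset_cat ssetE.
have d : fdisjoint (sset s) (sset t).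
  apply/fdisjointP => y; rewrite !ssetE => ys; move: u; rewrite cat_uniq => /and3P[_ /hasPn h _].
  by apply/negP => /h; rewrite /= ys.
have fF : f \in F by rewrite eF' !inE eqxx.
have fH : f \in H by apply: (fsubsetP FH).
have s1 : F `<=` f |` (sset s `|` sset t) by rewrite -eF'.
have s2 : f |` (sset s `|` sset t) `<=` F by rewrite -eF'.
rewrite /opt1 in_fsetD fH andbT; case: (boolP (f \in C)) => fC /=; fs.
Qed.

Lemma opp_cat l1 l2 : opp (l1 ++ l2) = opp l2 ++ opp l1.
Proof. by rewrite /opp map_cat rev_cat. Qed.

Definition allCF l := all (fun p : face * face => p.2 `<=` p.1) l.

Lemma opp_starP F x p : x \notin p.1 -> p.2 `<=` p.1 -> opp (starP F x p) = starP F x (compl p).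
Proof.
case: p => H C /= xH CH; rewrite /starP /=; case: ifP => FH; last by rewrite /opp /=.
have := @blk_opp F x H C (ordF F C) [::] FH CH xH; rewrite !cats0 uniq_ordF /opp => -> //.
  congr (blk _ _ _ _ _); rewrite /ordF rev_cat revK.
  have -> : F `&` (H `\` C) = F `\` C by fs.
  by have -> : F `\` (H `\` C) = F `&` C by fs.
by apply/fsetP => y; rewrite ssetE mem_ordF.
Qed.

Lemma starL_cat F x l1 l2 : starL F x (l1 ++ l2) = starL F x l1 ++ starL F x l2.
Proof. by rewrite /starL map_cat flatten_cat. Qed.

Lemma opp_starL F x l : xfree x l -> allCF l -> opp (starL F x l) = starL F x (opp l).
Proof.
elim: l => //= p l IH /andP[xp xl] /andP[cp cl].
rewrite -[p :: l]cat1s starL_cat !opp_cat starL_cat IH //; congr (_ ++ _).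
by rewrite /starL /= cats0 opp_starP // /opp /= cats0.
Qed.

Lemma shl_allCF l : shl l -> allCF l.
Proof. by elim: l => //= -[F C] l IH /= [-> _ /IH]. Qed.

(** Of such a list [l2 ++ l1], the part [l1] is shelled as it stands and the part [l2] in the
    opposite order. This is how a subcomplex will be shellable and co-shellable at once. *)
Definition bish l := shl l /\ shl (opp l).

Lemma xfree_opp x l : xfree x (opp l) = xfree x l.
Proof. by rewrite /xfree /opp all_rev all_map. Qed.

Lemma bish_starL F x l : F != fset0 -> x \notin F -> xfree x l -> bish l -> bish (starL F x l).
Proof.
move=> F0 xF xl [h1 h2]; split; first exact: shl_starL.
by rewrite opp_starL //; [apply: shl_starL; rewrite ?xfree_opp | exact: shl_allCF].
Qed.

(** The facets of [bd H] opposite to the vertices in [s], which form a shelling in any order. *)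
Fixpoint ini H s := if s is f :: s' then (H `\ f, sset s') :: ini H s' else [::].

Lemma gn_ini H s G : gn (ini H s) G = has (fun f => G `<=` H `\ f) s.
Proof. by elim: s => //= f s ->. Qed.

Lemma shl_ini H s : uniq s -> {subset s <= H} -> shl (ini H s).
Proof.
elim: s => //= f s IH /andP[fs us] sH.
have sH' : sset s `<=` H.
  by apply/fsubsetP => y; rewrite ssetE => ys; apply: sH; rewrite inE ys orbT.
have f_s : f \notin sset s by rewrite ssetE.
split; [fs| |by apply: IH => // y ys; apply: sH; rewrite inE ys orbT].
move=> G sG; rewrite gn_ini; apply/hasP/idP => [[y ys sy]|/fsubsetPn[y]].
  by have : y \in sset s; [rewrite ssetE | fs].
by rewrite ssetE => ys yG; exists y => //; fs.
Qed.

Lemma ini_opp H s t : uniq (s ++ t) -> H = sset (s ++ t) ->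
  opp (ini H s) ++ ini H t = ini H (rev s ++ t).
Proof.
elim: s t => //= f s IH t /andP[fst u] eH.
rewrite -[_ :: ini H s]cat1s opp_cat -catA [rev (f :: s)]rev_cons cat_rcons -IH /=; last 2 first.
- move: fst u; rewrite !mem_cat negb_or !cat_uniq /= => /andP[fs ft] /and3P[us h ut].
  rewrite us ft ut /= !andbT negb_or fs /=; exact: h.
- by rewrite eH; apply/fsetP => z; rewrite !(inE, mem_cat) orbCA.
congr (_ ++ _); rewrite /opp /=; congr (_ :: _); rewrite /compl /=; congr (_, _).
have eH' : H = f |` (sset s `|` sset t) by rewrite -sset_cat -sset_cons.
have f1 : f \notin sset s `|` sset t by rewrite -sset_cat ssetE.
have d : fdisjoint (sset s) (sset t).
  apply/fdisjointP => y; rewrite !ssetE => ys; move: u; rewrite cat_uniq => /and3P[_ /hasPn h _].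
  by apply/negP => /h; rewrite /= ys.
rewrite eH'; fs.
Qed.

Lemma bish_ini H s : uniq s -> H = sset s -> bish (ini H s).
Proof.
move=> us eH; split; first by apply: shl_ini => // y ys; rewrite eH ssetE.
have := @ini_opp H s [::]; rewrite !cats0 => -> //.
by apply: shl_ini; rewrite ?rev_uniq // => y; rewrite mem_rev eH ssetE.
Qed.
End Bishellings.
Import Bishellings.

(** * Iterated stellar subdivisions and their carriers *)

Module IteratedStars.
Implicit Types (K L M S X N : cplx) (A B C D E F G H : face) (x y z v f : T)
  (U V us : face) (l : seq (face * face)) (s t : seq T) (b : face -> T) (bs : seq face).

Lemma shl_catr l1 l2 : shl (l1 ++ l2) -> shl l2.
Proof. by elim: l1 => //= -[F C] l IH [_ _ /IH]. Qed.

Lemma gn_opp l G : gn (opp l) G = gn l G.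
Proof. by rewrite /gn /opp has_rev has_map; apply: eq_has. Qed.

(** In the reversed shelling the facets of [l2] precede [F], and the restriction of [F] is
    [F \ C]. *)
Lemma bish_later l2 F C l1 G : bish (l2 ++ (F, C) :: l1) -> G `<=` F ->
  gn l2 G = ~~ (F `\` C `<=` G).
Proof.
move=> [_]; rewrite opp_cat -[_ :: l1]cat1s opp_cat -catA => /shl_catr /= [_ + _] GF.
by move=> /(_ G GF); rewrite gn_opp.
Qed.

Lemma bish_CF l2 F C l1 : bish (l2 ++ (F, C) :: l1) -> C `<=` F.
Proof. by case=> /shl_catr /= [? _ _]. Qed.

(** The facet is the latest one containing [G]: the reversed shelling meets [G] there for the first
    time. *)
Lemma last_facet l2 l1 G : bish (l2 ++ l1) -> gn l1 G -> ~~ gn l2 G ->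
  exists F C l3 l4, [/\ l1 = l3 ++ (F, C) :: l4, G `<=` F & F `\` C `<=` G].
Proof.
elim: l1 l2 => //= -[F C] l1 IH l2 h; case: (boolP (G `<=` F)) => /= GF.
  move=> _; rewrite (bish_later h GF) negbK => AG.
  by exists F, C, [::], l1.
move=> g1 g2; have [|||F' [C' [l3 [l4 [-> ? ?]]]]] := IH (l2 ++ [:: (F, C)]).
- by rewrite -catA.
- by [].
- by rewrite gn_cat negb_or g2 /= orbF.
by exists F', C', ((F, C) :: l3), l4.
Qed.

Lemma bish_noA l2 l1 F C l3 : bish (l2 ++ l1) -> l1 = (F, C) :: l3 -> noA l3 F.
Proof.
move=> h e; subst l1; apply/allP => -[F' C'] /path.splitPr hin; case: hin h => l4 l5 h /=.
apply/negP => AF.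
have h' : bish ((l2 ++ (F, C) :: l4) ++ (F', C') :: l5) by rewrite -catA.
have /(bish_later h') : F' `\` C' `<=` F' by fs.
rewrite fsubset_refl /= gn_cat /= AF orbT //.
Qed.

Lemma mem_gn l F C G : (F, C) \in l -> G `<=` F -> gn l G.
Proof. by move=> h GF; apply/hasP; exists (F, C). Qed.

(** The predicate [inn] marks the interior faces of the ball shelled by [l1], those that do not lie
    in [l2]. Every interior face contains the [F \ C] of its latest facet, and every [F \ C] is
    interior, so that coning off removes precisely the interior faces. *)
Lemma shok_of_bish X l2 l1 (inn : face -> bool) : closed X -> bish (l2 ++ l1) -> l2 != [::] ->
  (forall H, H \in X -> inn H -> gn l1 H && ~~ gn l2 H) ->
  (forall G, gn l1 G -> G \in X) -> (forall G, gn l1 G -> ~~ gn l2 G -> inn G) ->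
  (forall G H, G `<=` H -> inn G -> inn H) ->
  shok X [fset fset0] l1 /\ forall H, H \in X -> noA l1 H = ~~ inn H.
Proof.
move=> clX hb l20 h1 h2 h3 h4.
have hA F C l3 l4 : l1 = l3 ++ (F, C) :: l4 -> inn (F `\` C).
  move=> e; apply: h3; first by apply: (@mem_gn _ F C); [rewrite e mem_cat mem_head orbT | fs].
  move: hb; rewrite e catA => hb.
  have /(bish_later hb) : F `\` C `<=` F by fs.
  by rewrite gn_cat fsubset_refl => /negbT; rewrite negb_or => /andP[].
split; last first.
  move=> H HX; apply/allP/idP => [hno|ni [F C] hin /=]; last first.
    by apply: contra ni => AH; apply: (h4 _ _ AH); case/path.splitPr: hin (hA F C) => a c /(_ a c); apply.
  apply/negP => inH; have /andP[g1 g2] := h1 _ HX inH.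
  have [F [C [l3 [l4 [e _ AH]]]]] := last_facet hb g1 g2.
  by have := hno (F, C); rewrite e mem_cat mem_head orbT AH => /(_ isT).
suff H l3 l4 : l1 = l3 ++ l4 -> shok X [fset fset0] l4 by apply: (H [::]).
elim: l4 l3 => //= -[F C] l4 IH l3 e.
have hb' : bish ((l2 ++ l3) ++ (F, C) :: l4) by rewrite -catA -e.
have Fl : (F, C) \in l1 by rewrite e mem_cat mem_head orbT.
split; [split|split].
- exact: bish_CF hb'.
- apply/negP => /eqP A0; have := @bish_later _ F C _ fset0 hb' (fsub0set _).
  rewrite A0 fsub0set /= gn_cat => /negbT; rewrite negb_or => /andP[].
  by case: (l2) l20 => //= p l _; rewrite fsub0set.
- by move: hb' => [/shl_catr /= [_ h _] _].
- exact: (bish_noA hb').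
- by rewrite vs_fset00 fdisjointX0.
- by move=> n; rewrite in_fset1 => /eqP ->; rewrite fsetU0; apply: h2; apply: (mem_gn Fl).
- move=> H HX AH no; rewrite in_fset1; apply/eqP.
  have inH : inn H by apply: (h4 _ _ AH); exact: hA e.
  have /andP[g1 g2] := h1 _ HX inH.
  have [F' [C' [l5 [l6 [e' HF' AH']]]]] := last_facet hb g1 g2.
  suff e2 : (F', C') = (F, C) by case: e2 => e2 _; rewrite -e2; fs.
  have hin : (F', C') \in l1 by rewrite e' mem_cat mem_head orbT.
  move: (hin); rewrite e mem_cat inE => /or3P[hin3|/eqP//|hin4]; last first.
    by have := allP no _ hin4; rewrite AH'.
  have /(bish_later hb') : F `\` C `<=` F by fs.
  rewrite fsubset_refl /= gn_cat => /negbT; rewrite negb_or => /andP[_ /hasPn /(_ _ hin3) /=].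
  by case/negP; fs.
by apply: (IH (l3 ++ [:: (F, C)])); rewrite -catA.
Qed.

(* [car b bs G] is the carrier in [K] of a face [G] of the iterated star [beta b bs K]; which faces
   are created, [val], does not depend on [K]. *)
Fixpoint beta b bs K := if bs is F :: bs' then beta b bs' (mv F [fset b F] K) else K.
Fixpoint betaL b bs l := if bs is F :: bs' then betaL b bs' (starL F (b F) l) else l.
Fixpoint car b bs G := if bs is F :: bs' then carF F (b F) (car b bs' G) else G.
Fixpoint valid b bs G := if bs is F :: bs' then valid b bs' G && ~~ (F `<=` car b bs' G) else true.
Fixpoint okb b bs U := if bs is F :: bs' then
  [/\ F != fset0, F `<=` U, b F \notin U & okb b bs' (b F |` U)] else True.

Lemma betaE b bs U K G : okb b bs U -> vs K `<=` U ->
  (G \in beta b bs K) = valid b bs G && (car b bs G \in K).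
Proof.
elim: bs U K => //= F bs IH U K [F0 FU bU ok_] hv; rewrite (IH (b F |` U)) //; last first.
  by have := vs_mv F [fset b F] K; fs.
by rewrite mv_car -?andbA //; fs.
Qed.

Definition lsub l U := all (fun p : face * face => p.1 `<=` U) l.

Lemma lsub_starL F x l U : F `<=` U -> lsub l U -> lsub (starL F x l) (x |` U).
Proof.
move=> FU; elim: l => //= -[H C] l IH /= /andP[HU hl].
rewrite /lsub /starL /= all_cat -/(starL F x l) [X in _ && X]IH // andbT /starP /=.
case: ifP => FH; last by rewrite /= andbT; fs.
by elim: (ordF F C) => //= f s ->; rewrite andbT; fs.
Qed.

Lemma lsub_xfree x l U : lsub l U -> x \notin U -> xfree x l.
Proof. by move=> h xU; apply: sub_all h => -[F C] /=; fs. Qed.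

Lemma gn_betaL b bs U l G : okb b bs U -> lsub l U ->
  gn (betaL b bs l) G = valid b bs G && gn l (car b bs G).
Proof.
elim: bs U l => //= F bs IH U l [F0 FU bU ok_] hl; rewrite (IH _ _ ok_); last exact: lsub_starL.
rewrite gn_starL -?andbA //; first by fs.
exact: lsub_xfree hl bU.
Qed.

Lemma bish_betaL b bs U l : okb b bs U -> lsub l U -> bish l -> bish (betaL b bs l).
Proof.
elim: bs U l => //= F bs IH U l [F0 FU bU ok_] hl h.
apply: (IH _ _ ok_); first exact: lsub_starL.
by apply: bish_starL => //; [fs|exact: lsub_xfree hl bU].
Qed.

Lemma betaL_cat b bs l1 l2 : betaL b bs (l1 ++ l2) = betaL b bs l1 ++ betaL b bs l2.
Proof. by elim: bs l1 l2 => //= F bs IH l1 l2; rewrite starL_cat IH. Qed.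

Lemma carF_mono F x G H : G `<=` H -> carF F x G `<=` carF F x H.
Proof. by rewrite /carF => h; case: ifP => h1; case: ifP => h2; fs. Qed.

Lemma car_mono b bs G H : G `<=` H -> car b bs G `<=` car b bs H.
Proof. by elim: bs => //= F bs IH /IH; exact: carF_mono. Qed.

(** Since starring at an absent face does nothing, one and the same family of faces can be starred
    in all complexes of a chain. *)
Lemma mv_notin F x K : closed K -> F \notin K -> mv F [fset x] K = K.
Proof.
move=> cl FK; apply/fsetP => G; rewrite mvE.
have -> : F `|` G `\ x \in K = false.
  by apply/negbTE; apply: contra FK => /cl; apply; fs.
rewrite andbF orbF andb_idl // => GK; apply: contra FK; exact: cl.
Qed.

Lemma beta_sq b bs U K : okb b bs U -> vs K `<=` U -> closed K -> sq K (beta b bs K).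
Proof.
elim: bs U K => [*|F bs IH U K /= [F0 FU bU ok_] hv cl]; first exact: sq_refl.
have hs : sq K (mv F [fset b F] K).
  case: (boolP (F \in K)) => FK; last by rewrite mv_notin //; exact: sq_refl.
  by apply: sq_mv => //; apply: star_ok => //; fs.
apply: (sq_trans hs); apply: (IH (b F |` U)) => //.
  by have := vs_mv F [fset b F] K; fs.
exact: sq_closed hs cl.
Qed.

Lemma beta_id b bs K : closed K -> (forall F, F \in bs -> F \notin K) -> beta b bs K = K.
Proof.
move=> cl; elim: bs => //= F bs IH h; rewrite mv_notin //; last by apply: h; rewrite mem_head.
by apply: IH => F' hF'; apply: h; rewrite inE hF' orbT.
Qed.

Definition flipQ (Q : face -> Prop) K L := exists A C,
  [/\ closed K, star_is K A C [fset fset0], Q (A `|` C) & L = mv A C K].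

Inductive flQ Q K : cplx -> Prop :=
| flQ_refl : flQ Q K K
| flQ_step L M : flQ Q K L -> flipQ Q L M -> flQ Q K M.

Lemma flipQ_sym Q K L : flipQ Q K L -> flipQ Q L K.
Proof.
move=> [A [C [cl st r e]]]; subst L; have okA := star_is_ok st closed_fset0.
exists C, A; split.
- exact: mv_closed.
- by apply: star_is_inv => //; exact: closed_fset0.
- by rewrite fsetUC.
by rewrite mv_inv.
Qed.

Lemma flQ_trans Q K L M : flQ Q K L -> flQ Q L M -> flQ Q K M.
Proof. by move=> h; elim=> // N P _ IH s; apply: flQ_step s. Qed.

Lemma flQ_sym Q K L : flQ Q K L -> flQ Q L K.
Proof.
elim=> [|N P _ IH s]; first exact: flQ_refl.
by apply: flQ_trans IH; apply: flQ_step (flQ_refl _ _) _; exact: flipQ_sym.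
Qed.

(** With trivial [N] each move of the coning is an elementary flip inside the simplex on [v] and a
    facet. *)
Lemma coneY_flQ Q X v l : closed X -> v \notin vs X -> shok X [fset fset0] l ->
  (forall p, p \in l -> Q (v |` p.1)) -> flQ Q X (coneY X [fset fset0] v l).
Proof.
move=> clX vX; have clN := closed_fset0; have N0 : (fset0 : face) \in [fset fset0] by rewrite in_fset1.
elim: l => [|[F C] l IH] h r; first by rewrite coneY_nil //; exact: flQ_refl.
have hl : shok X [fset fset0] l by case: h => _ [].
have sY := coneY_closed_sq clX clN N0 vX hl.
apply: flQ_step (IH hl _) _; first by move=> p pl; apply: r; rewrite inE pl orbT.
exists (F `\` C), (v |` C); split.
- exact: (sq_closed sY clX).
- exact: cone_star.
- case: h => -[sC _ _ _ _] _; have /= rF := r (F, C) (mem_head _ _).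
  by have -> : F `\` C `|` (v |` C) = v |` F by fs.
by rewrite cone_mv.
Qed.
End IteratedStars.
Import IteratedStars.

(** * An elementary flip seen after an iterated subdivision *)

Module StarredFlips.
Implicit Types (K L M S X N : cplx) (A B C D E F G H : face) (x y z v f : T)
  (U V us : face) (l : seq (face * face)) (s t : seq T) (b : face -> T) (bs : seq face).

Fixpoint inip H s t := if s is f :: s' then (H `\ f, sset (s' ++ t)) :: inip H s' t else [::].

Lemma ini_cat H s t : ini H (s ++ t) = inip H s t ++ ini H t.
Proof. by elim: s => //= f s ->. Qed.

Lemma gn_inip H s t G : gn (inip H s t) G = has (fun f => G `<=` H `\ f) s.
Proof. by elim: s => //= f s ->. Qed.

Lemma has_sub H (s : face) G : s `<=` H -> has (fun f => G `<=` H `\ f) s = (G `<=` H) && ~~ (s `<=` G).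
Proof.
move=> sH; apply/hasP/idP => [[f fS h]|/andP[GH /fsubsetPn[f fS fG]]]; last by exists f => //; fs.
have {}fS : f \in s := fS.
by apply/andP; split; fs.
Qed.

Lemma lsub_inip H s t U : H `<=` U -> lsub (inip H s t) U.
Proof. by move=> HU; elim: s => //= f s ->; rewrite andbT; fs. Qed.

Lemma lsub_ini H s U : H `<=` U -> lsub (ini H s) U.
Proof. by move=> HU; elim: s => //= f s ->; rewrite andbT; fs. Qed.

Lemma starL_nil F x l : F != fset0 -> (starL F x l == [::]) = (l == [::]).
Proof.
move=> F0; case: l => // p l; rewrite /starL /= /starP; case: ifP => //= _.
have : ordF F p.2 != [::].
  by case/fset0Pn: F0 => y; rewrite -(mem_ordF F p.2); case: (ordF F p.2).
by case: (ordF F p.2).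
Qed.

Lemma betaL_nil b bs U l : okb b bs U -> (betaL b bs l == [::]) = (l == [::]).
Proof. by elim: bs U l => //= F bs IH U l [F0 _ _ /IH->]; rewrite starL_nil. Qed.

Section BetaHalf.
Variables (b : face -> T) (bs : seq face) (U : face) (K : cplx) (A C : face) (v : T).
Hypotheses (okb_ : okb b bs U) (vK : vs K `<=` U) (cl : closed K)
  (st : star_is K A C [fset fset0]) (CU : C `<=` U) (vv : v \notin vs (beta b bs K)).
Let H := A `|` C.
Let l1 := betaL b bs (ini H C).
Let l2 := betaL b bs (inip H A C).
Let X := beta b bs K.

Let AU : A `<=` U.
Proof.
by have [_ [AK _ _]] := star_is_ok st closed_fset0; have := sub_vs AK; fs.
Qed.
Let HU : H `<=` U. Proof. by rewrite /H; fs. Qed.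
Let dAC : fdisjoint A C. Proof. by have [[]] := st. Qed.

Lemma gn_half1 G : gn l1 G = [&& valid b bs G, car b bs G `<=` H & ~~ (C `<=` car b bs G)].
Proof.
rewrite (gn_betaL _ okb_ (lsub_ini _ HU)) gn_ini has_sub //; rewrite /H; fs.
Qed.

Lemma gn_half2 G : gn l2 G = [&& valid b bs G, car b bs G `<=` H & ~~ (A `<=` car b bs G)].
Proof.
rewrite (gn_betaL _ okb_ (lsub_inip _ _ HU)) gn_inip has_sub //; rewrite /H; fs.
Qed.

Lemma bish_half : bish (l2 ++ l1).
Proof.
rewrite -betaL_cat -ini_cat; apply: (bish_betaL okb_ (lsub_ini _ HU)); apply: bish_ini.
  rewrite cat_uniq !fset_uniq andbT /=; apply/hasP => -[y yC yA].
  have {}yC : y \in C := yC; have {}yA : y \in A := yA; have := dAC; fs.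
by rewrite sset_cat !sset_id.
Qed.

Lemma star_simplex G : A `<=` G -> (G \in K) = (G `<=` H) && ~~ (C `<=` G).
Proof.
have [_ [_ _ h]] := st; move=> AG; rewrite h // in_fset1 fsetD_eq0 andbC //.
Qed.

(** The balls [A * bd C] and [bd A * C] make up the boundary of the simplex on [A] and [C]. Its
    bishelling, subdivided, restricts to the ball in [K], whose interior faces are those with
    carrier over [A]. *)
Lemma half_shok : shok X [fset fset0] l1 /\ forall G, G \in X -> noA l1 G = ~~ (A `<=` car b bs G).
Proof.
have clX : closed X by apply: (sq_closed (beta_sq okb_ vK cl)).
apply: (@shok_of_bish X l2 l1 (fun G => A `<=` car b bs G) clX bish_half).
- rewrite (betaL_nil _ okb_); have [[A0 _ _ _] _] := st; case/fset0Pn: A0 => a.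
  by rewrite -[a \in A]/(a \in enum_fset A); case: (enum_fset A).
- move=> G; rewrite (betaE _ okb_ vK) => /andP[hv hc] hA; rewrite gn_half1 gn_half2 hv hA /= andbF andbT.
  by rewrite -star_simplex.
- move=> G; rewrite gn_half1 => /and3P[hv hc nC]; rewrite (betaE _ okb_ vK) hv /=.
  have : A `|` car b bs G \in K.
    rewrite star_simplex; last by fs.
    by apply/andP; split; [move: hc; rewrite /H; fs|have := dAC; fs].
  by move=> /cl; apply; fs.
- by move=> G; rewrite gn_half1 gn_half2 => /and3P[-> -> _] /=; rewrite negbK.
by move=> G G' h1 h2; apply: (fsubset_trans h2); exact: car_mono.
Qed.

Lemma half_mem F C' : (F, C') \in l1 -> F \in X.
Proof.
move=> h; have [sh _] := half_shok.
by have [_ /= h'] := shok_mem sh h; have := h' fset0; rewrite in_fset1 fsetU0 => /(_ (eqxx _)).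
Qed.

Lemma half_cone G : G \in coneY X [fset fset0] v l1 = if v \in G then
    [&& valid b bs (G `\ v), car b bs (G `\ v) `<=` H, ~~ (C `<=` car b bs (G `\ v)) &
        ~~ (A `<=` car b bs (G `\ v))]
  else [&& valid b bs G, car b bs G \in K & ~~ (A `<=` car b bs G)].
Proof.
have [sh no] := half_shok; have [_ _ h2] : [/\ True, True & forall G, gn l1 G -> G \in X].
  split=> // G' /hasP[[F C'] hin /= sG]; have clX : closed X by apply: (sq_closed (beta_sq okb_ vK cl)).
  by apply: (clX _ _ (half_mem hin)).
rewrite coneYE; case: ifP => vG; last first.
  case: (boolP (G \in X)) => hG; last by move: hG; rewrite /X (betaE _ okb_ vK) andbA => /negbTE ->.
  by rewrite no // andbA; move: hG; rewrite (betaE _ okb_ vK) => ->.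
rewrite gnN_fset0.
have -> : noA l1 G = noA l1 (G `\ v).
  apply: eq_in_all => -[F C'] hin /=; congr (~~ _).
  have h3 : v \notin vs X := vv; have h4 := sub_vs (half_mem hin).
  by apply/idP/idP; fs.
case: (boolP (gn l1 (G `\ v))) => hg.
  by rewrite no ?h2 //; move: hg; rewrite gn_half1 => /and3P[-> -> ->].
move: hg; rewrite gn_half1 /=; case: (valid _ _ _) => //=; case: (_ `<=` H) => //=.
by move/negbTE ->.
Qed.

Lemma half_flQ Q : (forall F, F \in X -> Q (v |` F)) -> flQ Q X (coneY X [fset fset0] v l1).
Proof.
move=> hQ; have [sh no] := half_shok.
apply: coneY_flQ => //; first by apply: (sq_closed (beta_sq okb_ vK cl)).
by move=> [F C'] /half_mem /hQ.
Qed.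
End BetaHalf.

(** The subdivided balls before and after the flip have the same boundary, so coning off either with
    apex [v] gives the same complex. All flips take place in simplices [v * F] with [F] in a
    subdivided complex, which bounds the colors. *)
Lemma beta_flQ b bs U K A C v Q : okb b bs U -> vs K `<=` U -> closed K ->
  star_is K A C [fset fset0] -> C `<=` U ->
  v \notin vs (beta b bs K) -> v \notin vs (beta b bs (mv A C K)) ->
  (forall F, F \in beta b bs K -> Q (v |` F)) ->
  (forall F, F \in beta b bs (mv A C K) -> Q (v |` F)) ->
  flQ Q (beta b bs K) (beta b bs (mv A C K)).
Proof.
move=> okb_ vK cl st CU v1 v2 q1 q2.
have okA := star_is_ok st closed_fset0; have cl' := mv_closed cl okA.
have st' := star_is_inv cl closed_fset0 st.
have vK' : vs (mv A C K) `<=` U by have := vs_mv A C K; fs.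
have AU : A `<=` U by have [_ [AK _ _]] := okA; have := sub_vs AK; fs.
apply: flQ_trans (half_flQ okb_ vK cl st CU v1 q1) _.
apply: flQ_sym; have := half_flQ okb_ vK' cl' st' AU v2 q2.
set Z1 := coneY _ _ _ _; set Z2 := coneY _ _ _ _; suff -> : Z1 = Z2 by [].
apply/fsetP => G; rewrite (half_cone okb_ vK cl st CU v1) (half_cone okb_ vK' cl' st' AU v2); case: ifP => vG.
  by rewrite [C `|` A]fsetUC; congr [&& _, _ & _]; rewrite andbC.
congr (_ && _); rewrite mvE; set c := car _ _ _.
case: (boolP (A `<=` c)) => hA /=; first by rewrite andbF.
rewrite andbT; case: (boolP (C `<=` c)) => hC /=; last by rewrite orbF andbT.
rewrite andbF; apply/esym/negbTE; have [_ [_ CK _]] := okA; apply: contra CK => /cl; exact.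
Qed.
End StarredFlips.
Import StarredFlips.

(** * Removing the colors above [d] *)

Module ColorReduction.
Implicit Types (K L M S X N : cplx) (A B C D E F G H : face) (x y z v f r : T)
  (U V us : face) (l : seq (face * face)) (s t : seq T) (b : face -> T) (bs : seq face).

(* The faces to be subdivided: some color exceeds [d], and each color [c <= d] satisfies
   [c < #|F| - 1], so that the new vertex may receive the color [#|F| - 1]. *)
Definition cond d F := has (fun z => d < col z) F && all (fun z => (col z <= d) ==> (col z < #|` F|.-1)) F.

Lemma condP d F : reflect ((exists2 z, z \in F & (d < col z)%N) /\
   forall z, z \in F -> (col z <= d)%N -> (col z < #|` F|.-1)%N) (cond d F).
Proof.
apply: (iffP andP) => -[h1 h2]; split.
- by case/hasP: h1 => z zF h; exists z.
- by move=> z zF; apply/implyP; exact: (allP h2).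
- by case: h1 => z zF h; apply/hasP; exists z.
by apply/allP => z zF; apply/implyP; exact: h2.
Qed.

Definition geF F G := (#|` G| <= #|` F|)%N.
(** Larger faces are starred first, as in a derived subdivision, so that new vertices are adjacent
    only over nested faces. *)
Definition fam d U : seq face := sort geF [seq F <- fpowerset U | cond d F].

Lemma mem_fam d U F : (F \in fam d U) = (F `<=` U) && cond d F.
Proof. by rewrite mem_sort mem_filter fpowersetE andbC. Qed.

Lemma uniq_fam d U : uniq (fam d U).
Proof. by rewrite sort_uniq filter_uniq // fset_uniq. Qed.

Lemma geF_trans : transitive geF.
Proof. by move=> F G H; rewrite /geF => h1 h2; apply: leq_trans h2 h1. Qed.

Lemma sorted_fam d U : sorted geF (fam d U).
Proof. by apply: sort_sorted => F G; exact: leq_total. Qed.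

Lemma fam_split d U bs1 F bs2 : fam d U = bs1 ++ F :: bs2 ->
  (forall G, G \in bs1 -> (#|` F| <= #|` G|)%N) /\ (forall G, G \in bs2 -> (#|` G| <= #|` F|)%N).
Proof.
move=> e; have := sorted_fam d U; rewrite e (sorted_pairwise geF_trans).
rewrite pairwise_cat /= => /and3P[/allrelP h _ /andP[/allP h' _]]; split.
  by move=> G hG; apply: h => //; rewrite mem_head.
by move=> G hG; apply: h'.
Qed.

Section Color.
Variables (d : nat) (U : face) (b : face -> T) (K : cplx).
Hypotheses (bcol : forall F, col (b F) = #|` F|.-1) (bU : forall F, b F \notin U)
  (binj : {in fam d U &, injective b}) (cl : closed K) (vK : vs K `<=` U) (rK : allrb K)
  (dK : forall F, F \in K -> (#|` F| <= d.+1)%N).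

Lemma cond_add F r : cond d F -> r \notin F -> ((col r <= d)%N -> (col r < #|` F|)%N) -> cond d (r |` F).
Proof.
move=> /condP[[z zF hz] h] rF hr; apply/condP; split; first by exists z => //; rewrite inE zF orbT.
rewrite cardfsU1 rF add1n /= => y; rewrite !inE => /orP[/eqP->//|yF] /(h _ yF) lt.
by apply: leq_trans lt _; exact: leq_pred.
Qed.

(** The third clause compares an old vertex [r] with a new one. If [F] with [r] added belongs to the
    family, it is larger and was starred before [F], so [r] was not in the link of [F]. This
    separates their colors in [beta_color]. *)
Definition stage_inv (dn : seq face) M :=
  [/\ closed M, forall G, G \in M -> G `<=` U -> G \in K /\ forall F, F \in dn -> ~~ (F `<=` G),
      forall r F, r \in U -> F \in dn -> [fset r; b F] \in M -> r \in F \/ ~~ cond d (r |` F),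
      forall F F', F \in dn -> F' \in dn -> F != F' -> [fset b F; b F'] \in M ->
         F `<=` F' \/ F' `<=` F &
      forall z, z \in vs M -> z \in U \/ exists2 F, F \in dn /\ z = b F & F \in K].

Lemma vs_pair M x y : closed M -> [fset x; y] \in M -> x \in vs M.
Proof. by move=> clM h; rewrite vs_sub_mem //; apply: (clM _ _ h); fs. Qed.

Lemma inv_step dn F bs M : fam d U = dn ++ F :: bs -> stage_inv dn M -> stage_inv (rcons dn F) (mv F [fset b F] M).
Proof.
move=> e [clM R E1 E2 V].
have Ff : F \in fam d U by rewrite e mem_cat mem_head orbT.
have := Ff; rewrite mem_fam => /andP[FU cF].
have F0 : F != fset0 by have /condP[[z zF _] _] := cF; apply/fset0Pn; exists z.
have dnf G : G \in dn -> G \in fam d U by move=> h; rewrite e mem_cat h.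
have Fdn : F \notin dn.
  have := uniq_fam d U; rewrite e cat_uniq => /and3P[_ /hasPn h _].
  by apply: h; rewrite mem_head.
have bdn G : G \in dn -> b G != b F.
  by move=> hG; apply: contra Fdn => /eqP /binj h; rewrite -h // dnf.
have bM : b F \notin vs M.
  apply/negP => /V[|[G [hG /eqP]]]; first by apply/negP; exact: bU.
  by rewrite eq_sym (negbTE (bdn G hG)).
have [big small] := fam_split e.
have bigdn G : G `<=` U -> cond d G -> (#|` F| < #|` G|)%N -> G \in dn.
  move=> GU cG lt; have : G \in fam d U by rewrite mem_fam GU.
  rewrite e mem_cat inE => /or3P[//|/eqP eG|/small]; first by rewrite eG ltnn in lt.
  by rewrite leqNgt lt.
have hM : forall G, G \in mv F [fset b F] M -> b F \notin G -> G \in M.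
  by move=> G; rewrite mv_car // /carF => /andP[_ +] hb; rewrite (negbTE hb).
have hMb y : [fset b F; y] \in mv F [fset b F] M -> y != b F -> y |` F \in M.
  rewrite mv_car // /carF => /andP[_ +] hy.
  have -> : b F \in [fset b F; y] by rewrite !inE eqxx.
  by have -> : F `|` [fset b F; y] `\ b F = y |` F by fs.
have rbF r : r \in U -> r != b F by apply: contraTneq => ->; exact: bU.

have pC x y : [fset x; y] = [fset y; x] by fs.
have caseF r : r \in U -> r |` F \in M -> r \in F \/ ~~ cond d (r |` F).
  move=> rU h; case: (boolP (r \in F)) => rF; [by left|right; apply/negP => c].
  have sU : r |` F `<=` U by fs.
  have [_ hR] := R _ h sU; have /hR : r |` F \in dn by apply: bigdn; rewrite // cardfsU1 rF.
  by rewrite fsubset_refl.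
(* Every vertex of [F] was adjacent to [b F']. One outside [F'] would violate the third clause: its
   color, if at most [d], is below [#|F| - 1], hence below [#|F'|], so that adding it to [F'] gives
   another face of the family. *)
have pair F' : F' \in dn -> [fset b F; b F'] \in mv F [fset b F] M -> F `<=` F'.
  move=> hF' /hMb /(_ (bdn _ hF')) h; apply/fsubsetP => r rF.
  have rU : r \in U by fs.
  have pM : [fset r; b F'] \in M by apply: (clM _ _ h); fs.
  case: (E1 r F' rU hF' pM) => // nc.
  have := dnf _ hF'; rewrite mem_fam => /andP[_ cF'].
  apply/negPn/negP => rF'; move/negP: nc; apply; apply: cond_add => // rd.
  have /condP[_ /(_ r rF rd) lt] := cF.
  apply: leq_trans lt _; apply: leq_trans (leq_pred _) _; exact: big.
split.
- case: (boolP (F \in M)) => FM; last by rewrite mv_notin.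
  by apply: mv_closed => //; exact: star_ok.
- move=> G GM GU; have bG : b F \notin G by have := bU F; fs.
  have [h1 h2] := R _ (hM _ GM bG) GU; split=> // F'; rewrite mem_rcons inE => /orP[/eqP->|/h2//].
  by move: GM; rewrite mv_car // => /andP[].
- move=> r F' rU; rewrite mem_rcons inE => /orP[/eqP->|F'dn] h.
    by apply: caseF => //; apply: hMb; rewrite ?rbF // pC.
  apply: E1 => //; apply: hM h _; have := rbF r rU; have := bdn _ F'dn.
  by rewrite !inE negb_or ![b F == _]eq_sym => -> ->.
- move=> F1 F2; rewrite !mem_rcons !inE => /orP[/eqP->|h1] /orP[/eqP->|h2] ne h.
  + by rewrite eqxx in ne.
  + by left; apply: pair.
  + by right; apply: pair; rewrite // pC.
  apply: E2 => //; apply: hM h _.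
  by rewrite !inE negb_or ![b F == _]eq_sym !bdn.
move=> z /vsP[G GM zG]; case: (boolP (b F \in G)) => bG; last first.
  have /V[|[F' [h1 h2] h3]] : z \in vs M by apply/vsP; exists G => //; exact: hM.
    by left.
  by right; exists F' => //; rewrite mem_rcons inE h1 orbT.
move: GM; rewrite mv_car // /carF bG => /andP[_ h].
case: (eqVneq z (b F)) => [->|zb].
  right; exists F; first by rewrite mem_rcons mem_head.
  by have [] := R F; first by apply: (clM _ _ h); fs.
have /V[|[F' [h1 h2] h3]] : z \in vs M by apply/vsP; exists (F `|` G `\ b F) => //; fs.
  by left.
by right; exists F' => //; rewrite mem_rcons inE h1 orbT.
Qed.

Lemma inv_beta dn bs M : fam d U = dn ++ bs -> stage_inv dn M -> stage_inv (fam d U) (beta b bs M).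
Proof.
elim: bs dn M => [|F bs IH] dn M e h /=; first by rewrite e cats0.
by apply: (IH (rcons dn F)); [rewrite cat_rcons|exact: inv_step e h].
Qed.

(** An old vertex of color above [d] is itself in the family, hence gone. An old [r] adjacent to
    [b F] has color below [#|F| - 1] if it lies in [F], and at least [#|F|] otherwise, as [F] with
    [r] is not in the family. Adjacent new vertices belong to nested faces of different sizes. *)
Lemma beta_color F : F \in beta b (fam d U) K -> rb F /\ forall z, z \in F -> (col z <= d)%N.
Proof.
have i0 : stage_inv [::] K.
  split=> // z zK; left; exact: (fsubsetP vK).
have [clB R E1 E2 V] := inv_beta (dn := [::]) (erefl _) i0.
set B := beta _ _ _ in clB R E1 E2 V * => FB.
have cold r : r \in U -> r \in vs B -> (col r <= d)%N.
  move=> rU; rewrite vs_sub_mem // => rB; rewrite leqNgt; apply/negP => h.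
  have rs : [fset r] `<=` U by fs.
  have [_ /(_ [fset r])] := R _ rB rs; rewrite fsubset_refl mem_fam rs /= => H.
  suff /H : cond d [fset r] by [].
  apply/condP; split; first by exists r; rewrite ?inE.
  by move=> z; rewrite inE => /eqP -> h'; move: h; rewrite ltnNge h'.
have mixed r F' : r \in U -> F' \in fam d U -> [fset r; b F'] \in B -> col r != col (b F').
  move=> rU F'f h; have rd : (col r <= d)%N by apply: cold => //; exact: vs_pair clB h.
  have := F'f; rewrite mem_fam => /andP[_ c]; rewrite bcol.
  have := E1 r F' rU F'f h; case: (boolP (r \in F')) => rF'.
    by have /condP[_ /(_ r rF' rd)] := c; rewrite neq_ltn => ->.
  case=> // nc; have lt : (#|` F'| <= col r)%N.
    by rewrite leqNgt; apply: contra nc => lt; apply: cond_add.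
  have /condP[[z zF' _] _] := c.
  have pos : (0 < #|` F'|)%N by rewrite cardfs_gt0; apply/fset0Pn; exists z.
  by rewrite neq_ltn orbC (leq_trans _ lt) // prednK.
split; last first.
  move=> z zF; have zB : z \in vs B by apply/vsP; exists F.
  case: (V z zB) => [zU|[F' [F'f ->] /dK h]]; first exact: cold.
  by rewrite bcol; case: (#|` F'|) h.
have fampos F' : F' \in fam d U -> (0 < #|` F'|)%N.
  rewrite mem_fam => /andP[_ /condP[[z zF' _] _]].
  by rewrite cardfs_gt0; apply/fset0Pn; exists z.
move=> x y xF yF e; apply/eqP/negPn/negP => ne.
have pB : [fset x; y] \in B by apply: (clB _ _ FB); fs.
have pB' : [fset y; x] \in B by apply: (clB _ _ FB); fs.
have xB : x \in vs B by exact: vs_pair clB pB.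
have yB : y \in vs B by exact: vs_pair clB pB'.
case: (V x xB) (V y yB) => [xU|[F1 [F1f e1] _]] [yU|[F2 [F2f e2] _]].
- have sU : [fset x; y] `<=` U by fs.
  have [pK _] := R _ pB sU.
  by case/eqP: ne; apply: (rK pK) => //; rewrite !inE eqxx ?orbT.
- by have := mixed x F2 xU F2f; rewrite -e2 => /(_ pB); rewrite e eqxx.
- by have := mixed y F1 yU F1f; rewrite -e1 => /(_ pB'); rewrite e eqxx.
have ne' : F1 != F2 by apply: contra ne => /eqP ef; rewrite e1 e2 ef.
have ec : #|` F1| = #|` F2|.
  move: e; rewrite e1 e2 !bcol => e; rewrite -[LHS]prednK ?fampos // -[RHS]prednK ?fampos //.
  by rewrite e.
have := E2 F1 F2 F1f F2f ne'; rewrite -e1 -e2 => /(_ pB).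
by case=> h; move/eqP: ne'; apply; apply/eqP; [|rewrite eq_sym]; rewrite eqEfcard h ec leqnn.
Qed.
End Color.

Lemma fam_b d U : exists b, [/\ forall F, col (b F) = #|` F|.-1, forall F, b F \notin U &
  {in fam d U &, injective b}] /\ okb b (fam d U) U.
Proof.
have [N hN] := id_bound U.
pose b F : T := (#|` F|.-1, (N + index F (fam d U))%N).
have h1 F : b F \notin U by apply/negP => /hN /=; rewrite ltnNge leq_addr.
have h2 : {in fam d U &, injective b}.
  by move=> F G hF hG [_ /addnI]; apply: index_inj.
exists b; split; first by split.
have H bs V : uniq bs -> {subset bs <= fam d U} -> U `<=` V ->
   (forall F, F \in bs -> b F \notin V) -> okb b bs V.
  elim: bs V => //= F bs IH V /andP[Fb ub] sb UV hV.
  have Ff : F \in fam d U by apply: sb; rewrite mem_head.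
  have := Ff; rewrite mem_fam => /andP[FU /condP[[z zF _] _]].
  split; [by apply/fset0Pn; exists z|by fs|by apply: hV; rewrite mem_head|].
  apply: IH => //; first by move=> G hG; apply: sb; rewrite inE hG orbT.
    by fs.
  move=> G hG; rewrite !inE negb_or (hV G) ?inE ?hG ?orbT // andbT.
  by apply/eqP => /h2 e; move: Fb; rewrite -e ?hG // sb // inE hG orbT.
apply: H => //; exact: uniq_fam.
Qed.
End ColorReduction.
Import ColorReduction.

(** * Connectivity, and rigidity of spheres *)

Module Rigidity.
Implicit Types (K L M S X N Y : cplx) (A B C D E F G H : face) (x y z v u w a : T)
  (l : seq (face * face)) (P : T -> bool).

(** Connectivity tested by two-valued functions on the vertices, which pass through a stellar
    subdivision more easily than paths. *)
Definition Conn K := forall P, (forall u w, [fset u; w] \in K -> P u = P w) ->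
  forall u w, u \in vs K -> w \in vs K -> P u = P w.

Lemma Conn_step K K' : step K K' -> Conn K -> Conn K'.
Proof.
move=> st; have cl' := step_closed st; case: st => A [x [cl AK A0 xK e]] cK P hP.
have xA : x \notin A by have := sub_vs AK; fs.
have [a aA] := fset0Pn _ A0.
(* If [A] is the single vertex [z], then [z] disappears and [x] takes its place. *)
pose P' z := if A == [fset z] then P x else P z.
have PA z F : z \in F -> A `<=` F -> F \in K -> P' z = P x.
  move=> zF AF FK; rewrite /P'; case: (eqVneq A [fset z]) => // ne; symmetry; apply: hP; subst K'.
  rewrite mvE; apply/andP; split.
    apply: contra ne => h; rewrite eqEfsubset; apply/andP.
    have h' : A `<=` [fset z] by fs.
    by split=> //; case/fset0Pn: A0 => y yA; have := fsubsetP h' y yA; rewrite inE => /eqP <-; fs.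
  by apply/orP; right; apply/andP; split; [fs|apply: (cl _ _ FK); fs].
have hP' u w : [fset u; w] \in K -> P' u = P' w.
  move=> uw; case: (boolP (A `<=` [fset u; w])) => AF.
    by rewrite !(PA _ _ _ AF uw) // !inE eqxx ?orbT.
  rewrite /P'; case: (eqVneq A [fset u]) => eu; first by case/negP: AF; rewrite eu; fs.
  case: (eqVneq A [fset w]) => ew; first by case/negP: AF; rewrite ew; fs.
  by apply: hP; subst K'; rewrite mvE AF uw.
have aK : a \in vs K by have := sub_vs AK; fs.
have key z : z \in vs K' -> P z = P' a.
  case: (eqVneq z x) => [-> _|zx]; first by rewrite (PA a A).
  rewrite vs_sub_mem // e mvE => /andP[nA h].
  have zK : z \in vs K.
    case/orP: h => [h|/andP[h _]]; first by rewrite vs_sub_mem.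
    by move: h; rewrite fsub1set inE eq_sym (negbTE zx).
  rewrite -(cK _ hP' z a) // /P'; case: eqP => // ez; by rewrite ez fsubset_refl in nA.
by move=> u w /key -> /key ->.
Qed.

Lemma Conn_step' K K' : step K K' -> Conn K' -> Conn K.
Proof.
move=> st; have cl' := step_closed st; case: st => A [x [cl AK A0 xK e]] cK P hP.
have xA : x \notin A by have := sub_vs AK; fs.
have [a aA] := fset0Pn _ A0.
pose P' z := if z == x then P a else P z.
have hx w : w != x -> [fset x; w] \in K' -> P a = P w.
  rewrite e mvE => wx /andP[_ /orP[/sub_vs h|/andP[_ h]]]; first by case/negP: xK; fs.
  by apply: hP; apply: (cl _ _ h); fs.
have hP' u w : [fset u; w] \in K' -> P' u = P' w.
  rewrite /P'; case: (eqVneq u x) => [->|ux]; case: (eqVneq w x) => [-> //|wx].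
  - exact: hx.
  - have -> : [fset u; x] = [fset x; u] by fs.
    by move/(hx _ ux).
  rewrite e mvE => /andP[_ /orP[/hP//|/andP[h _]]].
  by move: h; rewrite fsub1set !inE ![x == _]eq_sym (negbTE ux) (negbTE wx).
have xK' : x \in vs K'.
  rewrite vs_sub_mem // e mvE; apply/andP; split; first by fs.
  by apply/orP; right; apply/andP; split; [fs|apply: (cl _ _ AK); fs].
have key z : z \in vs K -> P z = P' x.
  move=> zK; case: (eqVneq A [fset z]) => ez.
    by move: aA; rewrite ez inE => /eqP <-; rewrite /P' eqxx.
  have zx : z != x by apply: contraNneq xK => <-.
  rewrite -(cK _ hP' z x) //; first by rewrite /P' (negbTE zx).
  rewrite vs_sub_mem // e mvE -vs_sub_mem // zK andbT; apply: contra ez => h.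
  rewrite eqEfsubset h /=; have := fsubsetP h a aA; rewrite inE => /eqP <-; fs.
by move=> u w /key -> /key ->.
Qed.

Lemma Conn_sq K L : sq K L -> Conn K -> Conn L.
Proof. by move=> h c; elim: h => // [N P _ IH /Conn_step|N P _ IH /Conn_step']; apply. Qed.

Lemma Conn_bd B : (2 < #|` B|)%N -> Conn (bd B).
Proof.
move=> cB P hP u w; rewrite !vs_bd ?(ltn_trans _ cB) // => uB wB; apply: hP; rewrite bdE.
apply/andP; split; first by fs.
apply: contraTN cB => /fsubset_leq_card h; rewrite -leqNgt (leq_trans h) //.
by rewrite cardfs2; case: eqP.
Qed.

Lemma Conn_sph n S : sph n.+2 S -> Conn S.
Proof. by move=> [B cB h]; apply: (Conn_sq (sq_sym h)); apply: Conn_bd; rewrite cB. Qed.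

Lemma step_unit K L : step K L -> (K == [fset fset0]) = false /\ (L == [fset fset0]) = false.
Proof.
move=> st; case: (st) => A [x [cl AK A0 xK e]]; split; apply/negbTE/eqP => h.
  by move: AK; rewrite h in_fset1 (negbTE A0).
have : [fset x] \in L.
  rewrite e mvE; have := sub_vs AK => hA.
  apply/andP; split; first by fs.
  by apply/orP; right; apply/andP; split; [fs|apply: (cl _ _ AK); fs].
by rewrite h in_fset1 => /eqP/fsetP/(_ x); rewrite !inE eqxx.
Qed.

Lemma sq_unit K L : sq K L -> (K == [fset fset0]) = (L == [fset fset0]).
Proof. by elim=> // [N P _ -> /step_unit[-> ->]|N P _ -> /step_unit[-> ->]]. Qed.

Lemma sph0 S : sph 0 S -> S = [fset fset0].
Proof. by move=> [B cB /sq_unit h]; apply/eqP; rewrite h bd1. Qed.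

Lemma sph_vertex n S : sph n.+1 S -> exists v, v \in vs S.
Proof.
move=> h; have cl := sph_closed h; have S0 := sph_fset0 h; case: h => B cB /sq_unit.
case: (S =P [fset fset0]) => [_ /esym/eqP h|ne _].
  have : vs (bd B) = B by rewrite vs_bd ?cB.
  by rewrite h vs_fset00 => /esym e; rewrite e cardfs0 in cB.
apply/fset0Pn; apply/eqP => h; apply: ne; apply/fsetP => F; rewrite in_fset1.
by apply/idP/eqP => [/sub_vs|->//]; rewrite h => ?; fs.
Qed.

Lemma vertex_sq K L : sq K L -> fset0 \in L -> (exists v, v \in vs K) -> exists v, v \in vs L.
Proof.
move=> /sq_unit h L0 [v vK]; apply/fset0Pn; apply/eqP => e.
have eL : L == [fset fset0].
  apply/eqP/fsetP => F; rewrite in_fset1; apply/idP/eqP => [/sub_vs|->//].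
  by rewrite e => ?; fs.
by move: h; rewrite eL => /eqP eK; move: vK; rewrite eK vs_fset00.
Qed.

Definition two_points S := exists a b, a != b /\ S = bd [fset a; b].

Lemma two_mv a b c : a != b -> c != a -> c != b -> mv [fset a] [fset c] (bd [fset a; b]) = bd [fset c; b].
Proof.
move=> ab ca cb; apply/fsetP => G; rewrite mvE !bdE.
have da : fdisjoint [fset a] ([fset b] `|` [fset c]) by apply/fdisjointP => z; rewrite !inE => /eqP ->; rewrite (negbTE ab) eq_sym (negbTE ca).
have db : fdisjoint [fset b] [fset c] by apply/fdisjointP => z; rewrite !inE => /eqP ->; rewrite eq_sym (negbTE cb).
apply/idP/idP; first by case/andP => h /orP[/andP[h1 h2]|/and3P[h1 h2 h3]]; apply/andP; split; fs.
case/andP => h1 h2; apply/andP; split; first by fs.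
case: (boolP (c \in G)) => cG; last by apply/orP; left; apply/andP; split; fs.
by apply/orP; right; apply/and3P; split; fs.
Qed.

Lemma two_step S S' : step S S' -> two_points S -> two_points S'.
Proof.
move=> [A [x [cl AK A0 xK e]]] [a [b [ab e']]]; subst S; move: AK xK; rewrite bdE vs_bd ?cardfs2 ?ab //.
rewrite !inE negb_or => /andP[h1 h2] /andP[xa xb].
have : A = [fset a] \/ A = [fset b].
  case/fset0Pn: A0 => z zA; have := fsubsetP h1 z zA; rewrite !inE => /orP[] /eqP ez; subst z.
    by left; fs.
  by right; fs.
case=> eA; subst A; first by exists x, b; rewrite e two_mv.
exists x, a; rewrite e; have -> : [fset a; b] = [fset b; a] by fs.
by rewrite two_mv // eq_sym.
Qed.

Lemma two_step' S S' : step S S' -> two_points S' -> two_points S.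
Proof.
move=> st [a [b [ab e']]]; have := st => -[A [x [cl AK A0 xK e]]].
have okA := star_ok AK A0 cl xK.
have := mv_inv cl okA; rewrite -e e' => <-.
have hA := sub_vs AK; have xA : x \notin A by fs.
have x' : [fset x] \in S'.
  rewrite e mvE; apply/andP; split; first by fs.
  by apply/orP; right; apply/andP; split; [fs|apply: (cl _ _ AK); fs].
have [c eA] : exists c, A = [fset c].
  case/fset0Pn: (A0) => c cA; exists c; apply/eqP; rewrite eqEfsubset; apply/andP; split; last by fs.
  apply/negPn/negP => h; have : [fset x; c] \in S'.
    rewrite e mvE; apply/andP; split; first by fs.
    by apply/orP; right; apply/andP; split; [fs|apply: (cl _ _ AK); fs].
  move: x'; rewrite e' !bdE fsub1set !inE => /andP[xab _] /andP[h1 h2].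
  have : [fset a; b] = [fset x; c].
    apply/esym/eqP; rewrite eqEfcard h1 !cardfs2 ab; case: eqP => //= xc.
    by rewrite xc cA in xA.
  by move=> e2; rewrite e2 fsubset_refl in h2.
subst A; have cS : c \notin vs S'.
  rewrite vs_sub_mem; last exact: (step_closed st).
  by rewrite e mvE fsubset_refl.
move: cS x'; rewrite e' vs_bd ?cardfs2 ?ab // bdE fsub1set !inE negb_or => /andP[ca cb] /andP[/orP[]/eqP ex _]; subst x.
  by exists c, b; rewrite two_mv.
exists c, a; split=> //; have -> : [fset a; b] = [fset b; a] by fs.
by rewrite two_mv // eq_sym.
Qed.

Lemma sph1 S : sph 1 S -> two_points S.
Proof.
move=> [B cB h]; have : two_points (bd B).
  have /fset0Pn[a aB] : B != fset0 by rewrite -cardfs_gt0 cB.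
  have := cardfsD1 a B; rewrite aB cB => -[] /esym/eqP/cardfs1P[b eb].
  have ba : b \in B `\ a by rewrite eb inE.
  have eB : B = [fset a; b] by rewrite -(fsetD1K aB) eb.
  by exists a, b; rewrite -eB; split=> //; move: ba; rewrite !inE eq_sym => /andP[].
have {h} := sq_sym h; elim=> // N P _ IH st /IH; [exact: two_step|exact: two_step'].
Qed.

Lemma fset1_neq0 v : [fset v] != fset0.
Proof. by rewrite -cardfs_gt0 cardfs1. Qed.

Lemma lk_vertex n X v : mfd n X -> v \in vs X -> sph n.-1 (lk [fset v] X).
Proof.
move=> [cl _ h]; rewrite vs_sub_mem // => vX.
have [_] := h _ vX (fset1_neq0 v); by rewrite cardfs1 subn1.
Qed.

Lemma lk_sub N M F : closed N -> closed M -> N `<=` M -> lk F N `<=` lk F M.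
Proof.
move=> cN cM /fsubsetP s; apply/fsubsetP => G; rewrite !lkE // => /andP[-> /s ->] //.
Qed.

(** At a vertex of [N] the links in [N] and [M] agree by the hypothesis on spheres, so the edges of
    [M] there are edges of [N]. By connectivity [N] has all the vertices of [M], and then, links
    being equal, all the faces. *)
Lemma mfd_sub_eq n N M v :
  (forall S S', sph n S -> sph n S' -> S `<=` S' -> S = S') ->
  mfd n.+1 N -> mfd n.+1 M -> N `<=` M -> Conn M -> v \in vs N -> N = M.
Proof.
move=> IH mN mM s cM vN; have clN : closed N by case: mN. have clM : closed M by case: mM.
have elk u : u \in vs N -> lk [fset u] N = lk [fset u] M.
  move=> uN; apply: IH; [exact: lk_vertex mN uN| |exact: lk_sub].
  by apply: (lk_vertex mM); apply: (fsubsetP (vsS s)).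
have edge u w : [fset u; w] \in M -> u \in vs N -> w \in vs N.
  move=> uw uN; case: (eqVneq w u) => [->//|ne].
  have : [fset w] \in lk [fset u] M.
    by rewrite lkE // uw andbT; apply/fdisjointP => z; rewrite !inE => /eqP ->.
  rewrite -elk // lkE // => /andP[_ h]; rewrite vs_sub_mem //; apply: (clN _ _ h); fs.
have allv w : w \in vs M -> w \in vs N.
  move=> wM; have vM := fsubsetP (vsS s) v vN.
  rewrite -(cM (fun z => z \in vs N) _ v w vM wM) // => a b ab.
  apply/idP/idP; apply: edge => //; by have <- : [fset a; b] = [fset b; a] by fs.
apply/eqP; rewrite eqEfsubset s /=; apply/fsubsetP => F FM.
case: (eqVneq F fset0) => [->|/fset0Pn[u uF]]; first by case: mN.
have uN : u \in vs N by apply: allv; apply/vsP; exists F.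
have : F `\ u \in lk [fset u] M.
  by rewrite lkE //; apply/andP; split; [fs|have -> : u |` F `\ u = F by fs].
by rewrite -elk // lkE // => /andP[_]; have -> : u |` F `\ u = F by fs.
Qed.

(** A combinatorial invariance of domain. The recursion over links ends at the pair of points, which
    is not connected and is treated by counting. *)
Lemma sph_eq n N M : sph n N -> sph n M -> N `<=` M -> N = M.
Proof.
elim: n N M => [|[|n] IH] N M hN hM s.
- by rewrite (sph0 hN) (sph0 hM).
- have [a [b [ab eN]]] := sph1 hN; have [c [d [cd eM]]] := sph1 hM.
  have : [fset a; b] `<=` [fset c; d].
    have := vsS s; by rewrite eN eM !vs_bd // cardfs2 ?ab ?cd.
  move=> h; rewrite eN eM; congr bd; apply/eqP; by rewrite eqEfcard h !cardfs2 ab cd.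
have [v vN] := sph_vertex hN.
by apply: (mfd_sub_eq IH) vN => //; [exact: sph_mfd|exact: sph_mfd|exact: Conn_sph hM].
Qed.

Lemma mfd_eq n N M v : mfd n.+1 N -> mfd n.+1 M -> N `<=` M -> Conn M -> v \in vs N -> N = M.
Proof. by apply: mfd_sub_eq => S S'; exact: sph_eq. Qed.

Lemma sph_pure n S : sph n S -> exists2 F, F \in S & #|` F| = n.
Proof.
elim: n S => [|n IH] S h; first by exists fset0; rewrite ?cardfs0 //; exact: sph_fset0 h.
have [v vS] := sph_vertex h; have cl := sph_closed h.
have [F] := IH _ (lk_vertex (sph_mfd h) vS); rewrite lkE // => /andP[d FS] cF.
exists (v |` F) => //; rewrite cardfsU1 cF; by have -> : v \notin F by fs.
Qed.

Lemma mfd_pure n X v F : mfd n X -> v \in vs X -> F \in X ->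
  exists2 G, G \in X & F `<=` G /\ #|` G| = n.
Proof.
move=> mX vX FX; have [cl X0 h] := mX.
wlog F0 : F FX / F != fset0.
  move=> W; case: (eqVneq F fset0) => [e|]; last exact: W.
  have vX' : [fset v] \in X by rewrite -vs_sub_mem.
  have [G GX [_ cG]] := W _ vX' (fset1_neq0 v); exists G => //; split=> //.
  by rewrite e fsub0set.
have [cF /sph_pure[G]] := h _ FX F0; rewrite lkE // => /andP[d GX] cG.
exists (F `|` G) => //; split; first by fs.
rewrite cardfsU; have -> : F `&` G = fset0 by fs.
by rewrite cardfs0 subn0 cG subnKC.
Qed.

Lemma shok_noA X l G : shok X [fset fset0] l -> G \in X -> ~~ gn l G -> noA l G.
Proof.
elim: l => //= -[F C] l IH [_ [_ h hl]] GX; rewrite negb_or => /andP[h1 h2] /=.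
have n := IH hl GX h2; rewrite n andbT; apply: contra h1 => h1.
by have := h _ GX h1 n; rewrite in_fset1 fsetD_eq0.
Qed.

Lemma noA_sub l G H : noA l G -> H `<=` G -> noA l H.
Proof. by move=> h s; apply/allP => p /(allP h); apply: contra => /fsubset_trans; exact. Qed.

Section Manifold.
Variables (n : nat) (X : cplx) (u0 : T) (l : seq (face * face)).
Hypotheses (mX : mfd n.+2 X) (u0X : u0 \in vs X) (cX : Conn X).
Hypotheses (cl_ : forall p, p \in l -> #|` p.1| = n.+2).

(** Coning off [l] leaves a manifold, so [H] lies in one of its facets. If this contains the apex,
    the ridge opposite to the apex has a link of two points, and the other point gives a facet
    without the apex; it belongs to [X] and not to [l]. *)
Lemma noA_gen H : shok X [fset fset0] l -> H \in X -> noA l H ->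
  exists2 G, G \in X & [/\ H `<=` G, #|` G| = n.+2, noA l G & ~~ gn l G].
Proof.
move=> sh HX nH; have clX : closed X by case: mX.
have [v vX] := fresh_vertex (vs X).
have hl p : p \in l -> p.1 \in X.
  by move=> /(shok_mem sh)[_ /(_ fset0)]; rewrite fsetU0 in_fset1; apply.
have sY : sq X (coneY X [fset fset0] v l).
  by apply: coneY_closed_sq => //; [exact: closed_fset0|rewrite in_fset1].
set Y := coneY _ _ _ _ in sY; have mY := mfd_sq sY mX; have clY : closed Y by case: mY.
have nov G : v \notin G -> G \in Y = (G \in X) && noA l G by rewrite coneYE => /negbTE ->.
have vH : v \notin H by have := sub_vs HX; fs.
have [w wY] : exists w, w \in vs Y by apply: (vertex_sq sY); [case: mY|exists u0].
suff [G [vG GY HG cG]] : exists G, [/\ v \notin G, G \in Y, H `<=` G & #|` G| = n.+2].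
  move: GY; rewrite nov // => /andP[GX nG]; exists G => //; split=> //.
  apply/hasPn => -[F C] pl /=; apply/negP => GF.
  have e : G = F by have /= cF := cl_ pl; apply/eqP; rewrite eqEfcard GF cG cF leqnn.
  by have /= := allP nG _ pl; rewrite e fsubsetDl.
have HY : H \in Y by rewrite nov // HX.
have [G GY [HG cG]] := mfd_pure mY wY HY.
case: (boolP (v \in G)) => vG; last by exists G.
have cR : #|` G `\ v| = n.+1 by have := cardfsD1 v G; rewrite vG cG => -[].
have RY : G `\ v \in Y by apply: (clY _ _ GY); fs.
have R0 : G `\ v != fset0 by rewrite -cardfs_gt0 cR.
have [_ _ /(_ _ RY R0)[_]] := mY; rewrite cR subSn // subnn => s1.
have [a [b [ab e]]] := sph1 s1.
have [c cv hc] : exists2 c, c != v & [fset c] \in lk (G `\ v) Y.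
  have hh z : z \in [fset a; b] -> [fset z] \in lk (G `\ v) Y.
    by move=> hz; rewrite -vs_sub_mem ?e ?vs_bd // ?cardfs2 ?ab //; exact: bd_closed.
  case: (eqVneq a v) => av; last by exists a => //; apply: hh; rewrite !inE eqxx.
  by exists b; [rewrite -av eq_sym|apply: hh; rewrite !inE eqxx orbT].
move: hc; rewrite lkE // => /andP[d hc].
exists (G `\ v `|` [fset c]); split=> //.
- by rewrite !inE eqxx /= eq_sym.
- by fs.
rewrite fsetUC cardfsU1 cR; by have -> : c \notin G `\ v by fs.
Qed.

(** The shelling knows nothing of [X], so that it does not tell by itself that coning off [F] is a
    legal move; rigidity does. The facet [G0] outside [l] keeps the last facet from closing up the
    whole manifold. *)
Lemma shok_of_shl G0 : shl l -> (forall p, p \in l -> p.1 \in X) ->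
  G0 \in X -> #|` G0| = n.+2 -> ~~ gn l G0 -> shok X [fset fset0] l.
Proof.
elim: l cl_ => [//|[F C] l' IH] hc /= [sC h1 sl] hX G0X cG; rewrite negb_or => /andP[gF gl'].
have hc' p : p \in l' -> #|` p.1| = n.+2 by move=> hp; apply: hc; rewrite inE hp orbT.
have hX' p : p \in l' -> p.1 \in X by move=> hp; apply: hX; rewrite inE hp orbT.
have sh := IH hc' sl hX' G0X cG gl'.
have FX : F \in X := hX _ (mem_head _ _); have cF : #|` F| = n.+2 := hc _ (mem_head _ _).
have nF : noA l' F by apply: (shok_noA sh FX); rewrite h1 // sC.
have clX : closed X by case: mX.
have [v vX] := fresh_vertex (vs X).
have sY : sq X (coneY X [fset fset0] v l').
  by apply: coneY_closed_sq => //; [exact: closed_fset0|rewrite in_fset1].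
set Y := coneY _ _ _ _ in sY; have mY := mfd_sq sY mX; have clY : closed Y by case: mY.
have YE G : G \in Y = (if v \in G then gn l' (G `\ v) else G \in X) && noA l' G.
  by rewrite coneYE gnN_fset0.
have nov G : v \notin G -> G \in Y = (G \in X) && noA l' G by rewrite YE => /negbTE ->.
have vF : v \notin F by have := sub_vs FX; fs.
have noF G : G `\ v `<=` F -> noA l' G.
  move=> h; apply/allP => -[F' C'] pl /=; have /= /sub_vs h' := hX' _ pl.
  by have /= := allP nF _ pl; fs.
have sub G : G `<=` v |` F -> ~~ (v |` C `<=` G) -> G \in Y.
  move=> h h2; rewrite YE noF ?andbT; last by fs.
  case: ifP => vG; last by apply: (clX _ _ FX); fs.
  by rewrite h1; fs.
(* Otherwise the boundary of the simplex [v * F] would lie in [Y], hence be all of [Y], which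
   contains the further facet [G0]. *)
have A0 : F `\` C != fset0.
  apply/negP; rewrite fsetD_eq0 => FC; have eC : C = F by fs.
  have sY' : bd (v |` F) `<=` Y.
    by apply/fsubsetP => G; rewrite bdE => /andP[g1 g2]; apply: sub => //; rewrite eC.
  have mB : mfd n.+2 (bd (v |` F)) by apply: mfd_bd; rewrite cardfsU1 vF cF.
  have vB : v \in vs (bd (v |` F)) by rewrite vs_bd ?cardfsU1 ?vF ?cF // !inE eqxx.
  have e := mfd_eq mB mY sY' (Conn_sq sY cX) vB.
  have vG0 : v \notin G0 by have := sub_vs G0X; fs.
  have : G0 \in Y by rewrite nov // G0X; exact: shok_noA sh G0X gl'.
  rewrite -e bdE => /andP[h _]; case/negP: gF; fs.
have AX : F `\` C \in X by apply: (clX _ _ FX); fs.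
split; split=> //.
- by rewrite vs_fset00 fdisjointX0.
- by move=> m; rewrite in_fset1 => /eqP ->; rewrite fsetU0.
move=> H HX AH nH; rewrite in_fset1 fsetD_eq0.
have AY : F `\` C \in Y by apply: sub; fs.
have [_ _ /(_ _ AY A0)[le sA]] := mY.
(* Two spheres of the same dimension; the inclusion comes from the shelling condition. *)
have eq_ : bd (v |` C) = lk (F `\` C) Y.
  apply: (sph_eq (n := (n.+2 - #|` F `\` C|)%N)) => //.
    apply: sph_bd; have vC : v \notin C by fs.
    rewrite cardfsU1 vC add1n; congr S; rewrite -cF cardfsD (_ : F `&` C = C); last by fs.
    by rewrite subKn // fsubset_leq_card.
  apply/fsubsetP => G; rewrite bdE lkE // => /andP[g1 g2]; apply/andP; split; first by fs.
  by apply: sub; fs.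
have vH : v \notin H by have := sub_vs HX; fs.
have : H `\` (F `\` C) \in lk (F `\` C) Y.
  rewrite lkE //; apply/andP; split; first by fs.
  have -> : F `\` C `|` H `\` (F `\` C) = H by fs.
  by rewrite nov // HX.
by rewrite -eq_ bdE => /andP[h _]; fs.
Qed.
End Manifold.
End Rigidity.
Import Rigidity.

(** * Flips with a single extra color *)

Module ReducedFlips.
Implicit Types (K L M S X N Y : cplx) (A B C D E F G H : face) (x y z v u w a : T)
  (l : seq (face * face)) (b : face -> T) (U V : face) (Q : face -> Prop).

Definition colQ m F := rb F /\ forall z, z \in F -> (col z <= m)%N.

Definition goodb d U b := [/\ forall F, col (b F) = #|` F|.-1, forall F, b F \notin U,
  {in fam d U &, injective b} & okb b (fam d U) U].

Lemma goodb_ex d U : exists b, goodb d U b.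
Proof. by have [b [[h1 h2 h3] h4]] := fam_b d U; exists b. Qed.

Lemma flipQ_sq Q K L : flipQ Q K L -> sq K L.
Proof.
by move=> [A [C [cl st _ ->]]]; apply: sq_mv => //; exact: (star_is_ok st closed_fset0).
Qed.

Lemma flQ_sq Q K L : flQ Q K L -> sq K L.
Proof.
elim=> [|N P _ IH /flipQ_sq h]; first exact: sq_refl.
exact: sq_trans IH h.
Qed.

Lemma mv_simplex K A C G : star_is K A C [fset fset0] -> G \in mv A C K -> G \in K \/ G `<=` A `|` C.
Proof.
move=> st; rewrite mvE => /andP[_ /orP[|/andP[CG]]]; first by left.
by rewrite (star_isU _ st) => /andP[_]; rewrite in_fset1 fsetD_eq0; right; fs.
Qed.

Lemma flipQ_all Q K L : (forall F G, Q F -> G `<=` F -> Q G) -> flipQ Q K L ->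
  (forall F, F \in K -> Q F) -> forall F, F \in L -> Q F.
Proof.
move=> mono [A [C [cl st q ->]]] h F /(mv_simplex st)[/h//|]; exact: mono.
Qed.

Lemma colQ_sub m F G : colQ m F -> G `<=` F -> colQ m G.
Proof.
move=> [r h] s; split; first exact: rb_sub r s.
by move=> z /(fsubsetP s)/h.
Qed.

Lemma rb_sub' F G : rb F -> G `<=` F -> rb G. Proof. exact: rb_sub. Qed.

Lemma mfd_card n K F : mfd n K -> F \in K -> (#|` F| <= n)%N.
Proof.
move=> [_ _ h] FK; case: (eqVneq F fset0) => [->|F0]; first by rewrite cardfs0.
by have [] := h _ FK F0.
Qed.

Lemma goodb_color d U b K F : goodb d U b -> mfd d.+1 K -> vs K `<=` U -> allrb K ->
  F \in beta b (fam d U) K -> colQ d F.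
Proof.
move=> [b1 b2 b3 b4] m vK r; apply: beta_color => //; first by case: m.
by move=> G; exact: mfd_card.
Qed.

(** The set [U] bounds the vertices of the whole chain, so that one family serves all its complexes
    and the new vertices avoid every one of them. *)
Lemma fl_beta d K L : fl K L -> mfd d.+1 K -> allrb K ->
  allrb L /\ exists U, forall U' b, U `<=` U' -> goodb d U' b ->
    vs L `<=` U' /\ flQ (colQ d.+1) (beta b (fam d U') K) (beta b (fam d U') L).
Proof.
move=> h m r; elim: h => [|N P hN [rN [U IH]] st].
  by split=> //; exists (vs K) => U' b hU g; split=> //; exact: flQ_refl.
have mN := mfd_sq (fl_sq hN) m.
have rP : allrb P := flipQ_all rb_sub' st rN.
have mP := mfd_sq (flipQ_sq st) mN.
split=> //; case: st => A [C [cl st rAC e]].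
exists (U `|` vs N `|` vs P `|` C) => U' b hU g.
have [vN hQ] : vs N `<=` U' /\ flQ (colQ d.+1) (beta b (fam d U') K) (beta b (fam d U') N).
  by apply: IH => //; fs.
have vP : vs P `<=` U' by fs.
split=> //; apply: flQ_trans hQ _.
have [k hk] := id_bound (vs (beta b (fam d U') N) `|` vs (beta b (fam d U') P)).
(* The apex carries the one extra color: the subdivided complexes have colors at most [d]. *)
pose v : T := (d.+1, k).
have hv : v \notin vs (beta b (fam d U') N) `|` vs (beta b (fam d U') P).
  by apply/negP => /hk; rewrite ltnn.
have q M F : mfd d.+1 M -> vs M `<=` U' -> allrb M -> F \in beta b (fam d U') M -> colQ d.+1 (v |` F).
  move=> mM vM rM /(goodb_color g mM vM rM)[rF cF]; split.
    by apply: rb_add => // z /cF; rewrite /col /v /= neq_ltn ltnS => ->.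
  by move=> z; rewrite !inE => /orP[/eqP->//|/cF/leqW].
have [b1 b2 b3 b4] := g.
rewrite e in hv rP mP vP *; apply: (beta_flQ (U := U') (v := v)) => //; try by fs.
  by move=> F; apply: q.
by move=> F; apply: q.
Qed.

Lemma fam_notin d U K F : (forall F, F \in K -> colQ d F) -> F \in fam d U -> F \notin K.
Proof.
move=> h; rewrite mem_fam => /andP[_ /condP[[z zF hz] _]]; apply/negP => /h[_ /(_ z zF)].
by rewrite leqNgt hz.
Qed.

(** The ends of the chain have no color above [d], so none of their faces is in the family and the
    subdivision leaves them unchanged. *)
Lemma flQ_of_sq d K L : mfd d.+1 K -> sq K L -> (forall F, F \in K -> colQ d F) ->
  (forall F, F \in L -> colQ d F) -> flQ (colQ d.+1) K L.
Proof.
move=> m h cK cL; have mL := mfd_sq h m.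
have rK : allrb K by move=> F /cK[]. have rL : allrb L by move=> F /cL[].
have [_ [U hU]] := fl_beta (fl_of_sq m h rK rL) m rK.
have [b g] := goodb_ex d U; have [_] := hU U b (fsubset_refl _) g.
rewrite !beta_id //; first by case: mL.
- by move=> F; exact: fam_notin.
- by case: m.
by move=> F; exact: fam_notin.
Qed.
End ReducedFlips.
Import ReducedFlips.

(** * Simplicial fans and their subdivisions *)

Module Cones.
Import Order.TTheory GRing.Theory Num.Theory.
Local Open Scope ring_scope.
Implicit Types (K L M S X N Y : cplx) (A B C D E F G H : face) (x y z v u a : T) (U V : face).

Lemma fset_argmin (R : realFieldType) (f : T -> R) A : A != fset0 ->
  exists2 a, a \in A & forall y, y \in A -> f a <= f y.
Proof.
case/fset0Pn => a0 a0A; pose i0 : A := [` a0A].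
case: (arg_minP (fun i : A => f (fsval i)) (i0 := i0) (P := predT)) => // i _ h.
by exists (fsval i); [exact: fsvalP|move=> y yA; exact: (h [` yA])].
Qed.

Section Cone.
Variables (R : archiRealFieldType) (m : nat).
Implicit Types (p : T -> 'rV[R]_m) (c d w : T -> R) (q : 'rV[R]_m).

Definition cmb F c p : 'rV[R]_m := \sum_(x <- F) c x *: p x.
Definition co F c := (forall x, 0 <= c x) /\ forall x, x \notin F -> c x = 0.
(** The cone over the face with apex at the origin, in place of the simplex; the empty face is the
    origin. *)
Definition inc F p q := exists2 c, co F c & q = cmb F c p.
(** The cones over the faces form a simplicial fan. Linear independence of the vertices of a face is
    a consequence ([Geo_free]). *)
Definition Geo X p := forall F G c d, F \in X -> G \in X -> co F c -> co G d ->
  cmb F c p = cmb G d p -> c =1 d.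

Lemma cmb_sub F G c p : F `<=` G -> (forall x, x \notin F -> c x = 0) -> cmb G c p = cmb F c p.
Proof.
by move=> s h; apply/esym/big_fset_incl => // x _ /h ->; rewrite scale0r.
Qed.

Lemma cmb_eqc F c d p : (forall x, x \in F -> c x = d x) -> cmb F c p = cmb F d p.
Proof. by move=> h; apply: eq_big_seq => x /h ->. Qed.

Lemma cmb_eqp F c p p' : (forall x, x \in F -> p x = p' x) -> cmb F c p = cmb F c p'.
Proof. by move=> h; apply: eq_big_seq => x /h ->. Qed.

Lemma cmbD F c d p : cmb F (fun x => c x + d x) p = cmb F c p + cmb F d p.
Proof. by rewrite -big_split; apply: eq_bigr => x _; rewrite scalerDl. Qed.

Lemma cmbZ F k c p : cmb F (fun x => k * c x) p = k *: cmb F c p.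
Proof. by rewrite scaler_sumr; apply: eq_bigr => x _; rewrite scalerA. Qed.

Lemma cmbD1 F c p x : x \in F -> cmb F c p = c x *: p x + cmb (F `\ x) c p.
Proof. by move=> xF; rewrite /cmb (big_fsetD1 x). Qed.

Definition ind F x : R := (x \in F)%:R.

Lemma cmb1 F p x : x \in F -> cmb F (ind [fset x]) p = p x.
Proof.
move=> xF; rewrite (@cmb_sub [fset x]); last first.
- by move=> y; rewrite /ind => /negbTE ->.
- by fs.
by rewrite /cmb big_seq_fset1 /ind inE eqxx scale1r.
Qed.

Lemma co_sub F G c : co F c -> F `<=` G -> co G c.
Proof. by move=> [h1 h2] s; split=> // x xG; apply: h2; fs. Qed.

Lemma coD F c d : co F c -> co F d -> co F (fun x => c x + d x).
Proof. by move=> [a1 a2] [b1 b2]; split=> x; [rewrite addr_ge0|move=> h; rewrite a2 ?b2 ?addr0]. Qed.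

Lemma coZ F k c : 0 <= k -> co F c -> co F (fun x => k * c x).
Proof. by move=> k0 [a1 a2]; split=> x; [rewrite mulr_ge0|move=> h; rewrite a2 ?mulr0]. Qed.

Lemma co1 F x : x \in F -> co F (ind [fset x]).
Proof.
move=> xF; split=> y; rewrite /ind; first exact: ler0n.
by rewrite inE; case: eqP => // ->; rewrite xF.
Qed.

Lemma co0 F : co F (fun _ => 0).
Proof. by split. Qed.

Lemma inc_p F p x : x \in F -> inc F p (p x).
Proof. by move=> xF; exists (ind [fset x]); [exact: co1|rewrite cmb1]. Qed.

Lemma inc_sub F G p q : inc F p q -> F `<=` G -> inc G p q.
Proof.
move=> [c hc ->] s; exists c; first exact: co_sub hc s.
by rewrite (cmb_sub _ s) //; case: hc.
Qed.

Lemma inc0 F p : inc F p 0.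
Proof. by exists (fun _ => 0); [exact: co0|rewrite /cmb big1 // => x _; rewrite scale0r]. Qed.

Lemma incD F p q q' : inc F p q -> inc F p q' -> inc F p (q + q').
Proof. by move=> [c hc ->] [d hd ->]; exists (fun x => c x + d x); [exact: coD|rewrite cmbD]. Qed.

Lemma incZ F p q k : 0 <= k -> inc F p q -> inc F p (k *: q).
Proof. by move=> k0 [c hc ->]; exists (fun x => k * c x); [exact: coZ|rewrite cmbZ]. Qed.

Lemma inc_cmb F G c p : co F c -> (forall x, x \in F -> inc G p (p x)) -> inc G p (cmb F c p).
Proof.
move=> [h1 _] h; rewrite /cmb big_seq.
by apply: big_ind => [|a1 a2|x xF]; [exact: inc0|exact: incD|apply: incZ => //; exact: h].
Qed.

Lemma inc_trans F G p q : inc F p q -> (forall x, x \in F -> inc G p (p x)) -> inc G p q.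
Proof. by move=> [c hc ->]; exact: inc_cmb. Qed.

Lemma inc_eqp F p p' q : (forall x, x \in F -> p x = p' x) -> inc F p q -> inc F p' q.
Proof. by move=> h [c hc ->]; exists c => //; exact: cmb_eqp. Qed.

Lemma Geo_eqp X p p' : (forall x, x \in vs X -> p x = p' x) -> Geo X p -> Geo X p'.
Proof.
move=> h g F G c d FX GX hc hd e; apply: (g F G) => //.
have e' H : H \in X -> forall c, cmb H c p = cmb H c p'.
  by move=> HX c'; apply: cmb_eqp => x xH; apply: h; apply/vsP; exists H.
by rewrite !e'.
Qed.

(** The faces of a fan are extreme. The coordinates of [cmb F c p] are unique, vanish off [H], and
    are sums of nonnegative contributions, so every contribution with positive weight vanishes off
    [H]. *)
Lemma inc_ext X p F G H c x : Geo X p -> G \in X -> H \in X -> co F c ->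
  (forall y, y \in F -> inc G p (p y)) -> inc H p (cmb F c p) -> x \in F -> 0 < c x -> inc H p (p x).
Proof.
move=> g GX HX hc hF [e he E] xF cx; have [d hd Ed] := hF x xF.
have [d' hd' Ed'] : inc G p (cmb (F `\ x) c p).
  apply: (inc_trans (F := F)); last exact: hF.
  have hF' : inc (F `\ x) p (cmb (F `\ x) c p).
    exists (fun y => if y == x then 0 else c y).
      case: hc => h1 h2; split=> y; first by case: eqP.
      by rewrite !inE; case: eqP => //= _; exact: h2.
    by apply: cmb_eqc => y; rewrite !inE => /andP[/negbTE ->].
  by apply: inc_sub hF' _; fs.
have key := g G H (fun y => c x * d y + d' y) e GX HX _ he.
rewrite cmbD cmbZ -Ed -Ed' -cmbD1 // in key.
have {}key := key (coD (coZ (ltW cx) hd) hd') E.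
have dH y : y \notin H -> d y = 0.
  move=> yH; have := key y; case: he => _ /(_ y yH) -> h.
  have [h1 _] := hd; have [h2 _] := hd'.
  have /eqP : c x * d y + d' y == 0 by apply/eqP.
  rewrite (rwP eqP) paddr_eq0 ?h2 ?mulr_ge0 ?(ltW cx) // => /andP[+ _].
  by rewrite mulf_eq0 (gt_eqF cx) => /eqP.
exists d; first by case: hd.
rewrite Ed; transitivity (cmb (G `|` H) d p).
  by rewrite (@cmb_sub G) //; [fs|case: hd].
by rewrite (@cmb_sub H) //; fs.
Qed.

(** Geometric subdivision with one placement for both complexes: the cones of [N] lie in cones of
    [M] and cover them. *)
Definition Sub N M p := [/\ Geo N p, Geo M p,
  (forall F, F \in N -> exists2 G, G \in M & forall x, x \in F -> inc G p (p x)) &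
  (forall G q, G \in M -> inc G p q -> exists2 F, F \in N & inc F p q)].

Lemma Sub_refl M p : Geo M p -> Sub M M p.
Proof.
move=> g; split=> // [F FM|F q FM h]; exists F => // x xF; exact: inc_p.
Qed.

Lemma Sub_trans N M K p : Sub N M p -> Sub M K p -> Sub N K p.
Proof.
move=> [g1 g2 f1 c1] [g3 g4 f2 c2]; split=> //.
  move=> F /f1[G /f2[H HK h2] h1]; exists H => // x /h1 h; exact: inc_trans h h2.
by move=> G q GK /(c2 _ _ GK)[F FM h]; apply: (c1 F).
Qed.

Lemma Sub_refine N M K p : Sub N K p -> Sub M K p ->
  (forall F, F \in N -> exists2 G, G \in M & forall x, x \in F -> inc G p (p x)) -> Sub N M p.
Proof.
move=> [g1 g2 f1 c1] [g3 g4 f2 c2] h; split=> // G q GM hq.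
by have [H HK hG] := f2 _ GM; apply: (c1 H) => //; exact: inc_trans hq hG.
Qed.

Lemma Sub_eqp N M p p' : (forall x, x \in vs N `|` vs M -> p x = p' x) -> Sub N M p -> Sub N M p'.
Proof.
move=> h [g1 g2 f1 c1].
have hN F x : F \in N -> x \in F -> p x = p' x.
  by move=> FN xF; apply: h; rewrite inE; apply/orP; left; apply/vsP; exists F.
have hM F x : F \in M -> x \in F -> p x = p' x.
  by move=> FN xF; apply: h; rewrite inE; apply/orP; right; apply/vsP; exists F.
split.
- by apply: Geo_eqp g1 => x xN; apply: h; rewrite inE xN.
- by apply: Geo_eqp g2 => x xN; apply: h; rewrite inE xN orbT.
- move=> F FN; have [G GM hG] := f1 _ FN; exists G => // x xF; rewrite -(hN F) //.
  by apply: inc_eqp (hG _ xF) => y; exact: hM.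
move=> G q GM hq; have hq' : inc G p q by apply: inc_eqp hq => y yG; rewrite (hM G).
have [F FN hF] := c1 _ _ GM hq'; exists F => //; apply: inc_eqp hF => y; exact: hN.
Qed.

Section Star.
Variables (X : cplx) (A : face) (x : T) (w : T -> R) (p : T -> 'rV[R]_m).
Hypotheses (AX0 : [/\ closed X, A \in X & A != fset0]) (xX : x \notin vs X)
  (wA : forall a, a \in A -> 0 < w a) (g : Geo X p) (px : p x = cmb A w p).
Let X' := mv A [fset x] X.

(** Coordinates on the carrier of a face of the star, with [p x] expanded over [A]. *)
Let dd c y := if y == x then 0 else c y + (if y \in A then c x * w y else 0).

Let cl : closed X. Proof. by case: AX0. Qed.
Let AX : A \in X. Proof. by case: AX0. Qed.
Let xA : x \notin A. Proof. by have := sub_vs AX; fs. Qed.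

Lemma star_face H : H \in X' -> ~~ (A `<=` H) /\ carF A x H \in X.
Proof. by rewrite /X' mv_car // => /andP[]. Qed.

Lemma dd_co H c : H \in X' -> co H c -> co (carF A x H) (dd c).
Proof.
move=> /star_face[nA hX] [h1 h2]; split=> y; rewrite /dd.
  case: eqP => // _; rewrite addr_ge0 //; case: ifP => // yA.
  by rewrite mulr_ge0 // ltW // wA.
case: eqP => // yx; rewrite /carF; case: ifP => xH.
  by rewrite !inE => /norP[/negbTE -> /=]; case: eqP => //= _ yH; rewrite h2 ?addr0.
by move=> yH; rewrite h2 // (h2 x) ?xH // mul0r if_same addr0.
Qed.

Lemma dd_cmb H c : H \in X' -> co H c -> cmb H c p = cmb (carF A x H) (dd c) p.
Proof.
move=> /star_face[nA hX] [h1 h2]; rewrite /carF; case: ifP => xH; last first.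
  apply: cmb_eqc => y yH; rewrite /dd; case: eqP => [e|_]; first by rewrite -e yH in xH.
  by rewrite (h2 x) ?xH // mul0r if_same addr0.
rewrite (cmbD1 _ _ xH) px.
pose e1 y := if y == x then 0 else c y; pose e2 y := if y \in A then c x * w y else 0.
have -> : cmb (A `|` H `\ x) (dd c) p = cmb (A `|` H `\ x) (fun y => e1 y + e2 y) p.
  apply: cmb_eqc => y; rewrite /dd /e1 /e2 !inE; case: eqP => // ->.
  by rewrite (negbTE xA).
rewrite cmbD addrC; congr (_ + _).
  rewrite (@cmb_sub (H `\ x)); last first.
  - by move=> y; rewrite !inE /e1; case: eqP => //= _; exact: h2.
  - by fs.
  by apply: cmb_eqc => y; rewrite !inE /e1 => /andP[/negbTE ->].
rewrite (@cmb_sub A); last first.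
- by move=> y /negbTE yA; rewrite /e2 yA.
- by fs.
by rewrite -cmbZ; apply: cmb_eqc => y yA; rewrite /e2 yA.
Qed.

(** A face of the star misses some [a] in [A], where [dd c a] is just [c x * w a]. So [c x] is the
    least quotient of [dd c] by [w] on [A], and is determined by [dd c]. *)
Lemma dd_inj H H' c c' : H \in X' -> H' \in X' -> co H c -> co H' c' -> dd c =1 dd c' -> c =1 c'.
Proof.
have ddA H0 c0 a : H0 \in X' -> co H0 c0 -> a \in A -> dd c0 a = c0 a + c0 x * w a.
  by move=> _ _ aA; rewrite /dd aA; case: eqP => // e; rewrite e (negbTE xA) in aA.
have le H1 H2 c1 c2 : H1 \in X' -> H2 \in X' -> co H1 c1 -> co H2 c2 -> dd c1 =1 dd c2 -> c1 x <= c2 x.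
  move=> hH1 hH2 hc1 hc2 e; have [/fsubsetPn[a aA aH] _] := star_face hH2.
  have := e a; rewrite (ddA H1) // (ddA H2) //; have [_ ->] := hc2 => //; rewrite add0r => e'.
  rewrite -(ler_pM2r (wA aA)) -e'; have [h _] := hc1; by rewrite lerDr.
move=> hH hH' hc hc' e; have ex : c x = c' x by apply/eqP; rewrite eq_le !(le _ _ _ _ _ _ hc hc') ?(le _ _ _ _ _ _ hc' hc).
move=> y; have := e y; rewrite /dd; case: eqP => [->//|_]; rewrite ex; exact: addIr.
Qed.

Lemma Geo_star : Geo X' p.
Proof.
move=> H H' c c' hH hH' hc hc' e; apply: (dd_inj hH hH' hc hc').
apply: (g (F := carF A x H) (G := carF A x H')); rewrite -?dd_cmb //; try exact: dd_co.
  by case: (star_face hH).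
by case: (star_face hH').
Qed.

Lemma Sub_star : Sub X' X p.
Proof.
split=> //; first exact: Geo_star.
  move=> H /star_face[nA hX]; exists (carF A x H) => // y yH; move: hX; rewrite /carF.
  case: ifP => xH hX; last exact: inc_p.
  case: (eqVneq y x) => [->|yx]; last by apply: inc_p; rewrite !inE yx yH orbT.
  apply: (@inc_sub A); last by fs.
  exists (fun y => if y \in A then w y else 0).
    by split=> z; [case: ifP => // /wA /ltW|move=> /negbTE ->].
  by rewrite px; apply: cmb_eqc => z ->.
move=> G q GX [d [h1 h2] ->]; case: (boolP (A `<=` G)) => AG; last first.
  by exists G; [rewrite mvE AG GX|exists d].
(* The largest multiple of [p x] that leaves nonnegative coordinates is subtracted; the minimizing
   vertex [a] drops out. *)
have [a aA ha] : exists2 a, a \in A & forall y, y \in A -> d a / w a <= d y / w y.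
  by apply: fset_argmin; case: AX0.
have xG : x \notin G by have := sub_vs GX; fs.
have aG : a \in G by fs.
pose t := d a / w a; have t0 : 0 <= t by rewrite divr_ge0 // ltW // wA.
pose c y := if y == x then t else if y \in A then d y - t * w y else d y.
pose H := x |` (G `\ a).
have HX : H \in X'.
  rewrite mvE; apply/andP; split; first by rewrite /H; have := xA; fs.
  apply/orP; right; apply/andP; split; first by rewrite /H; fs.
  by apply: (cl GX); rewrite /H; fs.
have hc : co H c.
  split=> y; rewrite /c.
    case: eqP => // _; case: ifP => // yA; rewrite subr_ge0 -ler_pdivlMr ?wA //; exact: ha.
  rewrite /H !inE negb_or => /andP[/negbTE -> ]; rewrite negb_and negbK => /orP[/eqP->|yG].
    by rewrite aA /t divfK ?subrr // gt_eqF // wA.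
  by rewrite ifF ?h2 //; apply/negbTE; fs.
exists H => //; exists c => //; rewrite (dd_cmb HX hc).
have -> : carF A x H = G.
  rewrite /carF /H; have -> : x \in x |` (G `\ a) by fs.
  by fs.
apply: cmb_eqc => y yG; rewrite /dd /c eqxx; case: eqP => [e|_]; first by rewrite e (negbTE xG) in yG.
by case: ifP => _; rewrite ?addr0 // subrK.
Qed.
End Star.
End Cone.
End Cones.
Import Cones.

(** * From a shelled subdivision to the derived subdivision *)

Module Derived.
Implicit Types (K L M S X N Y P : cplx) (A B C D E F G H : face) (x y z u a : T)
  (l : seq (face * face)) (U V : face).

Section Derived.
Variables (N M : cplx) (v : face -> T) (cr : face -> face).
Let M' := M `\ fset0.
Let vM : face := v @` M'.
Hypotheses (clN : closed N) (clM : closed M) (N0 : fset0 \in N)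
  (vinj : injective v) (vN : fdisjoint (vs N) vM)
  (crM : forall F, F \in N -> cr F \in M) (cr_mono : forall F G, G \in N -> F `<=` G -> cr F `<=` cr G)
  (cr0 : forall F, F \in N -> cr F = fset0 -> F = fset0) (cr00 : cr fset0 = fset0).

Definition Nin t := [fset F in N | cr F `<=` t].

Hypothesis shelled : forall t, t \in M' -> exists l, [/\ shok (Nin t) [fset fset0] l,
  forall G, G \in Nin t -> gn l G & forall G, G \in Nin t -> noA l G = (cr G != t)].

Definition kap H : cplx := [fset r in M' | v r \in H].
Definition chain (k : cplx) := [forall r : k, [forall s : k, (fsval r `<=` fsval s) || (fsval s `<=` fsval r)]].

Lemma chainP (k : cplx) : reflect (forall r s, r \in k -> s \in k -> r `<=` s \/ s `<=` r) (chain k).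
Proof.
apply: (iffP forallP) => [h r s rk sk|h r].
  by apply/orP; exact: (forallP (h [` rk]) [` sk]).
by apply/forallP => s; apply/orP; exact: h (fsvalP r) (fsvalP s).
Qed.

Lemma chain_sub (k k' : cplx) : k `<=` k' -> chain k' -> chain k.
Proof. by move=> /fsubsetP s /chainP h; apply/chainP => r t /s h1 /s h2; exact: h. Qed.

(* The faces [F `|` v(chain)]: the cells in [P] have been coned off, with apex [v r] over [r]. *)
Definition stg P : cplx := [fset H in fpowerset (vs N `|` vM) |
  [&& H `\` vM \in N, cr (H `\` vM) \notin P, chain (kap H) &
      all (fun r => (r \in P) && (cr (H `\` vM) `<` r)) (kap H)]].

Lemma kapE H r : (r \in kap H) = (r \in M') && (v r \in H).
Proof. by rewrite !inE. Qed.

Lemma stgP P H : reflect [/\ H `\` vM \in N, cr (H `\` vM) \notin P, chain (kap H) &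
   forall r, r \in kap H -> r \in P /\ cr (H `\` vM) `<` r] (H \in stg P).
Proof.
rewrite !inE /= fpowersetE; apply: (iffP andP).
  by move=> [_ /and4P[h1 h2 h3 /allP h4]]; split=> // r /h4 /andP[].
move=> [h1 h2 h3 h4]; split; first by have := sub_vs h1; fs.
by apply/and4P; split=> //; apply/allP => r /h4[-> ->].
Qed.

Lemma kapN F : F \in N -> kap F = fset0.
Proof.
move=> /sub_vs h; apply/fsetP => r; rewrite kapE in_fset0; apply/negP => /andP[rM vF].
have : v r \in vM by apply/imfsetP; exists r.
by move: vN; fs.
Qed.

Lemma stg0 : stg fset0 = N.
Proof.
apply/fsetP => H; apply/stgP/idP => [[h1 _ _ h4]|HN]; last first.
  have e : H `\` vM = H by have := sub_vs HN; move: vN; fs.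
  rewrite e kapN //; split=> //; first by apply/chainP => r s; rewrite in_fset0.
suff -> : H = H `\` vM by [].
apply/eqP; rewrite eqEfsubset fsubsetDl andbT; apply/fsubsetP => z zH; rewrite inE zH andbT.
apply/negP => /imfsetP[r /= rM ez]; have : r \in kap H by rewrite kapE rM -ez.
by move=> /h4[]; rewrite in_fset0.
Qed.

Lemma stg1 H : (H \in stg M') = (H `<=` vM) && chain (kap H).
Proof.
apply/stgP/andP => [[h1 h2 h3 h4]|[h1 h2]].
  split=> //; rewrite -fsetD_eq0; apply/eqP/cr0 => //.
  by move: h2; rewrite in_fsetD1 (crM h1) andbT negbK => /eqP.
have e : H `\` vM = fset0 by apply/eqP; rewrite fsetD_eq0.
rewrite e cr00; split=> //; first by rewrite in_fsetD1 eqxx.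
move=> r; rewrite kapE => /andP[rM _]; split=> //; rewrite fproperEneq fsub0set andbT.
by move: rM; rewrite in_fsetD1 eq_sym => /andP[].
Qed.

Lemma kap_mono G H : G `<=` H -> kap G `<=` kap H.
Proof. by move=> s; apply/fsubsetP => r; rewrite !kapE => /andP[-> /(fsubsetP s) ->]. Qed.

(** Flags of cells above [t]: what the interior of [t] is joined with once those cells have been
    coned off. *)
Definition above t : cplx := [fset H in fpowerset vM | chain (kap H) && all (fun r => t `<` r) (kap H)].

Lemma aboveP t H : reflect [/\ H `<=` vM, chain (kap H) & forall r, r \in kap H -> t `<` r] (H \in above t).
Proof.
rewrite !inE /= fpowersetE; apply: (iffP and3P) => -[h1 h2 h3]; split=> //; first exact/allP.
exact/allP.
Qed.

Lemma above_closed t : closed (above t).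
Proof.
move=> F G /aboveP[h1 h2 h3] s; have k := kap_mono s; apply/aboveP; split; first by fs.
  exact: chain_sub h2.
by move=> r /(fsubsetP k)/h3.
Qed.

Section Step.
Variables (P : cplx) (t : face).
Hypotheses (PM : P `<=` M') (up : forall r s, r \in P -> s \in M' -> r `<=` s -> s \in P)
  (tM : t \in M') (tP : t \notin P) (tmax : forall r, r \in M' -> t `<` r -> r \in P).

Lemma stg_closed : closed (stg P).
Proof.
move=> H G /stgP[h1 h2 h3 h4] s; have k := kap_mono s.
have s' : G `\` vM `<=` H `\` vM by fs.
have GN : G `\` vM \in N by apply: (clN h1).
have sc := cr_mono h1 s'; apply/stgP; split=> //.
- apply: contra h2 => h2; apply: (up h2 _ sc); rewrite in_fsetD1 (crM h1) andbT.
  have := fsubsetP PM _ h2; rewrite in_fsetD1 => /andP[n0 _].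
  by apply: contra n0 => /eqP e; rewrite -fsubset0 -e.
- exact: chain_sub h3.
move=> r /(fsubsetP k)/h4[rP lt]; split=> //; exact: fsub_proper_trans lt.
Qed.

Lemma vs_stg : vs (stg P) `<=` vs N `|` (v @` P).
Proof.
apply/fsubsetP => z /vsP[H /stgP[h1 h2 h3 h4] zH]; case: (boolP (z \in vM)) => zM.
  case/imfsetP: (zM) => r /= rM ez; rewrite inE; apply/orP; right; apply/imfsetP; exists r => //=.
  by have : r \in kap H; [rewrite kapE rM -ez|move/h4=> []].
by rewrite inE; apply/orP; left; have := sub_vs h1; fs.
Qed.

Lemma vt_stg : v t \notin vs (stg P).
Proof.
apply/negP => /(fsubsetP vs_stg); rewrite inE => /orP[h|/imfsetP[r /= rP /vinj e]].
  have h' : v t \in vM by apply/imfsetP; exists t.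
  by move: vN; fs.
by rewrite -e (negbTE tP) in rP.
Qed.

Section List.
Variable l : seq (face * face).
Hypotheses (sh : shok (Nin t) [fset fset0] l) (gl : forall G, G \in Nin t -> gn l G)
  (nl : forall G, G \in Nin t -> noA l G = (cr G != t)).

Lemma NinE G : (G \in Nin t) = (G \in N) && (cr G `<=` t).
Proof. by rewrite !inE. Qed.

Lemma l_mem F C : (F, C) \in l -> F \in Nin t.
Proof. by move=> /(shok_mem sh)[_ /(_ fset0)]; rewrite in_fset1 fsetU0; apply. Qed.

Lemma l_crA F C : (F, C) \in l -> F `\` C \in N /\ cr (F `\` C) = t.
Proof.
move=> h; have := l_mem h; rewrite NinE => /andP[FN Ft].
have AN : F `\` C \in N by apply: (clN FN); fs.
split=> //; apply/eqP; rewrite -[_ == _]negbK; rewrite -nl.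
  by apply/allPn; exists (F, C); rewrite //= negbK fsubset_refl.
by rewrite NinE AN (fsubset_trans _ Ft) //; apply: cr_mono => //; fs.
Qed.

Lemma l_disj F C : (F, C) \in l -> fdisjoint F vM.
Proof. by move=> /l_mem; rewrite NinE => /andP[/sub_vs h _]; move: vN; fs. Qed.

Lemma l_cr G F C : G \in N -> cr G \notin P -> (F, C) \in l -> F `\` C `<=` G -> cr G = t.
Proof.
move=> GN GP pl AG; have [_ e] := l_crA pl; have le := cr_mono GN AG; rewrite e in le.
apply/eqP; apply: contraR GP => ne; apply: tmax; last by rewrite fproperEneq eq_sym ne.
rewrite in_fsetD1 (crM GN) andbT; move: tM; rewrite in_fsetD1 => /andP[t0 _].
by apply: contra t0 => /eqP e'; rewrite -fsubset0 -e'.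
Qed.

Lemma noA_N G : G \in N -> cr G \notin P -> noA l G = (cr G != t).
Proof.
move=> GN GP; case: (eqVneq (cr G) t) => e.
  by rewrite nl ?e ?eqxx // NinE GN e fsubset_refl.
by apply/allP => -[F C] pl /=; apply: contra e => h; apply/eqP; exact: l_cr h.
Qed.

Lemma noA_vM l' H : {subset l' <= l} -> noA l' H = noA l' (H `\` vM).
Proof.
move=> s; apply: eq_in_all => -[F C] /s/l_disj d /=; congr (~~ _); by apply/idP/idP; fs.
Qed.

Lemma kapD G H : fdisjoint G vM -> kap (G `|` H) = kap H.
Proof.
move=> d; apply/fsetP => r; rewrite !kapE; case: (boolP (r \in M')) => //= rM.
have h : v r \in vM by apply/imfsetP; exists r.
by apply/idP/idP; fs.
Qed.

Lemma cr_F F C : (F, C) \in l -> cr F = t.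
Proof.
move=> h; have := l_mem h; rewrite NinE => /andP[FN Ft]; have [_ e] := l_crA h.
by apply/eqP; rewrite eqEfsubset Ft -e; apply: cr_mono => //; fs.
Qed.

Lemma shok_stg : shok (stg P) (above t) l.
Proof.
have H l' : {subset l' <= l} -> shok (Nin t) [fset fset0] l' -> shok (stg P) (above t) l'; last exact: H.
elim: l' => //= -[F C] l' IH sl [[s1 s2 s3 s4 s5] [s6 s7 s8]].
have Fl : (F, C) \in l by apply: sl; rewrite mem_head.
have sl' : {subset l' <= l} by move=> q ql; apply: sl; rewrite inE ql orbT.
have dF := l_disj Fl; have FN : F \in N by have := l_mem Fl; rewrite NinE => /andP[].
split; split=> //.
- apply/fdisjointP => z zF; apply/negP => /vsP[H0 /aboveP[h _ _] zH]; move: dF; fs.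
- move=> n /aboveP[h1 h2 h3]; apply/stgP.
  have -> : (F `|` n) `\` vM = F by fs.
  rewrite kapD // (cr_F Fl); split=> // r hr; have lt := h3 _ hr; split=> //.
  by apply: tmax => //; move: hr; rewrite kapE => /andP[].
- move=> H0 /stgP[h1 h2 h3 h4] AH nH.
  have AH' : F `\` C `<=` H0 `\` vM by fs.
  have e := l_cr h1 h2 Fl AH'.
  have : H0 `\` vM `\` F \in [fset fset0].
    apply: s7 => //; last by rewrite -noA_vM.
    by rewrite NinE h1 e fsubset_refl.
  rewrite in_fset1 fsetD_eq0 => h; apply/aboveP.
  have k : kap (H0 `\` F) `<=` kap H0 by apply: kap_mono; fs.
  split; [by fs|exact: chain_sub h3|].
  by move=> r /(fsubsetP k)/h4[_]; rewrite e.
exact: IH.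
Qed.

Lemma kapD1 H : kap (H `\ v t) = kap H `\ t.
Proof.
apply/fsetP => r; rewrite in_fsetD1 !kapE in_fsetD1; case: (eqVneq r t) => [->|ne] /=.
  by rewrite eqxx andbF.
by rewrite (inj_eq vinj) ne.
Qed.

(** The faces with carrier [t] give way to cones with apex [v t] over faces carried by the boundary
    of [t]; accordingly, flags may now start at [t]. *)
Lemma coneY_stg : coneY (stg P) (above t) (v t) l = stg (t |` P).
Proof.
have vtM : v t \in vM by apply/imfsetP; exists t.
have lowP r : r \in P -> ~~ (r `<=` t) by move=> rP; apply: contra tP => h; exact: up rP tM h.
apply/fsetP => H; rewrite coneYE (noA_vM _ (l' := l)) //; case: ifP => vH; last first.
  apply/andP/stgP => [[/stgP[h1 h2 h3 h4] h5]|[h1 h2 h3 h4]].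
    rewrite noA_N // in h5; split=> //; first by rewrite in_fset1U negb_or h5.
    by move=> r /h4[rP lt]; rewrite in_fset1U rP orbT.
  move: h2; rewrite in_fset1U negb_or => /andP[h2 h2']; rewrite noA_N //; split=> //.
  apply/stgP; split=> // r hr; have [rP lt] := h4 _ hr; split=> //.
  move: rP; rewrite in_fset1U => /orP[/eqP e|//]; move: hr; rewrite kapE e vH andbF //.
set F := H `\` vM.
have tk : t \in kap H by rewrite kapE tM.
apply/andP/stgP => [[/hasP[[F' C'] pl /= /aboveP[h1 h2 h3]] h4]|[h1 h2 h3 h4]].
  have dF := l_disj pl; have FF' : F `<=` F' by rewrite /F; fs.
  have := l_mem pl; rewrite NinE => /andP[F'N F't].
  have FN : F \in N by apply: (clN F'N).
  have crt : cr F `<=` t by apply: fsubset_trans F't; exact: cr_mono.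
  have FP : cr F \notin P by apply/negP => /lowP; rewrite crt.
  rewrite noA_N // in h4.
  have kE : kap ((H `\ v t) `\` F') = kap H `\ t.
    rewrite -kapD1; apply/fsetP => r; rewrite !kapE; case: (boolP (r \in M')) => //= rM.
    have h : v r \in vM by apply/imfsetP; exists r.
    by apply/idP/idP; fs.
  rewrite kE in h2 h3; split=> //; first by rewrite in_fset1U negb_or h4.
    have ab r : r \in kap H -> r = t \/ (t `<` r /\ r \in kap H `\ t).
      by move=> hr; case: (eqVneq r t) => [->|ne]; [left|right; split; [apply: h3|]; rewrite in_fsetD1 ne].
    apply/chainP => r s /ab[->|[hr hr']] /ab[->|[hs hs']].
    - by left.
    - by left; exact: fproper_sub.
    - by right; exact: fproper_sub.
    by move/chainP: h2; apply.
  move=> r hr; case: (eqVneq r t) => [->|ne].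
    by rewrite in_fset1U eqxx fproperEneq h4 crt.
  have lt : t `<` r by apply: h3; rewrite in_fsetD1 ne.
  split; last exact: fsub_proper_trans crt lt.
  by rewrite in_fset1U tmax ?orbT //; move: hr; rewrite kapE => /andP[].
have [_ crt] := h4 _ tk; move: h2; rewrite in_fset1U negb_or => /andP[h2 h2'].
have FNt : F \in Nin t by rewrite NinE h1 fproper_sub.
split; last by rewrite noA_N.
case/hasP: (gl FNt) => -[F' C'] pl /= FF'; apply/hasP; exists (F', C') => //=.
have k : kap ((H `\ v t) `\` F') `<=` kap H `\ t by rewrite -kapD1; apply: kap_mono; fs.
apply/aboveP; split; first by move: FF'; rewrite /F; fs.
  by apply: chain_sub h3; apply: fsubset_trans k _; exact: fsubD1set.
move=> r /(fsubsetP k); rewrite in_fsetD1 => /andP[ne hr].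
have [rP _] := h4 _ hr; move: rP; rewrite in_fset1U (negbTE ne) /= => /lowP nrt.
move/chainP: h3 => /(_ _ _ hr tk)[h|h]; first by rewrite h in nrt.
by rewrite fproperEneq eq_sym ne.
Qed.
End List.

Lemma stg_step : sq (stg P) (stg (t |` P)).
Proof.
have [l [h1 h2 h3]] := shelled tM; rewrite -(coneY_stg h1 h2 h3).
apply: coneY_closed_sq; [exact: stg_closed|exact: above_closed| |exact: vt_stg|exact: shok_stg].
by apply/aboveP; rewrite kapN //; split=> //; apply/chainP.
Qed.
End Step.

Lemma stg_all P : P `<=` M' -> (forall r s, r \in P -> s \in M' -> r `<=` s -> s \in P) ->
  sq (stg P) (stg M').
Proof.
have [k] := ubnP #|` M' `\` P|; elim: k P => // k IH P hk PM up.
case: (eqVneq (M' `\` P) fset0) => [/eqP|/fset0Pn[t0 ht0]].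
  rewrite fsetD_eq0 => h; have -> : P = M' by apply/eqP; rewrite eqEfsubset PM.
  exact: sq_refl.
(* Cells are treated in decreasing dimension, so that all cells above [t] are already in [P]. *)
case: (arg_maxnP (fun i : M' `\` P => #|` fsval i|) (i0 := [` ht0]) (P := predT)) => // t _ ht.
have := fsvalP t; rewrite in_fsetD => /andP[tP tM].
have tmax r : r \in M' -> fsval t `<` r -> r \in P.
  move=> rM lt; apply/negPn/negP => rP; have rD : r \in M' `\` P by rewrite in_fsetD rP.
  have h : (#|` r| <= #|` fsval t|)%N := ht [` rD] isT.
  by move: h; rewrite leqNgt => /negP; apply; exact: fproper_ltn_card.
apply: sq_trans (stg_step PM up tM tP tmax) _; apply: IH.
- move: hk; rewrite ltnS; apply: leq_trans; apply: fproper_ltn_card; rewrite fproperE; apply/andP; split.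
    by apply/fsubsetP => r; rewrite !in_fsetD in_fset1U negb_or => /andP[/andP[_ ->] ->].
  by apply/fsubsetPn; exists (fsval t); [exact: fsvalP|rewrite in_fsetD in_fset1U eqxx].
- by apply/fsubsetP => r; rewrite in_fset1U => /orP[/eqP->//|/(fsubsetP PM)].
move=> r s; rewrite !in_fset1U => /orP[/eqP->|rP] sM rs.
  by case: (eqVneq s (fsval t)) => //= ne; apply: tmax => //; rewrite fproperEneq eq_sym ne.
by rewrite (up r s) ?orbT.
Qed.

Lemma sq_derived : sq N (stg M').
Proof. by rewrite -{1}stg0; apply: stg_all => // r s; rewrite in_fset0. Qed.
End Derived.

Lemma face_code (U : face) : exists v : face -> T, injective v /\ forall F, v F \notin U.
Proof.
have [B hB] := id_bound U.
exists (fun F => (0, (B + choice.pickle (F : {fset (nat * nat)%type}))%N)); split.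
  by move=> F G [/addnI /(pcan_inj choice.pickleK)].
by move=> F; apply/negP => /hB /=; rewrite ltnNge leq_addr.
Qed.

(** The procedure is applied to [N], and to [M] as a subdivision of itself with carrier [id]. It
    ends both times in the complex of flags of [M], as [stg1] shows. *)
Lemma sq_of_shelled N M (cr : face -> face) : closed N -> closed M -> fset0 \in N ->
  (forall F, F \in N -> cr F \in M) -> (forall F G, G \in N -> F `<=` G -> cr F `<=` cr G) ->
  (forall F, F \in N -> cr F = fset0 -> F = fset0) -> cr fset0 = fset0 ->
  (forall t, t \in M -> t != fset0 -> exists l, [/\ shok (Nin N cr t) [fset fset0] l,
    forall G, G \in Nin N cr t -> gn l G & forall G, G \in Nin N cr t -> noA l G = (cr G != t)]) ->
  sq N M.
Proof.
move=> clN clM N0 crM cr_mono cr0 cr00 sh.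
have [v [vinj hv]] := face_code (vs N `|` vs M).
have dv X : vs X `<=` vs N `|` vs M -> fdisjoint (vs X) (v @` (M `\ fset0)).
  move=> s; apply/fdisjointP => z zX; apply/negP => /imfsetP[r _ ez]; have := hv r.
  by rewrite -ez => /negP; apply; fs.
have M0 : fset0 \in M by rewrite -cr00; exact: crM.
have sh' t : t \in M `\ fset0 -> exists l, [/\ shok (Nin N cr t) [fset fset0] l,
    forall G, G \in Nin N cr t -> gn l G & forall G, G \in Nin N cr t -> noA l G = (cr G != t)].
  by rewrite in_fsetD1 => /andP[t0 tM]; exact: sh.
have dN : fdisjoint (vs N) (v @` (M `\ fset0)) by apply: dv; fs.
have dM : fdisjoint (vs M) (v @` (M `\ fset0)) by apply: dv; fs.
apply: (sq_trans (sq_derived clN N0 vinj dN crM cr_mono sh')).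
have shM t : t \in M `\ fset0 -> exists l, [/\ shok (Nin M id t) [fset fset0] l,
    forall G, G \in Nin M id t -> gn l G & forall G, G \in Nin M id t -> noA l G = (id G != t)].
  (* A cell that is not subdivided is a single facet with empty restriction. *)
  rewrite in_fsetD1 => /andP[t0 tM]; exists [:: (t, fset0)]; split.
  - split; split=> //=.
    + by rewrite fsetD0.
    + by move=> G _; rewrite fsub0set.
    + by rewrite vs_fset00 fdisjointX0.
    + by move=> n; rewrite in_fset1 => /eqP ->; rewrite fsetU0 !inE tM fsubset_refl.
    by move=> H; rewrite !inE => /andP[_ h] _ _; rewrite fsetD_eq0.
  - by move=> G; rewrite !inE /= orbF => /andP[].
  by move=> G; rewrite !inE /= andbT fsetD0 => /andP[_ h]; rewrite eqEfsubset h.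
have crM' (F : face) : F \in M -> id F \in M by [].
have mono' F G : G \in M -> F `<=` G -> id F `<=` id G by [].
have c0 F : F \in M -> id F = fset0 -> F = fset0 by [].
have := sq_derived clM M0 vinj dM crM' mono' shM.
set Z := stg _ _ _ _ _; set Z' := stg _ _ _ _ _; suff -> : Z = Z' by apply: sq_sym.
apply/fsetP => H; rewrite /Z /Z' !stg1 //.
Qed.
End Derived.
Import Derived.

(** * Line shellings of regular subdivisions *)

Module RegularSubdivisions.
Import Order.TTheory GRing.Theory Num.Theory.
Local Open Scope ring_scope.
Implicit Types (K L M S X N Y : cplx) (A B C D E F G H : face) (x y z v u : T) (U V : face).

(** For all large [n]. Small perturbations are expressed, up to scale, as large multiples of the
    unperturbed point. *)
Definition ev (P : nat -> Prop) := exists n0 : nat, forall n, (n0 <= n)%N -> P n.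

Lemma ev_and (P Q : nat -> Prop) : ev P -> ev Q -> ev (fun n => P n /\ Q n).
Proof.
move=> [a ha] [b hb]; exists (maxn a b) => n; rewrite geq_max => /andP[h1 h2].
by split; [exact: ha|exact: hb].
Qed.

Lemma ev_all (I : eqType) (s : seq I) (P : I -> nat -> Prop) :
  (forall i, i \in s -> ev (P i)) -> ev (fun n => forall i, i \in s -> P i n).
Proof.
elim: s => [|i s IH] h; first by exists 0%N.
have [|n0 h1] := ev_and (h i (mem_head _ _)) (IH _); first by move=> j js; apply: h; rewrite inE js orbT.
by exists n0 => n /h1[a b] j; rewrite inE => /orP[/eqP->|/b].
Qed.

Lemma ev_ex P : ev P -> exists n, (0 < n)%N /\ P n.
Proof. by move=> [n0 h]; exists n0.+1; split=> //; exact: h. Qed.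

Lemma fchoice (I J : Type) (P : I -> J -> Prop) : (forall i, exists j, P i j) -> exists f, forall i, P i (f i).
Proof. by move=> /choice[f h]; exists f. Qed.

Section Cone2.
Variables (R : archiRealFieldType) (m : nat).
Implicit Types (p : T -> 'rV[R]_m) (c d w : T -> R) (q : 'rV[R]_m) (a : 'cV[R]_m).

Lemma ev_neg (s t : R) : s < 0 -> ev (fun n => n%:R * s + t < 0).
Proof.
move=> s0; have := archi_boundP (normr_ge0 (t / s)); set n0 := Num.bound _ => h.
exists n0 => n hn; have h2 : `|t / s| < n%:R by apply: lt_le_trans h _; rewrite ler_nat.
have h3 : - (t / s) < n%:R by apply: le_lt_trans h2; rewrite -normrN ler_norm.
have : n%:R * s < - (t / s) * s by rewrite ltr_nM2r.
by rewrite mulNr divfK ?lt_eqF //; lra.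
Qed.

Definition dot a q : R := (q *m a) 0 0.
Lemma dotD a q q' : dot a (q + q') = dot a q + dot a q'.
Proof. by rewrite /dot mulmxDl mxE. Qed.
Lemma dotZ a k q : dot a (k *: q) = k * dot a q.
Proof. by rewrite /dot -scalemxAl mxE. Qed.
Lemma dot0 a : dot a 0 = 0.
Proof. by rewrite /dot mul0mx mxE. Qed.
Lemma dotBl a a' q : dot (a - a') q = dot a q - dot a' q.
Proof. by rewrite /dot mulmxBr !mxE. Qed.
Lemma dotDl a a' q : dot (a + a') q = dot a q + dot a' q.
Proof. by rewrite /dot mulmxDr mxE. Qed.
Lemma dotZl k a q : dot (k *: a) q = k * dot a q.
Proof. by rewrite /dot -scalemxAr mxE. Qed.

Lemma dot_cmb a F c p : dot a (cmb F c p) = \sum_(x <- F) c x * dot a (p x).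
Proof.
rewrite /cmb; elim/big_rec2: _ => [|x r q _ IH]; first exact: dot0.
by rewrite dotD dotZ IH.
Qed.

(* Regularity: over each cell [t] of [M], the heights [om] of the vertices of [N] lie on the graph
   of a convex function whose domains of linearity are the faces of [N]. *)
Definition Reg N M p (om : T -> R) := forall t F, t \in M -> F \in N ->
  (forall x, x \in F -> inc t p (p x)) -> exists a, (forall x, x \in F -> dot a (p x) = om x) /\
  (forall x, x \in vs N -> inc t p (p x) -> x \notin F -> dot a (p x) < om x).

Lemma Geo_free X p F c d : Geo X p -> F \in X -> cmb F c p = cmb F d p ->
  forall x, x \in F -> c x = d x.
Proof.
(* A common shift makes both sets of coefficients nonnegative. *)
move=> g FX e x xF; pose k y := `|c y| + `|d y|.
pose c' y := if y \in F then c y + k y else 0; pose d' y := if y \in F then d y + k y else 0.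
have nn (s t : R) : 0 <= s + (`|s| + `|t|).
  by rewrite addrA addr_ge0 // -lerBlDl sub0r -normrN ler_norm.
have hc : co F c' by split=> y; rewrite /c'; case: ifP => // _; exact: nn.
have hd : co F d' by split=> y; rewrite /d'; case: ifP => // _; rewrite /k (addrC `|c y|); exact: nn.
have E : cmb F c' p = cmb F d' p.
  transitivity (cmb F (fun y => c y + k y) p); first by apply: cmb_eqc => y yF; rewrite /c' yF.
  transitivity (cmb F (fun y => d y + k y) p); last by apply: cmb_eqc => y yF; rewrite /d' yF.
  by rewrite !cmbD e.
by have := g _ _ _ _ FX FX hc hd E x; rewrite /c' /d' xF => /addIr.
Qed.

Lemma cmbB F c d p : cmb F (fun x => c x - d x) p = cmb F c p - cmb F d p.
Proof.
rewrite -[in RHS]scaleN1r -cmbZ -cmbD; apply: cmb_eqc => x _; by rewrite mulN1r.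
Qed.

Definition rs F c x := if x \in F then c x else 0 : R.

Lemma cmb_rs F G c p : F `<=` G -> cmb G (rs F c) p = cmb F c p.
Proof.
move=> s; rewrite (cmb_sub _ s); last by move=> x /negbTE; rewrite /rs => ->.
by apply: cmb_eqc => x; rewrite /rs => ->.
Qed.

Section Regular.
Variables (N M : cplx) (p : T -> 'rV[R]_m) (om : T -> R).
Hypotheses (clN : closed N) (clM : closed M) (N0 : fset0 \in N) (sub : Sub N M p) (reg : Reg N M p om).

Let gN : Geo N p. Proof. by case: sub. Qed.
Let gM : Geo M p. Proof. by case: sub. Qed.

Lemma kx_ex : exists kx : T -> T -> R, forall x, x \in vs N ->
  exists G, [/\ G \in M, co G (kx x) & p x = cmb G (kx x) p].
Proof.
apply: (fchoice (P := fun x c => x \in vs N -> exists G, [/\ G \in M, co G c & p x = cmb G c p])) => x.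
case: (pselect (x \in vs N)) => [xN|nx]; last by exists (fun _ => 0) => h.
have [_ _ h _] := sub; have /vsP[F FN xF] := xN; have [G GM hG] := h _ FN.
by have [c hc e] := hG _ xF; exists c => _; exists G.
Qed.

Variable kx : T -> T -> R.
Hypothesis hkx : forall x, x \in vs N -> exists G, [/\ G \in M, co G (kx x) & p x = cmb G (kx x) p].

Definition crx x := [fset y in vs M | kx x y != 0].
(** The carrier: the least face of [M] whose cone contains the vertices of [F] ([cr_in]). *)
Definition cr F := \bigcup_(x <- F) crx x.

Lemma crP F y : reflect (exists2 x, x \in F & y \in crx x) (y \in cr F).
Proof.
apply: (iffP (bigfcupP _ _ _ _)) => [[x /andP[xF _] h]|[x xF h]]; first by exists x.
by exists x => //; rewrite xF.
Qed.

Lemma inc_unique t x : t \in M -> x \in vs N -> inc t p (p x) -> co t (kx x).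
Proof.
move=> tM xN [c hc e]; have [G [GM hk e']] := hkx xN.
have E : c =1 kx x by apply: (gM tM GM hc hk); rewrite -e.
by case: hc => h1 h2; split=> y; [rewrite -E|move=> yt; rewrite -E h2].
Qed.

Lemma cr_in t F : t \in M -> F \in N -> (cr F `<=` t) <-> (forall x, x \in F -> inc t p (p x)).
Proof.
move=> tM FN; have hN x : x \in F -> x \in vs N by move=> xF; apply/vsP; exists F.
split=> [/fsubsetP h x xF|h].
  have [G [GM [h1 h2] e]] := hkx (hN _ xF).
  have hk y : y \notin t -> kx x y = 0.
    move=> yt; apply/eqP; rewrite -[_ == _]negbK; apply/negP => ne; case/negP: yt; apply: h; apply/crP.
    exists x => //; rewrite !inE /= ne andbT; apply/vsP; exists G => //.
    by apply: contraNT ne => yG; rewrite h2.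
  exists (kx x) => //; rewrite e; transitivity (cmb (G `|` t) (kx x) p).
    by rewrite (@cmb_sub _ _ G) //; fs.
  by rewrite (@cmb_sub _ _ t) //; fs.
apply/fsubsetP => y /crP[x xF]; rewrite !inE /= => /andP[_ ne].
have [_ h2] := inc_unique tM (hN _ xF) (h _ xF).
by apply: contraNT ne => yt; rewrite h2.
Qed.

Lemma cr_M F : F \in N -> cr F \in M.
Proof.
move=> FN; have [_ _ h _] := sub; have [G GM hG] := h _ FN.
by apply: (clM GM); apply/(cr_in GM FN).
Qed.

Lemma cr_mono F G : F `<=` G -> cr F `<=` cr G.
Proof.
by move=> /fsubsetP s; apply/fsubsetP => y /crP[x /s xG h]; apply/crP; exists x.
Qed.

Lemma cr_0 F : F \in N -> cr F = fset0 -> F = fset0.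
Proof.
move=> FN e; apply/eqP/negPn/negP => /fset0Pn[x xF].
have M0 : fset0 \in M by rewrite -e; exact: cr_M.
have /(cr_in M0 FN)/(_ x xF)[c _ px] : cr F `<=` fset0 by rewrite e.
have p0 : p x = 0 by rewrite px /cmb big_seq_fset0.
have e2 : cmb F (ind R [fset x]) p = cmb F (fun _ => 0) p.
  by rewrite cmb1 // p0 /cmb big1 // => y _; rewrite scale0r.
by have /eqP := Geo_free gN FN e2 xF; rewrite /ind inE eqxx oner_eq0.
Qed.

Lemma cr_00 : cr fset0 = fset0.
Proof. by apply/fsetP => y; rewrite in_fset0; apply/negP => /crP[x]; rewrite in_fset0. Qed.

Section Face.
Variable t : face.
Hypotheses (tM : [/\ True, t \in M & t != fset0]).
Let tM' : t \in M. Proof. by case: tM. Qed.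
Local Notation Nt := (Nin N cr t).

Lemma NtP F : F \in Nt -> F \in N /\ forall x, x \in F -> inc t p (p x).
Proof. by rewrite NinE => /andP[FN h]; split=> //; apply/(cr_in tM' FN). Qed.

Lemma Nt_closed : closed Nt.
Proof.
move=> F G; rewrite !NinE => /andP[FN h] s; rewrite (clN FN s) /=.
exact: fsubset_trans (cr_mono s) h.
Qed.

Definition itr q := exists c, [/\ co t c, forall x, x \in t -> 0 < c x & q = cmb t c p].
Definition sp F q := exists b : T -> R, q = cmb F b p.
(** For generic [q] no such face contains another ([spanning_anti]), and these faces are the facets
    of the subdivided cell that get shelled. *)
Definition spanning q := [fset F in Nt | `[< sp F q >]].

Lemma spanningP F q : reflect (F \in Nt /\ sp F q) (F \in spanning q).
Proof. by rewrite !inE; apply: (iffP andP) => -[h1 /asboolP h2]; split. Qed.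

Lemma spD F q q' k k' : sp F q -> sp F q' -> sp F (k *: q + k' *: q').
Proof.
by move=> [b ->] [b' ->]; exists (fun x => k * b x + k' * b' x); rewrite cmbD !cmbZ.
Qed.

Lemma itr_ex : exists q, itr q.
Proof.
exists (cmb t (ind R t) p), (ind R t); split=> //; last by move=> x xt; rewrite /ind xt.
by split=> x; [exact: ler0n|rewrite /ind => /negbTE ->].
Qed.

(* A point lying in the least possible number of spans of faces is generic. *)
Lemma generic : exists2 q, itr q & forall F b, F \in spanning q -> q = cmb F b p ->
  forall x, x \in F -> b x != 0.
Proof.
have : exists n, `[< exists2 q, itr q & #|` spanning q| = n >].
  by have [q h] := itr_ex; exists #|` spanning q|; apply/asboolP; exists q.
move=> ex; case: (ex_minnP ex) => n /asboolP[q hq cq] min; exists q => // F b FS e x xF.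
apply/negP => /eqP b0; have /spanningP[FNt _] := FS; have [FN Fin] := NtP FNt.
pose F' := F `\ x; have e' : q = cmb F' b p by rewrite e (cmbD1 _ _ xF) b0 scale0r add0r.
have nsp : ~ sp F' (p x).
  move=> [b' hb']; have : cmb F (ind R [fset x]) p = cmb F (rs F' b') p.
    by rewrite cmb1 // hb' cmb_rs // /F'; fs.
  move/(Geo_free gN FN)/(_ x xF)/eqP; rewrite /ind /rs /F' !inE eqxx /=.
  by rewrite oner_eq0.
(* A perturbation of [q], up to scale. A span without [q] contains at most one [qn n], so for large
   [n] no span is gained. The span of [F \ x] is lost, as it contains [q] but not [p x]; this
   contradicts minimality. *)
pose qn (n : nat) := n%:R *: q + p x.
have evG G : G \in Nt -> ev (fun n => G \notin spanning q -> ~ sp G (qn n)).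
  move=> GN; case: (pselect (exists n, sp G (qn n) /\ G \notin spanning q)) => [[k [hk nG]]|no]; last first.
    by exists 0%N => k _ nG hk; apply: no; exists k.
  exists k.+1 => j hj _ hs; case/spanningP: nG; split=> //.
  have jk : (j%:R - k%:R : R) != 0 by rewrite subr_eq0 eqr_nat gtn_eqF.
  have := spD (j%:R - k%:R)^-1 (- (j%:R - k%:R)^-1) hs hk.
  suff -> : (j%:R - k%:R)^-1 *: qn j + - (j%:R - k%:R)^-1 *: qn k = q by [].
  rewrite scaleNr -scalerBr /qn opprD addrACA subrr addr0 -scalerBl scalerA mulVf ?scale1r //.
have [k [k0 hk]] := ev_ex (ev_all evG).
have itk : itr (qn k).
  have [c [[h1 h2] h3 ec]] := hq; have [d [h4 h5] ed] := Fin _ xF.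
  exists (fun y => k%:R * c y + d y); split.
  - by apply: coD => //; apply: coZ => //; exact: ler0n.
  - by move=> y yt; rewrite ltr_pwDl ?mulr_gt0 ?ltr0n // h3.
  by rewrite cmbD cmbZ -ec -ed.
have sS : spanning (qn k) `<=` spanning q `\ F'.
  apply/fsubsetP => G /spanningP[GN hG]; rewrite in_fsetD1; apply/andP; split; last first.
    by apply/negPn/negP => nG; exact: hk nG hG.
  apply/eqP => eG; apply: nsp; rewrite eG in hG.
  have hq' : sp F' q by exists b.
  have := spD 1 (- k%:R) hG hq'.
  suff -> : 1 *: qn k + - k%:R *: q = p x by [].
  by rewrite scale1r /qn scaleNr addrAC subrr add0r.
have F'spanning : F' \in spanning q by apply/spanningP; split; [apply: (Nt_closed FNt); rewrite /F'; fs|exists b].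
have lt : (#|` spanning (qn k)| < n)%N.
  by have := fsubset_leq_card sS; rewrite -cq [#|` spanning q|](cardfsD1 F') F'spanning.
have /min : `[< exists2 q, itr q & #|` spanning q| = #|` spanning (qn k)| >] by apply/asboolP; exists (qn k).
by rewrite leqNgt lt.
Qed.

Section Generic.
Variables (q0 : 'rV[R]_m) (bb : face -> T -> R) (aa : face -> 'cV[R]_m).
Hypotheses (iq : itr q0) (gen : forall F b, F \in spanning q0 -> q0 = cmb F b p -> forall x, x \in F -> b x != 0)
  (hbb : forall F, F \in spanning q0 -> q0 = cmb F (bb F) p)
  (haa : forall F, F \in Nt -> (forall x, x \in F -> dot (aa F) (p x) = om x) /\
     (forall x, x \in vs N -> inc t p (p x) -> x \notin F -> dot (aa F) (p x) < om x)).

(** The vertices opposite to those walls of the cone over [F] that separate it from [q0]; by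
    genericity no coefficient vanishes. *)
Definition CF F := [fset x in F | bb F x < 0].
(** The height over [q0] of the hyperplane through the lifted face. A point sinking from the graph
    along the vertical line at [q0] crosses these hyperplanes in the order of the line shelling, the
    highest first. *)
Definition lF F := dot (aa F) q0.

Lemma spanning_Nt F : F \in spanning q0 -> F \in Nt. Proof. by case/spanningP. Qed.

Lemma AFP F x : F \in spanning q0 -> (x \in F `\` CF F) = (x \in F) && (0 < bb F x).
Proof.
move=> FS; rewrite !inE; case: (boolP (x \in F)) => //= xF.
by rewrite andbT -leNgt le0r (negbTE (gen FS (hbb FS) xF)).
Qed.

Lemma spanning_anti F F' : F \in spanning q0 -> F' \in spanning q0 -> F `<=` F' -> F = F'.
Proof.
move=> FS FS' s; apply/eqP; rewrite eqEfsubset s /=; apply/fsubsetP => x xF'.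
apply/negPn/negP => xF; have e : q0 = cmb F' (rs F (bb F)) p by rewrite cmb_rs // -hbb.
by have := gen FS' e xF'; rewrite /rs (negbTE xF) eqxx.
Qed.

(** By convexity the gaps [om x - dot (aa F') (p x)] are nonnegative and vanish on [F'], so the
    signs of the coefficients decide which height is larger. *)
Lemma lF_diff F F' : F \in spanning q0 -> F' \in spanning q0 ->
  lF F - lF F' = \sum_(x <- F) bb F x * (om x - dot (aa F') (p x)).
Proof.
move=> FS FS'; rewrite /lF {1}(hbb FS) {1}(hbb FS) !dot_cmb -sumrB; apply: eq_big_seq => x xF.
by rewrite -mulrBr; have [-> //] := haa (spanning_Nt FS).
Qed.

Lemma om_ge F F' x : F \in Nt -> F' \in Nt -> x \in F -> dot (aa F') (p x) <= om x.
Proof.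
move=> FN F'N xF; have [h1 h2] := haa F'N; case: (boolP (x \in F')) => xF'; first by rewrite h1.
have [FN' h3] := NtP FN; apply/ltW/h2 => //; last exact: h3.
by apply/vsP; exists F.
Qed.

Lemma om_gt F F' x : F \in Nt -> F' \in Nt -> x \in F -> x \notin F' -> dot (aa F') (p x) < om x.
Proof.
move=> FN F'N xF xF'; have [h1 h2] := haa F'N.
have [FN' h3] := NtP FN; apply/h2 => //; last exact: h3.
by apply/vsP; exists F.
Qed.

Lemma sum_pos (F : face) (f : T -> R) x0 : (forall x, x \in F -> 0 <= f x) -> x0 \in F -> 0 < f x0 ->
  0 < \sum_(x <- F) f x.
Proof.
move=> h xF h0; rewrite (big_fsetD1 x0) //=; apply: ltr_pwDl => //.
by rewrite big_seq; apply: sumr_ge0 => x; rewrite !inE => /andP[_ /h].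
Qed.

(** The gaps vanish on [G], and off [G] the coefficients of [F] are positive. *)
Lemma first_facet_lt F F' G : F \in spanning q0 -> F' \in spanning q0 -> F != F' -> G `<=` F -> G `<=` F' ->
  CF F `<=` G -> lF F' < lF F.
Proof.
move=> FS FS' ne GF GF' CG; rewrite -subr_gt0 lF_diff //.
have /fsubsetPn[x0 x0F x0F'] : ~~ (F `<=` F').
  by apply: contra ne => /(spanning_anti FS FS') ->.
have pos x : x \in F -> x \notin G -> 0 < bb F x.
  move=> xF xG; rewrite lt0r (gen FS (hbb FS) xF) /= leNgt; apply/negP => lt.
  by case/negP: xG; apply: (fsubsetP CG); rewrite !inE /= xF.
apply: (@sum_pos _ _ x0) => //; last first.
  rewrite mulr_gt0 ?subr_gt0 ?(om_gt (spanning_Nt FS) (spanning_Nt FS')) //; apply: pos => //.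
  by apply: contra x0F' => /(fsubsetP GF').
move=> x xF; case: (boolP (x \in G)) => xG.
  by have [-> ] := haa (spanning_Nt FS'); rewrite ?subrr ?mulr0 // (fsubsetP GF').
by rewrite mulr_ge0 ?subr_ge0 ?(om_ge (spanning_Nt FS) (spanning_Nt FS')) // ltW // pos.
Qed.

Lemma last_facet_lt F F' G : F \in spanning q0 -> F' \in spanning q0 -> F != F' -> G `<=` F -> G `<=` F' ->
  F `\` CF F `<=` G -> lF F < lF F'.
Proof.
move=> FS FS' ne GF GF' AG; rewrite -subr_gt0 -opprB lF_diff // -sumrN.
have /fsubsetPn[x0 x0F x0F'] : ~~ (F `<=` F').
  by apply: contra ne => /(spanning_anti FS FS') ->.
have neg x : x \in F -> x \notin G -> 0 < - bb F x.
  move=> xF xG; rewrite oppr_gt0 lt_def eq_sym (gen FS (hbb FS) xF) /= leNgt; apply/negP => lt.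
  by case/negP: xG; apply: (fsubsetP AG); rewrite AFP // xF.
apply: (@sum_pos _ _ x0) => //; last first.
  rewrite -mulNr mulr_gt0 ?subr_gt0 ?(om_gt (spanning_Nt FS) (spanning_Nt FS')) //; apply: neg => //.
  by apply: contra x0F' => /(fsubsetP GF').
move=> x xF; rewrite -mulNr; case: (boolP (x \in G)) => xG.
  by have [-> ] := haa (spanning_Nt FS'); rewrite ?subrr ?mulr0 // (fsubsetP GF').
by rewrite mulr_ge0 ?subr_ge0 ?(om_ge (spanning_Nt FS) (spanning_Nt FS')) // ltW // neg.
Qed.

(* Moving from the barycentre of [G] in the direction [r] one enters a face containing [G]. *)
Lemma reach G r : G \in Nt -> ev (fun n => inc t p (n%:R *: cmb G (ind R G) p + r)) ->
  exists F, F \in Nt /\ G `<=` F /\ exists (n : nat) c, co F c /\ r = cmb F (fun x => c x - n%:R * ind R G x) p.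
Proof.
move=> GN he; set q := cmb G (ind R G) p in he *.
have evF F : F \in Nt -> ev (fun n => ~~ (G `<=` F) -> ~ inc F p (n%:R *: q + r)).
  move=> FN; case: (boolP (G `<=` F)) => [_|/fsubsetPn[x0 x0G x0F]]; first by exists 0%N.
  pose h := aa F - aa G.
  have hF x : x \in F -> 0 <= dot h (p x).
    by move=> xF; rewrite dotBl; have [-> //] := haa FN; rewrite subr_ge0 (om_ge FN GN).
  have hq : dot h q < 0.
    rewrite dot_cmb -oppr_gt0 -sumrN; apply: (@sum_pos _ _ x0) => //.
      move=> x xG; rewrite /ind xG mul1r dotBl opprB.
      by have [-> //] := haa GN; rewrite subr_ge0 (om_ge GN FN).
    by rewrite /ind x0G mul1r dotBl opprB; have [-> //] := haa GN; rewrite subr_gt0 (om_gt GN FN).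
  have [n0 hn0] := ev_neg (dot h r) hq; exists n0 => n /hn0 lt _ [c [h1 h2] e].
  have : 0 <= dot h (n%:R *: q + r).
    by rewrite e dot_cmb big_seq; apply: sumr_ge0 => x xF; rewrite mulr_ge0 ?hF.
  by rewrite dotD dotZ leNgt lt.
have [n [n0 [h1 h2]]] := ev_ex (ev_and he (ev_all evF)).
have [_ _ fine cover] := sub; have [F FN [c hc ec]] := cover _ _ tM' h1.
pose F0 := [fset x in F | 0 < c x].
have F0F : F0 `<=` F by apply/fsubsetP => x; rewrite !inE => /andP[].
have [c0 c1] := hc.
have hc0 : co F0 c.
  split=> // x; rewrite !inE negb_and -leNgt => /orP[/c1//|le].
  by apply/eqP; rewrite eq_le le c0.
have ec0 : n%:R *: q + r = cmb F0 c p by rewrite ec (cmb_sub _ F0F) //; case: hc0.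
have F0N : F0 \in N by apply: (clN FN).
have F0t : F0 \in Nt.
  rewrite NinE F0N /=; apply/(cr_in tM' F0N) => x xF0; have [G' G'M hG'] := fine _ F0N.
  rewrite ec0 in h1; apply: (inc_ext gM G'M tM' hc0 hG' h1 xF0).
  by move: xF0; rewrite !inE => /andP[].
have GF0 : G `<=` F0 by apply/negPn/negP => nG; apply: (h2 _ F0t nG); exists c.
exists F0; split=> //; split=> //; exists n, c; split=> //.
have indE : ind R G =1 rs G (ind R G) by move=> y; rewrite /rs /ind; case: ifP => // ->.
rewrite cmbB -ec0 cmbZ (cmb_eqc (d := rs G (ind R G))); last by move=> *; rewrite -indE.
by rewrite cmb_rs // addrAC subrr add0r.
Qed.

(** The face is the one entered from the barycentre of [G] in the direction of [q0]. *)
Lemma first_ex G : G \in Nt -> exists F, [/\ F \in spanning q0, G `<=` F & CF F `<=` G].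
Proof.
move=> GN; have [GN' hG] := NtP GN; have [c0 [hc0 hp e0]] := iq.
have he : ev (fun n => inc t p (n%:R *: cmb G (ind R G) p + q0)).
  exists 0%N => n _; apply: incD; last by exists c0.
  apply: incZ; first exact: ler0n.
  apply: inc_cmb hG; split=> x; [exact: ler0n|by rewrite /ind => /negbTE ->].
have [F [FN [GF [n [c [[h1 h2] e]]]]]] := reach GN he.
have FS : F \in spanning q0 by apply/spanningP; split=> //; eexists; exact: e.
exists F; split=> //; apply/fsubsetP => x; rewrite !inE /= => /andP[xF lt].
apply/negPn/negP => xG; have [FN' _] := NtP FN.
rewrite (hbb FS) in e; have := Geo_free gN FN' e xF; rewrite /ind (negbTE xG) mulr0 subr0 => ex.
by move: lt; rewrite ex ltNge h1.
Qed.

(** The face is the one entered in the direction away from [q0]; this direction stays in the cell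
    because [G] is interior to [t]. *)
Lemma last_ex G : G \in Nt -> cr G = t -> exists F, [/\ F \in spanning q0, G `<=` F & F `\` CF F `<=` G].
Proof.
move=> GN ct; have [GN' hG] := NtP GN; have [c0 [hc0 hp e0]] := iq.
have iG : co G (ind R G) by split=> x; [exact: ler0n|rewrite /ind => /negbTE ->].
have [e he1 he2] : inc t p (cmb G (ind R G) p) by apply: inc_cmb hG.
have epos y : y \in t -> 0 < e y.
  move=> yt; have [h1 h2] := he1; rewrite lt0r h1 andbT; apply/eqP => ey.
  have tyM : t `\ y \in M by apply: (clM tM'); fs.
  have : cr G `<=` t `\ y.
    apply/(cr_in tyM GN') => x xG; apply: (inc_ext gM tM' tyM iG hG _ xG); last by rewrite /ind xG.
    exists e; last by rewrite he2 (cmbD1 _ _ yt) ey scale0r add0r.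
    by split=> // z; rewrite !inE negb_and negbK => /orP[/eqP->|/h2].
  by rewrite ct => h; have := yt; move: h; fs.
have he : ev (fun n => inc t p (n%:R *: cmb G (ind R G) p + - q0)).
  have : ev (fun n => forall y, y \in t -> n%:R * - e y + c0 y < 0).
    by apply: ev_all => y yt; apply: ev_neg; rewrite oppr_lt0; exact: epos.
  move=> [n0 h]; exists n0 => n /h {}h; exists (fun y => n%:R * e y - c0 y).
    have [h1 h2] := he1; have [h3 h4] := hc0; split=> y.
      case: (boolP (y \in t)) => yt; last by rewrite h2 // h4 // mulr0 subrr.
      by have := h _ yt; rewrite mulrN; lra.
    by move=> yt; rewrite h2 // h4 // mulr0 subrr.
  by rewrite cmbB cmbZ -he2 -e0.
have [F [FN [GF [n [c [[h1 h2] e']]]]]] := reach GN he.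
have eq0 : q0 = cmb F (fun x => -1 * (c x - n%:R * ind R G x)) p by rewrite cmbZ -e' scaleN1r opprK.
have FS : F \in spanning q0 by apply/spanningP; split=> //; eexists; exact: eq0.
exists F; split=> //; apply/fsubsetP => x; rewrite AFP // => /andP[xF lt].
apply/negPn/negP => xG; have [FN' _] := NtP FN.
rewrite (hbb FS) in eq0; have := Geo_free gN FN' eq0 xF; rewrite /ind (negbTE xG) mulr0 subr0 mulN1r => ex.
by move: lt; rewrite ex oppr_gt0 ltNge h1.
Qed.

(** A large multiple of the barycentre of [G], minus [q0], lies in the cone over [F], because the
    coefficients of [q0] off [G] are negative. So the multiple is [q0] plus a point of the cell, and
    is interior because [q0] is. *)
Lemma interior G F : F \in spanning q0 -> G `<=` F -> F `\` CF F `<=` G -> cr G = t.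
Proof.
move=> FS GF AG; have [FN hF] := NtP (spanning_Nt FS); have GN : G \in N by apply: (clN FN).
have GNt : G \in Nt by exact: Nt_closed (spanning_Nt FS) GF.
apply/eqP; move: (GNt); rewrite NinE GN eqEfsubset => /= -> /=; apply/fsubsetP => y yt.
apply/negPn/negP => ny; set s := cr G in ny.
have sM : s \in M by exact: cr_M.
have hs : forall x, x \in G -> inc s p (p x) by apply/(cr_in sM GN).
have iG : co G (ind R G) by split=> x; [exact: ler0n|rewrite /ind => /negbTE ->].
have [e he1 he2] : inc s p (cmb G (ind R G) p) by apply: inc_cmb hs.
have [c0 [hc0 hp e0]] := iq.
have [n [_ hn]] : exists n, (0 < n)%N /\ forall x, x \in F -> n%:R * (-1) + bb F x < 0.
  by apply: ev_ex; apply: ev_all => x _; apply: ev_neg; rewrite oppr_lt0.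
pose c x := if x \in F then n%:R * ind R G x - bb F x else 0.
have hc : co F c.
  split=> x; rewrite /c; last by move/negbTE => ->.
  case: ifP => // xF; rewrite /ind; case: (boolP (x \in G)) => xG.
    by have := hn _ xF; rewrite mulrN1 mulr1; lra.
  rewrite mulr0 sub0r oppr_ge0 leNgt; apply: contra xG => lt.
  by apply: (fsubsetP AG); rewrite AFP // xF.
have [f hf1 hf2] : inc t p (cmb F c p) by apply: inc_cmb hF.
have E : cmb F c p = n%:R *: cmb G (ind R G) p - q0.
  rewrite (cmb_eqc (d := fun x => n%:R * ind R G x - bb F x)); last by move=> x; rewrite /c => ->.
  rewrite cmbB cmbZ -hbb //; congr (_ *: _ - _).
  have indE : ind R G =1 rs G (ind R G) by move=> z; rewrite /rs /ind; case: ifP => // ->.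
  by rewrite (cmb_eqc (d := rs G (ind R G))) ?cmb_rs // => *; rewrite -indE.
have E2 : cmb t (fun x => f x + c0 x) p = cmb s (fun x => n%:R * e x) p.
  by rewrite cmbD cmbZ -hf2 -e0 E -he2 subrK.
have := gM tM' sM (coD hf1 hc0) (coZ (ler0n R n) he1) E2 y.
have [_ ->] := he1 => //; rewrite mulr0 => /eqP; rewrite gt_eqF // ltr_wpDl ?hp //.
by case: hf1.
Qed.

Lemma shok_geo : exists l, [/\ shok Nt [fset fset0] l,
  forall G, G \in Nt -> gn l G & forall G, G \in Nt -> noA l G = (cr G != t)].
Proof.
(* Smallest height in front, since lists begin with the latest facet. *)
pose le F F' := lF F <= lF F'; pose s := sort le (spanning q0).
have sS F : (F \in s) = (F \in spanning q0) by rewrite mem_sort.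
have sU : uniq s by rewrite sort_uniq fset_uniq.
have tr : transitive le by move=> a b c; exact: le_trans.
have sO : pairwise le s.
  rewrite -(sorted_pairwise tr); apply: sort_sorted => F F'; exact: le_total.
pose l := [seq (F, CF F) | F <- s]; exists l; split.
- rewrite /l; have : {subset s <= spanning q0} by move=> F; rewrite sS.
  (* For the induction on the list: a spanning face is in the current tail, or comes later in the
     shelling than all of that tail. *)
  have pre : forall F, F \in spanning q0 -> F \in s \/ (forall F', F' \in s -> F != F' /\ lF F <= lF F').
    by move=> F FS; left; rewrite sS.
  elim: s sU sO pre {sS l} => //= F s IH /andP[Fs us] /andP[/allP ao po] pre sub'.
  have FS : F \in spanning q0 by apply: sub'; rewrite mem_head.
  have sS' : {subset s <= spanning q0} by move=> F' h; apply: sub'; rewrite inE h orbT.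
  have later F' : F' \in s -> lF F <= lF F' by move=> /ao.
  have mems F' : F' \in spanning q0 -> lF F < lF F' -> F' \in s.
    move=> F'spanning lt; case: (pre _ F'spanning) => [|h]; last first.
      by have [_] := h F (mem_head _ _); rewrite leNgt lt.
    by rewrite inE => /orP[/eqP e|//]; rewrite e ltxx in lt.
  have gnP G : reflect (exists2 F', F' \in s & G `<=` F') (gn [seq (F, CF F) | F <- s] G).
    rewrite /gn has_map; apply: (iffP hasP) => -[F' h1 h2]; by exists F'.
  have noP G : reflect (forall F', F' \in s -> ~~ (F' `\` CF F' `<=` G)) (noA [seq (F, CF F) | F <- s] G).
    rewrite /noA all_map; exact: (iffP allP).
  have CFF : CF F `<=` F by apply/fsubsetP => x; rewrite !inE => /andP[].
  have neF F' : F' \in s -> F != F' by move=> h; apply: contraNneq Fs => ->.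
  have AF0 : F `\` CF F != fset0.
    apply/eqP => e; have : cr fset0 = t by apply: (interior FS); rewrite ?e ?fsub0set.
    by rewrite cr_00 => e'; case: tM => _ _; rewrite -e' eqxx.
  split; split=> //.
  + move=> G GF; have GN : G \in Nt by exact: Nt_closed (spanning_Nt FS) GF.
    apply/gnP/idP => [[F' F's GF']|nC].
      apply/negP => CG; have := first_facet_lt FS (sS' _ F's) (neF _ F's) GF GF' CG.
      by rewrite ltNge later.
    have [F0 [F0S GF0 CG0]] := first_ex GN; exists F0 => //.
    have ne : F0 != F by apply: contra nC => /eqP <-.
    by apply: mems => //; exact: first_facet_lt ne GF0 GF CG0.
  + apply/noP => F' F's; apply/negP => AF; have ne : F' != F by rewrite eq_sym neF.
    have AF' : F' `\` CF F' `<=` F' by fs.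
    have := last_facet_lt (sS' _ F's) FS ne AF' AF (fsubset_refl _).
    by rewrite ltNge later.
  + by rewrite vs_fset00 fdisjointX0.
  + by move=> n; rewrite in_fset1 => /eqP ->; rewrite fsetU0; exact: spanning_Nt.
  + move=> G GN AG /noP no; rewrite in_fset1 fsetD_eq0.
    have AF' : F `\` CF F `<=` F by fs.
    have cA : cr (F `\` CF F) = t by exact: (interior FS).
    have cG : cr G = t.
      apply/eqP; rewrite eqEfsubset -{2}cA cr_mono // andbT.
      by move: GN; rewrite NinE => /andP[].
    have [F0 [F0S GF0 AG0]] := last_ex GN cG.
    case: (eqVneq F F0) => [->//|ne].
    have AF0' : F `\` CF F `<=` F0 by apply: fsubset_trans GF0.
    have := last_facet_lt FS F0S ne AF' AF0' (fsubset_refl _) => /(mems _ F0S)/no.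
    by rewrite AG0.
  apply: IH => // F' F'spanning; case: (pre _ F'spanning) => [|h].
    rewrite inE => /orP[/eqP->|]; last by left.
    by right=> F2 h2; split; [exact: neF|exact: later].
  by right=> F2 h2; apply: h; rewrite inE h2 orbT.
- move=> G /first_ex[F [FS GF _]]; apply/hasP; exists (F, CF F) => //.
  by apply/mapP; exists F; rewrite ?sS.
move=> G GN; apply/allP/idP => [h|ne [F C] /mapP[F' F's [-> ->]] /=].
  apply/eqP => cG; have [F [FS GF AG]] := last_ex GN cG.
  have /h : (F, CF F) \in l by apply/mapP; exists F; rewrite ?sS.
  by rewrite /= AG.
rewrite sS in F's; apply: contra ne => AG; have AF : F' `\` CF F' `<=` F' by fs.
have cA := interior F's AF (fsubset_refl _).
by rewrite eqEfsubset -{2}cA cr_mono // andbT; move: GN; rewrite NinE => /andP[].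
Qed.
End Generic.

Lemma shok_face : exists l, [/\ shok Nt [fset fset0] l,
  forall G, G \in Nt -> gn l G & forall G, G \in Nt -> noA l G = (cr G != t)].
Proof.
have [q iq gen] := generic.
have [bb hbb] : exists bb : face -> T -> R, forall F, F \in spanning q -> q = cmb F (bb F) p.
  apply: (fchoice (P := fun F b => F \in spanning q -> q = cmb F b p)) => F.
  by case: (spanningP F q) => [[_ [b e]]|n]; [exists b|exists (fun _ => 0)].
have [aa haa] : exists aa : face -> 'cV[R]_m, forall F, F \in Nt ->
   (forall x, x \in F -> dot (aa F) (p x) = om x) /\
     (forall x, x \in vs N -> inc t p (p x) -> x \notin F -> dot (aa F) (p x) < om x).
  apply: (fchoice (P := fun F a => F \in Nt -> (forall x, x \in F -> dot a (p x) = om x) /\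
     (forall x, x \in vs N -> inc t p (p x) -> x \notin F -> dot a (p x) < om x))) => F.
  case: (boolP (F \in Nt)) => [h|]; last by exists 0.
  by have [FN hF] := NtP h; have [a ha] := reg tM' FN hF; exists a.
exact: shok_geo gen hbb haa.
Qed.
End Face.

Lemma sq_regular_ : sq N M.
Proof.
apply: (@sq_of_shelled N M cr) => //; [exact: cr_M|by move=> F G _; exact: cr_mono|exact: cr_0|exact: cr_00|].
by move=> t tM t0; exact: shok_face.
Qed.
End Regular.

Theorem sq_regular N M p om : closed N -> closed M -> fset0 \in N -> Sub N M p -> Reg N M p om -> sq N M.
Proof.
move=> clN clM N0 sub reg; have [kx hkx] := kx_ex sub.
exact: (sq_regular_ clN clM N0 sub reg hkx).
Qed.
End Cone2.
End RegularSubdivisions.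
Import RegularSubdivisions.

(** * Cutting by hyperplanes *)

Module Cuts.
Import Order.TTheory GRing.Theory Num.Theory.
Local Open Scope ring_scope.
Implicit Types (K L M S X N Y : cplx) (A B C D E F G H : face) (x y z v u : T) (U V : face).

Section Cut.
Variables (R : archiRealFieldType) (m : nat).
Implicit Types (p : T -> 'rV[R]_m) (c d w om : T -> R) (q : 'rV[R]_m) (a : 'cV[R]_m).

Lemma ev_inv (s : R) : 0 < s -> ev (fun n => n%:R^-1 < s).
Proof.
move=> s0; have ms : - s < 0 by rewrite oppr_lt0.
have [n0 h] := ev_neg 1 ms; exists n0.+1 => n hn; have n0' : (0 : R) < n%:R by rewrite ltr0n (leq_trans _ hn).
have := h n (ltnW hn); rewrite mulrN => lt; rewrite -[_^-1]mul1r ltr_pdivrMr //.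
by lra.
Qed.

Lemma inc_star t A w p X M : Geo M p -> t \in M -> A \in X -> (forall y, y \in A -> 0 < w y) ->
  (exists2 G, G \in M & forall y, y \in A -> inc G p (p y)) ->
  inc t p (cmb A w p) -> forall y, y \in A -> inc t p (p y).
Proof.
move=> gM tM AX wA [G GM hG] h y yA.
have hw : co A (rs A w).
  by split=> z; rewrite /rs; [case: ifP => // /wA/ltW|move/negbTE ->].
have e : cmb A w p = cmb A (rs A w) p by rewrite cmb_rs.
rewrite e in h; apply: (inc_ext gM GM tM hw hG h yA); by rewrite /rs yA wA.
Qed.

(** The new vertex gets a height slightly below the one interpolated over [A]. At [x] the functional
    of a face not over [A] is below the interpolated value by the gap [s]; there are finitely many
    gaps, so a small push respects them all. *)
Lemma Reg_star X M A x w p om : [/\ closed X, A \in X & A != fset0] -> x \notin vs X ->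
  (forall y, y \in A -> 0 < w y) -> p x = cmb A w p -> Sub X M p -> Reg X M p om ->
  exists om', Reg (mv A [fset x] X) M p om'.
Proof.
move=> hA xX wA px sub reg; have [cl AX A0] := hA; have [gX gM fine _] := sub.
have xA : x \notin A by have := sub_vs AX; fs.
pose inn t F := forall y, y \in F -> inc t p (p y).
have [aa haa] : exists aa : face * face -> 'cV[R]_m, forall tF, tF.1 \in M -> tF.2 \in X -> inn tF.1 tF.2 ->
    (forall y, y \in tF.2 -> dot (aa tF) (p y) = om y) /\
    (forall y, y \in vs X -> inc tF.1 p (p y) -> y \notin tF.2 -> dot (aa tF) (p y) < om y).
  apply: (fchoice (P := fun tF a => tF.1 \in M -> tF.2 \in X -> inn tF.1 tF.2 ->
    (forall y, y \in tF.2 -> dot a (p y) = om y) /\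
    (forall y, y \in vs X -> inc tF.1 p (p y) -> y \notin tF.2 -> dot a (p y) < om y))) => -[t F] /=.
  case: (pselect [/\ t \in M, F \in X & inn t F]) => [[h1 h2 h3]|no].
    by have [a ha] := reg t F h1 h2 h3; exists a.
  by exists 0 => h1 h2 h3; case: no.
pose wom : R := \sum_(y <- A) w y * om y.
pose s t F := \sum_(y <- A) w y * (om y - dot (aa (t, F)) (p y)).
have AvX y : y \in A -> y \in vs X by move=> yA; apply/vsP; exists A.
have sE t F : dot (aa (t, F)) (p x) = wom - s t F.
  rewrite px dot_cmb /wom /s -sumrB; apply: eq_bigr => y _; ring.
have s0 t F : t \in M -> F \in X -> inn t F -> inn t A -> ~~ (A `<=` F) -> 0 < s t F.
  move=> tM FX h1 h2 /fsubsetPn[y0 yA yF]; have [/= e1 e2] := haa (t, F) tM FX h1.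
  apply: (@sum_pos _ _ _ y0) => //.
    move=> y y'A; case: (boolP (y \in F)) => y'F; first by rewrite e1 // subrr mulr0.
    by rewrite mulr_ge0 ?ltW ?wA // subr_gt0 e2 ?AvX //; exact: h2.
  by rewrite mulr_gt0 ?wA // subr_gt0 e2 ?AvX //; exact: h2.
have [n [n0 hn]] : exists n, (0 < n)%N /\ forall t, t \in M -> forall F, F \in X ->
    inn t F -> inn t A -> ~~ (A `<=` F) -> n%:R^-1 < s t F.
  apply: ev_ex; apply: ev_all => t tM; apply: ev_all => F FX.
  case: (pselect [/\ inn t F, inn t A & ~~ (A `<=` F)]) => [[h1 h2 h3]|no]; last first.
    by exists 0%N => n _ h1 h2 h3; case: no.
  by have [n0 h] := ev_inv (s0 _ _ tM FX h1 h2 h3); exists n0 => n /h.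
pose e : R := n%:R^-1; have e0 : 0 < e by rewrite invr_gt0 ltr0n.
exists (fun y => if y == x then wom - e else om y) => t H tM HX' hH.
have [nA HX] : ~~ (A `<=` H) /\ carF A x H \in X by apply/andP; rewrite -mv_car.
have innA : inc t p (p x) -> inn t A.
  by rewrite px => h y yA; exact: (inc_star gM tM AX wA (fine _ AX) h yA).
have vX' y : y \in vs (mv A [fset x] X) -> y != x -> y \in vs X.
  by move=> h yx; have := fsubsetP (vs_mv A [fset x] X) y h; rewrite !inE (negbTE yx) orbF.
move: HX; rewrite /carF; case: ifP => xH HX; last first.
  have [/= e1 e2] := haa (t, H) tM HX hH; exists (aa (t, H)); split=> [y yH|y yX' yt yH].
    by rewrite e1 //; case: eqP => // ey; rewrite -ey yH in xH.
  case: (eqVneq y x) => [ey|yx]; last by apply: e2 => //; exact: vX'.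
  rewrite ey sE ltrD2l ltrN2; apply: hn => //; apply: innA; by rewrite -ey.
have hA' : inn t A by apply: innA; exact: hH.
pose H0 := H `\ x; pose F := A `|` H0.
have H0X : H0 \in X by apply: (cl _ _ HX); rewrite /H0; fs.
have hH0 : inn t H0 by move=> y; rewrite !inE => /andP[_]; exact: hH.
have hF : inn t F by move=> y; rewrite in_fsetU => /orP[/hA'//|/hH0].
have nA0 : ~~ (A `<=` H0) by apply: contra nA; rewrite /H0; fs.
have es := hn _ tM _ H0X hH0 hA' nA0; have sp := s0 _ _ tM H0X hH0 hA' nA0.
pose k := e / s t H0; have k0 : 0 < k by rewrite divr_gt0.
have k1 : k < 1 by rewrite ltr_pdivrMr // mul1r.
have ks : k * s t H0 = e by rewrite /k divfK // gt_eqF.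
have [/= e1 e2] := haa (t, F) tM HX hF; have [/= e3 e4] := haa (t, H0) tM H0X hH0.
(* The new vertex is pushed down by [e]; interpolating between the two old functionals hits it. *)
exists ((1 - k) *: aa (t, F) + k *: aa (t, H0)); split=> [y yH|y yX' yt yH]; rewrite dotDl !dotZl.
  case: (eqVneq y x) => [->|yx].
    have -> : dot (aa (t, F)) (p x) = wom.
      rewrite px dot_cmb; apply: eq_big_seq => z zA; rewrite e1 // in_fsetU; apply/orP; left; exact: zA.
    by rewrite sE -ks; ring.
  have yH0 : y \in H0 by rewrite !inE yx.
  by rewrite e1 ?e3 //; [ring|rewrite inE yH0 orbT].
have yx : y != x by apply: contraNneq yH => ->.
rewrite (negbTE yx); have yX := vX' _ yX' yx.
have yH0 : y \notin H0 by rewrite !inE (negbTE yH) andbF.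
have le1 : dot (aa (t, F)) (p y) <= om y.
  by case: (boolP (y \in F)) => yF; [rewrite e1|apply/ltW/e2].
have lt2 := e4 _ yX yt yH0.
have : (1 - k) * dot (aa (t, F)) (p y) <= (1 - k) * om y by rewrite ler_wpM2l // subr_ge0 ltW.
have : k * dot (aa (t, H0)) (p y) < k * om y by rewrite ltr_pM2l.
by lra.
Qed.

Definition setp p x q y := if y == x then q else p y.

Definition csign a X p := forall F, F \in X ->
  (forall y, y \in F -> 0 <= dot a (p y)) \/ (forall y, y \in F -> dot a (p y) <= 0).

Definition badF a p F := [&& #|` F| == 2, has (fun y => 0 < dot a (p y)) F &
  has (fun y => dot a (p y) < 0) F].

Section CutLemma.
Variables (P : cplx -> (T -> 'rV[R]_m) -> Prop) (U0 : face).
Hypotheses (Pcl : forall X p, P X p -> closed X)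
  (Pst : forall X p u v x (k1 k2 : R), P X p -> [fset u; v] \in X -> u != v -> x \notin vs X `|` U0 ->
     0 < k1 -> 0 < k2 ->
     P (mv [fset u; v] [fset x] X) (setp p x (k1 *: p u + k2 *: p v))).

Lemma csign_star a X p u v x (k1 k2 : R) : csign a X p -> [fset u; v] \in X -> x \notin vs X ->
  0 < k1 -> 0 < k2 -> csign a (mv [fset u; v] [fset x] X) (setp p x (k1 *: p u + k2 *: p v)).
Proof.
move=> h uv xX k1p k2p G; rewrite mv_car; last by have := sub_vs uv; fs.
rewrite /carF => /andP[_]; have uvx : u != x /\ v != x.
  have := sub_vs uv => s; split; apply: contraNneq xX => <-; fs.
have off y : y != x -> setp p x (k1 *: p u + k2 *: p v) y = p y by rewrite /setp => /negbTE ->.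
have onx : setp p x (k1 *: p u + k2 *: p v) x = k1 *: p u + k2 *: p v by rewrite /setp eqxx.
case: ifP => xG /h; last first.
  by case=> hG; [left|right] => y yG; rewrite off ?hG //; apply: contraFneq xG => <-.
case=> hG; [left|right] => y yG; case: (eqVneq y x) => [->|yx].
- by rewrite onx dotD !dotZ addr_ge0 // mulr_ge0 ?(ltW k1p) ?(ltW k2p) // hG // !inE eqxx ?orbT.
- by rewrite off // hG // !inE yx yG orbT.
- rewrite onx dotD !dotZ -oppr_ge0 opprD -!mulrN addr_ge0 // mulr_ge0 ?(ltW k1p) ?(ltW k2p) //;
  by rewrite oppr_ge0 hG // !inE eqxx ?orbT.
by rewrite off // hG // !inE yx yG orbT.
Qed.

(** Induction on the number of edges crossing the hyperplane: the starred edge is gone, and no edge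
    at the new vertex crosses, as this vertex lies on the hyperplane. Being a positive combination,
    it keeps the signs arranged for [s]. *)
Lemma cut1 a (s : seq 'cV[R]_m) X p : P X p -> (forall b, b \in s -> csign b X p) ->
  exists X' p', [/\ P X' p', forall b, b \in s -> csign b X' p' & csign a X' p'].
Proof.
have [k] := ubnP #|` [fset F in X | badF a p F]|; elim: k X p => // k IH X p hk hP hs.
set Bd := [fset F in X | badF a p F] in hk; have cl := Pcl hP.
case: (eqVneq Bd fset0) => [e|/fset0Pn[F]].
  exists X, p; split=> // F FX.
  case: (boolP (has (fun y => 0 < dot a (p y)) F)) => [/hasP[u uF u0]|/hasPn h]; last first.
    by right=> y /h; rewrite -leNgt.
  left=> v vF; rewrite leNgt; apply/negP => v0.
  have {}uF : u \in F := uF.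
  have ne : u != v by apply/eqP => e'; move: u0; rewrite e' ltNge ltW.
  have : [fset u; v] \in Bd.
    rewrite !inE /= (cl _ _ FX) /=; last by fs.
    by rewrite /badF cardfs2 ne /=; apply/andP; split; apply/hasP; [exists u|exists v]; rewrite // !inE eqxx ?orbT.
  by rewrite e in_fset0.
rewrite !inE /= => /andP[FX /and3P[c2 /hasP[u uF u0] /hasP[v vF v0]]].
have {}uF : u \in F := uF; have {}vF : v \in F := vF.
have ne : u != v by apply/eqP => e'; move: u0; rewrite e' ltNge ltW.
have eF : F = [fset u; v].
  by apply/esym/eqP; rewrite eqEfcard (eqP c2) cardfs2 ne andbT; fs.
have [x hx] := fresh_vertex (vs X `|` U0).
have xX : x \notin vs X by fs.
(* With these weights the functional vanishes at the new vertex. *)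
pose k1 := - dot a (p v); pose k2 := dot a (p u).
have k1p : 0 < k1 by rewrite oppr_gt0.
pose p' := setp p x (k1 *: p u + k2 *: p v).
have uvX : [fset u; v] \in X by rewrite -eF.
apply: (IH (mv [fset u; v] [fset x] X) p').
- rewrite ltnS in hk; apply: leq_trans hk; rewrite (cardfsD1 [fset u; v] Bd).
  have -> : [fset u; v] \in Bd.
    rewrite !inE /= uvX /badF cardfs2 ne /=.
    by apply/andP; split; apply/hasP; [exists u|exists v]; rewrite // !inE eqxx ?orbT.
  rewrite add1n ltnS; apply: fsubset_leq_card; apply/fsubsetP => G; rewrite !inE /= => /andP[GX /and3P[cG hp hn]].
  have dx : dot a (p' x) = 0 by rewrite /p' /setp eqxx dotD !dotZ /k1 /k2; ring.
  have xG : x \notin G.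
    apply/negP => xG; case/hasP: hp => y yG; case/hasP: hn => z zG z0 y0.
    have {}yG : y \in G := yG; have {}zG : z \in G := zG.
    have yx : y != x by apply/eqP => e; move: y0; rewrite e dx ltxx.
    have zx : z != x by apply/eqP => e; move: z0; rewrite e dx ltxx.
    have yz : y != z by apply/eqP => e; move: y0; rewrite e ltNge ltW.
    have : (#|` [fset x; y; z]| <= #|` G|)%N by apply: fsubset_leq_card; fs.
    by rewrite fsetUC cardfsU1 !inE negb_or zx [z == y]eq_sym yz /= cardfs2 eq_sym yx (eqP cG).
  move: GX; rewrite mvE => /andP[nA /orP[GX|/andP[h _]]]; last by move: h; rewrite fsub1set (negbTE xG).
  have off y : y \in G -> p' y = p y.
    by move=> yG; rewrite /p' /setp ifF //; apply: contraNF xG => /eqP <-.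
  rewrite GX /badF cG /=; apply/and3P; split.
  + by apply: contra nA => /eqP ->; fs.
  + by case/hasP: hp => y yG h; apply/hasP; exists y; rewrite // -off.
  by case/hasP: hn => y yG h; apply/hasP; exists y; rewrite // -off.
- exact: Pst.
by move=> b bs; apply: csign_star => //; exact: hs.
Qed.

Lemma cut (s : seq 'cV[R]_m) X p : P X p ->
  exists X' p', P X' p' /\ forall b, b \in s -> csign b X' p'.
Proof.
move=> hP; elim: s => [|a s [X' [p' [h1 h2]]]]; first by exists X, p.
have [X2 [p2 [h3 h4 h5]]] := cut1 a h1 h2; exists X2, p2; split=> // b.
by rewrite inE => /orP[/eqP->|/h4].
Qed.
End CutLemma.

Lemma dot_col (k : nat) (C : 'M[R]_(m, k)) j q : dot (matrix.col j C) q = (q *m C) 0 j.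
Proof. by rewrite /dot !mxE; apply: eq_bigr => i _; rewrite mxE. Qed.

(** A simplicial cone is cut out by its coordinate functionals, columns of [pinvmx B], and by the
    equations of its span, columns of [cokermx B] with both signs. *)
Lemma cone_functionals X p F : Geo X p -> F \in X -> exists s : seq 'cV[R]_m,
  forall q, inc F p q <-> forall a, a \in s -> 0 <= dot a q.
Proof.
move=> g FX; set k := #|` F|; pose e (i : 'I_k) : T := nth (0, 0)%N F i.
pose B : 'M[R]_(k, m) := \matrix_(i < k) p (e i).
have sz : size F = k by [].
have cmbE c : cmb F c p = (\row_i c (e i)) *m B.
  rewrite mulmx_sum_row /cmb (big_nth (0, 0)%N) big_mkord; apply: eq_bigr => i _.
  by rewrite mxE rowK.
have eF i : e i \in F by rewrite /e; exact: mem_nth.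
have einj : injective e.
  by move=> i j /eqP; rewrite nth_uniq ?fset_uniq ?sz // => /eqP/val_inj.
pose ofr (v : 'rV[R]_k) x : R := \sum_(i | e i == x) v 0 i.
have ofrE (v : 'rV[R]_k) i : ofr v (e i) = v 0 i.
  by rewrite /ofr (big_pred1 i) // => j; rewrite /= (inj_eq einj).
have rowE (v : 'rV[R]_k) : \row_i ofr v (e i) = v by apply/rowP => i; rewrite mxE ofrE.
have rf : row_free B.
  apply/inj_row_free => v vB; apply/rowP => i; rewrite -[v]rowE mxE.
  have h : cmb F (ofr v) p = cmb F (fun _ => 0) p.
    rewrite cmbE rowE vB /cmb big1 // => *; exact: scale0r.
  by rewrite (Geo_free g FX h (eF i)) mxE.
pose s := [seq matrix.col j (pinvmx B) | j <- enum 'I_k] ++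
  ([seq matrix.col j (cokermx B) | j <- enum 'I_m] ++ [seq - matrix.col j (cokermx B) | j <- enum 'I_m]).
exists s => q; split.
  move=> [c [c0 c1] ->] a; rewrite cmbE !mem_cat => /or3P[] /mapP[j _ ->].
  - by rewrite dot_col mulmxKp // mxE.
  - by rewrite dot_col -mulmxA mulmx_coker mulmx0 mxE.
  by rewrite -[- _]sub0r dotBl dot_col -mulmxA mulmx_coker mulmx0 mxE subr0 /dot mulmx0 mxE.
move=> h; have qB : (q <= B)%MS.
  rewrite submxE; apply/eqP/rowP => j; rewrite [RHS]mxE -dot_col; apply/eqP; rewrite eq_le; apply/andP; split.
    rewrite -oppr_ge0; have -> : - dot (matrix.col j (cokermx B)) q = dot (- matrix.col j (cokermx B)) q.
      by rewrite -[- matrix.col _ _]scaleN1r dotZl mulN1r.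
    by apply: h; rewrite !mem_cat; apply/or3P/Or33/mapP; exists j; rewrite ?mem_enum.
  by apply: h; rewrite !mem_cat; apply/or3P/Or32/mapP; exists j; rewrite ?mem_enum.
pose v := q *m pinvmx B.
exists (ofr v); last by rewrite cmbE rowE /v mulmxKpV.
split=> x; rewrite /ofr.
  apply: sumr_ge0 => i _; rewrite /v -dot_col; apply: h.
  by rewrite !mem_cat; apply/or3P/Or31/mapP; exists i; rewrite ?mem_enum.
by move=> xF; rewrite big1 // => i /eqP ex; rewrite -ex eF in xF.
Qed.

(** The sum of the vertices of a face [H] of [X] lies in some cone of [N]. A functional of this cone
    does not change sign on [H] and is nonnegative on the sum, hence nonnegative on each vertex. *)
Lemma refine_functionals N p : Geo N p -> exists s : seq 'cV[R]_m, forall X K p',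
  (forall y, y \in vs N -> p' y = p y) -> Sub X K p' -> Sub N K p' ->
  (forall a, a \in s -> csign a X p') -> Sub X N p'.
Proof.
move=> g.
have [ss hss] : exists ss : face -> seq 'cV[R]_m, forall F, F \in N ->
   forall q, inc F p q <-> forall a, a \in ss F -> 0 <= dot a q.
  apply: (fchoice (P := fun F s => F \in N -> forall q, inc F p q <-> forall a, a \in s -> 0 <= dot a q)) => F.
  by case: (boolP (F \in N)) => [h|]; [have [s hs] := cone_functionals g h; exists s|exists [::]].
exists (flatten [seq ss F | F <- N]) => X K p' ep sX sN cs.
apply: (Sub_refine sX sN) => H HX; have [gX gK fX _] := sX; have [_ _ _ coverN] := sN.
have iH : co H (ind R H) by split=> y; [exact: ler0n|rewrite /ind => /negbTE ->].
have [G GK hG] := fX _ HX.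
have [F FN hF] : exists2 F, F \in N & inc F p' (cmb H (ind R H) p').
  by apply: (coverN G) => //; exact: inc_cmb hG.
have FNp y : y \in F -> p' y = p y by move=> yF; apply: ep; apply/vsP; exists F.
exists F => // x xH; apply: (inc_eqp (p := p)); first by move=> y yF; rewrite FNp.
apply/(hss _ FN) => a aF.
have : 0 <= dot a (cmb H (ind R H) p').
  by move: a aF; apply/(hss _ FN); apply: inc_eqp hF.
have af : a \in flatten [seq ss F | F <- N] by apply/flattenP; exists (ss F) => //; exact: map_f.
case: (cs a af H HX) => [h _|h]; first exact: h.
rewrite dot_cmb => h0; rewrite leNgt; apply/negP => lt.
move: h0; rewrite leNgt => /negP; apply; rewrite -oppr_gt0 -sumrN; apply: (@sum_pos _ _ _ x) => //.
  by move=> y yH; rewrite /ind yH mul1r oppr_ge0 h.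
by rewrite /ind xH mul1r oppr_gt0.
Qed.

Lemma setp_off p x q y : y != x -> setp p x q y = p y.
Proof. by rewrite /setp => /negbTE ->. Qed.

Lemma setp_on p x q : setp p x q x = q.
Proof. by rewrite /setp eqxx. Qed.

Lemma cmb2 p u v (k1 k2 : R) : u != v ->
  cmb [fset u; v] (fun y => if y == u then k1 else k2) p = k1 *: p u + k2 *: p v.
Proof.
move=> uv; rewrite /cmb big_fsetU1 ?inE //= big_seq_fset1 eqxx.
by rewrite [v == u]eq_sym (negbTE uv).
Qed.

Lemma Sub_setp X K p u v x (k1 k2 : R) : Sub X K p -> closed X -> [fset u; v] \in X -> u != v ->
  x \notin vs X `|` vs K -> 0 < k1 -> 0 < k2 ->
  Sub (mv [fset u; v] [fset x] X) K (setp p x (k1 *: p u + k2 *: p v)) /\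
  Sub X K (setp p x (k1 *: p u + k2 *: p v)) /\
  setp p x (k1 *: p u + k2 *: p v) x =
    cmb [fset u; v] (fun y => if y == u then k1 else k2) (setp p x (k1 *: p u + k2 *: p v)).
Proof.
move=> sub cl uvX uv hx k1p k2p; have uvs := sub_vs uvX.
have ux : u != x by apply: contraNneq hx => <-; fs.
have vx : v != x by apply: contraNneq hx => <-; fs.
set p' := setp _ _ _.
have sub' : Sub X K p'.
  by apply: Sub_eqp sub => y yX; rewrite /p' setp_off //; apply: contraNneq hx => <-.
have px : p' x = cmb [fset u; v] (fun y => if y == u then k1 else k2) p'.
  by rewrite cmb2 // /p' setp_on !setp_off.
split=> //; apply: (Sub_trans _ sub'); case: sub' => g' _ _ _.
apply: (Sub_star _ _ _ g' px); last by move=> y; case: ifP.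
  by split=> //; rewrite -cardfs_gt0 cardfs2; case: (u != v).
by fs.
Qed.

(** [K] is cut by edge stars until it refines [N]. The result [X] is regular over [K], and with the
    same heights over [N], because a cell of [N] lies in a cell of [K]. So [X] is equivalent to
    both. *)
Theorem sq_of_Sub N K p om : closed N -> closed K -> fset0 \in N -> fset0 \in K -> Sub N K p ->
  Reg K K p om -> sq N K.
Proof.
move=> clN clK N0 K0 sub reg; have [gN gK _ _] := sub.
have [s hs] := refine_functionals gN.
pose P X p' := [/\ closed X, Sub X K p', sq K X, exists om', Reg X K p' om' &
  forall y, y \in vs K `|` vs N -> p' y = p y].
have Pcl X p' : P X p' -> closed X by case.
have [||X [p' [[clX sX sqX [om' rX] eX] csX]]] := @cut P (vs K `|` vs N) Pcl _ s K p.
- move=> X p' u v x k1 k2 [clX sX sqX [om' rX] eX] uvX uv hx k1p k2p.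
  have hx' : x \notin vs X `|` vs K by fs.
  have [s1 [s2 px]] := Sub_setp sX clX uvX uv hx' k1p k2p.
  have st : [/\ closed X, [fset u; v] \in X & [fset u; v] != fset0].
    by split=> //; rewrite -cardfs_gt0 cardfs2; case: (u != v).
  have xX : x \notin vs X by fs.
  have step_ : step X (mv [fset u; v] [fset x] X) by exists [fset u; v], x; case: st.
  split=> //.
  + exact: step_closed step_.
  + exact: sq_up step_.
  + apply: (@Reg_star X K _ _ _ _ om' st xX _ px s2); first by move=> y _; case: ifP.
    have offX y : y \in vs X -> setp p' x (k1 *: p' u + k2 *: p' v) y = p' y.
      by move=> yX; rewrite setp_off //; apply: contraNneq xX => <-.
    have offK y : y \in vs K -> setp p' x (k1 *: p' u + k2 *: p' v) y = p' y.
      by move=> yK; rewrite setp_off //; apply: contraNneq hx' => <-; rewrite inE yK orbT.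
    move=> t F tK FX hF.
    have tv y : y \in t -> y \in vs K by move=> yt; apply/vsP; exists t.
    have Fv y : y \in F -> y \in vs X by move=> yt; apply/vsP; exists F.
    have [|a [h1 h2]] := rX t F tK FX.
      move=> y yF; have := hF y yF; rewrite offX; last exact: Fv.
      by apply: inc_eqp => z zt; rewrite offK //; exact: tv.
    exists a; split=> [y yF|y yX]; rewrite offX //; [exact: h1|exact: Fv|].
    by move=> hy; apply: h2 => //; apply: inc_eqp hy => z zt; rewrite offK //; exact: tv.
  move=> y hy; rewrite setp_off ?eX //; apply: contraNneq hx => <-; move: hy; fs.
- by split=> //; [exact: Sub_refl|exact: sq_refl|exists om].
have sN' : Sub N K p' by apply: Sub_eqp sub => y hy; rewrite eX //; move: hy; fs.
have eN y : y \in vs N -> p' y = p y by move=> yN; apply: eX; rewrite inE yN orbT.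
have sXN := hs X K p' eN sX sN' csX.
apply: sq_sym; apply: (sq_trans sqX).
apply: (@sq_regular _ _ _ _ p' om') => //; first exact: sq_fset0 sqX K0.
move=> t F tN FX hF; have [_ _ fine _] := sN'; have [G GK hG] := fine _ tN.
have up q : inc t p' q -> inc G p' q by move=> h; exact: inc_trans h hG.
have [|a [h1 h2]] := rX G F GK FX; first by move=> y yF; apply: up; exact: hF.
by exists a; split=> // y yX yt; apply: h2 => //; exact: up.
Qed.
End Cut.
End Cuts.
Import Cuts.

(** * Stellar equivalence gives a common subdivision *)

Module Homeomorphisms.
Import Order.TTheory GRing.Theory Num.Theory.
Local Open Scope ring_scope.
Implicit Types (K L M S X N Y : cplx) (A B C D E F G H : face) (x y z v u : T) (U V : face).

Section Homeo.
Variable (R : archiRealFieldType).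

Lemma inc_kx m N M (p : T -> 'rV[R]_m) (kx : T -> T -> R) t x : Geo M p ->
  (forall x, x \in vs N -> exists G, [/\ G \in M, co G (kx x) & p x = cmb G (kx x) p]) ->
  t \in M -> x \in vs N -> inc t p (p x) -> co t (kx x).
Proof.
move=> gM hkx tM xN [c hc e]; have [G [GM hk e']] := hkx _ xN.
have E : c =1 kx x by apply: (gM _ _ _ _ tM GM hc hk); rewrite -e.
by case: hc => h1 h2; split=> y; [rewrite -E|move=> yt; rewrite -E h2].
Qed.

(** A vertex of [N] keeps its coordinates over [L] while [L] is realized by [p2] instead of [p]. *)
Lemma transport m m' N L (p : T -> 'rV[R]_m) (p2 : T -> 'rV[R]_m') : closed L -> Sub N L p -> Geo L p2 ->
  exists2 p' : T -> 'rV[R]_m', (forall y, y \notin vs N -> p' y = p2 y) /\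
    (forall y, y \in vs L -> p' y = p2 y) & Sub N L p'.
Proof.
move=> clL sub g2; have [gN gL fine cover] := sub; have [kx hkx] := kx_ex sub.
pose p' y := if y \in vs N then cmb (vs L) (kx y) p2 else p2 y.
have Lv G : G \in L -> G `<=` vs L := @sub_vs L G.
have hL y : y \in vs L -> p' y = p2 y.
  move=> yL; rewrite /p'; case: ifP => // yN.
  have [G [GL hc e]] := hkx _ yN.
  have yL' : [fset y] \in L by rewrite -vs_sub_mem.
  have yy : y \in [fset y] by rewrite inE.
  have ek : kx y =1 ind R [fset y].
    apply: (gL G [fset y]) => //; first exact: co1.
    by rewrite -e cmb1.
  by rewrite (cmb_eqc (d := ind R [fset y])) ?cmb1.
pose dd F c y : R := \sum_(x <- F) c x * kx x y.
have ddE m0 (p0 : T -> 'rV[R]_m0) F c :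
    cmb (vs L) (dd F c) p0 = \sum_(x <- F) c x *: cmb (vs L) (kx x) p0.
  rewrite /cmb; under eq_bigr do rewrite scaler_suml.
  by rewrite exchange_big; apply: eq_bigr => x _; rewrite scaler_sumr; apply: eq_bigr => y _; rewrite scalerA.
have key F c : F \in N -> co F c -> exists G, [/\ G \in L, co G (dd F c),
   cmb F c p = cmb G (dd F c) p & cmb F c p' = cmb G (dd F c) p2].
  move=> FN [c0 c1]; have [G GL hG] := fine _ FN.
  have vF x : x \in F -> x \in vs N by move=> xF; apply/vsP; exists F.
  have kG x : x \in F -> co G (kx x) by move=> xF; apply: (inc_kx gL hkx) => //; [exact: vF|exact: hG].
  have cd : co G (dd F c).
    split=> y; rewrite /dd big_seq.
      by apply: sumr_ge0 => x xF; rewrite mulr_ge0 //; case: (kG _ xF).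
    by move=> yG; rewrite big1 // => x xF; have [_ ->] := kG _ xF; rewrite ?mulr0.
  have [_ cd1] := cd; exists G; split=> //.
    rewrite -(cmb_sub _ (Lv _ GL) cd1) ddE; apply: eq_big_seq => x xF.
    have [G' [G'L [_ h2] ->]] := hkx _ (vF _ xF); by rewrite (cmb_sub _ (Lv _ G'L)).
  rewrite -(cmb_sub _ (Lv _ GL) cd1) ddE; apply: eq_big_seq => x xF.
  by rewrite /p' (vF _ xF).
have gL' : Geo L p' by apply: Geo_eqp g2 => y yL; rewrite hL.
have cL G c : G \in L -> cmb G c p' = cmb G c p2.
  by move=> GL; apply: cmb_eqp => y yG; rewrite hL //; apply: (fsubsetP (Lv _ GL)).
exists p'; first by split=> // y; rewrite /p' => /negbTE ->.
split=> //.
- move=> F F' c c' FN F'N hc hc' e.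
  have [G [GL h1 h2 h3]] := key _ _ FN hc; have [G' [G'L h1' h2' h3']] := key _ _ F'N hc'.
  apply: (gN _ _ _ _ FN F'N hc hc'); rewrite h2 h2'.
  have ed : dd F c =1 dd F' c' by apply: (g2 _ _ _ _ GL G'L h1 h1'); rewrite -h3 -h3'.
  have [_ z1] := h1; have [_ z2] := h1'.
  by rewrite -(cmb_sub _ (Lv _ GL) z1) -(cmb_sub _ (Lv _ G'L) z2); apply: cmb_eqc.
- move=> F FN; have [G GL hG] := fine _ FN; exists G => // x xF.
  have xN : x \in vs N by apply/vsP; exists F.
  have kG := inc_kx gL hkx GL xN (hG _ xF); exists (kx x) => //; rewrite cL // /p' xN.
  by rewrite (cmb_sub _ (Lv _ GL)) //; case: kG.
move=> G r GL [e he ->]; rewrite cL //.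
have [F FN [c hc E]] : exists2 F, F \in N & inc F p (cmb G e p) by apply: (cover G) => //; exists e.
have [G1 [G1L h1 h2 h3]] := key _ _ FN hc.
have ed : e =1 dd F c by apply: (gL _ _ _ _ GL G1L he h1); rewrite E.
exists F => //; exists c => //; rewrite h3.
have [_ z1] := h1; have [_ z2] := he.
by rewrite -(cmb_sub _ (Lv _ GL) z2) -(cmb_sub _ (Lv _ G1L) z1); apply: cmb_eqc.
Qed.

(** Standard position: the vertices are placed at the unit vectors, and [idx] tells which vertex
    belongs to a coordinate. *)
Definition Unit m X (p : T -> 'rV[R]_m) (idx : 'I_m -> T) :=
  (forall x i, x \in vs X -> p x 0 i = (idx i == x)%:R) /\ (forall x, x \in vs X -> exists i, idx i = x).

Lemma Unit_coord m X (p : T -> 'rV[R]_m) idx F c i : Unit X p idx -> F \in X -> co F c ->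
  cmb F c p 0 i = c (idx i).
Proof.
move=> [h1 h2] FX [c0 c1]; rewrite /cmb summxE.
rewrite (eq_big_seq (fun x => c x * (idx i == x)%:R)); last first.
  by move=> x xF; rewrite mxE h1 //; apply/vsP; exists F.
case: (boolP (idx i \in F)) => hi; last first.
  rewrite c1 // big_seq big1 // => x xF; case: eqP => [e|_]; last by rewrite mulr0.
  by rewrite e xF in hi.
rewrite (big_fsetD1 (idx i)) //= eqxx mulr1 big_seq big1 ?addr0 // => x.
by rewrite !inE eq_sym => /andP[/negbTE ->]; rewrite mulr0.
Qed.

Lemma Geo_unit m X (p : T -> 'rV[R]_m) idx : Unit X p idx -> Geo X p.
Proof.
move=> h F G c d FX GX hc hd e x; case: (boolP (x \in vs X)) => xX; last first.
  have nx H : H \in X -> x \notin H by move=> /sub_vs s; fs.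
  by have [_ ->] := hc; rewrite ?nx //; have [_ ->] := hd; rewrite ?nx.
have [_ /(_ x xX)[i <-]] := h.
by rewrite -(Unit_coord i h FX hc) -(Unit_coord i h GX hd) e.
Qed.

Lemma Reg_unit m X (p : T -> 'rV[R]_m) idx : Unit X p idx -> Reg X X p (fun _ => 0).
Proof.
move=> [h1 h2] t F tX FX _; pose a : 'cV[R]_m := \col_i (if idx i \in F then 0 else -1).
have da x : x \in vs X -> dot a (p x) = \sum_(i | idx i == x) (if x \in F then 0 else -1).
  move=> xX; rewrite /dot mxE [RHS]big_mkcond; apply: eq_bigr => i _; rewrite h1 // mxE.
  by case: eqP => [->|_]; rewrite ?mul1r ?mul0r.
exists a; split=> [x xF|x xX _ xF].
  by rewrite da ?xF ?big1 //; apply/vsP; exists F.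
rewrite da // (negbTE xF); have [i hi] := h2 _ xX; rewrite -oppr_gt0 -sumrN (bigD1 i) ?hi //= opprK.
by apply: ltr_pwDl => //; apply: sumr_ge0.
Qed.

Lemma Unit_ex X : exists m (p : T -> 'rV[R]_m) idx, Unit X p idx.
Proof.
exists #|` vs X|, (fun x => \row_i (nth (0, 0)%N (vs X) i == x)%:R), (fun i => nth (0, 0)%N (vs X) i).
split=> [x i _|x xX]; first by rewrite mxE.
have hi : (index x (vs X) < #|` vs X|)%N by rewrite index_mem.
by exists (Ordinal hi); rewrite /= nth_index.
Qed.

(** A common subdivision, realized separately over [K] and over [L]. It can avoid any given [U], so
    that vertices added to [L] later do not clash with it. *)
Definition Homeo K L := forall U, exists N m1 m2 (p : T -> 'rV[R]_m1) (q : T -> 'rV[R]_m2),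
  [/\ closed N, fdisjoint (vs N) U, Sub N K p & Sub N L q].

Lemma Sub_copy K U : closed K -> exists N m (p : T -> 'rV[R]_m),
  [/\ closed N, fdisjoint (vs N) U & Sub N K p].
Proof.
move=> clK; have [m [p [idx un]]] := Unit_ex K; have gK := Geo_unit un.
have [f finj [_ hf]] := shift_away (U `|` vs K) fset0.
have {}hf z : f z \notin U `|` vs K by have := hf z (negbT (in_fset0 z)); rewrite fsetU0.
pose p' y := if [pick z : vs K | f (fsval z) == y] is Some z then p (fsval z) else p y.
have pf z : z \in vs K -> p' (f z) = p z.
  move=> zK; rewrite /p'; case: pickP => [w /eqP/finj <-//|/(_ [` zK])]; by rewrite /= eqxx.
have pK z : z \in vs K -> p' z = p z.
  move=> zK; rewrite /p'; case: pickP => // w /eqP e; have := hf (fsval w).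
  by rewrite e inE zK orbT.
have cf F c : F \in K -> cmb (f @` F) c p' = cmb F (c \o f) p'.
  move=> FK; rewrite /cmb big_imfset /=; last by move=> x y _ _; exact: finj.
  by apply: eq_big_seq => x xF; have xK : x \in vs K by [apply/vsP; exists F]; rewrite pf ?pK.
have gK' : Geo K p' by apply: Geo_eqp gK => y yK; rewrite pK.
have cof F (c : T -> R) : co (f @` F) c -> co F (c \o f).
  move=> [h1 h2]; split=> x /=; first exact: h1.
  by move=> xF; apply: h2; apply/imfsetP => -[y yF /finj e]; rewrite e (yF : y \in F) in xF.
exists (imf f K), m, p'; split.
- exact: imf_closed.
- rewrite vs_imf; apply/fdisjointP => x /imfsetP[z _ ->]; have := hf z; fs.
split=> //.
- move=> _ _ c d /imfP[F FK ->] /imfP[G GK ->] hc hd; rewrite !cf // => e.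
  have h := gK' _ _ _ _ FK GK (cof _ _ hc) (cof _ _ hd) e => x.
  case: (pselect (exists z, x = f z)) => [[z ->]|no]; first exact: h.
  have nx H : x \notin f @` H by apply/imfsetP => -[z _ e']; apply: no; exists z.
  by have [_ ->] := hc; rewrite ?nx //; have [_ ->] := hd; rewrite ?nx.
- move=> _ /imfP[F FK ->]; exists F => // x /imfsetP[z /= zF ->].
  have zK : z \in vs K by apply/vsP; exists F.
  by rewrite pf // -pK //; exact: inc_p.
move=> G r GK [c [c0 c1] ->]; exists (f @` G); first by apply/imfP; exists G.
have [g hg] : exists g, forall x, g (f x) = x.
  have [g hg] : exists g : T -> T, forall y, (exists x, y = f x) -> y = f (g y).
    apply: (fchoice (P := fun y x => (exists x, y = f x) -> y = f x)) => y.
    by case: (pselect (exists x, y = f x)) => [[x e]|no]; [exists x|exists y].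
  by exists g => x; apply: finj; rewrite -hg //; exists x.
exists (rs (f @` G) (c \o g)).
  by split=> x; rewrite /rs; [case: ifP => //= _|move/negbTE ->].
rewrite cmb_rs // cf //; apply: cmb_eqc => x xG /=; by rewrite hg.
Qed.

Lemma Homeo_refl K : closed K -> Homeo K K.
Proof.
by move=> cl U; have [N [m [p [h1 h2 h3]]]] := Sub_copy U cl; exists N, m, m, p, p.
Qed.

(** The common subdivision is cut by the functionals of [L'], in its realization over [L], until it
    refines [L']. Each edge star is copied with the same weights in the realization over [K]. *)
Lemma Homeo_up K L L' : Homeo K L -> step L L' -> Homeo K L'.
Proof.
move=> h st U; have clL' := step_closed st; case: (st) => A [x [clL AL A0 xL eL]].
pose U0 := U `|` (vs K `|` vs L `|` vs L' `|` [fset x]).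
have [N [m1 [m2 [p [q [clN dN sK sL]]]]]] := h U0.
pose q1 := setp q x (cmb A (fun _ => 1) q).
have xA : x \notin A by have := sub_vs AL; fs.
have q1x : q1 x = cmb A (fun _ => 1) q1.
  rewrite /q1 setp_on; apply: cmb_eqp => y yA; rewrite setp_off //; apply: contraNneq xA => <- //.
have sL1 : Sub N L q1.
  apply: Sub_eqp sL => y hy; rewrite /q1 setp_off //; apply: contraTneq hy => ->.
  by move: dN xL; rewrite /U0; fs.
have gL1 : Geo L q1 by case: sL1.
have sL'L : Sub L' L q1.
  rewrite eL; apply: (Sub_star _ _ _ gL1 q1x) => //.
have gL' : Geo L' q1 by case: sL'L.
have [s hs] := refine_functionals gL'.
pose P X q' := exists p' : T -> 'rV[R]_m1, [/\ closed X, fdisjoint (vs X) U0, Sub X K p', Sub X L q' &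
  forall y, y \in vs L `|` vs L' -> q' y = q1 y].
have Pcl X q' : P X q' -> closed X by move=> [p' []].
have [||X [q' [[p' [clX dX sXK sXL eX]] csX]]] := @cut R m2 P U0 Pcl _ s N q1.
- move=> X q' u v y k1 k2 [p' [clX dX sXK sXL eX]] uvX uv hy k1p k2p.
  have hyK : y \notin vs X `|` vs K by move: hy; rewrite /U0; fs.
  have hyL : y \notin vs X `|` vs L by move: hy; rewrite /U0; fs.
  have [s1 _] := Sub_setp sXK clX uvX uv hyK k1p k2p.
  have [s2 _] := Sub_setp sXL clX uvX uv hyL k1p k2p.
  exists (setp p' y (k1 *: p' u + k2 *: p' v)); split=> //.
  + apply: (@step_closed X); exists [fset u; v], y; split=> //; last by fs.
    by rewrite -cardfs_gt0 cardfs2; case: (u != v).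
  + by have := vs_mv [fset u; v] [fset y] X; move: hy dX; rewrite /U0; fs.
  move=> z hz; rewrite setp_off ?eX //; apply: contraTneq hz => ->; move: hy; rewrite /U0; fs.
- by exists p.
exists X, m1, m2, p', q'; split=> //; first by move: dX; rewrite /U0; fs.
apply: (hs X L q') => //; first by move=> y hy; rewrite eX // inE hy orbT.
by apply: Sub_eqp sL'L => y hy; rewrite eX // fsetUC.
Qed.

(** Here [L] subdivides [L'], so the common subdivision only has to be transported to the
    realization of [L] inside [L']. *)
Lemma Homeo_dn K L L' : Homeo K L -> step L' L -> Homeo K L'.
Proof.
move=> h st U; have clL := step_closed st; case: (st) => A [x [clL' AL A0 xL eL]].
have [N [m1 [m2 [p [q [clN dN sK sL]]]]]] := h (U `|` (vs L `|` vs L')).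
have [m3 [p3 [idx un]]] := Unit_ex L'; have gL3 := Geo_unit un.
pose q1 := setp p3 x (cmb A (fun _ => 1) p3).
have xA : x \notin A by have := sub_vs AL; fs.
have q1x : q1 x = cmb A (fun _ => 1) q1.
  rewrite /q1 setp_on; apply: cmb_eqp => y yA; rewrite setp_off //; apply: contraNneq xA => <- //.
have gL' : Geo L' q1.
  by apply: Geo_eqp gL3 => y hy; rewrite /q1 setp_off //; apply: contraNneq xL => <-.
have sLL' : Sub L L' q1 by rewrite eL; apply: (Sub_star _ _ _ gL' q1x).
have [gL _ _ _] := sLL'.
have [q2 [h1 h2] sN] := transport clL sL gL.
exists N, m1, m3, p, q2; split=> //; first by move: dN; fs.
apply: (Sub_trans sN); apply: Sub_eqp sLL' => y hy; rewrite h1 //; move: dN hy; fs.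
Qed.

Lemma Homeo_sq K L : closed K -> sq K L -> Homeo K L.
Proof.
move=> cl; elim=> [|N P _ IH st|N P _ IH st]; first exact: Homeo_refl.
  exact: Homeo_up IH st.
exact: Homeo_dn IH st.
Qed.
End Homeo.
End Homeomorphisms.
Import Homeomorphisms.

(** * Stellar equivalence and PL homeomorphism *)

Module PLBridge.
Import Order.TTheory GRing.Theory Num.Theory.
Local Open Scope ring_scope.
Local Notation R := Rdefinitions.R.

Definition tf (V : finType) (e : V -> T) (F : {set V}) : face := [fset e v | v in F].
Definition cT (V : finType) (e : V -> T) (K : {set {set V}}) : cplx := [fset tf e F | F in K].

Section Embed.
Variables (V : finType) (e : V -> T).
Implicit Types (K : {set {set V}}) (F G : {set V}).

Lemma tfP F x : reflect (exists2 v, v \in F & x = e v) (x \in tf e F).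
Proof. exact: imfsetP. Qed.

Lemma cTP K X : reflect (exists2 F, F \in K & X = tf e F) (X \in cT e K).
Proof. exact: imfsetP. Qed.

Hypothesis einj : injective e.

Lemma mem_tf F v : (e v \in tf e F) = (v \in F).
Proof. by apply/tfP/idP => [[w wF /einj ->]|vF] //; exists v. Qed.

Lemma tf_sub F G : (tf e F `<=` tf e G) = (F \subset G).
Proof.
apply/fsubsetP/subsetP => h; first by move=> v vF; rewrite -mem_tf; apply: h; rewrite mem_tf.
by move=> x /tfP[v vF ->]; rewrite mem_tf; exact: h.
Qed.

Lemma tf_inj : injective (tf e).
Proof. by move=> F G h; apply/setP => v; rewrite -!mem_tf h. Qed.

Lemma sub_tf X F : X `<=` tf e F -> X = tf e [set v in F | e v \in X].
Proof.
move=> /fsubsetP h; apply/fsetP => x; apply/idP/tfP => [xX|[v + ->]]; last by rewrite inE => /andP[].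
by have /tfP[v vF ex] := h _ xX; exists v => //; rewrite inE vF -ex.
Qed.

Lemma mem_cT K F : (tf e F \in cT e K) = (F \in K).
Proof. by apply/cTP/idP => [[G GK /tf_inj ->]|FK] //; exists F. Qed.

Lemma cT_closed K : is_complex K -> closed (cT e K).
Proof.
move=> h _ X /cTP[F FK ->] s; rewrite (sub_tf s) mem_cT; apply: (h F) => //.
by apply/subsetP => v; rewrite inE => /andP[].
Qed.

Lemma tf0 : tf e set0 = fset0.
Proof. by apply/fsetP => x; rewrite in_fset0; apply/negP => /tfP[v]; rewrite inE. Qed.

Lemma tf1 v : tf e [set v] = [fset e v].
Proof.
apply/fsetP => x; rewrite in_fset1; apply/tfP/eqP => [[w]|->]; first by rewrite inE => /eqP ->.
by exists v; rewrite ?inE.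
Qed.

Lemma vs_cT K : is_complex K -> vs (cT e K) = tf e (vert K).
Proof.
move=> h; apply/fsetP => x; apply/vsP/tfP => [[_ /cTP[F FK ->] /tfP[v vF ->]]|[v + ->]].
  by exists v => //; rewrite inE; apply: h FK _; rewrite sub1set.
by rewrite inE => vK; exists (tf e [set v]); rewrite ?mem_cT // mem_tf inE.
Qed.

Lemma perm_tf F : perm_eq (tf e F) [seq e v | v <- enum F].
Proof.
apply: uniq_perm; rewrite ?fset_uniq ?map_inj_uniq ?enum_uniq // => x.
apply/tfP/mapP => [[v vF ->]|[v]]; first by exists v; rewrite ?mem_enum.
by rewrite mem_enum => vF ->; exists v.
Qed.

Lemma card_tf F : #|` tf e F| = #|F|.
Proof. by rewrite (perm_size (perm_tf F)) size_map cardE. Qed.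

Lemma big_tf (M : zmodType) F (f : T -> M) : \sum_(x <- tf e F) f x = \sum_(v in F) f (e v).
Proof. by rewrite (perm_big _ (perm_tf F)) /= big_map big_enum. Qed.

Lemma big_tf_all F (f : T -> R) : (forall v, v \notin F -> f (e v) = 0) ->
  \sum_(x <- tf e F) f x = \sum_v f (e v).
Proof.
move=> h; rewrite big_tf big_mkcond; apply: eq_bigr => v _; case: ifP => // /negbT/h ->; done.
Qed.
End Embed.

(** All vertices get the color [k]; a large [k] makes the image disjoint from given sets. *)
Definition em (k : nat) (V : finType) (v : V) : T := (k, nat_of_ord (enum_rank v)).

Lemma em_inj k V : injective (@em k V).
Proof. by move=> v w [/val_inj/enum_rank_inj]. Qed.

Lemma in_realP (V : finType) (K : {set {set V}}) (b : V -> R) : in_real K b <->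
  [/\ forall v, 0 <= b v, \sum_v b v = 1 & exists2 F, F \in K & forall v, v \notin F -> b v = 0].
Proof.
split=> [[h1 [h2 [F [h3 h4]]]]|[h1 h2 [F h3 h4]]].
  by split=> // [v|]; [apply/RleP; exact: h1|exists F].
by split; [move=> v; apply/RleP; exact: h1|split=> //; exists F].
Qed.

Lemma lin_extE (W V : finType) (pos : W -> V -> R) b v : lin_ext pos b v = \sum_w b w * pos w v.
Proof. by []. Qed.

Section FromFrozen.
Variables (V U : finType) (K : {set {set V}}) (M : {set {set U}}) (pos : U -> V -> R).
Variables (eV : V -> T) (eU : U -> T).
Hypotheses (iV : injective eV) (iU : injective eU) (dis : forall v u, eV v != eU u)
  (cK : is_complex K) (K0 : set0 \in K) (sub : subdivides M K pos).

Let p (y : T) : 'rV[R]_#|V| := if [pick v | eV v == y] is Some v then \row_i (enum_val i == v)%:R else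
  if [pick u | eU u == y] is Some u then \row_i pos u (enum_val i) else 0.

Let pV v : p (eV v) = \row_i (enum_val i == v)%:R.
Proof. by rewrite /p; case: pickP => [w /eqP/iV ->//|/(_ v)]; rewrite eqxx. Qed.

Let pU u : p (eU u) = \row_i pos u (enum_val i).
Proof.
rewrite /p; case: pickP => [w|_]; first by rewrite (negbTE (dis w u)).
by case: pickP => [w /eqP/iU ->//|/(_ u)]; rewrite eqxx.
Qed.

Let cM : is_complex M. Proof. by case: sub. Qed.
(** [M] may have no faces at all, when [K] has no vertices; [cplx] arguments want the empty face. *)
Let M' := set0 |: M.
Let cM' : is_complex M'.
Proof.
move=> F G; rewrite !inE => /orP[/eqP->|FM] s; first by move: s; rewrite subset0 => ->.
by rewrite (cM FM s) orbT.
Qed.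
Let N := cT eU M'.

Lemma unit_frozen : Unit (cT eV K) p (fun i => eV (enum_val i)).
Proof.
split=> [x i|x]; rewrite vs_cT // => /tfP[v vK ->].
  by rewrite pV mxE (inj_eq iV).
by exists (enum_rank v); rewrite enum_rankK.
Qed.

Let cV F c v : F \in K -> co (tf eV F) c -> cmb (tf eV F) c p 0 (enum_rank v) = c (eV v).
Proof.
move=> FK hc; rewrite (Unit_coord _ unit_frozen) ?mem_cT ?enum_rankK //.
Qed.

Let cU F (c : T -> R) i : co (tf eU F) c -> cmb (tf eU F) c p 0 i = lin_ext pos (c \o eU) (enum_val i).
Proof.
move=> [c0 c1]; rewrite lin_extE /cmb summxE big_tf_all //.
  by apply: eq_bigr => u _; rewrite mxE pU mxE.
by move=> u uF; rewrite mxE c1 ?mul0r // mem_tf.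
Qed.

Let pos_real F u : F \in M' -> u \in F -> in_real K (pos u).
Proof.
move=> FM uF; have [_ h _ _ _] := sub; apply: h; rewrite inE.
have : [set u] \in M' by apply: (cM' FM); rewrite sub1set.
by rewrite !inE => /orP[/eqP/setP/(_ u)|//]; rewrite !inE eqxx.
Qed.

Let total F (c : T -> R) : F \in M' -> co (tf eU F) c ->
  \sum_v lin_ext pos (c \o eU) v = \sum_u c (eU u).
Proof.
move=> FM [c0 c1]; under eq_bigr do rewrite lin_extE.
rewrite exchange_big; apply: eq_bigr => u _ /=; rewrite -mulr_sumr.
case: (boolP (u \in F)) => uF; last by rewrite c1 ?mul0r // mem_tf.
by have /in_realP[_ -> _] := pos_real FM uF; rewrite mulr1.
Qed.

(** From the cone to the simplex: coordinates are divided by their sum, which by [total] is the same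
    over [M] and over [K]. *)
Let norm F (c : T -> R) : F \in M' -> co (tf eU F) c -> 0 < \sum_u c (eU u) ->
  in_real M (fun u => c (eU u) / \sum_u c (eU u)).
Proof.
move=> FM [c0 c1] s0; apply/in_realP; split.
- by move=> u; rewrite divr_ge0 // ltW.
- by rewrite -mulr_suml divff // gt_eqF.
move: FM; rewrite !inE => /orP[/eqP F0|FM]; last by exists F => // u uF; rewrite c1 ?mul0r // mem_tf.
move: s0; rewrite big1 ?ltxx // => u _; apply: c1; by rewrite F0 tf0 in_fset0.
Qed.

Lemma Sub_frozen : Sub N (cT eV K) p.
Proof.
have gK := Geo_unit unit_frozen; split=> //.
- move=> _ _ c d /cTP[F FM ->] /cTP[G GM ->] hc hd E.
  have El v : lin_ext pos (c \o eU) v = lin_ext pos (d \o eU) v.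
    by rewrite -[v]enum_rankK -(cU _ hc) -(cU _ hd) E.
  have es : \sum_u c (eU u) = \sum_u d (eU u).
    by rewrite -(total FM hc) -(total GM hd); apply: eq_bigr.
  have eqU u : c (eU u) = d (eU u).
    have [c0 _] := hc; have [d0 _] := hd.
    case: (ltgtP (\sum_u c (eU u)) 0) => s0.
    + by have : 0 <= \sum_u c (eU u) by [apply: sumr_ge0]; rewrite leNgt s0.
    + have [_ _ _ inj _] := sub.
      have s0' : 0 < \sum_u d (eU u) by rewrite -es.
      have := inj _ _ (norm FM hc s0) (norm GM hd s0') _ u.
      rewrite -es => h; have {}h := h _; apply: (mulIf (x := (\sum_u c (eU u))^-1)).
        by rewrite invr_eq0 gt_eqF.
      apply: h => v; rewrite !lin_extE.
      have := El v; rewrite !lin_extE => h.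
      transitivity ((\sum_u0 (c \o eU) u0 * pos u0 v) / \sum_u c (eU u)).
        by rewrite mulr_suml; apply: eq_bigr => w _; rewrite mulrAC.
      by rewrite h mulr_suml; apply: eq_bigr => w _; rewrite mulrAC.
    have zc : c (eU u) = 0 by apply: (psumr_eq0P _ s0).
    rewrite zc; apply/esym/(psumr_eq0P (P := predT) (F := fun u => d (eU u))) => //; by rewrite -es.
  move=> x; case: (pselect (exists u, x = eU u)) => [[u ->]//|no].
  have nx H : x \notin tf eU H by apply/tfP => -[u _ e']; apply: no; exists u.
  by have [_ ->] := hc; rewrite ?nx //; have [_ ->] := hd; rewrite ?nx.
- move=> _ /cTP[F FM ->]; move: (FM); rewrite !inE => /orP[/eqP->|FM'].
    by exists fset0; [rewrite -(tf0 eV) mem_cT|move=> x; rewrite tf0 in_fset0].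
  have [_ _ h _ _] := sub; have [G GK hG] := h _ FM'; exists (tf eV G); first by rewrite mem_cT.
  move=> x /tfP[u uF ->]; have /in_realP[p0 _ _] := pos_real FM uF.
  pose c y : R := if [pick v | eV v == y] is Some v then pos u v else 0.
  have cE v : c (eV v) = pos u v.
    by rewrite /c; case: pickP => [w /eqP/iV ->//|/(_ v)]; rewrite eqxx.
  have hc : co (tf eV G) c.
    split=> y; rewrite /c; case: pickP => // v /eqP <-.
    by rewrite mem_tf // => vG; apply: hG.
  exists c => //; apply/rowP => i; rewrite -(enum_valK i) cV // pU mxE cE enum_rankK //.
move=> _ q /cTP[G GK ->] [c hc ->].
have [c0 c1] := hc; set s := \sum_v c (eV v).
have s0 : 0 <= s by apply: sumr_ge0.
case: (eqVneq s 0) => [e|ne].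
  exists fset0; first by rewrite -(tf0 eU) mem_cT // !inE eqxx.
  suff -> : cmb (tf eV G) c p = 0 by exact: inc0.
  apply/rowP => i; rewrite -(enum_valK i) cV // mxE.
  exact: (psumr_eq0P (fun v _ => c0 (eV v)) e).
have sp : 0 < s by rewrite lt0r ne.
have [_ _ _ _ cover] := sub.
have hr : in_real K (fun v => c (eV v) / s).
  apply/in_realP; split; first by move=> v; rewrite divr_ge0.
    by rewrite -mulr_suml divff.
  by exists G => // v vG; rewrite c1 ?mul0r // mem_tf.
have [b /in_realP[b0 b1 [F FM hF]] hb] := cover _ hr; exists (tf eU F); first by rewrite mem_cT // !inE FM orbT.
pose d y : R := if [pick u | eU u == y] is Some u then s * b u else 0.
have dE u : d (eU u) = s * b u.
  by rewrite /d; case: pickP => [w /eqP/iU ->//|/(_ u)]; rewrite eqxx.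
have hd : co (tf eU F) d.
  split=> y; rewrite /d; case: pickP => // u; first by rewrite mulr_ge0.
  by move=> /eqP <-; rewrite mem_tf // => uF; rewrite hF ?mulr0.
exists d => //; apply/rowP => i; rewrite cU // -{1}(enum_valK i) cV // lin_extE.
have := hb (enum_val i); rewrite lin_extE => hb'.
under eq_bigr do rewrite /= dE -mulrA.
by rewrite -mulr_sumr hb' mulrC divfK.
Qed.

Lemma sq_frozen : sq N (cT eV K).
Proof.
have h1 : closed N by exact: cT_closed.
have h2 : closed (cT eV K) by exact: cT_closed.
have h3 : fset0 \in N by rewrite -(tf0 eU) mem_cT // !inE eqxx.
have h4 : fset0 \in cT eV K by rewrite -(tf0 eV) mem_cT.
exact: (sq_of_Sub h1 h2 h3 h4 Sub_frozen (Reg_unit unit_frozen)).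
Qed.
End FromFrozen.

Theorem sq_of_PL (V W : finType) (K : {set {set V}}) (L : {set {set W}}) (eV : V -> T) (eW : W -> T) :
  injective eV -> injective eW ->
  is_complex K -> is_complex L -> set0 \in K -> set0 \in L -> PL_homeo K L ->
  sq (cT eV K) (cT eW L).
Proof.
move=> iV iW cK cL K0 L0 [U [M [pos1 [pos2 [s1 s2]]]]].
have [k hk] := col_bound (tf eV setT `|` tf eW setT).
have d1 v (u : U) : eV v != em k u.
  apply/eqP => e; have := hk (eV v); rewrite inE mem_tf // inE /= e /col /= ltnn.
  by move=> /(_ isT).
have d2 v (u : U) : eW v != em k u.
  apply/eqP => e; have := hk (eW v); rewrite inE (mem_tf iW) inE orbT /= e /col /= ltnn.
  by move=> /(_ isT).
have h1 := sq_frozen iV (@em_inj k U) d1 cK K0 s1.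
have h2 := sq_frozen iW (@em_inj k U) d2 cL L0 s2.
exact: sq_trans (sq_sym h1) h2.
Qed.

Section ToFrozen.
Variables (V : finType) (K : {set {set V}}) (N : cplx) (e : V -> T).
Variables (m0 : nat) (q : T -> 'rV[R]_m0).
Hypotheses (ei : injective e) (cK : is_complex K) (clN : closed N) (sub : Sub N (cT e K) q).

(** The way back from [cplx] to sets over a finite type, whose elements are the vertices. *)
Definition frz : {set {set vs N}} := [set F : {set vs N} | tf (fun x : vs N => fsval x) F \in N].

Lemma subdivides_of_Sub : exists pos, subdivides frz K pos.
Proof.
pose v0 (x : vs N) := fsval x; have vi : injective v0 := val_inj.
pose pu y : 'rV[R]_#|V| := \row_i (e (enum_val i) == y)%:R.
have un : Unit (cT e K) pu (fun i => e (enum_val i)).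
  split=> [x i _|x]; first by rewrite mxE.
  by rewrite vs_cT // => /tfP[v vK ->]; exists (enum_rank v); rewrite enum_rankK.
have [p [_ pK] sN] := transport (cT_closed ei cK) sub (Geo_unit un).
have [gN gK fine cover] := sN.
have unp : Unit (cT e K) p (fun i => e (enum_val i)).
  by have [u1 u2] := un; split=> // x i xK; rewrite pK // u1.
have cV G c v : G \in K -> co (tf e G) c -> cmb (tf e G) c p 0 (enum_rank v) = c (e v).
  by move=> GK hc; rewrite (Unit_coord _ unp) ?mem_cT ?enum_rankK.
pose co1 (x : vs N) v : R := p (v0 x) 0 (enum_rank v).
pose sg x := \sum_v co1 x v.
have NF F : F \in frz -> tf v0 F \in N by rewrite inE.
have frzE X : X \in N -> exists2 F, F \in frz & X = tf v0 F.
  move=> XN; pose F := [set x : vs N | v0 x \in X]; have eX : X = tf v0 F.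
    apply/fsetP => y; apply/idP/tfP => [yX|[x + ->]]; last by rewrite inE.
    have yN : y \in vs N by apply/vsP; exists X.
    by exists [` yN]; rewrite ?inE.
  by exists F => //; rewrite inE -/(tf v0 F) -eX.
have cfrz : is_complex frz.
  move=> F G; rewrite !inE => h s; apply: (clN h); by rewrite tf_sub.
have rep F : F \in frz -> exists2 G, G \in K & forall x, x \in F ->
    [/\ forall v, 0 <= co1 x v, forall v, v \notin G -> co1 x v = 0 & 0 < sg x].
  move=> FM; have [_ /cTP[G GK ->] hG] := fine _ (NF _ FM); exists G => // x xF.
  have [c hc ex] : inc (tf e G) p (p (v0 x)) by apply: hG; rewrite mem_tf.
  have cE v : co1 x v = c (e v) by rewrite /co1 ex cV.
  have [c0 c1] := hc.
  split=> [v|v vG|]; rewrite ?cE //; first by rewrite c1 // mem_tf.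
  rewrite lt0r sumr_ge0 ?andbT; last by move=> v _; rewrite cE.
  apply/eqP => s0; have z v : co1 x v = 0.
    by apply: (psumr_eq0P (P := predT) (F := co1 x)) => // w _; rewrite cE.
  have p0 : p (v0 x) = 0 by apply/rowP => i; rewrite -(enum_valK i) -/(co1 x _) z mxE.
  have e2 : cmb (tf v0 F) (ind R [fset v0 x]) p = cmb (tf v0 F) (fun _ => 0) p.
    by rewrite cmb1 ?mem_tf // p0 /cmb big1 // => y _; rewrite scale0r.
  have xt : v0 x \in tf v0 F by rewrite mem_tf.
  by have /eqP := Geo_free gN (NF _ FM) e2 xt; rewrite /ind inE eqxx oner_eq0.
have coord F (c : T -> R) v : co (tf v0 F) c -> cmb (tf v0 F) c p 0 (enum_rank v) = \sum_x c (v0 x) * co1 x v.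
  move=> [c0 c1]; rewrite /cmb summxE (big_tf_all vi (f := fun x => (c x *: p x) 0 (enum_rank v))).
    by apply: eq_bigr => x _; rewrite mxE.
  by move=> x xF; rewrite c1 ?mem_tf // scale0r mxE.
(* The vertices of [N] lie in cones, where the coordinates need not have sum 1. They are projected
   to the simplex by dividing by [sg], and [lift] converts barycentric coordinates accordingly. *)
pose lift (b : vs N -> R) (y : T) : R := if insub y is Some x then b x / sg x else 0.
have liftE b x : lift b (v0 x) = b x / sg x by rewrite /lift valK.
have lift_co F b : F \in frz -> (forall x, 0 <= b x) -> (forall x, x \notin F -> b x = 0) -> co (tf v0 F) (lift b).
  move=> FM b0 b1; have [G GK hG] := rep _ FM; split=> y; rewrite /lift; case: insubP => // x _ ex.
    case: (boolP (x \in F)) => xF; last by rewrite b1 // mul0r.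
    by have [_ _ s0] := hG _ xF; rewrite divr_ge0 // ltW.
  by rewrite -ex -/(v0 x) mem_tf // => xF; rewrite b1 // mul0r.
pose pos x v : R := co1 x v / sg x.
have lin F b v : F \in frz -> (forall x, 0 <= b x) -> (forall x, x \notin F -> b x = 0) ->
    lin_ext pos b v = cmb (tf v0 F) (lift b) p 0 (enum_rank v).
  move=> FM b0 b1; rewrite (coord _ _ _ (lift_co _ _ FM b0 b1)) lin_extE; apply: eq_bigr => x _.
  by rewrite liftE /pos mulrA mulrAC.
exists pos; split=> //.
- move=> x; rewrite inE => xM; have [G GK hG] := rep _ xM.
  have [p0 p1 s0] := hG x (set11 x); apply/in_realP; split.
  + by move=> v; rewrite divr_ge0 // ltW.
  + by rewrite -mulr_suml divff // gt_eqF.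
  by exists G => // v vG; rewrite /pos p1 // mul0r.
- move=> F FM; have [G GK hG] := rep _ FM; exists G => // x v xF vG.
  by have [_ p1 _] := hG _ xF; rewrite /pos p1 // mul0r.
- move=> b1 b2 /in_realP[b10 b11 [F FM hF]] /in_realP[b20 b21 [G GM hG]] E x.
  have h : lift b1 =1 lift b2.
    apply: (gN _ _ _ _ (NF _ FM) (NF _ GM) (lift_co _ _ FM b10 hF) (lift_co _ _ GM b20 hG)).
    by apply/rowP => i; rewrite -(enum_valK i) -(lin F b1) // E (lin G b2).
  have := h (v0 x); rewrite !liftE => h'.
  case: (boolP (x \in F :|: G)) => hx; last first.
    by move: hx; rewrite inE negb_or => /andP[/hF -> /hG ->].
  have s0 : 0 < sg x.
    move: hx; rewrite inE => /orP[xF|xG].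
      by have [G' _ hG'] := rep _ FM; have [] := hG' _ xF.
    by have [G' _ hG'] := rep _ GM; have [] := hG' _ xG.
  by apply: (mulIf (x := (sg x)^-1)) => //; rewrite invr_eq0 gt_eqF.
move=> a /in_realP[a0 a1 [G GK hG]].
pose c y : R := if [pick v | e v == y] is Some v then a v else 0.
have cE v : c (e v) = a v.
  by rewrite /c; case: pickP => [w /eqP/ei ->//|/(_ v)]; rewrite eqxx.
have hc : co (tf e G) c.
  split=> y; rewrite /c; case: pickP => // v /eqP <-.
  by rewrite mem_tf // => vG; apply: hG.
have hi : inc (tf e G) p (cmb (tf e G) c p) by exists c.
have hm : tf e G \in cT e K by rewrite mem_cT.
have [X XN [d hd Ed]] := cover _ _ hm hi.
have [F FM eX] := frzE _ XN; rewrite {}eX in hd Ed; have [d0 d1] := hd.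
pose b x := d (v0 x) * sg x.
have [G' _ rp] := rep _ FM.
have bF x : x \notin F -> b x = 0 by move=> xF; rewrite /b d1 ?mul0r // mem_tf.
have b0 x : 0 <= b x.
  case: (boolP (x \in F)) => xF; last by rewrite bF.
  by have [_ _ s0] := rp _ xF; rewrite /b mulr_ge0 // ltW.
have Ea v : \sum_x d (v0 x) * co1 x v = a v by rewrite -(coord F) // -Ed cV ?cE.
exists b.
  apply/in_realP; split=> //; last by exists F.
  rewrite -a1 /b /sg; under eq_bigr do rewrite mulr_sumr.
  by rewrite exchange_big; apply: eq_bigr => v _.
move=> v; rewrite (lin F) // -Ea (coord _ _ _ (lift_co _ _ FM b0 bF)); apply: eq_bigr => x _.
rewrite liftE; case: (boolP (x \in F)) => xF; last by rewrite bF // mul0r d1 ?mem_tf.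
by have [_ _ s0] := rp _ xF; rewrite /b mulfK // gt_eqF.
Qed.
End ToFrozen.

Theorem PL_of_sq (V W : finType) (K : {set {set V}}) (L : {set {set W}}) (eV : V -> T) (eW : W -> T) :
  injective eV -> injective eW -> is_complex K -> is_complex L ->
  sq (cT eV K) (cT eW L) -> PL_homeo K L.
Proof.
move=> iV iW cK cL h.
have [N [m1 [m2 [p [q [clN _ s1 s2]]]]]] := @Homeo_sq R _ _ (cT_closed iV cK) h fset0.
have [pos1 h1] := subdivides_of_Sub iV cK clN s1; have [pos2 h2] := subdivides_of_Sub iW cL clN s2.
by exists (vs N : finType), (frz N), pos1, pos2.
Qed.
End PLBridge.
Import PLBridge.

(** * Manifolds, colorings and isomorphisms in both encodings *)

Module ManifoldBridge.
Section Link.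
Variables (V : finType) (e : V -> T).
Hypothesis ei : injective e.
Implicit Types (K : {set {set V}}) (F G : {set V}).

Lemma tfU F G : tf e (F :|: G) = tf e F `|` tf e G.
Proof.
apply/fsetP => x; rewrite inE; apply/tfP/orP => [[v + ->]|[]/tfP[v vF ->]].
- by rewrite inE => /orP[h|h]; [left|right]; rewrite mem_tf.
- by exists v; rewrite // inE vF.
by exists v; rewrite // inE vF orbT.
Qed.

Lemma link_complex K v : is_complex K -> is_complex (link K v).
Proof.
move=> c F G; rewrite !inE => /and3P[h1 h2 h3] s; apply/and3P; split.
- exact: c h1 s.
- by apply: contra h2; apply: (subsetP s).
by apply: c h3 _; exact: setUS.
Qed.

Lemma lk_cT K v : is_complex K -> lk [fset e v] (cT e K) = cT e (link K v).
Proof.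
move=> c; have cl := cT_closed ei c; apply/fsetP => X; rewrite lkE //; apply/andP/cTP.
  move=> [d h]; have /cTP[F FK eF] := h.
  have s : X `<=` tf e F by rewrite -eF; fs.
  exists [set v0 in F | e v0 \in X]; last exact: sub_tf.
  set G := [set v0 in F | e v0 \in X]; have eX : X = tf e G by exact: sub_tf.
  rewrite !inE; apply/and3P; split.
  - by rewrite -(mem_cT ei) -eX; apply: (cl _ _ h); fs.
  - by apply/negP => /andP[_ h']; move: d; fs.
  by rewrite -(mem_cT ei) tfU tf1 -eX.
move=> [G + ->]; rewrite !inE => /and3P[h1 h2 h3]; split.
  apply/fdisjointP => x /tfP[w wG ->]; rewrite inE (inj_eq ei).
  by apply: contraNneq h2 => <-.
by rewrite -tf1 -tfU mem_cT.
Qed.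
End Link.

Lemma cT_bd n (e : 'I_n.+1 -> T) : injective e -> cT e (simplex_bd n) = bd (tf e setT).
Proof.
move=> ei; apply/fsetP => X; rewrite bdE; apply/cTP/andP => [[F + ->]|[h1 h2]].
  by rewrite inE !tf_sub // subsetT subTset => h; split.
exists [set v in setT | e v \in X]; last exact: sub_tf.
rewrite inE; apply: contra h2 => /eqP h; by rewrite [X in _ `<=` X](sub_tf h1) h.
Qed.

Lemma simplex_bd_complex n : is_complex (simplex_bd n).
Proof.
move=> F G; rewrite !inE -!subTset => h s; apply: contra h => h; exact: subset_trans h s.
Qed.

Lemma simplex_bd0 n : set0 \in simplex_bd n.
Proof. by rewrite inE; apply/eqP => /setP/(_ ord0); rewrite !inE. Qed.

Lemma set0_cx (V : finType) (K : {set {set V}}) F : is_complex K -> F \in K -> set0 \in K.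
Proof. by move=> c FK; apply: c FK _; exact: sub0set. Qed.

Lemma sph_of_comb (V : finType) (K : {set {set V}}) (e : V -> T) n : injective e -> is_complex K ->
  set0 \in K -> comb_sphere n K -> sph n (cT e K).
Proof.
move=> ei c K0 h; exists (tf (@em 0 'I_n.+1) setT); first by rewrite card_tf ?cardsT ?card_ord //; exact: em_inj.
rewrite -cT_bd; last exact: em_inj.
apply: sq_of_PL => //; [exact: em_inj|exact: simplex_bd_complex|exact: simplex_bd0].
Qed.

Lemma comb_of_sph (V : finType) (K : {set {set V}}) (e : V -> T) n : injective e -> is_complex K ->
  sph n (cT e K) -> comb_sphere n K.
Proof.
move=> ei c [B cB h].
pose f (i : 'I_n.+1) : T := nth (0, 0) B i.
have fi : injective f.
  by move=> i j /eqP; rewrite nth_uniq ?fset_uniq ?cB // => /eqP/val_inj.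
have eB : tf f setT = B.
  apply/fsetP => x; apply/tfP/idP => [[i _ ->]|xB]; first by rewrite /f; apply: mem_nth; rewrite cB.
  have hi : (index x B < n.+1)%N by rewrite -cB index_mem.
  by exists (Ordinal hi) => //; rewrite /f /= nth_index.
apply: (PL_of_sq ei fi) => //; first exact: simplex_bd_complex.
by rewrite cT_bd // eB.
Qed.

(** The link of a larger face is a link in the link of one of its vertices, and spheres are
    manifolds. *)
Lemma mfd_of_vertices n K : closed K -> fset0 \in K ->
  (forall v, v \in vs K -> sph n (lk [fset v] K)) -> mfd n.+1 K.
Proof.
move=> cl K0 h; split=> // F FK /fset0Pn[v vF].
have vK : v \in vs K by apply/vsP; exists F.
have s := h _ vK; have [cl' _ m] := sph_mfd s.
have FL : F `\ v \in lk [fset v] K.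
  rewrite lkE //; apply/andP; split; first by fs.
  by have -> : v |` F `\ v = F by fs.
have cF : #|` F| = (#|` F `\ v|).+1 by rewrite [LHS](cardfsD1 v) vF.
rewrite cF subSS ltnS.
have eL : lk F K = lk (F `\ v) (lk [fset v] K).
  apply/fsetP => G; rewrite (lkE _ _ cl') (lkE _ _ cl) (lkE _ _ cl).
  have -> : [fset v] `|` (F `\ v `|` G) = F `|` G by fs.
  by apply/idP/idP => [/andP[d ->]|/and3P[d d' ->]]; rewrite andbT; [apply/andP; split|]; fs.
case: (eqVneq (F `\ v) fset0) => [e0|ne]; last by rewrite eL; exact: m.
rewrite eL e0 cardfs0 subn0; split=> //.
suff -> : lk fset0 (lk [fset v] K) = lk [fset v] K by [].
by apply/fsetP => G; rewrite (lkE _ _ cl') fset0U fdisjointX0.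
Qed.

Section FrozenMfd.
Variables (d : nat) (V : finType) (K : {set {set V}}) (e : V -> T).
Hypotheses (ei : injective e) (cm : closed_mfd d K).

Let c : is_complex K. Proof. by case: cm. Qed.

Lemma frozen_set0 : set0 \in K.
Proof. by case: cm => c' [v]; rewrite inE => vK _ _; exact: set0_cx vK. Qed.

Lemma frozen_mfd : mfd d.+1 (cT e K).
Proof.
apply: mfd_of_vertices; first exact: cT_closed.
  by rewrite -(tf0 e) mem_cT // frozen_set0.
move=> x; rewrite vs_cT // => /tfP[v vK ->]; rewrite lk_cT //.
apply: sph_of_comb => //; first exact: link_complex.
  by rewrite !inE setU0 frozen_set0 /=; move: vK; rewrite inE.
by case: cm => _ _ _; apply.
Qed.

Lemma frozen_vertex : exists v, v \in vs (cT e K).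
Proof. by case: cm => _ [v vK] _ _; exists (e v); rewrite vs_cT // mem_tf. Qed.

Lemma frozen_Conn : Conn (cT e K).
Proof.
move=> P hP u w; rewrite vs_cT // => /tfP[v vK ->] /tfP[v' v'K ->].
have [_ _ /(_ v v' vK v'K) /connectP[s hs ->] _] := cm; elim: s v {vK} hs => //= v1 s IH v /andP[h hs].
rewrite -(IH v1) //; apply: hP; have -> : [fset e v; e v1] = tf e [set v; v1] by rewrite tfU // !tf1.
by rewrite mem_cT.
Qed.
End FrozenMfd.

Lemma balanced_embed d (V : finType) (K : {set {set V}}) : balanced d K -> is_complex K ->
  exists2 e : V -> T, injective e & forall F, F \in cT e K -> colQ d F.
Proof.
move=> [k hk] c; pose e v : T := (nat_of_ord (k v), nat_of_ord (enum_rank v)).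
have ei : injective e by move=> v w [_ /val_inj/enum_rank_inj].
exists e => // _ /cTP[F FK ->]; split; last first.
  by move=> x /tfP[v _ ->]; rewrite /col /= -ltnS.
move=> _ _ /tfP[v vF ->] /tfP[w wF ->]; rewrite /col /= => /val_inj ek.
congr e; apply/eqP/negPn/negP => ne; have := hk v w; rewrite ek eqxx => h.
suff : false by []; apply: h => //; apply: c FK _; by rewrite subUset !sub1set vF.
Qed.

Local Notation vv X := (fun x : vs X => fsval x).

Section Frz.
Variables (X : cplx).
Hypothesis cl : closed X.

Lemma vv_inj : injective (vv X). Proof. exact: val_inj. Qed.

Lemma frz_complex : is_complex (frz X).
Proof. by move=> F G; rewrite !inE => h s; apply: (cl h); rewrite tf_sub //; exact: vv_inj. Qed.

Lemma cT_frz : cT (vv X) (frz X) = X.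
Proof.
apply/fsetP => Y; apply/cTP/idP => [[F + ->]|YX]; first by rewrite inE.
have eY : Y = tf (vv X) [set x in setT | fsval x \in Y].
  apply: sub_tf; apply/fsubsetP => y yY; have yX : y \in vs X by apply/vsP; exists Y.
  by apply/tfP; exists [` yX].
by exists [set x in setT | fsval x \in Y] => //; rewrite inE -eY.
Qed.

End Frz.

Section ToFrozenMfd.
Variables (V : finType) (K : {set {set V}}) (e : V -> T) (d : nat).
Hypotheses (ei : injective e) (c : is_complex K).

Lemma balanced_of_col : (forall F, F \in cT e K -> colQ d F) -> balanced d K.
Proof.
move=> h; exists (fun x => inord (col (e x))) => u v uv ne; have /h[r hc] : tf e [set u; v] \in cT e K by rewrite mem_cT.
have uF : e u \in tf e [set u; v] by rewrite mem_tf // !inE eqxx.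
have vF : e v \in tf e [set u; v] by rewrite mem_tf // !inE eqxx orbT.
apply: contra ne => /eqP/(congr1 (@nat_of_ord _)); rewrite /= !inordK ?ltnS ?hc // => /(r _ _ uF vF)/ei ->.
exact: eqxx.
Qed.

Lemma closed_mfd_of_mfd v : mfd d.+1 (cT e K) -> Conn (cT e K) -> v \in vs (cT e K) -> closed_mfd d K.
Proof.
move=> m cX vX; split=> //.
- by move: vX; rewrite vs_cT // => /tfP[w wK _]; exists w.
(* [Conn] is applied to reachability from [u], which is constant along edges. *)
- move=> u w uK wK; pose P (t : T) := if [pick x | e x == t] is Some x then connect (fun a b => [set a; b] \in K) u x else false.
  have PE x : P (e x) = connect (fun a b => [set a; b] \in K) u x.
    by rewrite /P; case: pickP => [y /eqP/ei ->//|/(_ x)]; rewrite eqxx.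
  have sym : connect_sym (fun a b => [set a; b] \in K).
    by apply: sym_connect_sym => a b; rewrite setUC.
  rewrite -PE -(cX P _ (e u)) ?PE ?connect0 ?vs_cT ?mem_tf // => a b ab.
  have aX : a \in vs (cT e K) by apply/vsP; exists [fset a; b]; rewrite // !inE eqxx.
  have bX : b \in vs (cT e K) by apply/vsP; exists [fset a; b]; rewrite // !inE eqxx orbT.
  move: aX bX ab; rewrite !vs_cT // => /tfP[x xK ->] /tfP[y yK ->].
  have -> : [fset e x; e y] = tf e [set x; y] by rewrite tfU // !tf1.
  rewrite mem_cT // !PE => h; rewrite !(sym u); apply: (same_connect sym); exact: connect1.
move=> x xK; apply: (comb_of_sph ei); first exact: link_complex.
by rewrite -lk_cT //; apply: (lk_vertex m); rewrite vs_cT // mem_tf.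
Qed.
End ToFrozenMfd.

Lemma iso_of_cT (V W : finType) (K : {set {set V}}) (L : {set {set W}}) (eV : V -> T) (eW : W -> T) v0 :
  injective eV -> injective eW -> is_complex K -> is_complex L -> v0 \in vert K ->
  cT eV K = cT eW L -> iso_cx K L.
Proof.
move=> iV iW cK cL v0K E; have Ev : tf eV (vert K) = tf eW (vert L) by rewrite -!vs_cT // E.
have vW v : v \in vert K -> exists2 w, w \in vert L & eV v = eW w.
  by move=> vK; apply/tfP; rewrite -Ev mem_tf.
have [w0 w0L _] := vW _ v0K.
pose f v := if [pick w | eW w == eV v] is Some w then w else w0.
have fE v : v \in vert K -> eW (f v) = eV v.
  move=> /vW[w wL ev]; rewrite /f; case: pickP => [x /eqP//|/(_ w)]; by rewrite ev eqxx.
have fF (F : {set V}) : F \subset vert K -> tf eW (f @: F) = tf eV F.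
  move=> /subsetP s; apply/fsetP => x; apply/tfP/tfP => [[_ /imsetP[v vF ->] ->]|[v vF ->]].
    by exists v => //; rewrite fE // s.
  by exists (f v); rewrite ?imset_f // fE // s.
exists f; split.
- by move=> v w vK wK e; apply: iV; rewrite -!fE // e.
- by apply: (tf_inj iW); rewrite fF.
by move=> F FK; rewrite -(mem_cT iV) -(mem_cT iW) E fF.
Qed.

Lemma iso_cT (V W : finType) (K : {set {set V}}) (L : {set {set W}}) (eV : V -> T) (eW : W -> T) :
  injective eV -> injective eW -> is_complex K -> is_complex L -> iso_cx K L -> sq (cT eV K) (cT eW L).
Proof.
move=> iV iW cK cL [f [fi fv fF]].
pose g (t : T) : T := if [pick v | eV v == t] is Some v then eW (f v) else t.
have gE v : g (eV v) = eW (f v).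
  by rewrite /g; case: pickP => [w /eqP/iV -> //|/(_ v)]; rewrite eqxx.
have sv F : F \in K -> F \subset vert K.
  by move=> FK; apply/subsetP => v vF; rewrite inE; apply: cK FK _; rewrite sub1set.
have gF F : F \in K -> g @` tf eV F = tf eW (f @: F).
  move=> FK; apply/fsetP => x; apply/imfsetP/tfP => [[_ /= /tfP[v vF ->] ->]|[_ /imsetP[v vF ->] ->]].
    by exists (f v) => //; exact: imset_f.
  by exists (eV v); rewrite ?gE //=; rewrite mem_tf.
have -> : cT eW L = imf g (cT eV K).
  apply/fsetP => X; apply/cTP/imfP => [[G GL ->]|[_ /cTP[F FK ->] ->]].
    pose F := [set v in vert K | f v \in G].
    have eG : f @: F = G.
      apply/setP => w; apply/imsetP/idP => [[v + ->]|wG]; first by rewrite inE => /andP[].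
      have : w \in vert L by rewrite inE; apply: cL GL _; rewrite sub1set.
      by rewrite -fv => /imsetP[v vK ew]; exists v => //; rewrite inE vK -ew.
    have FK : F \in K by rewrite fF ?eG //; apply/subsetP => v; rewrite inE => /andP[].
    by exists (tf eV F); rewrite ?mem_cT // gF ?eG.
  by exists (f @: F); [rewrite -fF ?sv|rewrite gF].
apply: sq_iso; first exact: cT_closed.
by move=> a b; rewrite vs_cT // => /tfP[v vK ->] /tfP[w wK ->]; rewrite !gE => /iW/fi ->.
Qed.
End ManifoldBridge.
Import ManifoldBridge.

(** * Cross-flips are stellar equivalences *)

Module FlipsAreStellar.
Section Facets.
Variables (V : finType).
Implicit Types (K S : {set {set V}}) (F G H : {set V}).

Lemma facetP K F : reflect (F \in K /\ forall G, G \in K -> F \subset G -> G = F) (facet K F).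
Proof.
apply: (iffP andP) => -[FK h]; split=> //.
  by move=> G GK s; apply/eqP; move/forall_inP: h => /(_ G GK)/implyP; apply.
by apply/forall_inP => G GK; apply/implyP => s; apply/eqP; exact: h.
Qed.

Lemma facet_ex K F : F \in K -> exists2 G, facet K G & F \subset G.
Proof.
move=> FK; pose P G := (G \in K) && (F \subset G).
have P0 : P F by rewrite /P FK subxx.
case: (arg_maxnP (fun G => #|G|) P0) => G /andP[GK FG] h; exists G => //.
apply/facetP; split=> // H HK GH; apply/esym/eqP; rewrite eqEcard GH; apply: h.
by rewrite /P HK (subset_trans FG).
Qed.

Lemma genP S G : reflect (exists2 F, F \in S & G \subset F) (G \in gen S).
Proof. by rewrite inE; exact: exists_inP. Qed.

Lemma gen_complex S : is_complex (gen S).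
Proof. by move=> F G /genP[H HS s] s'; apply/genP; exists H => //; exact: subset_trans s' s. Qed.

Lemma facet_mfd n K F (e : V -> T) : injective e -> mfd n (cT e K) -> (exists v, v \in vs (cT e K)) ->
  facet K F = (F \in K) && (#|F| == n).
Proof.
move=> ei m [v vK]; apply/facetP/andP => [[FK h]|[FK /eqP cF]].
  have FT : tf e F \in cT e K by rewrite mem_cT.
  have [_ /cTP[G GK ->] [s cG]] := mfd_pure m vK FT; rewrite tf_sub // in s.
  by split=> //; rewrite -(h G GK s) -(card_tf ei) cG.
split=> // G GK s; apply/esym/eqP; rewrite eqEcard s cF -(card_tf ei) /=.
by apply: (mfd_card m); rewrite mem_cT.
Qed.
End Facets.

Lemma shell_list d (V : finType) (e : V -> T) (K : {set {set V}}) : injective e -> is_complex K ->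
  (forall F, facet K F -> #|F| = d.+1) -> shellable d K ->
  exists l, [/\ shl l, forall p, p \in l -> p.1 \in cT e K /\ #|` p.1| = d.+1 &
    forall G, gn l G = (G \in cT e K)].
Proof.
move=> ei c sz [s [us s0 sF sh]].
suff H j : (j <= size s)%N -> exists l, [/\ shl l, forall p, p \in l -> p.1 \in cT e K /\ #|` p.1| = d.+1 &
    forall G, gn l G = has (fun F => G `<=` tf e F) (take j s)].
  have [l [h1 h2 h3]] := H _ (leqnn _); exists l; split=> // G; rewrite h3 take_size.
  apply/hasP/cTP => [[F]|[F FK ->]].
    rewrite sF => /facetP[FK _] s'; exists [set v in F | e v \in G]; last exact: sub_tf.
    by apply: c FK _; apply/subsetP => v; rewrite inE => /andP[].
  by have [F' f' s'] := facet_ex FK; exists F'; rewrite ?sF ?tf_sub.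
elim: j => [|j IH] hj; first by exists [::]; split=> // G; rewrite take0.
have [l [h1 h2 h3]] := IH (ltnW hj); pose F := nth set0 s j.
have Fs : F \in s by exact: mem_nth.
have fF : facet K F by rewrite -sF.
have cF := sz _ fF; have [FK _] := facetP _ _ fF.
(* The vertices opposite to the ridges shared with earlier facets; purity says that these ridges
   generate the intersection. *)
pose C := [fset x in tf e F | gn l (tf e F `\ x)].
exists ((tf e F, C) :: l); split.
- split=> //; first by apply/fsubsetP => x; rewrite !inE => /andP[].
  move=> G GF; apply/idP/fsubsetPn => [gG|[x]]; last first.
    rewrite !inE => /andP[xF /hasP[p pl sp]] xG; apply/hasP; exists p => //.
    by apply: fsubset_trans sp; fs.
  have j0 : (0 < j)%N by rewrite lt0n; apply/eqP => j0; move: gG; rewrite h3 j0 take0.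
  have jj : (0 < j < size s)%N by rewrite j0.
  have [_ pu] := sh j jj; have eG := sub_tf GF; set G' := [set v in F | e v \in G] in eG.
  have inter (G0 : {set V}) : (G0 \in [set G0 : {set V} | (G0 \subset nth set0 s j) && [exists i : 'I_j, G0 \subset nth set0 s i]]) =
      (G0 \subset F) && gn l (tf e G0).
    rewrite inE h3 -/F; congr (_ && _); have szt : size (take j s) = j by rewrite size_takel // ltnW.
    apply/existsP/hasP => [[i si]|[F' F't si]].
      by exists (nth set0 s i); rewrite ?tf_sub // -(nth_take set0 (ltn_ord i)) mem_nth // szt.
    have hi : (index F' (take j s) < j)%N by rewrite -{2}szt index_mem.
    exists (Ordinal hi); rewrite /= -(nth_take set0 hi) nth_index //.
    by rewrite -(tf_sub ei).
  have : G' \in [set G0 : {set V} | (G0 \subset nth set0 s j) && [exists i : 'I_j, G0 \subset nth set0 s i]].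
    by rewrite inter -eG gG andbT; apply/subsetP => v; rewrite inE => /andP[].
  move=> /pu/andP[_ /exists_inP[H]]; rewrite inter => /andP[HF gH] /andP[GH /eqP cH].
  have : #|F :\: H| = 1%N by rewrite cardsDS // cF cH subSn // subnn.
  move=> /eqP/cards1P[w ew]; have wF : w \in F :\: H by rewrite ew inE.
  have eH : tf e H = tf e F `\ e w.
    apply/fsetP => x; rewrite in_fsetD1; apply/idP/andP => [/tfP[v vH ->]|[ne /tfP[v vF ev]]].
      rewrite mem_tf // (subsetP HF _ vH) (inj_eq ei); split=> //.
      by apply: contraTneq vH => ->; move: wF; rewrite inE => /andP[].
    subst x; rewrite mem_tf //; apply/negPn/negP => vH; case/negP: ne.
    have : v \in F :\: H by rewrite inE vH.
    by rewrite ew inE => /eqP ->.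
  exists (e w); first by rewrite !inE -eH gH mem_tf //; move: wF; rewrite inE => /andP[_ ->].
  rewrite eG mem_tf //; apply: contraL wF => wG; rewrite inE negb_and negbK.
  by rewrite (subsetP GH _ wG).
- by move=> p; rewrite inE => /orP[/eqP->|/h2//]; rewrite mem_cT // card_tf.
by move=> G; rewrite /= h3 (take_nth set0) // has_rcons.
Qed.

Section Cross.
Variables (d : nat) (e : CX d -> T).
Hypothesis ei : injective e.

Lemma crossP (F : {set CX d}) : reflect (forall i, (i, false) \in F -> (i, true) \in F -> False) (F \in cross d).
Proof.
rewrite inE; apply: (iffP forallP) => h i; first by move=> h1 h2; have := h i; rewrite h1 h2.
by apply/negP => /andP[]; exact: h.
Qed.

Lemma cross_complex : is_complex (cross d).
Proof. by move=> F G /crossP h /subsetP s; apply/crossP => i /s h1 /s; exact: h. Qed.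

(** The boundary of the cross-polytope on the first [k] pairs; each further pair is joined as two
    points ([crk_step]). *)
Definition crk k := [set F : {set CX d} in cross d | [forall x in F, (x.1 < k)%N]].

Lemma crk_step k (hk : (k < d.+1)%N) : let i := Ordinal hk in
  cT e (crk k.+1) = cone_bd [fset e (i, false); e (i, true)] (cT e (crk k)).
Proof.
move=> i; set E := [fset _; _]; apply/fsetP => Y; rewrite cone_bdE; apply/cTP/andP.
  move=> [F + ->]; rewrite inE => /andP[Fc /forall_inP hF]; split.
    apply/negP => /fsubsetP s.
    have h b : (i, b) \in F by rewrite -(mem_tf ei); apply: s; rewrite !inE; case: b; rewrite eqxx ?orbT.
    exact: (elimT (crossP F) Fc i (h false) (h true)).
  have -> : tf e F `\` E = tf e [set x in F | e x \notin E].
    apply/fsetP => y; rewrite inE; apply/andP/tfP => [[yE /tfP[x xF ey]]|[x + ->]].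
      by subst y; exists x => //; rewrite inE xF.
    by rewrite inE => /andP[xF xE]; rewrite mem_tf.
  rewrite mem_cT // inE; apply/andP; split.
    by apply: (cross_complex Fc); apply/subsetP => x; rewrite inE => /andP[].
  apply/forall_inP => -[j b]; rewrite inE => /andP[xF]; rewrite !inE !(inj_eq ei) !xpair_eqE negb_or.
  move=> h; have := hF _ xF; rewrite /= ltnS leq_eqVlt => /orP[/eqP jk|//].
  have ej : j = i by apply: val_inj.
  by move: h; rewrite ej eqxx /=; case: (b).
move=> [nE /cTP[F + eF]]; rewrite inE => /andP[/crossP Fc /forall_inP hF].
pose F' := F :|: [set x | (e x \in E) && (e x \in Y)].
have memF x : (x \in F') = (x \in F) || (e x \in E) && (e x \in Y) by rewrite in_setU inE.
have notE x : x \in F -> e x \notin E.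
  by move=> xF; have : e x \in tf e F by [rewrite mem_tf]; rewrite -eF inE => /andP[].
have Ei x : e x \in E -> x.1 = i by case: x => j b; rewrite !inE !(inj_eq ei) => /orP[] /eqP[-> _].
have eY : Y = tf e F'.
  apply/fsetP => y; apply/idP/tfP => [yY|[x + ->]].
    case: (boolP (y \in E)) => yE.
      have [x ex] : exists x, y = e x by move: yE; rewrite !inE => /orP[] /eqP ->; eexists.
      by exists x => //; rewrite memF -ex yY yE orbT.
    have : y \in tf e F by rewrite -eF inE yE.
    by move=> /tfP[x xF ->]; exists x => //; rewrite memF xF.
  rewrite memF => /orP[xF|/andP[_ ->//]].
  by have : e x \in tf e F; [rewrite mem_tf|rewrite -eF inE => /andP[]].
exists F' => //; rewrite inE; apply/andP; split.
  apply/crossP => j; rewrite !memF => /orP[h1|/andP[h1 h1']] /orP[h2|/andP[h2 h2']].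
  - exact: Fc h1 h2.
  - by have /= ji := Ei _ h2; case/negP: (notE _ h1); rewrite ji !inE eqxx.
  - by have /= ji := Ei _ h1; case/negP: (notE _ h2); rewrite ji !inE eqxx orbT.
  have /= ji := Ei _ h1; subst j; case/negP: nE; apply/fsubsetP => y.
  by rewrite !inE => /orP[] /eqP ->.
apply/forall_inP => x; rewrite memF => /orP[/hF/leqW//|/andP[/Ei -> _]]; exact: ltnSn.
Qed.

Lemma sph_cross : sph d.+1 (cT e (cross d)).
Proof.
have H k : (k <= d.+1)%N -> sph k (cT e (crk k)).
  elim: k => [_|k IH hk].
    have -> : cT e (crk 0) = [fset fset0].
      apply/fsetP => X; rewrite in_fset1; apply/cTP/eqP => [[F + ->]|->].
        rewrite inE => /andP[_ /forall_inP h]; suff -> : F = set0 by rewrite tf0.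
        by apply/setP => x; rewrite inE; apply/negP => /h.
      exists set0; rewrite ?tf0 // inE; apply/andP; split; first by apply/crossP => i; rewrite inE.
      by apply/forall_inP => x; rewrite inE.
    exists [fset (0, 0)]; [by rewrite cardfs1|rewrite bd1 ?cardfs1 //; exact: sq_refl].
  rewrite (crk_step hk); set i := Ordinal hk.
  have ne : e (i, false) != e (i, true) by rewrite (inj_eq ei) xpair_eqE andbF.
  have -> : k.+1 = (k + #|` [fset e (i, false); e (i, true)]|).-1%N by rewrite cardfs2 ne addn2.
  apply: sph_join; [exact: IH (ltnW hk)|by rewrite -cardfs_gt0 cardfs2|].
  apply/fdisjointP => x xE; apply/negP => /vsP[_ /cTP[F + ->] /tfP[y yF ex]].
  rewrite inE => /andP[_ /forall_inP /(_ y yF)].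
  move: xE; rewrite ex !inE !(inj_eq ei) => /orP[] /eqP ->; by rewrite /= ltnn.
have -> : cross d = crk d.+1.
  apply/setP => F; rewrite [RHS]inE andb_idr // => _; apply/forall_inP => x _; exact: ltn_ord.
exact: H.
Qed.
End Cross.

Lemma shok_sub Y Z l : shok Y [fset fset0] l -> (forall p, p \in l -> p.1 \in Z) ->
  (forall p H, p \in l -> H \in Z -> p.1 `\` p.2 `<=` H -> H \in Y) -> shok Z [fset fset0] l.
Proof.
elim: l => //= -[F C] l IH [[h1 h2 h3 h4 h5] [h6 h7 h8]] hZ hY; split; split=> //.
- by move=> n; rewrite in_fset1 => /eqP ->; rewrite fsetU0; exact: hZ (mem_head _ _).
- by move=> H HZ AH; apply: h7 => //; exact: (hY (F, C)) (mem_head _ _) HZ AH.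
apply: IH => // [p pl|p H pl]; [apply: hZ|apply: hY]; by rewrite inE pl orbT.
Qed.

Lemma cT_gen (V : finType) (e : V -> T) (S : {set {set V}}) H : injective e ->
  (H \in cT e (gen S)) <-> exists2 F, F \in S & H `<=` tf e F.
Proof.
move=> ei; split=> [/cTP[G /genP[F FS s] ->]|[F FS s]]; first by exists F; rewrite ?tf_sub.
apply/cTP; exists [set v in F | e v \in H]; last exact: sub_tf.
by apply/genP; exists F => //; apply/subsetP => v; rewrite inE => /andP[].
Qed.

Lemma noA_v X l v G : v \notin vs X -> (forall p, p \in l -> p.1 \in X) -> noA l (G `\ v) = noA l G.
Proof.
move=> vX hl; apply: eq_in_all => -[F C] pl /=; congr (~~ _).
have /= /sub_vs := hl _ pl; by move=> h; apply/idP/idP; fs.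
Qed.

Section Flip.
Variables (n : nat) (V : finType) (K : {set {set V}}) (D0 : {set {set CX n.+1}}) (phi : CX n.+1 -> V).
Variable (e : V + CX n.+1 -> T).
Hypotheses (ei : injective e) (cm : closed_mfd n.+1 K) (ok_ : flip_ok K D0 phi).

Let psi (x : CX n.+1) := if x \in vert D0 then @inl V (CX n.+1) (phi x) else inr x.
Let eV := e \o inl.
Let ep := e \o psi.
Let iV : injective eV. Proof. by move=> v w h; have [] := ei h. Qed.
Let ip : injective ep.
Proof.
case: ok_ => _ [_ _ pi _ _] x y h; have := ei h; rewrite /= /psi; case: ifP => xD; case: ifP => yD // -[] //.
by apply: pi.
Qed.
Let cK : is_complex K. Proof. by case: cm. Qed.
Let cD : is_complex D0. Proof. by case: ok_ => -[]. Qed.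
Let X := cT eV K.
Let Cr := cT ep (cross n.+1).
Let D := cT ep D0.
Let Co := cT ep (cocx D0).
Let mX : mfd n.+2 X. Proof. exact: frozen_mfd. Qed.
Let mC : mfd n.+2 Cr. Proof. apply: sph_mfd; exact: sph_cross. Qed.
Let cC : Conn Cr. Proof. exact: Conn_sph (sph_cross ip). Qed.
Let clX : closed X. Proof. exact: cT_closed. Qed.
Let clC : closed Cr. Proof. apply: cT_closed => //; exact: cross_complex. Qed.
Let uC : exists v, v \in vs Cr. Proof. exact: sph_vertex (sph_cross ip). Qed.
Let uX : exists v, v \in vs X. Proof. exact: (frozen_vertex iV cm). Qed.

Let subD G : G \in D0 -> G \subset vert D0.
Proof. by move=> GD; apply/subsetP => x xG; rewrite inE; apply: cD GD _; rewrite sub1set. Qed.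

Let tfD (G : {set CX n.+1}) : G \subset vert D0 -> tf ep G = tf eV (phi @: G).
Proof.
move=> /subsetP s; apply/fsetP => y; apply/tfP/tfP => [[x xG ->]|[_ /imsetP[x xG ->] ->]].
  by exists (phi x); rewrite ?imset_f // /ep /= /psi s.
by exists x => //; rewrite /ep /= /psi s.
Qed.

Let DX : D `<=` X.
Proof.
apply/fsubsetP => _ /cTP[G GD ->]; rewrite tfD ?subD // mem_cT //.
by case: ok_ => _ [_ _ _ h _]; exact: h.
Qed.

Let DC : D `<=` Cr.
Proof.
by apply/fsubsetP => _ /cTP[G GD ->]; rewrite mem_cT //; case: ok_ => -[_ /subsetP h _ _] _; exact: h.
Qed.

Let fK F : facet K F = (F \in K) && (#|F| == n.+2).
Proof. exact: (facet_mfd _ iV). Qed.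
Let fC F : facet (cross n.+1) F = (F \in cross n.+1) && (#|F| == n.+2).
Proof. exact: (facet_mfd _ ip). Qed.

Let szD F : facet D0 F -> #|F| = n.+2.
Proof.
move=> /facetP[FD h]; case: ok_ => -[_ _ _ [_ pu]] _.
by have /andP[_ /exists_inP[H HD /andP[s /eqP <-]]] := pu _ FD; rewrite (h H).
Qed.

Let coP H : H \in Co <-> exists2 G, G \in Cr & [/\ #|` G| = n.+2, G \notin D & H `<=` G].
Proof.
rewrite /Co cT_gen //; split=> [[F + s]|[_ /cTP[F FC ->] [+ + s]]].
  rewrite inE fC => /andP[/andP[FC /eqP cF] FD]; exists (tf ep F); rewrite ?mem_cT //.
  by rewrite card_tf // mem_cT.
by rewrite card_tf // mem_cT // => cF FD; exists F => //; rewrite inE fC FC cF eqxx.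
Qed.

Let szC F : facet (cocx D0) F -> #|F| = n.+2.
Proof.
move=> /facetP[FC h]; have /genP[G + s] := FC; rewrite inE fC => /andP[/andP[GC /eqP cG] GD].
rewrite -(h G) //; apply/genP; exists G => //; by rewrite inE fC GC cG eqxx.
Qed.

Let Out H := exists2 G, G \in X & [/\ #|` G| = n.+2, G \notin D & H `<=` G].

Lemma flip_resultP H : H \in cT e (flip_result K D0 phi) <-> Out H \/ H \in Co.
Proof.
have inlE (F : {set V}) : tf e [set @inl V (CX n.+1) v | v in F] = tf eV F.
  apply/fsetP => y; apply/tfP/tfP => [[_ /imsetP[v vF ->] ->]|[v vF ->]]; first by exists v.
  by exists (inl v) => //; exact: imset_f.
have psiE (G : {set CX n.+1}) : tf e (psi @: G) = tf ep G.
  apply/fsetP => y; apply/tfP/tfP => [[_ /imsetP[v vF ->] ->]|[v vF ->]]; first by exists v.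
  by exists (psi v) => //; exact: imset_f.
have DE F : tf eV F \in D = (F \in [set phi @: G | G : {set CX n.+1} in D0]).
  apply/cTP/imsetP => [[G GD]|[G GD ->]].
    by rewrite tfD ?subD // => /(tf_inj iV) ->; exists G.
  by exists G; rewrite ?tfD ?subD.
rewrite cT_gen //; split=> [[_ /setUP[/imsetP[F + ->]|/imsetP[G + ->]] s]|].
- rewrite inE fK inlE in s * => /andP[/andP[FK /eqP cF] FD]; left; exists (tf eV F); rewrite ?mem_cT //.
  by rewrite card_tf // DE.
- rewrite inE -/psi psiE fC in s * => /andP[/andP[GC /eqP cG] GD]; right; apply/coP.
  by exists (tf ep G); rewrite ?mem_cT // card_tf // mem_cT.
case=> [[_ /cTP[F FK ->] [+ + s]]|/coP[_ /cTP[F FC ->] [+ + s]]].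
  rewrite card_tf // DE => cF FD; exists [set @inl V (CX n.+1) v | v in F]; last by rewrite inlE.
  by apply/setUP; left; apply: imset_f; rewrite inE fK FK cF eqxx.
rewrite card_tf // mem_cT // => cF FD; exists (psi @: F); last by rewrite psiE.
by apply/setUP; right; apply: imset_f; rewrite inE fC FC cF eqxx.
Qed.

Lemma flip_sq : sq X (cT e (flip_result K D0 phi)).
Proof.
set Z := cT e _.
have clZ : closed Z by apply: cT_closed => //; exact: gen_complex.
have [ok1 [ok2 ok3 _ _ induced]] := ok_; have [_ _ neD [[F0 F0D] puD]] := ok1.
have [l1 [sh1 m1 g1]] := shell_list ip cD szD ok2.
have [l2 [sh2 m2 g2]] := shell_list ip (@gen_complex _ _) szC ok3.
have CoC : Co `<=` Cr by apply/fsubsetP => H /coP[G GC [_ _ s]]; exact: clC GC s.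
have l1c p : p \in l1 -> #|` p.1| = n.+2 by move=> /m1[].
have l2c p : p \in l2 -> #|` p.1| = n.+2 by move=> /m2[].
have l1D p : p \in l1 -> p.1 \in D by move=> /m1[].
have l2C p : p \in l2 -> p.1 \in Co by move=> /m2[].
have [xC xCv] := uC; have [xX xXv] := uX.
have [G0 G0C [c0 n0]] : exists2 G, G \in Cr & #|` G| = n.+2 /\ G \notin D.
  have /subsetPn[F FC FD] : ~~ (cross n.+1 \subset D0).
    by apply: contra neD => h; rewrite eqEsubset h; case: ok1 => _ ->.
  have FT : tf ep F \in Cr by rewrite mem_cT.
  have [G GC [s cG]] := mfd_pure mC xCv FT; exists G => //; split=> //.
  by apply: contra FD => GD; rewrite -(mem_cT ip); apply: (cT_closed ip cD) GD s.
(* [D] is not all of [K]. Otherwise [K] would be a manifold inside the boundary of the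
   cross-polytope, hence equal to it by rigidity, while [D] misses the facet [G0]. *)
have [G1 G1X [c1 n1]] : exists2 G, G \in X & #|` G| = n.+2 /\ G \notin D.
  case: (pselect (exists2 G, G \in X & #|` G| = n.+2 /\ G \notin D)) => // no; exfalso.
  have XD : X `<=` D.
    apply/fsubsetP => H HX; have [G GX [s cG]] := mfd_pure mX xXv HX.
    apply: (cT_closed ip cD) (_ : G \in D) s; apply/negPn/negP => GD; apply: no; by exists G.
  have XC : X = Cr.
    by apply: (mfd_eq mX mC _ cC xXv); apply: fsubset_trans XD DC.
  by case/negP: n0; apply: (fsubsetP XD); rewrite XC.
have [G2 G2D c2] : exists2 G, G \in D & #|` G| = n.+2.
  have /andP[_ /exists_inP[H HD /andP[_ /eqP cH]]] := puD _ F0D.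
  by exists (tf ep H); rewrite ?mem_cT // card_tf.
have notCo G : G \in D -> #|` G| = n.+2 -> G \notin Co.
  move=> GD cG; apply/negP => /coP[G' G'C [cG' nG' s]]; case/negP: nG'.
  have -> : G' = G by apply/esym/eqP; rewrite eqEfcard s cG cG' leqnn.
  done.
have s1X : shok X [fset fset0] l1.
  apply: (shok_of_shl mX xXv (frozen_Conn iV cm) l1c sh1 _ G1X c1); last by rewrite g1.
  by move=> p /l1D; exact: (fsubsetP DX).
have s1C : shok Cr [fset fset0] l1.
  apply: (shok_of_shl mC xCv cC l1c sh1 _ G0C c0); last by rewrite g1.
  by move=> p /l1D; exact: (fsubsetP DC).
have s2C : shok Cr [fset fset0] l2.
  apply: (shok_of_shl mC xCv cC l2c sh2 _ (fsubsetP DC _ G2D) c2); last by rewrite g2 notCo.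
  by move=> p /l2C; exact: (fsubsetP CoC).
(* In the cross-polytope the faces that avoid the interior of [D] form the complement, by [noA_gen];
   [n2C] is the same with the two parts exchanged. *)
have n1C H : H \in Cr -> noA l1 H = (H \in Co).
  move=> HC; apply/idP/idP => [nH|/coP[G GC [cG nG s]]].
    by have [G GC [s cG _]] := noA_gen mC xCv l1c s1C HC nH; rewrite g1 => nG; apply/coP; exists G.
  by apply: noA_sub s; apply: (shok_noA s1C GC); rewrite g1.
have n2C H : H \in Cr -> noA l2 H = (H \in D).
  move=> HC; apply/idP/idP => [nH|HD].
    have [G GC [s cG _]] := noA_gen mC xCv l2c s2C HC nH; rewrite g2 => nG.
    apply: (cT_closed ip cD) (_ : G \in D) s; apply: contraNT nG => GD; apply/coP; by exists G.
  have [F FD eH] := cTP _ _ _ HD; have /andP[_ /exists_inP[F' F'D /andP[s /eqP cF']]] := puD _ FD.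
  have F'D' : tf ep F' \in D by rewrite mem_cT.
  apply: (noA_sub (G := tf ep F')); last by rewrite eH tf_sub.
  apply: (shok_noA s2C); first exact: (fsubsetP DC).
  by rewrite g2 notCo // card_tf.
have n1X H : H \in X -> noA l1 H <-> Out H.
  move=> HX; split=> [nH|[G GX [cG nG s]]].
    by have [G GX [s cG _]] := noA_gen mX xXv l1c s1X HX nH; rewrite g1 => nG; exists G.
  by apply: noA_sub s; apply: (shok_noA s1X GX); rewrite g1.
have OutX H : Out H -> H \in X by move=> [G GX [_ _ s]]; exact: clX GX s.
(* Here it enters that [D] is induced: a face of [K] that also belongs to [Co] has all its vertices
   in [D]. *)
have OutCo H : Out H -> H \in Co -> H \in D.
  move=> /OutX HX HC; have [F FK eH] := cTP _ _ _ HX; have [G GC eG] := cTP _ _ _ HC.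
  have s : F \subset phi @: vert D0.
    apply/subsetP => v vF; have : eV v \in H by rewrite eH mem_tf.
    rewrite eG => /tfP[x xG]; rewrite /eV /ep /= => /ei; rewrite /psi; case: ifP => // xD [->].
    exact: imset_f.
  have [G' G'D eF] := induced _ FK s.
  by apply/cTP; exists G' => //; rewrite tfD ?subD // -eF.
have A2 p : p \in l2 -> p.1 `\` p.2 \notin D.
  move=> pl; apply/negP => hD; have := n2C _ (fsubsetP DC _ hD); rewrite hD => /allP/(_ p pl).
  by rewrite fsubset_refl.
have A2Co p : p \in l2 -> p.1 `\` p.2 \in Co.
  by move=> pl; apply: (cT_closed ip (@gen_complex _ _) (l2C _ pl)); exact: fsubsetDl.
have Out_A2 p H : p \in l2 -> Out H -> ~~ (p.1 `\` p.2 `<=` H).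
  move=> pl [G GX [cG nG s]]; apply: contra (A2 _ pl) => s'.
  by apply: OutCo (A2Co _ pl); exists G => //; split=> //; exact: fsubset_trans s' s.
have s2Z : shok Z [fset fset0] l2.
  apply: (shok_sub s2C) => [p /l2C h|p H pl /flip_resultP[/(Out_A2 _ _ pl)/negbTE ->//|h] _].
    by apply/flip_resultP; right.
  exact: (fsubsetP CoC).
have [v hv] := fresh_vertex (vs X `|` vs Z).
have vX : v \notin vs X by fs.
have vZ : v \notin vs Z by fs.
have q1 : sq X (coneY X [fset fset0] v l1).
  by apply: coneY_closed_sq => //; [exact: closed_fset0|rewrite in_fset1].
have q2 : sq Z (coneY Z [fset fset0] v l2).
  by apply: coneY_closed_sq => //; [exact: closed_fset0|rewrite in_fset1].
suff E : coneY X [fset fset0] v l1 = coneY Z [fset fset0] v l2.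
  by apply: (sq_trans q1); rewrite E; exact: sq_sym.
apply/fsetP => H; rewrite !coneYE !gnN_fset0 g1 g2; case: ifP => vH.
  rewrite -(noA_v (X := X) _ vX); last by move=> p /l1D; exact: (fsubsetP DX).
  rewrite -(noA_v (l := l2) (X := Z) _ vZ); last by move=> p /l2C h; apply/flip_resultP; right.
  apply/andP/andP => -[h1 h2].
    have hC := fsubsetP DC _ h1; split; first by rewrite -n1C.
    by rewrite n2C.
  have hC := fsubsetP CoC _ h1; split; first by rewrite -n2C.
  by rewrite n1C.
apply/andP/andP => [[HX /(n1X _ HX) oH]|[/flip_resultP[oH|HC] nH]].
- split; first by apply/flip_resultP; left.
  by apply/allP => p pl; exact: Out_A2.
- by have HX := OutX _ oH; split=> //; apply/(n1X _ HX).
have hC := fsubsetP CoC _ HC; rewrite n2C // in nH; split; first exact: (fsubsetP DX).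
by rewrite n1C.
Qed.
End Flip.
End FlipsAreStellar.
Import FlipsAreStellar.

(** * Chains of cross-flips *)

Module FlipChains.
(* [iso_cx] ignores the sets of [K] that contain a non-vertex; [clean] removes them. *)
Definition clean (V : finType) (K : {set {set V}}) := [set F in K | F \subset vert K].

Lemma clean_id (V : finType) (K : {set {set V}}) : is_complex K -> clean K = K.
Proof.
move=> c; apply/setP => F; rewrite inE andb_idr // => FK; apply/subsetP => v vF.
by rewrite inE; apply: c FK _; rewrite sub1set.
Qed.

Lemma vert_clean (V : finType) (K : {set {set V}}) : vert (clean K) = vert K.
Proof. by apply/setP => v; rewrite !inE sub1set inE andbb. Qed.

Lemma iso_clean (V W : finType) (K : {set {set V}}) (L : {set {set W}}) :
  iso_cx K L -> iso_cx (clean K) (clean L).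
Proof.
move=> [f [fi fv fF]]; exists f; rewrite !vert_clean; split=> // F FK.
by rewrite !inE FK andbT fF // -fv imsetS // andbT.
Qed.

Lemma iso_refl (V : finType) (K : {set {set V}}) : iso_cx K K.
Proof. by exists id; split=> // [|F _]; rewrite imset_id. Qed.

Lemma iso_complex (V W : finType) (K : {set {set V}}) (L : {set {set W}}) :
  iso_cx K L -> is_complex K -> is_complex (clean L).
Proof.
move=> [f [fi fv fF]] c F G; rewrite !inE => /andP[FL sF] s; have sG := subset_trans s sF.
rewrite sG andbT.
pose pre (H : {set W}) := [set v in vert K | f v \in H].
have preS H : pre H \subset vert K by apply/subsetP => v; rewrite inE => /andP[].
have preE (H : {set W}) : H \subset vert L -> f @: pre H = H.
  move=> /subsetP sH; apply/setP => w; apply/imsetP/idP => [[v + ->]|wH].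
    by rewrite inE => /andP[].
  by have := sH _ wH; rewrite -fv => /imsetP[v vK ew]; exists v => //; rewrite inE vK -ew.
rewrite -(preE G) // -fF //; apply: (c (pre F)); first by rewrite fF // preE.
by apply/subsetP => v; rewrite !inE => /andP[-> /(subsetP s)].
Qed.

Lemma flips_sq n P Q : flips n.+1 P Q -> is_complex (clean (pK P)) -> is_complex (clean (pK Q)) ->
  forall (eP : pvt P -> T) (eQ : pvt Q -> T), injective eP -> injective eQ ->
  sq (cT eP (clean (pK P))) (cT eQ (clean (pK Q))).
Proof.
elim=> {P Q} [P Q iso|P Q S [_ [cm [D0 [phi [ok_ iso]]]]] _ IH] cP cQ eP eQ iP iQ.
  by apply: iso_cT => //; exact: iso_clean.
have c : is_complex (pK P) by case: cm.
have cQ' := iso_complex iso (@gen_complex _ _).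
have iE := @em_inj 0 (pvt P + CX n.+1)%type; have iE0 := @em_inj 0 (pvt Q).
apply: sq_trans (IH cQ' cQ _ eQ iE0 iQ); rewrite clean_id //.
have iV : injective (@em 0 (pvt P + CX n.+1)%type \o inl) by move=> v w h; have [] := iE _ _ h.
apply: (sq_trans (iso_cT iP iV c c (iso_refl _))).
apply: (sq_trans (flip_sq iE cm ok_)).
apply: iso_cT => //; first exact: gen_complex.
by have := iso_clean iso; rewrite [clean (flip_result _ _ _)]clean_id //; exact: gen_complex.
Qed.

Theorem PL_of_flips n (V W : finType) (K : {set {set V}}) (L : {set {set W}}) :
  is_complex K -> is_complex L -> flips n.+1 (Pcx K) (Pcx L) -> PL_homeo K L.
Proof.
move=> cK cL h; have iV := @em_inj 0 V; have iW := @em_inj 0 W.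
apply: (PL_of_sq iV iW) => //.
by have := flips_sq h; rewrite /= !clean_id //; apply.
Qed.
End FlipChains.
Import FlipChains.

(** * From shelling lists to shellability *)

Module ShellingLists.
Lemma sph_dim n m S : sph n S -> sph m S -> n = m.
Proof.
move=> h1 h2; apply/eqP; rewrite eqn_leq; apply/andP; split.
  by have [F FS <-] := sph_pure h1; exact: mfd_card (sph_mfd h2) FS.
by have [F FS <-] := sph_pure h2; exact: mfd_card (sph_mfd h1) FS.
Qed.

Lemma bish_anti l2 F C l1 : bish (l2 ++ (F, C) :: l1) -> ~~ gn l1 F /\ ~~ gn l2 F.
Proof.
move=> h; split; last by rewrite (bish_later h) // negbK fsubsetDl.
by case: h => /shl_catr /= [sC h _] _; rewrite h // sC.
Qed.

Lemma bish_max l F C G : bish l -> (F, C) \in l -> gn l G -> F `<=` G -> G = F.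
Proof.
move=> h /path.splitPr hin; case: hin h => l2 l1 h; rewrite gn_cat /= => g FG.
have [n1 n2] := bish_anti h.
have up l0 : gn l0 G -> gn l0 F by move=> /hasP[p pl s]; apply/hasP; exists p => //; exact: fsubset_trans s.
case/or3P: g => [/up|GF|/up]; rewrite ?(negbTE n1) ?(negbTE n2) //.
by apply/eqP; rewrite eqEfsubset GF.
Qed.

(** The intersection with the earlier facets is generated by the ridges [F \ c] with [c] in the
    restriction. *)
Lemma shellable_of_list d (V : finType) (e : V -> T) (K : {set {set V}}) l : injective e ->
  shl l -> (forall p, p \in l -> #|` p.1| = d.+1) -> l != [::] ->
  (forall G, gn l G = (G \in cT e K)) -> shellable d K.
Proof.
move=> ei sl cl l0 gl.
pose pre (X : face) := [set v | e v \in X].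
have preK p : p \in l -> tf e (pre p.1) = p.1.
  move=> pl; have /cTP[F FK eF] : p.1 \in cT e K by rewrite -gl; apply/hasP; exists p.
  by rewrite eF; congr tf; apply/setP => v; rewrite inE mem_tf.
have cpre p : p \in l -> #|pre p.1| = d.+1 by move=> pl; rewrite -(card_tf ei) preK // cl.
pose s (l : seq (face * face)) := rev [seq pre p.1 | p <- l].
have sc p l' : s (p :: l') = rcons (s l') (pre p.1) by rewrite /s /= rev_cons.
have mems l' F : {subset l' <= l} -> (F \in s l') -> exists2 p, p \in l' & F = pre p.1.
  by move=> _; rewrite mem_rev => /mapP[p pl ->]; exists p.
have preKp p : p \in l -> pre p.1 \in K.
  by move=> pl; rewrite -(mem_cT ei) preK // -gl; apply/hasP; exists p.
have H l' : {subset l' <= l} -> shl l' -> uniq (s l') /\ forall j, 0 < j < size (s l') ->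
    pure_sz [set G : {set V} | (G \subset nth set0 (s l') j) && [exists i : 'I_j, G \subset nth set0 (s l') i]] d.
  elim: l' => [|[F C] l' IH] sub /= ; first by split=> // j; rewrite /s /= ltn0 andbF.
  move=> [sC hF sl']; have Fl : (F, C) \in l by apply: sub; rewrite mem_head.
  have sub' : {subset l' <= l} by move=> p pl; apply: sub; rewrite inE pl orbT.
  have [u' h'] := IH sub' sl'; rewrite sc /=; have /= eF := preK _ Fl.
  have gnE G : gn l' (tf e G) = has (fun X : {set V} => G \subset X) (s l').
    rewrite /s has_rev has_map; apply: eq_in_has => p pl /=.
    by rewrite -{1}(preK p (sub' _ pl)) tf_sub.
  split.
    rewrite rcons_uniq u' andbT; apply/negP => h.
    have : gn l' F by rewrite -eF gnE; apply/hasP; exists (pre F).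
    by rewrite hF // sC.
  move=> j; rewrite size_rcons ltnS => /andP[j0]; rewrite leq_eqVlt => /orP[/eqP ej|lt]; last first.
    have := h' j; rewrite j0 lt => /(_ isT).
    suff -> : [set G : {set V} | (G \subset nth set0 (rcons (s l') (pre F)) j) && [exists i : 'I_j, G \subset nth set0 (rcons (s l') (pre F)) i]]
      = [set G : {set V} | (G \subset nth set0 (s l') j) && [exists i : 'I_j, G \subset nth set0 (s l') i]] by [].
    apply/setP => G; rewrite !inE nth_rcons lt; congr (_ && _); apply: eq_existsb => i.
    by rewrite nth_rcons (ltn_trans (ltn_ord i) lt).
  subst j; have inE' (G : {set V}) : (G \in [set G : {set V} | (G \subset nth set0 (rcons (s l') (pre F)) (size (s l'))) && [exists i : 'I_(size (s l')), G \subset nth set0 (rcons (s l') (pre F)) i]])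
     = (tf e G `<=` F) && gn l' (tf e G).
    rewrite inE nth_rcons ltnn eqxx -(tf_sub ei) eF; congr (_ && _); rewrite gnE.
    apply/existsP/hasP => [[i si]|[X Xs GX]].
      have hi : (i < size (s l'))%N by exact: ltn_ord.
      by exists (nth set0 (s l') i); [exact: mem_nth|move: si; rewrite nth_rcons hi].
    have hi : (index X (s l') < size (s l'))%N by rewrite index_mem.
    by exists (Ordinal hi); rewrite /= nth_rcons hi nth_index.
  have cF : #|` F| = d.+1 := cl _ Fl.
  have ridge c : c \in C -> exists2 H, tf e H = F `\ c & #|H| = d.
    move=> cC; have cF' : c \in F by fs.
    exists [set v in pre F | e v \in F `\ c].
      apply/esym; apply: sub_tf; rewrite eF; fs.
    rewrite -(card_tf ei) -sub_tf ?eF; last by fs.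
    by have := cardfsD1 c F; rewrite cF' cF => -[].
  split.
    exists set0; rewrite inE' tf0 fsub0set /=.
    have : l' != [::] by case: (l') j0.
    by case: (l') => // p l'' _; apply/hasP; exists p; rewrite ?mem_head ?fsub0set.
  move=> G; rewrite inE' => /andP[GF]; rewrite hF // => /fsubsetPn[c cC cG].
  have [H eH cH] := ridge c cC.
  have GH : G \subset H by rewrite -(tf_sub ei) eH; fs.
  apply/andP; split; first by rewrite -cH subset_leq_card.
  apply/exists_inP; exists H; last by rewrite GH cH eqxx.
  by rewrite inE' eH hF; [apply/andP; split; fs|fs].
have [us hs] := H l (fun _ h => h) sl; exists (s l); split=> //.
  by rewrite -size_eq0 size_rev size_map size_eq0.
move=> F; apply/idP/facetP.
  rewrite mem_rev => /mapP[p pl ->]; split; first exact: preKp.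
  move=> G GK sG; have : gn l (tf e G) by rewrite gl mem_cT.
  case/hasP => p' p'l GF; apply/esym/eqP; rewrite eqEcard sG /= cpre // -(cpre _ p'l).
  by apply: subset_leq_card; rewrite -(tf_sub ei) preK.
move=> [FK h]; have : gn l (tf e F) by rewrite gl mem_cT.
case/hasP => p pl FF; rewrite mem_rev; apply/mapP; exists p => //.
by rewrite (h (pre p.1)) ?preKp // -(tf_sub ei) preK.
Qed.
End ShellingLists.
Import ShellingLists.

(** * The subdivided boundary of a colored simplex is a cross-polytope *)

Module CrossPolytope.
Implicit Types (F G H : face) (x y z : T).

(** The link of [A] is [bd C], and the dimension of a sphere is well defined. *)
Lemma flip_card n Y A C : mfd n Y -> star_is Y A C [fset fset0] -> #|` A `|` C| = n.+1.
Proof.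
move=> m st; have [[A0 C0 dAC _] [_ _ h]] := st; have [cl _ hl] := m.
have okA := star_is_ok st closed_fset0; have [_ [AY _ _]] := okA.
have [le s] := hl _ AY A0.
have e : lk A Y = bd C.
  apply/fsetP => G; rewrite lkE // bdE; apply/andP/andP => [[d]|[h1 h2]].
    rewrite (star_simplex st); last by fs.
    by move=> /andP[h1 h2]; split; fs.
  split; first by fs.
  by rewrite (star_simplex st); [apply/andP; split|]; fs.
have cC : (0 < #|` C|)%N by rewrite cardfs_gt0.
have s' : sph #|` C|.-1 (lk A Y) by rewrite e; apply: sph_bd; rewrite prednK.
have := sph_dim s s'; rewrite cardfsU (_ : A `&` C = fset0) ?cardfs0 ?subn0; last by fs.
by move=> e'; rewrite -(prednK cC) -e' addnS subnKC.
Qed.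

Section Sigma.
Variables (d : nat) (U : face) (b : face -> T) (s : face).
Hypotheses (gb : goodb d U b) (cs : colQ d.+1 s) (cd : #|` s| = d.+2) (sU : s `<=` U).

Let bs := fam d U.

Definition cvert i : T := head (0, 0) [seq z <- s | col z == i].

Lemma w_in i : (i <= d.+1)%N -> cvert i \in s /\ col (cvert i) = i.
Proof.
move=> hi; have : i \in [seq col z | z <- s].
  have [rs hc] := cs.
  have us : uniq [seq col z | z <- s].
    by rewrite map_inj_in_uniq ?fset_uniq // => x y; exact: rs.
  have sub : {subset [seq col z | z <- s] <= iota 0 d.+2}.
    by move=> j /mapP[z zs ->]; rewrite mem_iota /= add0n ltnS; exact: hc.
  have hs : (size (iota 0 d.+2) <= size [seq col z | z <- s])%N by rewrite size_iota size_map cd.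
  by have [_ ->] := uniq_min_size us sub hs; rewrite mem_iota /= add0n ltnS.
move=> /mapP[z zs ez]; have : z \in [seq z <- s | col z == i] by rewrite mem_filter ez eqxx.
rewrite /cvert; case E : [seq _ <- s | _] => [//|y l] _ /=.
have : y \in [seq z <- s | col z == i] by rewrite E mem_head.
by rewrite mem_filter => /andP[/eqP ey ys].
Qed.

Lemma w_col z : z \in s -> cvert (col z) = z.
Proof.
move=> zs; have [rs hc] := cs; have [h1 h2] := w_in (hc _ zs).
by apply: (rs _ _ h1 zs).
Qed.

(** The faces of [s] that get starred form a flag: [Fi i] has [i + 1] vertices, and its new vertex
    has color [i]. *)
Definition Fi i := [fset z in s | (col z < i) || (col z == d.+1)].

Lemma FiP i z : (z \in Fi i) = (z \in s) && ((col z < i) || (col z == d.+1)).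
Proof. by rewrite !inE. Qed.

Lemma card_Fi i : (i <= d.+1)%N -> #|` Fi i| = i.+1.
Proof.
elim: i => [_|i IH hi].
  have -> : Fi 0 = [fset cvert d.+1]; last by rewrite cardfs1.
  have [h1 h2] := w_in (leqnn d.+1).
  apply/fsetP => z; rewrite FiP in_fset1 /=; apply/andP/eqP => [[zs /eqP <-]|->]; first by rewrite w_col.
  by rewrite h1 h2 eqxx.
have [h1 h2] := w_in (ltnW hi).
have -> : Fi i.+1 = cvert i |` Fi i.
  apply/fsetP => z; rewrite in_fset1U !FiP; apply/idP/idP => [/andP[zs]|].
    rewrite ltnS leq_eqVlt -orbA => /or3P[/eqP ez|lt|lt]; rewrite ?zs ?lt ?orbT //.
    by rewrite -ez w_col // eqxx.
  case/orP => [/eqP->|/andP[-> /orP[lt|->]]]; rewrite ?orbT //; first by rewrite h1 h2 ltnSn.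
  by rewrite (leqW lt).
rewrite cardfsU1 FiP h2 ltnn h1 /= (IH (ltnW hi)).
by have -> : (i == d.+1) = false by apply/negbTE; rewrite neq_ltn hi.
Qed.

Lemma Fi_fam i : (i <= d)%N -> Fi i \in fam d U.
Proof.
move=> hi; rewrite mem_fam; apply/andP; split.
  by apply: fsubset_trans sU; apply/fsubsetP => z; rewrite FiP => /andP[].
have [h1 h2] := w_in (leqnn d.+1); apply/condP; split.
  by exists (cvert d.+1); rewrite ?FiP h2 // h1 eqxx orbT.
move=> z; rewrite FiP card_Fi ?leqW // => /andP[_ /orP[//|/eqP->]].
by rewrite ltnn.
Qed.

(** Such an [F] contains the vertex of color [d + 1], and its other [#|F| - 1] vertices have colors
    below [#|F| - 1]; so each of these colors occurs. *)
Lemma fam_Fi F : F \in fam d U -> F `<=` s -> F = Fi #|` F|.-1.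
Proof.
rewrite mem_fam => /andP[_ /condP[[z0 z0F _] h]] Fs; have [rs hc] := cs.
have F0 : (0 < #|` F|)%N by rewrite cardfs_gt0; apply/fset0Pn; exists z0.
have le : (#|` F|.-1 <= d.+1)%N by rewrite -ltnS prednK // -cd fsubset_leq_card.
apply/eqP; rewrite eqEfcard card_Fi // prednK // leqnn andbT.
apply/fsubsetP => z zF; have zs := fsubsetP Fs _ zF; rewrite FiP zs /=.
have := hc _ zs; rewrite leq_eqVlt => /orP[->|lt]; first by rewrite orbT.
by rewrite h.
Qed.

(** The old and the new vertex of color [i] become antipodes. *)
Definition psi (x : CX d) : T := if x.2 then b (Fi x.1) else cvert x.1.

Let bU F : b F \notin U. Proof. by case: gb. Qed.
Let ltd (i : 'I_d.+1) : (i <= d)%N. Proof. by rewrite -ltnS ltn_ord. Qed.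

Lemma psi_inj : injective psi.
Proof.
have inU (i : 'I_d.+1) : cvert i \in U by apply: (fsubsetP sU); case: (w_in (leqW (ltd i))).
move=> [i [|]] [j [|]]; rewrite /psi /=.
- have [_ _ bi _] := gb; move=> /bi h.
  have := h (Fi_fam (ltd i)) (Fi_fam (ltd j)) => /(congr1 (fun F : face => #|` F|)).
  by rewrite !card_Fi ?leqW // => -[/val_inj ->].
- by move=> e; have := bU (Fi i); rewrite e inU.
- by move=> e; have := bU (Fi j); rewrite -e inU.
move=> e; have [_ h1] := w_in (leqW (ltd i)); have [_ h2] := w_in (leqW (ltd j)).
by have := congr1 col e; rewrite h1 h2 => /val_inj ->.
Qed.

Lemma inv_fam K : closed K -> vs K `<=` U -> stage_inv d U b K (fam d U) (beta b bs K).
Proof.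
move=> cl vK; have [b1 b2 b3 b4] := gb.
apply: (inv_beta b2 b3 vK (dn := [::])) => //; split=> // z zK; left; exact: (fsubsetP vK).
Qed.

(** The vertex of color [i] added to [Fi i] gives the next face of the flag. It satisfies [cond]
    too, and the third clause of [stage_inv] excludes the edge. *)
Lemma no_pair K (i : 'I_d.+1) : closed K -> vs K `<=` U ->
  [fset psi (i, false); psi (i, true)] \notin beta b bs K.
Proof.
move=> cl vK; have [_ _ E1 _ _] := inv_fam cl vK; have [h1 h2] := w_in (leqW (ltd i)).
apply/negP => h; have := E1 (cvert i) (Fi i) (fsubsetP sU _ h1) (Fi_fam (ltd i)) h.
have ni : cvert i \notin Fi i.
  by rewrite FiP h2 ltnn /= h1 /=; apply/eqP => e; have := ltn_ord i; rewrite e ltnn.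
case=> [|/negP]; first by rewrite (negbTE ni).
apply; apply: cond_add => //; first by have := Fi_fam (ltd i); rewrite mem_fam => /andP[].
by rewrite h2 (card_Fi (leqW (ltd i))) ltnSn.
Qed.

Lemma in_cross K G : closed K -> vs K `<=` U -> G \in beta b bs K -> G `<=` tf psi setT ->
  G \in cT psi (cross d).
Proof.
move=> cl vK GB s'; apply/cTP; exists [set x in setT | psi x \in G]; last exact: sub_tf.
have clB : closed (beta b bs K) by have [_ _ _ b4] := gb; exact: sq_closed (beta_sq b4 vK cl) cl.
apply/crossP => i; rewrite !inE /= => h1 h2; have /negP := no_pair i cl vK; apply.
by apply: (clB _ _ GB); fs.
Qed.

(** The absence of antipodal edges gives one inclusion; rigidity of spheres replaces the count of
    faces for the other. *)
Lemma cross_bd : beta b bs (bd s) = cT psi (cross d).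
Proof.
have [b1 b2 b3 b4] := gb.
have cl := @bd_closed s; have vK : vs (bd s) `<=` U by rewrite vs_bd // cd.
have [clB R E1 E2 V] := inv_fam cl vK.
apply: (sph_eq (n := d.+1)).
- by apply: sph_sq (beta_sq b4 vK cl) (sph_bd cd).
- exact: sph_cross psi_inj.
apply/fsubsetP => G GB; apply: (in_cross cl vK GB); apply/fsubsetP => z zG.
have zB : [fset z] \in beta b bs (bd s) by apply: (clB _ _ GB); fs.
have zB' : z \in vs (beta b bs (bd s)) by rewrite vs_sub_mem.
have sp (x : CX d) : x \in setT -> psi x \in tf psi setT by move=> h; rewrite mem_tf //; exact: psi_inj.
case: (V _ zB') => [zU|[F [Ff ez] FK]]; last first.
  move: FK; rewrite bdE => /andP[Fs nF].
  have eF := fam_Fi Ff Fs.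
  have le : (#|` F|.-1 < d.+1)%N.
    have lt : (#|` F| < d.+2)%N by rewrite -cd; apply: fproper_ltn_card; rewrite fproperE Fs.
    by move: lt; case: (#|` F|).
  by have := sp (Ordinal le, true) (in_setT _); rewrite /psi /= -eF -ez.
have zs : [fset z] `<=` U by fs.
have [zK /(_ (Fi 0))] := R _ zB zs; rewrite Fi_fam // => /(_ isT) nz.
have {}zs : z \in s by move: zK; rewrite bdE fsub1set => /andP[].
have lt : (col z < d.+1)%N.
  rewrite ltn_neqAle; have [_ ->] := cs; rewrite // andbT; apply: contra nz => /eqP ez.
  apply/fsubsetP => y; rewrite FiP /= => /andP[ys /eqP ey]; rewrite inE; apply/eqP.
  by rewrite -(w_col ys) -(w_col zs) ey ez.
by have := sp (Ordinal lt, false) (in_setT _); rewrite /psi /= w_col.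
Qed.
End Sigma.
End CrossPolytope.
Import CrossPolytope.

(** * A subdivided flip is a cross-flip *)

Module CrossFlips.
Implicit Types (F G H : face).

Section CrossFlip.
Variables (n : nat) (U : face) (b : face -> T) (Y : cplx) (A C : face).
Local Notation d := n.+1.
Let bs := fam d U.
Let s := A `|` C.
Let Y' := mv A C Y.
Let BY := beta b bs Y.
Let BY' := beta b bs Y'.
Hypotheses (gb : goodb d U b) (mY : mfd d.+1 Y) (cY : Conn Y) (uY : exists v, v \in vs Y)
  (hY : forall F, F \in Y -> colQ d.+1 F) (st : star_is Y A C [fset fset0]) (cs : colQ d.+1 s)
  (vY : vs Y `<=` U) (CU : C `<=` U).
Variables (V : finType) (K : {set {set V}}) (e : V -> T) (p0 : V).
Hypotheses (ei : injective e) (cK : is_complex K) (eK : cT e K = BY).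

Let okb_ : okb b bs U. Proof. by case: gb. Qed.
Let cl : closed Y. Proof. by case: mY. Qed.
Let okA : ok A C Y. Proof. exact: (star_is_ok st closed_fset0). Qed.
Let sU : s `<=` U.
Proof. by have [_ [AK _ _]] := okA; have := sub_vs AK; rewrite /s; move: vY CU; fs. Qed.
Let cd : #|` s| = d.+2. Proof. exact: flip_card mY st. Qed.
Let sqY : sq Y BY. Proof. exact: beta_sq okb_ vY cl. Qed.
Let clB : closed BY. Proof. exact: sq_closed sqY cl. Qed.
Let mB : mfd d.+1 BY. Proof. exact: mfd_sq sqY mY. Qed.
Let cB : Conn BY. Proof. exact: Conn_sq sqY cY. Qed.
Let rY : allrb Y. Proof. by move=> F /hY[]. Qed.
Let v0 := proj1_sig (boolp.cid (fresh_vertex (vs BY))).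
Let v0B : v0 \notin vs BY. Proof. exact: proj2_sig (boolp.cid (fresh_vertex (vs BY))). Qed.

Let uB : exists v, v \in vs BY.
Proof. by apply: (vertex_sq sqY) => //; case: mB. Qed.

Let l1 := betaL b bs (ini s C).
Let l2 := betaL b bs (inip s A C).
Let g1 := gn_half1 okb_ vY st CU v0B.
Let g2 := gn_half2 okb_ vY st CU v0B.
Let bi : bish (l2 ++ l1) := bish_half okb_ vY st CU v0B.
Let sh1 : shok BY [fset fset0] l1. Proof. by have [] := half_shok okb_ vY cl st CU v0B. Qed.
Let no1 H : H \in BY -> noA l1 H = ~~ (A `<=` car b bs H).
Proof. by have [_ h] := half_shok okb_ vY cl st CU v0B; exact: h. Qed.

Let ps : CX d -> T := psi b s.
Let pi : injective ps. Proof. exact: (psi_inj gb cs cd sU). Qed.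
Let Cr := cT ps (cross d).
Let mC : mfd d.+1 Cr. Proof. apply: sph_mfd; exact: sph_cross. Qed.
Let clC : closed Cr. Proof. apply: cT_closed => //; exact: cross_complex. Qed.
Let uC : exists v, v \in vs Cr. Proof. exact: sph_vertex (sph_cross pi). Qed.

Let CrE H : (H \in Cr) = gn l2 H || gn l1 H.
Proof.
rewrite /Cr /ps -(cross_bd gb cs cd sU) (betaE _ okb_); last by rewrite vs_bd ?cd.
rewrite bdE g1 g2; case: (valid b bs H) => //=; case: (car b bs H `<=` s) => //=.
by rewrite /s fsubUset negb_and.
Qed.

Let gnE : gn (l2 ++ l1) =1 mem Cr.
Proof. by move=> H; rewrite gn_cat /= CrE. Qed.

Let mem_l p : p \in l2 ++ l1 -> p.1 \in Cr /\ #|` p.1| = d.+1.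
Proof.
case: p => F0 C0 pl /=; have FC : F0 \in Cr by rewrite -[_ \in _]gnE; exact: mem_gn pl _.
have [v vC] := uC; have [G GC [sG cG]] := mfd_pure mC vC FC; split=> //.
by rewrite -cG; congr #|` _|; apply/esym; apply: (bish_max bi pl) => //; rewrite gnE.
Qed.

Let mem_l1 p : p \in l1 -> p.1 \in Cr /\ #|` p.1| = d.+1.
Proof. by move=> pl; apply: mem_l; rewrite mem_cat pl orbT. Qed.
Let mem_l2 p : p \in l2 -> p.1 \in Cr /\ #|` p.1| = d.+1.
Proof. by move=> pl; apply: mem_l; rewrite mem_cat pl. Qed.

Let gn1B H : gn l1 H -> H \in BY.
Proof.
case/hasP => p pl sp; have [_ h] := shok_mem sh1 pl.
have FB : p.1 \in BY by have := h fset0; rewrite in_fset1 fsetU0; apply.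
exact: clB FB sp.
Qed.

(** This makes [D0] induced. A carrier in [Y] never contains [C], and the faces of the
    cross-polytope with such carriers belong to [l1]. *)
Let BC H : H \in BY -> H `<=` tf ps setT -> gn l1 H.
Proof.
move=> HB h; have := in_cross gb cs cd sU cl vY HB h; rewrite -/ps -/Cr CrE => /orP[|//].
rewrite g1 g2 => /and3P[-> -> _] /=; have [_ [_ CY _]] := okA.
by move: HB; rewrite (betaE _ okb_ vY) => /andP[_ hc]; apply: contra CY => /(cl hc).
Qed.

(** The subdivided ball [A * bd C] as a part of the cross-polytope. *)
Let D0 : {set {set CX d}} := [set G : {set CX d} | gn l1 (tf ps G)].

Let DE H : (H \in cT ps D0) = gn l1 H.
Proof.
apply/cTP/idP => [[G + ->]|g]; first by rewrite inE.
have /cTP[G GC eG] : H \in Cr by rewrite CrE g orbT.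
by exists G => //; rewrite inE -eG.
Qed.

Let cD : is_complex D0.
Proof.
move=> F0 G0; rewrite !inE => /hasP[p pl sp] s'; apply/hasP; exists p => //.
by apply: fsubset_trans sp; rewrite tf_sub.
Qed.

Let phi (x : CX d) : V := if [pick v | e v == ps x] is Some v then v else p0.

Let phiE x : ps x \in vs BY -> e (phi x) = ps x.
Proof.
rewrite -eK vs_cT // => /tfP[v vK ex]; rewrite /phi; case: pickP => [u /eqP//|/(_ v)].
by rewrite ex eqxx.
Qed.

Let vertD x : (x \in vert D0) = gn l1 [fset ps x].
Proof. by rewrite !inE tf1. Qed.

Let vertD_B x : (x \in vert D0) = (ps x \in vs BY).
Proof.
rewrite vertD vs_sub_mem //; apply/idP/idP; first exact: gn1B.
by move=> h; apply: BC => //; rewrite fsub1set mem_tf.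
Qed.

Let tf_phi (G : {set CX d}) : G \subset vert D0 -> tf e (phi @: G) = tf ps G.
Proof.
move=> /subsetP h; apply/fsetP => y; apply/tfP/tfP => [[_ /imsetP[x xG ->] ->]|[x xG ->]].
  by exists x => //; rewrite phiE // -vertD_B h.
by exists (phi x); rewrite ?imset_f // phiE // -vertD_B h.
Qed.

Let subD (G : {set CX d}) : G \in D0 -> G \subset vert D0.
Proof. by move=> GD; apply/subsetP => x xG; rewrite inE; apply: cD GD _; rewrite sub1set. Qed.

Let l1_0 : l1 != [::].
Proof.
rewrite (betaL_nil _ okb_); have [[_ C0 _ _] _] := st; case/fset0Pn: C0 => c.
by rewrite -[c \in C]/(c \in enum_fset C); case: (enum_fset C).
Qed.

Let l2_0 : l2 != [::].
Proof.
rewrite (betaL_nil _ okb_); have [[A0 _ _ _] _] := st; case/fset0Pn: A0 => a.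
by rewrite -[a \in A]/(a \in enum_fset A); case: (enum_fset A).
Qed.

Let not1 p : p \in l2 -> ~~ gn l1 p.1.
Proof.
case: p => F0 C0 /path.splitPr hin; case: hin bi => l3 l4; rewrite -catA cat_cons => h /=.
by have [+ _] := bish_anti h; rewrite gn_cat negb_or => /andP[].
Qed.

Let coE H : (H \in cT ps (cocx D0)) = gn l2 H.
Proof.
apply/idP/idP.
  move=> /(cT_gen _ _ pi)[F0 + s']; rewrite inE => /andP[/facetP[FC _] FD].
  have : tf ps F0 \in Cr by rewrite mem_cT.
  rewrite CrE => /orP[/hasP[p pl sp]|g]; last by move: FD; rewrite inE g.
  by apply/hasP; exists p => //; exact: fsubset_trans s' sp.
case/hasP => p pl sp; have [/cTP[F0 FC eF] cF] := mem_l2 pl; apply/(cT_gen _ _ pi); exists F0; last by rewrite -eF.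
rewrite inE (facet_mfd _ pi mC uC) FC -(card_tf pi) -eF cF eqxx /= inE -eF; exact: not1.
Qed.

(** [l1] shells [D0] and [opp l2] shells the complement, both being parts of one bishelling of the
    cross-polytope. *)
Lemma cross_flip_ok : flip_ok K D0 phi.
Proof.
split; split.
- exact: cD.
- by apply/subsetP => G; rewrite inE => g; rewrite -(mem_cT pi) -/Cr CrE g orbT.
- apply/eqP => eD; case E : l2 l2_0 => [//|p l] _; have pl : p \in l2 by rewrite E mem_head.
  have [/cTP[F0 FC eF] _] := mem_l2 pl; have /negP := not1 pl; apply.
  by rewrite -DE eF mem_cT // eD.
- split.
    exists set0; rewrite inE tf0; case: (l1) l1_0 => // p l _.
    by apply/hasP; exists p; rewrite ?mem_head ?fsub0set.
  move=> G; rewrite inE => /hasP[p pl sp]; have [/cTP[F0 FC eF] cF] := mem_l1 pl.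
  have GF : G \subset F0 by rewrite -(tf_sub pi) -eF.
  have cF0 : #|F0| = d.+1 by rewrite -(card_tf pi) -eF.
  rewrite -cF0 subset_leq_card //=; apply/exists_inP; exists F0; last by rewrite GF eqxx.
  by rewrite inE -eF; apply/hasP; exists p.
- have h1 : shl l1 by case: bi => /shl_catr.
  have h2 p : p \in l1 -> #|` p.1| = d.+1 by move=> /mem_l1[].
  have h3 G : gn l1 G = (G \in cT ps D0) by rewrite DE.
  exact: shellable_of_list pi h1 h2 l1_0 h3.
- have h1 : shl (opp l2) by case: bi => _; rewrite opp_cat => /shl_catr.
  have h2 p : p \in opp l2 -> #|` p.1| = d.+1 by rewrite mem_rev => /mapP[q /mem_l2[_ cq] ->].
  have h0 : opp l2 != [::] by rewrite -size_eq0 size_rev size_map size_eq0.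
  have h3 G : gn (opp l2) G = (G \in cT ps (cocx D0)) by rewrite gn_opp coE.
  exact: shellable_of_list pi h1 h2 h0 h3.
- move=> x y; rewrite !vertD_B => hx hy h; by apply: pi; rewrite -(phiE hx) h (phiE hy).
- move=> G GD; rewrite -(mem_cT ei) tf_phi ?subD // eK; apply: gn1B; by move: GD; rewrite inE.
move=> F0 FK s'; have HB : tf e F0 \in BY by rewrite -eK mem_cT.
have h : tf e F0 `<=` tf ps setT.
  apply/fsubsetP => y /tfP[v vF ->]; have /imsetP[x xD ->] := subsetP s' _ vF.
  by rewrite phiE -?vertD_B // mem_tf.
have g := BC HB h; have /cTP[G GD eG] : tf e F0 \in cT ps D0 by rewrite DE.
by exists G => //; apply: (tf_inj ei); rewrite tf_phi ?subD.
Qed.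

Let cm : closed_mfd d K.
Proof.
by have [v vB] := uB; apply: (closed_mfd_of_mfd ei cK (v := v)); rewrite eK.
Qed.

Let rk (x : V + CX d) : T := (0, (proj1_sig (boolp.cid (id_bound (vs BY `|` tf ps setT))) + enum_rank x)%N).
Let ext (x : V + CX d) : T := match x return T with
  | inl v => if v \in vert K then e v else rk x
  | inr y => if y \in vert D0 then rk x else ps y end.

Let eB v : v \in vert K -> e v \in vs BY.
Proof. by move=> vK; rewrite -eK vs_cT // mem_tf. Qed.

Let ext_inj : injective ext.
Proof.
have rki : injective rk by move=> x y [/addnI/val_inj/enum_rank_inj].
have big x z : z \in vs BY `|` tf ps setT -> z != rk x.
  rewrite /rk; case: (boolp.cid _) => N hN /= /hN lt; apply/eqP => ex.
  by move: lt; rewrite ex /= ltnNge leq_addr.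
have eI v x : v \in vert K -> e v != rk x by move=> /eB h; apply: big; rewrite inE h.
have pI y x : ps y != rk x by apply: big; rewrite in_fsetU (mem_tf pi) in_setT orbT.
have pe v y : v \in vert K -> y \notin vert D0 -> e v != ps y.
  by move=> /eB vB; rewrite vertD_B; apply: contra => /eqP <-.
move=> [v|x] [w|y]; rewrite /ext; case: ifPn => h1; case: ifPn => h2 h.
- by rewrite (ei h).
- by have := eI _ (inl w) h1; rewrite h eqxx.
- by have := eI _ (inl v) h2; rewrite -h eqxx.
- exact: rki h.
- by have := eI _ (inr y) h1; rewrite h eqxx.
- by have := pe _ _ h1 h2; rewrite h eqxx.
- by have := rki _ _ h.
- by have := pI y (inl v); rewrite -h eqxx.
- by have := eI _ (inr x) h2; rewrite -h eqxx.
- by have := rki _ _ h.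
- by have := pe _ _ h2 h1; rewrite -h eqxx.
- by have := pI x (inl w); rewrite h eqxx.
- exact: rki h.
- by have := pI y (inr x); rewrite -h eqxx.
- by have := pI x (inr y); rewrite h eqxx.
by rewrite (pi h).
Qed.

Lemma cross_flip_step : flip_step d (Pcx K) (Pcx (frz BY')).
Proof.
have [b1 b2 b3 b4] := gb; have [v vB] := uB.
have clY' : closed Y' by exact: mv_closed.
have vY' : vs Y' `<=` U by have := vs_mv A C Y; rewrite -/Y'; move: vY CU; fs.
have clB' : closed BY' by exact: sq_closed (beta_sq b4 vY' clY') clY'.
split; last split=> //.
  apply: (balanced_of_col ei) => F0; rewrite eK => h; exact: goodb_color gb mY vY rY h.
exists D0, phi; split; first exact: cross_flip_ok.
have cR := @gen_complex (V + CX d)%type.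
have eVE : cT (ext \o inl) K = BY.
  rewrite -eK; apply/fsetP => X; apply/cTP/cTP => -[F0 FK ->]; exists F0 => //; apply/fsetP => y;
  apply/tfP/tfP => -[u uF ->]; exists u => //;
  have uK : u \in vert K by [rewrite inE; apply: cK FK _; rewrite sub1set];
  by rewrite /= uK.
pose psi0 (x : CX d) := if x \in vert D0 then @inl V (CX d) (phi x) else inr x.
have epE (S : {set {set CX d}}) : cT (ext \o psi0) S = cT ps S.
  have E x : (ext \o psi0) x = ps x.
    rewrite /= /psi0; case: ifPn => xD; rewrite /ext ?(negbTE xD) //.
    have h : ps x \in vs BY by rewrite -vertD_B.
    have hK : phi x \in vert K.
      by have := h; rewrite -(phiE h) -eK vs_cT // mem_tf.
    by rewrite hK phiE.
  apply/fsetP => X; apply/cTP/cTP => -[F0 FK ->]; exists F0 => //; apply/fsetP => y;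
  by apply/tfP/tfP => -[u uF ->]; exists u => //; rewrite E.
(* Faces are compared through carriers. Outside the ball the carrier is a face of [Y] not over [A];
   in the complement it is a face of the simplex not over [A]. Together these are the faces of
   [mv A C Y]. *)
have RE H : H \in cT ext (flip_result K D0 phi) <-> H \in BY'.
  rewrite (flip_resultP ext_inj cm cross_flip_ok) /= -/psi0 !epE eVE coE g2.
  have vE : H \in BY' = valid b bs H && (car b bs H \in Y') by rewrite (betaE _ okb_ vY').
  have bE : H \in BY = valid b bs H && (car b bs H \in Y) by rewrite (betaE _ okb_ vY).
  rewrite vE mvE; set c := car b bs H in bE *.
  have OE : (exists2 G, G \in BY & [/\ #|` G| = d.+1, G \notin cT ps D0 & H `<=` G]) <->
      (H \in BY) && ~~ (A `<=` c).
    have l1c p : p \in l1 -> #|` p.1| = d.+1 by move=> /mem_l1[].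
    split=> [[G GB [cG nG sG]]|/andP[HB nA]].
      have HB : H \in BY := clB GB sG; rewrite HB -no1 //; apply: noA_sub sG.
      by apply: (shok_noA sh1 GB); rewrite -DE.
    rewrite -no1 // in nA; have [G GB [sG cG _ nG]] := noA_gen mB vB l1c sh1 HB nA.
    by exists G => //; split=> //; rewrite DE.
  rewrite OE bE; case: (valid b bs H) => /=; last by split=> // -[].
  case: (boolP (A `<=` c)) => nA /=; first by rewrite ?andbF; split=> // -[].
  rewrite !andbT; split.
    case=> [->//|cS]; apply/orP; case: (boolP (C `<=` c)) => Cc; [right|left].
      rewrite /= (star_simplex st); last by fs.
      by have [[_ C0 dAC _] _] := st; apply/andP; split; fs.
    have h : A `|` c \in Y.
      rewrite (star_simplex st); last by fs.
      by have [[_ _ dAC _] _] := st; apply/andP; split; fs.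
    by apply: (cl h); fs.
  case/orP => [->|/andP[Cc]]; first by left.
  by rewrite (star_simplex st); [move=> /andP[h _]; right|]; fs.
have EQ : cT ext (flip_result K D0 phi) = cT (fun x : vs BY' => fsval x) (frz BY').
  by rewrite cT_frz //; apply/fsetP => H; apply/idP/idP => /RE.
have [v' v'B] : exists v', v' \in vs BY'.
  have q : sq Y BY' by apply: (sq_trans (sq_mv cl okA)); exact: beta_sq b4 vY' clY'.
  by apply: (vertex_sq q) => //; case: (mfd_sq q mY).
have : v' \in vs (cT ext (flip_result K D0 phi)) by rewrite EQ cT_frz.
rewrite vs_cT; [|exact: ext_inj|exact: cR].
move=> /tfP[x xR _]; apply: (iso_of_cT ext_inj (@vv_inj _) _ _ xR EQ); first exact: cR.
exact: frz_complex.
Qed.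
End CrossFlip.
End CrossFlips.
Import CrossFlips.

(** * Assembly of the two directions, and dimension 0 *)

Module Main.
Implicit Types (F G H : face).

Definition realizes (P : pcx) (X : cplx) := exists2 e : pvt P -> T, injective e &
  is_complex (pK P) /\ cT e (pK P) = X.

Lemma real_frz X : closed X -> realizes (Pcx (frz X)) X.
Proof.
by move=> cl; exists (fun x : vs X => fsval x); [exact: vv_inj|split; [exact: frz_complex|exact: cT_frz]].
Qed.

(** [flips] grows at its front and [flQ] at its end, so the chain is built from the back, with its
    final complex [Z] as a parameter. Quantifying over all realizations of a subdivided complex
    hides the choice of its vertex type. *)
Lemma flQ_flips n K L : flQ (colQ n.+2) K L -> mfd n.+2 K -> Conn K -> (exists v, v \in vs K) ->
  (forall F, F \in K -> colQ n.+2 F) ->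
  (forall F, F \in L -> colQ n.+2 F) /\ exists U, forall U' b, U `<=` U' -> goodb n.+1 U' b ->
  vs L `<=` U' /\ forall Z, (forall P, realizes P (beta b (fam n.+1 U') L) -> flips n.+1 P Z) ->
     forall P, realizes P (beta b (fam n.+1 U') K) -> flips n.+1 P Z.
Proof.
move=> h m cK uK qK; elim: h => [|N M hN [qN [U IH]] st].
  by split=> //; exists (vs K) => U' b hU gb; split=> // Z hZ P; exact: hZ.
have sN := flQ_sq hN; have mN := mfd_sq sN m; have cN := Conn_sq sN cK.
have uN : exists v, v \in vs N by apply: (vertex_sq sN) => //; case: mN.
have sM := flipQ_sq st; have clM : closed M by case: (mfd_sq sM mN).
split; first exact: flipQ_all (@colQ_sub n.+2) st qN.
case: st => A [C [clN st qAC eM]]; exists (U `|` vs N `|` vs M `|` C) => U' b hU gb.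
have [vN hN'] : vs N `<=` U' /\ forall Z, (forall P, realizes P (beta b (fam n.+1 U') N) -> flips n.+1 P Z) ->
     forall P, realizes P (beta b (fam n.+1 U') K) -> flips n.+1 P Z by apply: IH => //; fs.
have vM : vs M `<=` U' by fs.
split=> // Z hZ; apply: hN' => -[V KP] [e ei [c eK]].
have [b1 b2 b3 b4] := gb.
have CU : C `<=` U' by fs.
have clB : closed (beta b (fam n.+1 U') M) := sq_closed (beta_sq b4 vM clM) clM.
have [v vB] : exists v, v \in vs (beta b (fam n.+1 U') N).
  by apply: (vertex_sq (beta_sq b4 vN clN)) => //; case: (mfd_sq (beta_sq b4 vN clN) mN).
move: vB; rewrite -eK vs_cT // => /tfP[p0 _ _].
apply: flips_step (hZ _ (real_frz clB)); rewrite eM.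
exact: (cross_flip_step gb mN cN uN qN st qAC vN CU p0 ei c eK).
Qed.

Lemma real_iso d X P Q : (exists v, v \in vs X) -> realizes P X -> realizes Q X -> flips d P Q.
Proof.
move=> [v vX] [e ei [c eX]] [e' ei' [c' eX']]; apply: flips_iso.
move: vX; rewrite -eX vs_cT // => /tfP[x xK _].
by apply: (iso_of_cT ei ei' c c' xK); rewrite eX eX'.
Qed.

Theorem flips_of_PL n (V W : finType) (K : {set {set V}}) (L : {set {set W}}) :
  balanced n.+1 K -> balanced n.+1 L -> closed_mfd n.+1 K -> closed_mfd n.+1 L ->
  PL_homeo K L -> flips n.+1 (Pcx K) (Pcx L).
Proof.
move=> bK bL mK mL h; have cK : is_complex K by case: mK.
have cL : is_complex L by case: mL.
have [e ei qK] := balanced_embed bK cK; have [f fi qL] := balanced_embed bL cL.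
have q : sq (cT e K) (cT f L) by apply: sq_of_PL => //; [exact: frozen_set0 mK|exact: frozen_set0 mL].
have m := frozen_mfd ei mK; have [v vK] := frozen_vertex ei mK.
have fq := flQ_of_sq m q qK qL.
have up (X : cplx) : (forall F, F \in X -> colQ n.+1 F) -> forall F, F \in X -> colQ n.+2 F.
  by move=> hX F /hX[r hc]; split=> // z /hc/leqW.
have uK : exists v, v \in vs (cT e K) by exists v.
have [_ [U hU]] := flQ_flips fq m (frozen_Conn ei mK) uK (up _ qK).
have [b gb] := goodb_ex n.+1 U; have [_] := hU U b (fsubset_refl _) gb.
rewrite !beta_id; [|exact: cT_closed|by move=> F; exact: fam_notin|exact: cT_closed|by move=> F; exact: fam_notin].
move=> hZ; apply: (hZ (Pcx L)); last by exists e.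
by move=> P hP; apply: (@real_iso _ (cT f L)) => //; [exact: frozen_vertex mL|exists f].
Qed.

Lemma point_of_mfd0 (V : finType) (K : {set {set V}}) : closed_mfd 0 K ->
  exists v, vert K = [set v] /\ K = [set set0; [set v]].
Proof.
move=> mK; have cK : is_complex K by case: mK.
have ei := @em_inj 0 V; have m := frozen_mfd ei mK.
have [_ [v vK] _ _] := mK; exists v.
have K0 := frozen_set0 mK.
have small (F : {set V}) : F \in K -> #|F| <= 1.
  by move=> FK; rewrite -(card_tf ei); apply: (mfd_card m); rewrite mem_cT.
have vE : vert K = [set v].
  apply/eqP; rewrite eqEsubset sub1set vK andbT; apply/subsetP => u uK; rewrite inE.
  have [_ _ /(_ v u vK uK)/connectP[s hs ->] _] := mK.
  elim: s v {vK uK} hs => //= w s IH v /andP[vw hs].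
  have e : w = v.
    apply/eqP; rewrite eq_sym; apply/negPn/negP => ne; have := small _ vw; by rewrite cards2 ne.
  by rewrite e in hs *; exact: IH.
split=> //; apply/setP => F; rewrite !inE; apply/idP/orP => [FK|[]/eqP-> //]; last by move: vK; rewrite inE.
have : F \subset [set v] by rewrite -vE; apply/subsetP => u uF; rewrite inE; apply: cK FK _; rewrite sub1set.
by rewrite subset1 => /orP[->|->]; [right|left].
Qed.

Lemma iso_mfd0 (V W : finType) (K : {set {set V}}) (L : {set {set W}}) :
  closed_mfd 0 K -> closed_mfd 0 L -> iso_cx K L.
Proof.
move=> /point_of_mfd0[v [vK eK]] /point_of_mfd0[w [vL eL]]; exists (fun _ => w); rewrite vK vL; split.
- by move=> x y; rewrite !inE => /eqP -> /eqP ->.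
- by rewrite imset_set1.
move=> F; rewrite subset1 => /orP[]/eqP->; rewrite ?imset_set1 ?imset0 eK eL !inE !eqxx ?orbT //.
Qed.
End Main.
Import Main.

Theorem theorem1p2 (d : nat) (V W : finType)
    (K : {set {set V}}) (L : {set {set W}}) :
  is_complex K -> is_complex L ->
  balanced d K -> balanced d L ->
  closed_mfd d K -> closed_mfd d L ->
  (PL_homeo K L <-> flips d (Pcx K) (Pcx L)).
Proof.
case: d => [|n] cK cL bK bL mK mL.
  (* The boundary of the cross-polytope is connected only from dimension 1 on. In dimension 0 a
     connected manifold is a point, and both sides follow from an isomorphism. *)
  have iso := iso_mfd0 mK mL; split=> _; first exact: flips_iso.
  apply: (PL_of_sq (@em_inj 0 V) (@em_inj 0 W)) => //.
  by apply: iso_cT => //; exact: em_inj.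
split; first exact: flips_of_PL.
exact: PL_of_flips.
Qed.
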